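(* Let $\Omega\subset\mathbb R^3$ be a bounded Lipschitz domain that is simply connected with connected boundary, and let $\boldsymbol f\in\boldsymbol H(\operatorname{div},\Omega)$ with $\operatorname{div}\boldsymbol f=0$. The mixed formulation of the fourth order curl equation: find $\boldsymbol\phi\in\boldsymbol H(\operatorname{curl}\operatorname{curl},(K_0^c)')$ and $\boldsymbol u\in K_0^c$ such that $$(\boldsymbol\phi,\boldsymbol\psi)+\langle\operatorname{curl}\operatorname{curl}\boldsymbol\psi,\boldsymbol u\rangle=0\quad\forall\,\boldsymbol\psi\in\boldsymbol H(\operatorname{curl}\operatorname{curl},(K_0^c)'),$$ $$\langle\operatorname{curl}\operatorname{curl}\boldsymbol\phi,\boldsymbol v\rangle=(\boldsymbol f,\boldsymbol v)\quad\forall\,\boldsymbol v\in K_0^c,$$ is equivalent to the decoupled problem: find $\boldsymbol w\in K_0^c$, $\boldsymbol\sigma\in\boldsymbol H^0(\mathbf{div},\operatorname{dev}\operatorname{sym})$ and $\boldsymbol u\in K_0^c$ such that $$(\operatorname{curl}\boldsymbol w,\operatorname{curl}\boldsymbol v)=\langle\boldsymbol f,\boldsymbol v\rangle\quad\forall\,\boldsymbol v\in K_0^c,$$ $$(\operatorname{skw}\boldsymbol\sigma,\operatorname{skw}\boldsymbol\tau)=-(\operatorname{spn}\boldsymbol w,\operatorname{skw}\boldsymbol\tau)\quad\forall\,\boldsymbol\tau\in\boldsymbol H^0(\mathbf{div},\operatorname{dev}\operatorname{sym}),$$ $$(\operatorname{curl}\boldsymbol u,\operatorname{curl}\boldsymbol\chi)=-(\boldsymbol\phi,\boldsymbol\chi)\quad\forall\,\boldsymbol\chi\in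 K_0^c,$$ where $\boldsymbol\phi=\operatorname{spn}^{-1}\operatorname{skw}\boldsymbol\sigma+\boldsymbol w$.
   Context: $(\cdot,\cdot)$ is the $L^2$ inner product and $\langle\cdot,\cdot\rangle$ the duality pairing. $\mathbb M$ is the space of $3\times3$ matrices; $\operatorname{sym}\boldsymbol\tau=(\boldsymbol\tau+\boldsymbol\tau^{\intercal})/2$, $\operatorname{skw}\boldsymbol\tau=(\boldsymbol\tau-\boldsymbol\tau^{\intercal})/2$, $\operatorname{dev}\boldsymbol\tau=\boldsymbol\tau-\tfrac13(\operatorname{tr}\boldsymbol\tau)\boldsymbol I$. For $\boldsymbol a\in\mathbb R^3$, $\operatorname{spn}\boldsymbol a=\begin{pmatrix}0&-a_3&a_2\\ a_3&0&-a_1\\ -a_2&a_1&0\end{pmatrix}$, a bijection onto the skew-symmetric matrices with inverse $\operatorname{spn}^{-1}$. $\boldsymbol H^0(\mathbf{div},\operatorname{dev}\operatorname{sym})=\{\boldsymbol\tau\in\boldsymbol L^2(\Omega;\mathbb M):\int_\Omega\operatorname{tr}\boldsymbol\tau=0,\ \mathbf{div}\boldsymbol\tau=\boldsymbol0,\ \operatorname{dev}\operatorname{sym}\boldsymbol\tau=\boldsymbol0\}$, with $\mathbf{div}$ the row-wise divergence. $\boldsymbol H_0(\operatorname{curl},\Omega)$ is the space of $\boldsymbol L^2$ fields with $\boldsymbol L^2$ curl and vanishing tangential trace; $K_0^c=\{\boldsymbol\phi\in\boldsymbol H_0(\operatorname{curl},\Omega):\operatorname{div}\boldsymbol\phi=0\}$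 with the $H(\operatorname{curl})$ norm. Since $\boldsymbol H_0(\operatorname{curl},\Omega)=K_0^c\oplus\nabla H_0^1(\Omega)$, an element of $(K_0^c)'$ is regarded as a functional on $\boldsymbol H_0(\operatorname{curl},\Omega)$ vanishing on $\nabla H_0^1(\Omega)$, hence as a divergence-free distribution; in this sense $\boldsymbol H(\operatorname{curl}\operatorname{curl},(K_0^c)')=\{\boldsymbol\phi\in\boldsymbol L^2(\Omega;\mathbb R^3):\operatorname{curl}\operatorname{curl}\boldsymbol\phi\in(K_0^c)'\}$. ''Equivalent'' means that $(\boldsymbol\phi,\boldsymbol u)$ solves the mixed formulation if and only if $\boldsymbol\phi=\operatorname{spn}^{-1}\operatorname{skw}\boldsymbol\sigma+\boldsymbol w$ for some $\boldsymbol w,\boldsymbol\sigma$ such that $(\boldsymbol w,\boldsymbol\sigma,\boldsymbol u)$ solves the decoupled problem. *)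

(* Defs.v *)
From HB Require Import structures.
From mathcomp Require Import all_boot all_order all_algebra.
From mathcomp Require Import all_classical all_reals all_analysis.

Set Implicit Arguments.
Unset Strict Implicit.
Unset Printing Implicit Defensive.

Import Order.TTheory GRing.Theory Num.Theory.
Import numFieldNormedType.Exports.

Local Open Scope classical_set_scope.
Local Open Scope ring_scope.

(* Points of R^3 are triples, so that the product topology, the sup norm and
   the product sigma-algebra are all available; the values of vector and matrix
   fields are row vectors and matrices. A field is a function on all of R^3, of
   which only the restriction to Omega, up to null sets, matters. *)
Notation R3 R := (R * R * R)%type.
Notation vfield R := (R * R * R -> 'rV[R]_3).
Notation mfield R := (R * R * R -> 'M[R]_3).

Section Algebra.
Context {R : realType}.

Definition row3 (a b c : R) : 'rV[R]_3 := \row_j [:: a; b; c]`_j.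

Definition frob m n (A B : 'M[R]_(m, n)) : R := \sum_i \sum_j A i j * B i j.

Definition sym (A : 'M[R]_3) : 'M[R]_3 := 2^-1 *: (A + A^T).
Definition skw (A : 'M[R]_3) : 'M[R]_3 := 2^-1 *: (A - A^T).
Definition dev (A : 'M[R]_3) : 'M[R]_3 := A - (\tr A / 3)%:M.

Definition spn (a : 'rV[R]_3) : 'M[R]_3 :=
  \matrix_(i, j) (nth [::]
    [:: [:: 0; - a 0 2; a 0 1];
        [:: a 0 2; 0; - a 0 0];
        [:: - a 0 1; a 0 0; 0]] i)`_j.

(* The inverse of [spn] on skew-symmetric matrices. *)
Definition unspn (A : 'M[R]_3) : 'rV[R]_3 := row3 (A 2 1) (A 0 2) (A 1 0).

Lemma spnK : cancel spn unspn.
Proof.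
by move=> a; apply/rowP => -[[|[|[|//]]] Hj]; rewrite !mxE /= ?opprK;
  congr (a 0 _); apply/val_inj.
Qed.

Lemma unspnK (A : 'M[R]_3) : A^T = - A -> spn (unspn A) = A.
Proof.
move=> skA; have E i j : A i j = - A j i.
  by have := congr1 (fun B : 'M[R]_3 => B j i) skA; rewrite !mxE.
have D i : A i i = 0.
  have : A i i *+ 2 == 0 by rewrite mulr2n {1}E addNr.
  by rewrite mulrn_eq0 => /eqP.
apply/matrixP => i j; rewrite !mxE /=.
case: i => -[|[|[|//]]] Hi; case: j => -[|[|[|//]]] Hj; rewrite /= ?mxE /= -?E.
all: try by rewrite -[LHS](D (Ordinal Hi)); congr (A _ _); apply/val_inj.
all: by congr (A _ _); apply/val_inj.
Qed.

End Algebra.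

Section Geometry.
Context {R : realType}.
Implicit Type Omega : set (R3 R).

Definition coords (x : R3 R) : 'rV[R]_3 := row3 x.1.1 x.1.2 x.2.

Definition boundary Omega : set (R3 R) := closure Omega `\` Omega°.

(* Near each boundary point, after a rigid change of coordinates, [Omega] is
   the region strictly above the graph of a Lipschitz function. *)
Definition lipschitz_boundary Omega : Prop :=
  forall x0, boundary Omega x0 ->
  exists (Q : 'M[R]_3) (gamma : R * R -> R) (r : R),
    [/\ Q *m Q^T = 1%:M, [lipschitz gamma p | p in setT], 0 < r &
     forall x, ball x0 r x ->
       let y := coords x *m Q in
       Omega x <-> gamma (y 0 0, y 0 1) < y 0 2].

Definition bounded_lipschitz_domain Omega : Prop :=
  [/\ Omega !=set0, open Omega, connected Omega, bounded_set Omega &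
      lipschitz_boundary Omega].

Definition path_in Omega (gamma : R -> R3 R) : Prop :=
  {within `[0, 1], continuous gamma} /\
  (forall t, 0 <= t <= 1 -> Omega (gamma t)).

Definition null_homotopic_in Omega (gamma : R -> R3 R) : Prop :=
  exists H : R * R -> R3 R,
  [/\ {within `[0, 1] `*` `[0, 1], continuous H},
      forall s t, 0 <= s <= 1 -> 0 <= t <= 1 -> Omega (H (s, t)),
      forall t, 0 <= t <= 1 -> H (0, t) = gamma t,
      forall t, 0 <= t <= 1 -> H (1, t) = gamma 0 &
      forall s, 0 <= s <= 1 -> H (s, 0) = gamma 0 /\ H (s, 1) = gamma 0].

Definition simply_connected Omega : Prop :=
  (forall x y, Omega x -> Omega y ->
     exists gamma, [/\ path_in Omega gamma, gamma 0 = x & gamma 1 = y]) /\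
  (forall gamma, path_in Omega gamma -> gamma 0 = gamma 1 ->
     null_homotopic_in Omega gamma).

End Geometry.

Section Spaces.
Context {R : realType}.
Variable Omega : set (R3 R).

(* [measurableTypeR R] is R with its Borel sigma-algebra. *)
Definition lebesgue3 :
    {measure set (measurableTypeR R * measurableTypeR R * measurableTypeR R)
       -> \bar R} :=
  ((@lebesgue_measure R \x @lebesgue_measure R) \x @lebesgue_measure R)%E.

Definition ae_eq_on T (u v : R3 R -> T) : Prop :=
  {ae lebesgue3, forall x, Omega x -> u x = v x}.

Definition L2s (p : R3 R -> R) : Prop := p \_ Omega \in Lfun lebesgue3 2%:E.

Definition L2 m n (u : R3 R -> 'M[R]_(m, n)) : Prop :=
  forall i j, L2s (fun x => u x i j).

Definition ips (p q : R3 R -> R) : R :=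
  \int[lebesgue3]_(x in Omega) (p x * q x).

Definition ip m n (u v : R3 R -> 'M[R]_(m, n)) : R :=
  \int[lebesgue3]_(x in Omega) frob (u x) (v x).

Definition vcomp (u : vfield R) (i : 'I_3) : R3 R -> R := fun x => u x 0 i.

Definition e_ (i : 'I_3) : R3 R :=
  ((i == 0)%:R, (i == 1)%:R, (i == 2)%:R).

Definition partial (i : 'I_3) (p : R3 R -> R) : R3 R -> R :=
  fun x => 'D_(e_ i) p x.

Definition partials (s : seq 'I_3) (p : R3 R -> R) : R3 R -> R :=
  foldr partial p s.

Definition smooth (p : R3 R -> R) : Prop :=
  forall s : seq 'I_3,
    continuous (partials s p) /\
    (forall i x, derivable (partials s p) x (e_ i)).

Definition test (p : R3 R -> R) : Prop :=
  smooth p /\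
  exists K, [/\ compact K, K `<=` Omega & forall x, ~ K x -> p x = 0].

Definition vtest (eta : vfield R) : Prop := forall i, test (vcomp eta i).

(* [cgrad] and [ccurl] are classical, for test functions and fields. *)
Definition cgrad (p : R3 R -> R) : vfield R :=
  fun x => row3 (partial 0 p x) (partial 1 p x) (partial 2 p x).

Definition ccurl (eta : vfield R) : vfield R := fun x =>
  row3 (partial 1 (vcomp eta 2) x - partial 2 (vcomp eta 1) x)
       (partial 2 (vcomp eta 0) x - partial 0 (vcomp eta 2) x)
       (partial 0 (vcomp eta 1) x - partial 1 (vcomp eta 0) x).

Definition weak_grad (p : R3 R -> R) (g : vfield R) : Prop :=
  forall i phi, test phi -> ips (vcomp g i) phi = - ips p (partial i phi).

Definition weak_curl (u c : vfield R) : Prop :=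
  forall eta, vtest eta -> ip c eta = ip u (ccurl eta).

Definition weak_div (u : vfield R) (g : R3 R -> R) : Prop :=
  forall phi, test phi -> ips g phi = - ip u (cgrad phi).

(* The gradient and the curl are determined almost everywhere in Omega, if they
   exist in L2; they are 0 by convention otherwise. *)
Definition grad (p : R3 R -> R) : vfield R :=
  xget (fun=> 0) [set g : vfield R | L2 g /\ weak_grad p g].

Definition curl (u : vfield R) : vfield R :=
  xget (fun=> 0) [set c : vfield R | L2 c /\ weak_curl u c].

Definition H1 (p : R3 R -> R) : Prop :=
  L2s p /\ exists g, L2 g /\ weak_grad p g.

(* H^1_0 as the closure of the test functions in the H^1 norm. *)
Definition H10 (p : R3 R -> R) : Prop :=
  H1 p /\
  forall eps, 0 < eps -> exists2 phi, test phi &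
    ips (p \- phi) (p \- phi) +
    ip (fun x => grad p x - cgrad phi x) (fun x => grad p x - cgrad phi x)
      < eps.

Definition Hdiv (u : vfield R) : Prop :=
  L2 u /\ exists g, L2s g /\ weak_div u g.

Definition Hcurl (u : vfield R) : Prop :=
  L2 u /\ exists c, L2 c /\ weak_curl u c.

Definition Hcurl_norm (u : vfield R) : R :=
  Num.sqrt (ip u u + ip (curl u) (curl u)).

(* The tangential trace of u, as the functional on (traces of) H1 vector fields
   given by Green's formula. *)
Definition tangential_trace (u v : vfield R) : R :=
  ip (curl u) v - ip u (curl v).

Definition H0curl (u : vfield R) : Prop :=
  Hcurl u /\
  forall v, (forall i, H1 (vcomp v i)) -> tangential_trace u v = 0.

Definition K0c (u : vfield R) : Prop := H0curl u /\ weak_div u (fun=> 0).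

(* The dual of K0c, seen as the bounded linear functionals on H0curl vanishing
   on the gradients of H10 functions. The values outside H0curl are junk. *)
Definition K0c_dual (F : vfield R -> R) : Prop :=
  [/\ forall a u v, H0curl u -> H0curl v ->
        F (fun x => a *: u x + v x) = a * F u + F v,
      exists C, forall u, H0curl u -> `|F u| <= C * Hcurl_norm u &
      forall p, H10 p -> F (grad p) = 0].

(* On test fields F is the distribution curl curl phi, that is
   eta |-> (phi, curl curl eta). *)
Definition is_curlcurl (phi : vfield R) (F : vfield R -> R) : Prop :=
  K0c_dual F /\ forall eta, vtest eta -> F eta = ip phi (ccurl (ccurl eta)).

Definition Hcurlcurl (phi : vfield R) : Prop :=
  L2 phi /\ exists F, is_curlcurl phi F.

(* [curlcurl phi v] is the duality pairing of curl curl phi with v. On H0curl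
   the functional is unique, test fields being dense there. *)
Definition curlcurl (phi : vfield R) : vfield R -> R :=
  xget (fun=> 0) [set F | is_curlcurl phi F].

Definition H0div_devsym (tau : mfield R) : Prop :=
  [/\ L2 tau,
      \int[lebesgue3]_(x in Omega) \tr (tau x) = 0,
      forall i, weak_div (fun x => row i (tau x)) (fun=> 0) &
      ae_eq_on (fun x => dev (sym (tau x))) (fun=> 0)].

Definition mixed_solution (f phi u : vfield R) : Prop :=
  [/\ Hcurlcurl phi, K0c u,
      forall psi, Hcurlcurl psi -> ip phi psi + curlcurl psi u = 0 &
      forall v, K0c v -> curlcurl phi v = ip f v].

Definition phi_of (sigma : mfield R) (w : vfield R) : vfield R :=
  fun x => unspn (skw (sigma x)) + w x.

Definition decoupled_solution (f w : vfield R) (sigma : mfield R)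
    (u : vfield R) : Prop :=
  [/\ K0c w, H0div_devsym sigma & K0c u] /\
  [/\ forall v, K0c v -> ip (curl w) (curl v) = ip f v,
      forall tau, H0div_devsym tau ->
        ip (skw \o sigma) (skw \o tau) = - ip (spn \o w) (skw \o tau) &
      forall chi, K0c chi ->
        ip (curl u) (curl chi) = - ip (phi_of sigma w) chi].

End Spaces.

(* Main.v *)
From HB Require Import structures.
From mathcomp Require Import all_boot all_order all_algebra.
From mathcomp Require Import all_classical all_reals all_analysis.
From mathcomp Require Import measurable_realfun ring lra.
Require Import Defs.
Set Implicit Arguments.
Unset Strict Implicit.
Unset Printing Implicit Defensive.
Import Order.TTheory GRing.Theory Num.Theory.
Import numFieldNormedType.Exports.
Local Open Scope classical_set_scope.
Local Open Scope ring_scope.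

(** The stress tau = pI + spn a with p in L2 is row-wise divergence-free exactly
    when grad p + curl a = 0 weakly (up to the sign conventions fixed by
    [stress_pairing]), so the skew parts of the space of stresses are the fields
    a for which curl a is the gradient of an L2 function. On a simply connected
    Lipschitz domain these are exactly the L2 fields with curl curl a = 0
    ([pressure], [devsym_pressure], [pressure_devsym]). Given this, a field phi
    with curl curl phi in the dual of K0c splits as phi = w + a: the curl form
    represents the functional curl curl phi by some w in K0c, since the curl
    controls the L2 norm there ([friedrichs], [curl_riesz]), and a = phi - w has
    curl curl a = 0 ([residual_stress]). The second decoupled equation says that
    phi is orthogonal to all skew parts, the third one tests phi against K0c, and
    together they amount to the first mixed equation because of the splitting of
    its test field psi. The pairing of curl curl phi is unambiguous because test
    fields are dense in H0(curl) ([H0curl_dense]) and gradients split off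
    ([helmholtz]).

    The pressure of a is found as follows. Averages of a over small balls have a
    curl independent of the radius, as the difference of two radial kernels is
    the Laplacian of a test function; this gives a smooth curl-free field T that
    equals curl a weakly ([curl_regular]). A discrete Stokes formula on a null
    homotopy makes T a gradient, T = grad p ([potential]). Near the boundary the
    weighted bound of [caccioppoli] and the Hardy inequality of [hardy_boundary]
    put p in L2.

    Friedrichs' inequality on K0c holds since |(v, eta)| <= C |v| |curl eta| for v
    divergence-free and eta a test field: integrating downwards, eta is the sum
    of a field bounded by its curl and of the gradient of a function which, as
    the boundary is connected, is bounded by the curl outside the domain too
    ([boundary_good]); reflecting this function across the boundary makes its
    gradient orthogonal to v up to exterior terms ([boundary_extension]). *)

Notation space3 R := (measurableTypeR R * measurableTypeR R * measurableTypeR R)%type.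
Notation measurable3 f := (measurable_fun (setT : set (space3 _)) (f : space3 _ -> Real.sort _)).

(** * Square-integrable functions *)

Lemma psd_form (R: realType) (a b c: R): 0 <= a -> 0 <= c ->
 (forall s t, 0 <= s^+2 * a+2 * s * t * b+t^+2 * c) -> b^+2 <= a * c.
move=> a0 c0 key; have:= key c (- b); have:= key b (- (a+1)).
have [->|cn]:= eqVneq c 0.
 move=> h1 h2; suff ->: b = 0 by rewrite expr0n mulr0.
 have b2:= sqr_ge0 b.
 have: (a+2) * b^+2 <= 0 by lra.
 by rewrite pmulr_rle0; [move=> h; apply/eqP; rewrite -sqrf_eq0 eq_le h|lra].
move=> _ h2; have cp: 0 < c by rewrite lt_neqAle eq_sym cn.
have: 0 <= c * (a * c-b^+2) by lra.
by rewrite pmulr_rge0// subr_ge0.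
Qed.

Section RealIntegrable.
Context d (T: measurableType d) (R: realType).
Variable mu: {measure set T -> \bar R}.
Variable D: set T.
Hypothesis mD: measurable D.
Implicit Types f g h: T -> R.
Notation intg f:= (mu.-integrable D (EFin \o f)).

Lemma rintegrableD f g: intg f -> intg g -> intg (fun x=> f x+g x).
exact: (@integrableD _ _ _ mu _ mD (EFin \o f) (EFin \o g)). Qed.

Lemma rintegrableZ f c: intg f -> intg (fun x=> c * f x).
exact: (@integrableZl _ _ _ mu _ mD c (EFin \o f)). Qed.

Lemma rintegrableB f g: intg f -> intg g -> intg (fun x=> f x-g x).
exact: (@integrableB _ _ _ mu _ mD (EFin \o f) (EFin \o g)). Qed.

Lemma rintegrable_sum I (s: seq I) (P: pred I) (h: I -> T -> R) :
 (forall i, P i -> intg (h i)) -> intg (fun x=> \sum_(i <- s | P i) h i x).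
move=> hi; have:= @integrable_sum _ _ _ mu D mD I s P (fun i x=> (h i x)%:E) hi.
by apply: eq_integrable=> // x _ /=; rewrite -sumEFin.
Qed.

Lemma rintegrable_bmul f g c: measurable_fun D g -> (forall x, D x -> `|g x| <= c) ->
 intg f -> intg (fun x=> g x * f x).
move=> mg gc /[dup] fi /integrableP[/measurable_EFinP mf _].
apply: (@le_integrable _ _ _ mu _ mD _ (fun x=> (c * f x)%:E)).
- exact/measurable_EFinP/measurable_funM.
- move=> x Dx /=; rewrite lee_fin !normrM ler_wpM2r//.
 exact: le_trans (gc _ Dx) (ler_norm _).
- exact: rintegrableZ.
Qed.

Lemma le_rintegrable f g: measurable_fun D f -> (forall x, D x -> `|f x| <= g x) ->
 intg g -> intg f.
move=> mf fg; apply: le_integrable=> //; first exact/measurable_EFinP.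
by move=> x Dx /=; rewrite lee_fin (le_trans (fg _ Dx))// ler_norm.
Qed.

Lemma Rintegral_sum I (s: seq I) (P: pred I) (h: I -> T -> R) :
 (forall i, P i -> intg (h i)) ->
 \int[mu]_(x in D) (\sum_(i <- s | P i) h i x) =
 \sum_(i <- s | P i) \int[mu]_(x in D) h i x.
move=> hi; elim: s=> [|i s IH].
 by rewrite big_nil; under eq_Rintegral do rewrite big_nil; rewrite Rintegral_cst// mul0r.
rewrite big_cons; under eq_Rintegral do rewrite big_cons.
case: ifP=> Pi; last by rewrite IH.
by rewrite RintegralD ?IH//; [exact: hi|exact: rintegrable_sum].
Qed.

End RealIntegrable.

Section SquareIntegrable.
Context d (T: measurableType d) (R: realType).
Variable mu: {measure set T -> \bar R}.
Implicit Types f g h: T -> R.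

Definition sqint f:= measurable_fun setT f /\
 mu.-integrable setT (EFin \o (fun x=> f x^+2)).

Lemma Lfun2P f: f \in Lfun mu 2%:E <-> sqint f.
split=> [lf|[mf /integrableP[_ lf]]].
 split; last exact: Lfun2_integrable_sqr.
 by move: lf; rewrite inE=> /andP[/[!inE]].
rewrite inE; apply/andP; split; rewrite inE//=.
rewrite /finite_norm unlock /Lnorm poweR_lty//.
apply: le_lt_trans lf; rewrite le_eqVlt; apply/orP; left; apply/eqP.
by apply: eq_integral=> x _ /=; rewrite normrX powR_mulrn.
Qed.

Lemma sqint_mul f g: sqint f -> sqint g ->
 mu.-integrable setT (EFin \o (fun x=> f x * g x)).
move=> /Lfun2P lf /Lfun2P lg; apply/Lfun1_integrable.
exact: Lfun2_mul_Lfun1 lf lg.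
Qed.

Lemma sqintD f g: sqint f -> sqint g -> sqint (fun x=> f x+g x).
move=> /Lfun2P lf /Lfun2P lg; apply/Lfun2P.
by have [_]:= Lfun_addr_closed mu (lee1n 2); apply.
Qed.

Lemma sqint_bmul f g c: measurable_fun setT g -> (forall x, `|g x| <= c) ->
 sqint f -> sqint (fun x=> g x * f x).
move=> mg gc [mf lf]; split; first exact: measurable_funM.
apply: (@le_integrable _ _ _ mu _ measurableT _ (fun x=> (c^+2)%:E * (f x^+2)%:E)%E).
- by apply/measurable_EFinP; apply: measurable_funX; exact: measurable_funM.
- move=> x _ /=; have c0: 0 <= c:= le_trans (normr_ge0 _) (gc x).
 rewrite lee_fin normrX normrM exprMn normrM !normrX ler_wpM2r ?exprn_ge0//.
 by rewrite (ger0_norm c0) lerXn2r ?nnegrE.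
- exact: integrableZl.
Qed.

Lemma sqintZ f c: sqint f -> sqint (fun x=> c * f x).
by apply: (@sqint_bmul _ (cst c) `|c|)=> //; exact: measurable_cst. Qed.

Lemma sqintB f g: sqint f -> sqint g -> sqint (fun x=> f x-g x).
move=> lf lg; have:= sqintD lf (sqintZ (-1) lg).
by under eq_fun do rewrite mulN1r.
Qed.

Lemma eq_sqint f g: f =1 g -> sqint f -> sqint g.
by move=> /funext ->. Qed.

Lemma le_sqint f g: measurable_fun setT f -> (forall x, `|f x| <= `|g x|) ->
 sqint g -> sqint f.
move=> mf fg [mg lg]; split=> //.
apply: le_integrable lg=> //; first exact/measurable_EFinP/measurable_funX.
by move=> x _ /=; rewrite lee_fin !normrX lerXn2r ?nnegrE.
Qed.

Lemma sqint_CS f g: sqint f -> sqint g ->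
 (\int[mu]_x (f x * g x))^+2 <= \int[mu]_x (f x^+2) * \int[mu]_x (g x^+2).
move=> lf lg; set a:= \int[mu]_x (f x^+2); set b:= \int[mu]_x _.
set c:= \int[mu]_x (g x^+2).
have key s t: 0 <= s^+2 * a+2 * s * t * b+t^+2 * c.
 have <- : \int[mu]_x ((s * f x+t * g x)^+2) =
   s^+2 * a+2 * s * t * b+t^+2 * c.
  rewrite /a /b /c -!RintegralZl//; last 3 first.
  - by case: lg.
  - exact: sqint_mul.
  - by case: lf.
  have i1:= rintegrableZ measurableT (s^+2) lf.2.
  have i2:= rintegrableZ measurableT (2 * s * t) (sqint_mul lf lg).
  have i3:= rintegrableZ measurableT (t^+2) lg.2.
  rewrite -RintegralD// -RintegralD//; last exact: rintegrableD i1 i2.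
  by apply: eq_Rintegral=> x _; ring.
 by apply: Rintegral_ge0=> x _; exact: sqr_ge0.
have a0: 0 <= a by apply: Rintegral_ge0=> x _; exact: sqr_ge0.
have c0: 0 <= c by apply: Rintegral_ge0=> x _; exact: sqr_ge0.
exact: psd_form.
Qed.


Lemma sqint_ae f g: measurable_fun setT g -> {ae mu, forall x, f x = g x} ->
 sqint f -> sqint g.
move=> mg fg [mf fi]; split=> //.
have e: ae_eq mu setT (EFin \o (fun x=> f x^+2)) (EFin \o (fun x=> g x^+2)).
 by apply: filterS fg=> x /= -> _.
have mg2: measurable_fun setT (EFin \o (fun x=> g x^+2)).
 by apply/measurable_EFinP; exact: measurable_funX.
have mf2: measurable_fun setT (EFin \o (fun x=> f x^+2)).
 by apply/measurable_EFinP; exact: measurable_funX.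
apply/integrableP; split=> //; case/integrableP: fi=> _.
rewrite (@ae_eq_integral _ _ _ mu setT (fun x=> `|(g x^+2)%:E|)%E)//.
- exact: measurableT_comp.
- exact: measurableT_comp.
- by apply: filterS fg=> x /= -> _.
Qed.

Lemma Rintegral_ae f g: measurable_fun setT f -> measurable_fun setT g ->
 {ae mu, forall x, f x = g x} -> \int[mu]_x f x = \int[mu]_x g x.
move=> mf mg fg; congr fine; apply: ae_eq_integral=> //.
- exact/measurable_EFinP.
- exact/measurable_EFinP.
- by apply: filterS fg=> x /= -> _.
Qed.

Lemma geometric_cauchy (u: nat -> R) (c: R): 0 <= c ->
 (forall k, `|u k.+1-u k| <= c/2^+k) ->
 exists l: R, u @ \oo --> l /\ forall k, `|u k-l| <= 2 * c/2^+k.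
move=> c0 uc.
have cv: cvgn u.
 have st: cvgn (series (telescope u)).
  apply: normed_cvg; apply: (@series_le_cvg _ _ (geometric c (2^-1)))=> //.
  - by move=> n /=.
  - by move=> n /=; rewrite mulr_ge0// exprn_ge0// invr_ge0.
  - by move=> n /=; rewrite exprVn; exact: uc.
  - by apply: is_cvg_geometric_series; rewrite ger0_norm ?invr_ge0// invf_lt1// ltr1n.
 have ->: u = (fun n=> u 0%N+series (telescope u) n).
  by apply/funext=> n; exact: eq_sum_telescope.
 by apply: is_cvgD=> //; exact: is_cvg_cst.
exists (lim (u @ \oo)); split=> // k.
have bd i: `|u k-u (k+i)%N| <= 2 * c/2^+k.
 have: `|u k-u (k+i)%N| <= 2 * c/2^+k * (1-2^-1^+i).
  elim: i=> [|i IH]; first by rewrite addn0 subrr normr0 expr0 subrr mulr0.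
  rewrite addnS -(subrKA (u (k+i)%N)).
  apply: (le_trans (ler_normD _ _)).
  have h:= uc (k+i)%N; rewrite distrC in h.
  apply: (le_trans (lerD IH h)).
  rewrite le_eqVlt; apply/orP; left; apply/eqP.
  by rewrite exprD exprS exprVn; field; rewrite !expf_neq0.
 move/le_trans; apply; rewrite ler_piMr//.
  by rewrite !mulr_ge0// invr_ge0 exprn_ge0.
have h: (fun i=> `|u k-u i|) @ \oo --> `|u k-lim (u @ \oo)|.
 by apply: cvg_norm; apply: cvgB=> //; exact: cvg_cst.
rewrite -(cvg_lim _ h)//; apply: limr_le; first by apply/cvg_ex; eexists; exact: h.
by exists k=> // i /= ki; rewrite -(subnKC ki).
Qed.

Lemma sqint_dist f g h: sqint f -> sqint g -> sqint h ->
 \int[mu]_x ((f x-h x)^+2) <=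
 2 * \int[mu]_x ((f x-g x)^+2)+2 * \int[mu]_x ((g x-h x)^+2).
move=> lf lg lh; have l1:= sqintB lf lg; have l2:= sqintB lg lh.
have l3:= sqintB lf lh.
have m2: forall w, sqint w -> mu.-integrable setT (EFin \o (fun x=> 2 * w x^+2)).
 by move=> w lw; exact: rintegrableZ lw.2.
rewrite -!RintegralZl//; [|exact: l2.2|exact: l1.2].
rewrite -RintegralD//; [|exact: m2 _ l1|exact: m2 _ l2].
apply: le_Rintegral=> //; first exact: l3.2.
 by apply: rintegrableD=> //; [exact: m2 _ l1|exact: m2 _ l2].
move=> x _; have:= sqr_ge0 ((f x-g x)-(g x-h x)); nra.
Qed.

Lemma sqint_complete (f: nat -> T -> R): (forall n, sqint (f n)) ->
 (forall eps: R, 0 < eps -> exists N, forall n m, (N <= n)%N -> (N <= m)%N ->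
  \int[mu]_x ((f n x-f m x)^+2) <= eps) ->
 exists g, sqint g /\ forall eps: R, 0 < eps -> exists N, forall n, (N <= n)%N ->
  \int[mu]_x ((f n x-g x)^+2) <= eps.
move=> sf cau.
have e0 k: 0 < (8: R)^-1^+k by rewrite exprn_gt0// invr_gt0.
have [K KP]:= choice (fun k=> cau _ (e0 k)).
pose M k:= (\sum_(j < k.+1) K j+k)%N.
have MK k: (K k <= M k)%N by rewrite /M big_ord_recr/= addnAC leq_addl.
have MKS k: (K k <= M k.+1)%N.
 by rewrite /M 2!big_ord_recr/= -2!addnA addnCA leq_addr.
pose g k:= f (M k).
have gS k: \int[mu]_x ((g k.+1 x-g k x)^+2) <= 8^-1^+k by exact: KP.
pose w k x:= 4^+k * (g k.+1 x-g k x)^+2.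
have wi k: mu.-integrable setT (EFin \o w k).
 by apply: rintegrableZ=> //; exact: (sqintB (sf _) (sf _)).2.
have w0 k x: 0 <= w k x by rewrite /w mulr_ge0 ?sqr_ge0 ?exprn_ge0//.
pose S x:= (\sum_(0 <= k <oo) (w k x)%:E)%E.
have mw k: measurable_fun setT (EFin \o w k) by case/integrableP: (wi k).
have S0 x: (0 <= S x)%E by apply: nneseries_ge0=> n _ _; rewrite lee_fin.
have intS: (\int[mu]_x S x < +oo)%E.
 rewrite /S integral_nneseries//; last by move=> n x _; rewrite lee_fin.
 apply: (@le_lt_trans _ _ (\sum_(0 <= k <oo) ((geometric 1 2^-1 k)%:E))%E).
  apply: lee_nneseries=> [n _ _|n _]; first by apply: integral_ge0=> x _; rewrite lee_fin.
  rewrite -(fineK (integrable_fin_num measurableT (wi n))) lee_fin.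
  have ->: fine (\int[mu]_x (EFin \o w n) x) = \int[mu]_x w n x by [].
  rewrite /w RintegralZl//; last exact: (sqintB (sf _) (sf _)).2.
  have h:= ler_wpM2l (exprn_ge0 n (ler0n R 4)) (gS n).
  apply: (le_trans h); rewrite -exprMn /= mul1r le_eqVlt; apply/orP; left; apply/eqP.
  by congr (_ ^+ _); field.
 have:= @cvg_geometric_eseries_half R 2 0.
 move/(cvg_lim (@ereal_hausdorff R))=> h; apply: (@le_lt_trans _ _ (2: R)%:E); last exact: ltry.
 rewrite le_eqVlt; apply/orP; left; apply/eqP.
 rewrite expr0 divr1 in h; rewrite -h; congr (lim (_ @ \oo)).
 apply/funext=> n; apply: eq_bigr=> k _; congr (_%:E).
 by rewrite /= addn1 expnS natrM natrX mul1r exprVn invfM mulrA mulfV// mul1r.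
have mS: measurable_fun setT S.
 apply: (@emeasurable_fun_cvg _ _ _ _ (fun n x=> \sum_(0 <= k < n) (w k x)%:E)%E).
 - move=> n; apply: emeasurable_sum=> k; exact: mw.
 - by move=> x _; apply: is_cvg_nneseries=> n _ _; rewrite lee_fin.
have iS: mu.-integrable setT S.
 apply/integrableP; split=> //.
 by under eq_integral do rewrite gee0_abs//.
pose A:= [set x | S x \is a fin_num].
have mA: measurable A.
 by rewrite -[A]setTI; exact: (emeasurable_fin_num measurableT mS).
have aeA: {ae mu, forall x, A x}.
 by apply: filterS (integrable_ae measurableT iS)=> x; apply.
pose s x:= fine (S x).
have s0 x: 0 <= s x by rewrite fine_ge0.
have ms: measurable_fun setT s by exact: measurableT_comp.
have is_: mu.-integrable setT (EFin \o s).
 apply: le_integrable iS=> //; first exact/measurable_EFinP.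
 by move=> x _; rewrite /= /s; case: (S x) (S0 x)=> //= _; rewrite ?leey// normr0.
have ws k x: A x -> w k x <= s x.
 move=> Ax; rewrite -lee_fin fineK//.
 apply: le_trans (@nneseries_lim_ge _ (fun k=> (w k x)%:E) predT 0 k.+1 _); last by move=> i _ _; rewrite lee_fin.
 rewrite big_nat_recr//= leeDr// sume_ge0// => i _; by rewrite lee_fin.
have cg x: A x -> exists l: R, g^~ x @ \oo --> l /\
  forall k, `|g k x-l| <= 2 * Num.sqrt (s x)/2^+k.
 move=> Ax; apply: geometric_cauchy; first exact: sqrtr_ge0.
 move=> k; rewrite ler_pdivlMr ?exprn_gt0// -(ler_pXn2r (ltn0Sn 1)) ?nnegrE ?mulr_ge0 ?exprn_ge0 ?sqrtr_ge0//.
 rewrite sqr_sqrtr// exprMn -exprM mulnC exprM -natrX real_normK ?num_real// mulrC.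
 exact: ws.
pose l x:= if pselect (A x) is left Ax then projT1 (cid (cg x Ax)) else 0.
have lP x: A x -> g^~ x @ \oo --> l x /\
  forall k, `|g k x-l x| <= 2 * Num.sqrt (s x)/2^+k.
 by move=> Ax; rewrite /l; case: pselect=> // Ax'; exact: (projT2 (cid (cg x Ax'))).
have ml: measurable_fun setT l.
 apply: (@measurable_fun_cvg _ _ _ _ (fun k x=> g k x * \1_A x)).
  by move=> k; apply: measurable_funM; [exact: (sf _).1|exact: measurable_indic].
 move=> x _; have [Ax|nAx]:= pselect (A x).
  rewrite indicE mem_set//; under eq_fun do rewrite mulr1.
  exact: (lP x Ax).1.
 rewrite indicE memNset//; under eq_fun do rewrite mulr0.
 by rewrite /l; case: pselect=> // _; exact: cvg_cst.
pose r k x:= (g k x-l x) * \1_A x.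
have rE k: {ae mu, forall x, r k x = g k x-l x}.
 by apply: filterS aeA=> x Ax; rewrite /r indicE mem_set// mulr1.
have rb k x: r k x^+2 <= 4/4^+k * s x.
 have [Ax|nAx]:= pselect (A x).
  rewrite /r indicE mem_set// mulr1; have [_ /(_ k)]:= lP x Ax.
  rewrite -(ler_pXn2r (ltn0Sn 1)) ?nnegrE ?mulr_ge0 ?invr_ge0 ?exprn_ge0 ?sqrtr_ge0//.
  rewrite real_normK ?num_real// => /le_trans; apply.
  rewrite !exprMn sqr_sqrtr// exprVn -exprM mulnC exprM -!natrX.
  by rewrite le_eqVlt; apply/orP; left; apply/eqP; ring.
 by rewrite /r indicE memNset// mulr0 expr0n mulr_ge0 ?divr_ge0 ?exprn_ge0.
have mr k: measurable_fun setT (r k).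
 apply: measurable_funM; last exact: measurable_indic.
 by apply: measurable_funB=> //; exact: (sf _).1.
have sr k: sqint (r k).
 split=> //; apply: (@le_rintegrable _ _ _ _ _ measurableT _ (fun x=> 4/4^+k * s x)).
 - exact: measurable_funX.
 - by move=> x _; rewrite ger0_norm ?sqr_ge0.
 - exact: rintegrableZ.
have sgl k: sqint (fun x=> g k x-l x).
 apply: sqint_ae (rE k) (sr k); apply: measurable_funB=> //; exact: (sf _).1.
have sl: sqint l.
 by apply: eq_sqint (sqintB (sf (M 0%N)) (sgl 0%N))=> x; rewrite /g subKr.
exists l; split=> // eps eps0.
have Ik k: \int[mu]_x ((g k x-l x)^+2) <= 4/4^+k * \int[mu]_x s x.
 rewrite (@Rintegral_ae _ (fun x=> r k x^+2)); last first.
 - by apply: filterS (rE k)=> x ->.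
 - exact: measurable_funX.
 - by apply: measurable_funX; exact: (sgl k).1.
 rewrite -RintegralZl//; apply: le_Rintegral=> //; first exact: (sr k).2.
 exact: rintegrableZ.
have I0: 0 <= \int[mu]_x s x by exact: Rintegral_ge0.
have [N NP]:= cau (eps/4) ltac:(lra).
have [k Nk Hk]: exists2 k, (N <= M k)%N & 4/4^+k * \int[mu]_x s x <= eps/4.
 have: (fun k=> \int[mu]_x s x * geometric 4 4^-1 k) @ \oo --> \int[mu]_x s x * 0.
  by apply: cvgMr; apply: cvg_geometric; rewrite ger0_norm// invf_lt1// ltr1n.
 rewrite mulr0=> /cvgr0_norm_le /(_ (eps/4) ltac:(lra))[k0 _ k0P].
 exists (maxn N k0); first by rewrite (leq_trans (leq_maxl N k0))// leq_addl.
 have:= k0P (maxn N k0) (leq_maxr N k0); apply: le_trans.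
 by rewrite /= exprVn mulrC ler_norm.
exists N=> n Nn.
have:= sqint_dist (sf n) (sf (M k)) sl.
have:= NP n (M k) Nn Nk; have:= Ik k; rewrite /g; lra.
Qed.

End SquareIntegrable.

(** * Lebesgue measure on space *)

Section ProductSigmaFinite.
Local Open Scope ereal_scope.
Context d1 d2 (T1: measurableType d1) (T2: measurableType d2) (R: realType).
Variables (m1: {sigma_finite_measure set T1 -> \bar R}).
Variables (m2: {sigma_finite_measure set T2 -> \bar R}).

Lemma product_sigma_finite: sigma_finite setT (m1 \x m2).
have /sigma_finiteP[F [TF ndF Ffin]]:= sigma_finiteT m1.
have /sigma_finiteP[G [TG ndG Gfin]]:= sigma_finiteT m2.
exists (fun n=> F n `*` G n).
 apply/seteqP; split=> // -[x y] _.
 have [i _ Fx]: (\bigcup_i F i) x by rewrite -TF.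
 have [j _ Gy]: (\bigcup_j G j) y by rewrite -TG.
 exists (maxn i j)=> //; split=> /=.
 - by move: x Fx; exact/subsetPset/ndF/leq_maxl.
 - by move: y Gy; exact/subsetPset/ndG/leq_maxr.
move=> k; have [mF Fk]:= Ffin k; have [mG Gk]:= Gfin k.
split; first exact: measurableX.
by rewrite product_measure1E// lte_mul_pinfty// ge0_fin_numE.
Qed.

Definition sigma_finite_product: {sigma_finite_measure set (T1 * T2)%type -> \bar R} :=
 HB.pack_for {sigma_finite_measure set (T1 * T2)%type -> \bar R} (m1 \x m2)
  (Measure_isSigmaFinite.Build _ _ _ (m1 \x m2) product_sigma_finite).

End ProductSigmaFinite.

Definition leb2 (R: realType) :=
 sigma_finite_product (@lebesgue_measure R) (@lebesgue_measure R).
Definition leb3 (R: realType):= sigma_finite_product (leb2 R) (@lebesgue_measure R).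

Lemma integral_shift1 (R: realType) (h: R) (f: R -> \bar R): measurable_fun setT f ->
 (forall x, 0 <= f x)%E -> (\int[@lebesgue_measure R]_x f (x+h)%R = \int[@lebesgue_measure R]_x f x)%E.
move=> mf f0.
pose sh: measurableTypeR R -> measurableTypeR R:= fun x: R=> x+h.
have mh: measurable_fun setT sh by exact: measurable_funD.
transitivity (\int[pushforward (@lebesgue_measure R) sh]_y f y)%E.
 by rewrite ge0_integral_pushforward// preimage_setT.
apply: eq_measure_integral=> A mA _ /=; apply/esym.
apply: (@lebesgue_measure_unique R (pushforward (@lebesgue_measure R) sh))=> //= _ [[a b]] _ <-.
rewrite /pushforward /=.
have ->: sh @^-1` `]a, b]%classic = `](a-h), (b-h)]%classic.
 by apply/seteqP; split=> x /=; rewrite !in_itv/= ltrBlDr lerBrDr.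
by rewrite !lebesgue_measure_itv/= !lte_fin ltrD2r; case: ifP=> // _; congr (_%:E); ring.
Qed.

Lemma integral_reflect1 (R: realType) (f: R -> \bar R): measurable_fun setT f ->
 (forall x, 0 <= f x)%E -> (\int[@lebesgue_measure R]_x f (- x)%R = \int[@lebesgue_measure R]_x f x)%E.
move=> mf f0.
pose op: measurableTypeR R -> measurableTypeR R:= fun x: R=> - x.
transitivity (\int[pushforward (@lebesgue_measure R) op]_y f y)%E.
 rewrite ge0_integral_pushforward//; exact: oppr_measurable.
have mop: measurable_fun setT op by exact: oppr_measurable.
apply: eq_measure_integral=> A mA _.
have:= lebesgue_measureN mA.
exact.
Qed.

Section Space.
Context (R: realType).
Notation mu:= (leb3 R).
Notation leb1:= (@lebesgue_measure R).
Notation T2:= (measurableTypeR R * measurableTypeR R)%type.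
Notation T3:= (space3 R).

Lemma tonelli3 (f: R3 R -> \bar R) :
 measurable_fun (setT: set T3) (f: T3 -> \bar R) -> (forall x, 0 <= f x)%E ->
 (\int[mu]_x f x = \int[leb1]_a \int[leb1]_b \int[leb1]_c f (a, b, c))%E.
move=> mf f0.
have ->: (\int[mu]_x f x = \int[leb2 R]_x \int[leb1]_c f (x, c))%E.
 exact: (fubini_tonelli1 (m1:= leb2 R) (m2:= leb1) f mf f0).
pose F (x: R * R):= (\int[leb1]_c f (x, c))%E.
have mF: measurable_fun (setT: set T2) (F: T2 -> \bar R).
 exact: (measurable_fun_fubini_tonelli_F (m2:= leb1) f mf f0).
have F0 x: (0 <= F x)%E by apply: integral_ge0.
exact: (fubini_tonelli1 (m1:= leb1) (m2:= leb1) F mF F0).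
Qed.
Lemma measurable_shift3 (h: R3 R): measurable_fun (setT: set T3) ((fun x=> x+h): T3 -> T3).
case: h=> -[h1 h2] h3.
apply: measurable_fun_pair=> /=.
 apply: measurable_fun_pair=> /=.
  apply: measurable_funD=> //; apply: measurableT_comp=> //; exact: measurable_fst.
 apply: measurable_funD=> //; apply: measurableT_comp=> //; exact: measurable_fst.
by apply: measurable_funD=> //; exact: measurable_snd.
Qed.

Lemma integral_shift (h: R3 R) (f: R3 R -> \bar R) :
 measurable_fun (setT: set T3) (f: T3 -> \bar R) -> (forall x, 0 <= f x)%E ->
 (\int[mu]_x f (x+h)%R = \int[mu]_x f x)%E.
move=> mf f0.
have mfh: measurable_fun (setT: set T3) ((fun x=> f (x+h)): T3 -> \bar R).
 exact: measurableT_comp mf (measurable_shift3 h).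
rewrite (tonelli3 mfh (fun x=> f0 _)) (tonelli3 mf f0).
case: h {mfh}=> -[h1 h2] h3.
pose F (x: R * R):= (\int[leb1]_c f (x, c))%E.
have mF: measurable_fun (setT: set T2) (F: T2 -> \bar R).
 exact: (measurable_fun_fubini_tonelli_F (m2:= leb1) f mf f0).
have F0 x: (0 <= F x)%E by apply: integral_ge0.
pose G (a: R):= (\int[leb1]_b F (a, b))%E.
have mG: measurable_fun (setT: set (measurableTypeR R)) (G: measurableTypeR R -> \bar R).
 exact: (measurable_fun_fubini_tonelli_F (m2:= leb1) F mF F0).
have G0 x: (0 <= G x)%E by apply: integral_ge0.
rewrite -[RHS](integral_shift1 h1 mG G0); apply: eq_integral=> a _.
rewrite /G -[RHS](integral_shift1 h2); last 2 first.
- exact: (measurableT_comp mF (measurable_pair1 (a+h1))).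
- by move=> ?; exact: F0.
apply: eq_integral=> b _.
rewrite /F -[RHS](integral_shift1 h3) //.
exact: (measurableT_comp mf (measurable_pair1 (a+h1, b+h2))).
Qed.

Lemma open_measurable3 (U: set (R3 R)): open U -> measurable (U: set T3).
move=> oU.
pose B (q: rat * rat * rat * nat): set (R3 R) :=
 ball ((ratr q.1.1.1: R, ratr q.1.1.2: R, ratr q.1.2: R): R3 R) (q.2.+1%:R^-1: R).
have ->: U = \bigcup_(q in [set q | B q `<=` U]) B q.
 apply/seteqP; split=> [x Ux|x [q Bq]]; last exact: Bq.
 have /nbhs_ballP[e /= e0 eU]: nbhs x U by exact: open_nbhs_nbhs.
 have [n ne]: exists n, n.+1%:R^-1 < e/2.
  have [k hk]:= @ltr_add_invr R 0 (e/2) (divr_gt0 e0 (ltr0n R 2)); by exists k; rewrite add0r in hk.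
 have e2: n.+1%:R^-1+n.+1%:R^-1 < e by rewrite [ltRHS]splitr ltrD.
 have rq (t: R): exists q: rat, `|ratr q-t| < n.+1%:R^-1.
  have [|q]:= @rat_in_itvoo R (t-n.+1%:R^-1) (t+n.+1%:R^-1).
   by rewrite ltrD2l -subr_gt0 opprK addr_gt0// invr_gt0.
  rewrite in_itv/= => tq; exists q; rewrite ltr_distl; exact: tq.
 case: x Ux eU=> -[x1 x2] x3 Ux eU.
 have [q1 h1]:= rq x1; have [q2 h2]:= rq x2; have [q3 h3]:= rq x3.
 exists (q1, q2, q3, n); last by [].
 move=> [[y1 y2] y3] [[/= b1 b2] b3]; apply: eU.
 move: h1 h2 h3 b1 b2 b3; rewrite /ball/= => h1 h2 h3 b1 b2 b3.
 split; [split|]; rewrite /ball/=.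
 - by apply: (le_lt_trans (ler_distD (ratr q1) _ _)); rewrite distrC in h1; exact: lt_trans (ltrD h1 b1) e2.
 - by apply: (le_lt_trans (ler_distD (ratr q2) _ _)); rewrite distrC in h2; exact: lt_trans (ltrD h2 b2) e2.
 - by apply: (le_lt_trans (ler_distD (ratr q3) _ _)); rewrite distrC in h3; exact: lt_trans (ltrD h3 b3) e2.
rewrite bigcup_mkcond; apply: countable_bigcupT_measurable; first exact: countableP.
move=> [[[q1 q2] q3] n]; case: ifPn=> // _.
rewrite (_: B _ = (ball (ratr q1: R) (n.+1%:R^-1) `*` ball (ratr q2: R) (n.+1%:R^-1)) `*` ball (ratr q3: R) (n.+1%:R^-1)).
 by apply: measurableX; [apply: measurableX|]; exact: measurable_ball.
by [].
Qed.

Lemma continuous_measurable3 (f: R3 R -> R): continuous f ->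
 measurable3 f.
move=> /continuousP cf; apply: (measurability _ (RGenOpens.measurableE R)).
move=> _ [_ [a [b ->] <-]]; rewrite setTI; apply: open_measurable3.
exact/cf/interval_open.
Qed.

Lemma closed_measurable3 (K: set (R3 R)): closed K -> measurable (K: set T3).
move=> cK; rewrite -[K]setCK; apply: measurableC; apply: open_measurable3.
exact: closed_openC.
Qed.

Definition cube (M: R): set (R3 R):= (`[- M, M] `*` `[- M, M]) `*` `[- M, M].

Lemma cubeE M (x: R3 R): cube M x <-> `|x| <= M.
case: x=> -[a b] c; rewrite /cube/= !in_itv/= /Num.norm/= /Num.norm/= !ge_max !ler_norml.
by split=> [[[-> ->] ->]|/andP[/andP[-> ->] ->]].
Qed.

Lemma measurable_cube M: measurable (cube M: set T3).
by apply: measurableX; [apply: measurableX|]; exact: measurable_itv. Qed.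

Lemma cube_finite M: (mu (cube M) < +oo)%E.
rewrite /mu/= /sigma_finite_product /= product_measure1E/=; last 2 first.
- by apply: measurableX; exact: measurable_itv.
- exact: measurable_itv.
rewrite product_measure1E/=; [|exact: measurable_itv|exact: measurable_itv].
have h: (leb1 `[(- M)%R, M] < +oo)%E.
 by rewrite lebesgue_measure_itv/=; case: ifP=> _; [rewrite -EFinB ltry|].
have fn: leb1 `[(- M)%R, M] \is a fin_num by rewrite ge0_fin_numE.
by rewrite -(fineK fn) -!EFinM ltry.
Qed.

Lemma bounded_cube (A: set (R3 R)): bounded_set A -> exists2 M, 0 < M & A `<=` cube M.
move=> [M [_ MA]]; exists (`|M| + 1); first by rewrite ltr_wpDl.
move=> x Ax; apply/cubeE; apply: MA=> //.
by rewrite (le_lt_trans (ler_norm _))// ltrDl.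
Qed.

Lemma tonelli_swap d (Y: measurableType d) (nu: {sigma_finite_measure set Y -> \bar R})
  (f: R3 R * Y -> \bar R) :
 measurable_fun (setT: set (T3 * Y)%type) (f: T3 * Y -> \bar R) -> (forall z, 0 <= f z)%E ->
 (\int[nu]_y \int[mu]_x f (x, y) = \int[mu]_x \int[nu]_y f (x, y))%E.
by move=> mf f0; apply/esym; exact: (fubini_tonelli (m1:= mu) (m2:= nu) f mf f0). Qed.

Lemma integralE_shift (h: R3 R) (f: R3 R -> \bar R) :
 measurable_fun (setT: set T3) (f: T3 -> \bar R) ->
 (\int[mu]_x f (x+h)%R = \int[mu]_x f x)%E.
move=> mf; rewrite integralE [RHS]integralE; congr (_ - _)%E.
- transitivity (\int[mu]_x (f^\+ (x+h)%R))%E.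
  by apply: eq_integral=> x _; rewrite !funeposE.
 apply: (integral_shift h (f:= (f^\+)%E)); first exact: measurable_funepos.
 by move=> ?; exact: funepos_ge0.
- transitivity (\int[mu]_x (f^\- (x+h)%R))%E.
  by apply: eq_integral=> x _; rewrite !funenegE.
 apply: (integral_shift h (f:= (f^\-)%E)); first exact: measurable_funeneg.
 by move=> ?; exact: funeneg_ge0.
Qed.

Lemma Rintegral_shift (h: R3 R) (f: R3 R -> R) :
 measurable3 f ->
 \int[@lebesgue3 R]_x f (x+h) = \int[@lebesgue3 R]_x f x.
move=> mf; rewrite /Rintegral; congr fine.
apply: (integralE_shift h (f:= EFin \o f)); exact/measurable_EFinP.
Qed.

Lemma integrable_shift (h: R3 R) (f: R3 R -> R) :
 (@lebesgue3 R).-integrable setT (EFin \o f) ->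
 (@lebesgue3 R).-integrable setT (EFin \o (fun x=> f (x+h))).
move=> /integrableP[/measurable_EFinP mf fi].
have mfh: measurable3 (fun x=> f (x+h)).
 exact: measurableT_comp mf (measurable_shift3 h).
apply/integrableP; split; first exact/measurable_EFinP.
apply: le_lt_trans fi; rewrite le_eqVlt; apply/orP; left; apply/eqP.
apply: (integralE_shift h (f:= fun x=> `|(f x)%:E|%E)).
by apply: measurableT_comp=> //; exact/measurable_EFinP.
Qed.

Lemma integrable_cube M (A: set (R3 R)) (f: R3 R -> R) (c: R): measurable (A: set T3) ->
 A `<=` cube M -> measurable_fun (A: set T3) (f: T3 -> R) -> (forall x, A x -> `|f x| <= c) ->
 (@lebesgue3 R).-integrable A (EFin \o f).
move=> mA AM mf fc; apply: measurable_bounded_integrable=> //.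
 apply: le_lt_trans (cube_finite M); apply: le_measure=> //; rewrite inE//.
 exact: measurable_cube.
exists c; split; first exact: num_real.
by move=> y cy x Ax /=; apply: (le_trans (fc _ Ax)); exact: ltW.
Qed.

End Space.

(** * Variational minima and fields in L2 *)

Section VariationalMinimum.
Context (R: realType) (V: lmodType R).
Variables (S: V -> Prop) (B: V -> V -> R) (F: V -> R) (C: R).
Hypothesis C0: 0 <= C.
Hypothesis S0: S 0.
Hypothesis SL: forall a u v, S u -> S v -> S (a *: u+v).
Hypothesis Bsym: forall u v, S u -> S v -> B u v = B v u.
Hypothesis Blin: forall a u v w, S u -> S v -> S w -> B (a *: u+v) w = a * B u w+B v w.
Hypothesis Bpos: forall u, S u -> 0 <= B u u.
Hypothesis Flin: forall a u v, S u -> S v -> F (a *: u+v) = a * F u+F v.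
Hypothesis Fbd: forall u, S u -> (F u)^+2 <= C * B u u.

Lemma variational_minimum: exists v: nat -> V,
 [/\ forall n, S (v n),
   forall n m, B (v n-v m) (v n-v m) <= 2 * (n.+1%:R^-1+m.+1%:R^-1) &
   forall n s, S s -> (B (v n) s-F s)^+2 <= n.+1%:R^-1 * B s s].
have Blin2 a u v w: S u -> S v -> S w -> B w (a *: u+v) = a * B w u+B w v.
 by move=> Su Sv Sw; rewrite Bsym ?Blin// ?(Bsym Su)// 1?(Bsym Sv)//; exact: SL.
pose J v:= B v v-2 * F v.
have JL v s t: S v -> S s -> J (t *: s+v) = J v+2 * t * (B v s-F s)+t^+2 * B s s.
 move=> Sv Ss; rewrite /J Flin// Blin ?Blin2//; last exact: SL.
 by rewrite (Bsym Ss Sv); ring.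
have Jlow v: S v -> - C <= J v.
 move=> Sv; have b0:= Bpos Sv; have:= Fbd Sv; rewrite /J=> h.
 have C0':= C0; suff: 0 <= B v v+C-2 * F v by lra.
 rewrite subr_ge0; case: (leP (2 * F v) 0)=> [f0|f0]; first lra.
 rewrite -(ler_pXn2r (ltn0Sn 1)) ?nnegrE//; [|lra|lra].
 have:= sqr_ge0 (B v v-C); nra.
pose E:= [set J v | v in [set v | S v]].
have hE: has_inf E.
 split; first by exists (J 0); exists 0.
 by exists (- C)=> _ [v Sv <-]; exact: Jlow.
have Jm v: S v -> inf E <= J v.
 by move=> Sv; apply: ge_inf; [case: hE|exists v].
have ex n: exists v, S v /\ J v <= inf E+n.+1%:R^-1.
 have e0: 0 < n.+1%:R^-1 :> R by rewrite invr_gt0.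
 have [_ [v Sv <-] h]:= inf_adherent e0 hE.
 by exists v; split=> //; exact: ltW.
have [v vP]:= choice ex; exists v; split.
- by move=> n; case: (vP n).
- move=> n m; have [Sn Jn]:= vP n; have [Sm Jmm]:= vP m.
 have Sd: S (v n-v m) by rewrite addrC -scaleN1r; exact: SL.
 have:= Jm _ (SL (2^-1) Sd Sm); rewrite JL//.
 have:= JL (v m) (v n-v m) 1 Sm Sd; rewrite scale1r subrK=> e2.
 move: e2 Jn Jmm; rewrite expr1n mul1r mulr1.
 set x:= B (v m) _; set y:= F _; set z:= B _ _; move=> -> h1 h2 h3.
 have {}h3: inf E <= J (v m)+(x-y)+z/4.
  by apply: (le_trans h3); rewrite le_eqVlt; apply/orP; left; apply/eqP; field.
 move: h1 h2 h3; move: (n.+1%:R^-1) (m.+1%:R^-1)=> p q; lra.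
- move=> n s Ss; have [Sn]:= vP n.
 have: 0 <= n.+1%:R^-1 :> R by rewrite invr_ge0.
 move: (n.+1%:R^-1)=> d d0 Jn.
 apply: psd_form=> [||a t] //.
 + exact: Bpos.
 + have [->|a0]:= eqVneq a 0.
   by rewrite expr0n/= !(mul0r, mulr0) !add0r mulr_ge0 ?sqr_ge0 ?Bpos.
  have:= Jm _ (SL (t/a) Ss Sn); rewrite JL// => h.
  have: 0 <= d+2 * (t/a) * (B (v n) s-F s)+(t/a)^+2 * B s s by lra.
  move/(mulr_ge0 (sqr_ge0 a)); congr (0 <= _); field. exact: a0.
Qed.

End VariationalMinimum.

Section AlmostEverywhere.
Context d (T: measurableType d) (R: realType) (mu: {measure set T -> \bar R}).

Lemma ae_imp (P Q: T -> Prop): {ae mu, forall x, P x} -> (forall x, P x -> Q x) ->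
 {ae mu, forall x, Q x}.
by move=> hP PQ; apply: filterS hP. Qed.

Lemma ae_imp2 (P Q S: T -> Prop): {ae mu, forall x, P x} -> {ae mu, forall x, Q x} ->
 (forall x, P x -> Q x -> S x) -> {ae mu, forall x, S x}.
by move=> hP hQ PQ; apply: filterS2 hP hQ. Qed.

Lemma ae_finite (I: finType) (P: I -> T -> Prop) :
 (forall i, {ae mu, forall x, P i x}) -> {ae mu, forall x, forall i, P i x}.
move=> h; have h': {ae mu, forall x, forall i, i \in enum I -> P i x}.
 elim: (enum I)=> [|i s IH]; first exact: aeW.
 apply: (ae_imp2 (h i) IH)=> x h1 h2 j; rewrite inE=> /orP[/eqP->//|]; exact: h2.
by apply: (ae_imp h')=> x hx i; apply: hx; rewrite mem_enum.
Qed.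

Lemma ae_all (P: T -> Prop): (forall x, P x) -> {ae mu, forall x, P x}.
exact: aeW. Qed.

End AlmostEverywhere.

Section L2Omega.
Context (R: realType) (Om: set (R3 R)).
Notation T3:= (space3 R).
Notation mu:= (@lebesgue3 R).
Hypothesis mO: measurable (Om: set T3).
Implicit Types p q g: R3 R -> R.

Lemma L2sP p: L2s Om p <-> sqint mu (p \_ Om).
exact: Lfun2P. Qed.

Lemma ipsE p q: ips Om p q = \int[mu]_x ((p \_ Om) x * (q \_ Om) x).
rewrite /ips Rintegral_mkcond; apply: eq_Rintegral=> x _.
by rewrite !patchE; case: ifP=> // _; rewrite mul0r.
Qed.

Lemma ipsC p q: ips Om p q = ips Om q p.
by apply: eq_Rintegral=> x _; rewrite mulrC. Qed.

Lemma eq_L2s p q: (forall x, Om x -> p x = q x) -> L2s Om p -> L2s Om q.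
move=> e; rewrite /L2s; have -> // : p \_ Om = q \_ Om.
by apply/funext=> x; rewrite !patchE; case: ifPn=> // /set_mem/e.
Qed.

Lemma eq_ips p p' q q': (forall x, Om x -> p x = p' x) -> (forall x, Om x -> q x = q' x) ->
 ips Om p q = ips Om p' q'.
by move=> e e'; apply: eq_Rintegral=> x /set_mem Ox; rewrite e// e'. Qed.

Lemma L2sD p q: L2s Om p -> L2s Om q -> L2s Om (fun x=> p x+q x).
move=> /L2sP lp /L2sP lq; apply/L2sP; apply: eq_sqint (sqintD lp lq)=> x.
by rewrite !patchE; case: ifP=> // _; rewrite addr0.
Qed.

Lemma L2s_bmul p g (c: R): measurable_fun (Om: set T3) (g: T3 -> R) -> (forall x, Om x -> `|g x| <= c) ->
 L2s Om p -> L2s Om (fun x=> g x * p x).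
move=> mg gc /L2sP lp; apply/L2sP.
have mg': measurable_fun (setT: set T3) (g \_ Om: T3 -> R) by exact/(measurable_restrictT _ mO).
have gc' x: `|(g \_ Om) x| <= `|c|.
 rewrite patchE; case: ifPn=> [/set_mem/gc|_]; last by rewrite normr0.
 by move/le_trans; apply; exact: ler_norm.
apply: eq_sqint (sqint_bmul mg' gc' lp)=> x.
by rewrite !patchE; case: ifP=> // _; rewrite mul0r.
Qed.

Lemma L2sZ p (c: R): L2s Om p -> L2s Om (fun x=> c * p x).
by apply: (@L2s_bmul _ (cst c) `|c|)=> //; exact: measurable_cst. Qed.

Lemma L2sN p: L2s Om p -> L2s Om (fun x=> - p x).
by move/(L2sZ (-1)); under eq_fun do rewrite mulN1r. Qed.

Lemma L2sB p q: L2s Om p -> L2s Om q -> L2s Om (fun x=> p x-q x).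
by move=> lp /L2sN; exact: L2sD. Qed.

Lemma L2s0: L2s Om (fun=> 0).
apply/L2sP; split; first by apply/(measurable_restrictT _ mO); exact: measurable_cst.
apply: eq_integrable (integrable0 _ _)=> //= x _.
by rewrite patchE; case: ifP; rewrite expr0n.
Qed.

Lemma L2s_measurable p: L2s Om p -> measurable_fun (Om: set T3) (p: T3 -> R).
by case/L2sP=> /(measurable_restrictT _ mO). Qed.

Lemma ips_integrable p q: L2s Om p -> L2s Om q ->
 mu.-integrable Om (EFin \o (fun x=> p x * q x)).
move=> /L2sP lp /L2sP lq; rewrite (integrable_mkcond _ mO).
apply: eq_integrable (sqint_mul lp lq)=> // x _ /=.
by rewrite !patchE/=; case: ifP=> // _; rewrite mul0r.
Qed.

Lemma ips_linl a p p' q: L2s Om p -> L2s Om p' -> L2s Om q ->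
 ips Om (fun x=> a * p x+p' x) q = a * ips Om p q+ips Om p' q.
move=> lp lp' lq; rewrite /ips -RintegralZl//; last exact: ips_integrable.
rewrite -RintegralD//; last 2 first.
- exact: rintegrableZ (ips_integrable lp lq).
- exact: ips_integrable.
by apply: eq_Rintegral=> x _; ring.
Qed.

Lemma ips_ge0 p: 0 <= ips Om p p.
by apply: Rintegral_ge0=> x _; rewrite -expr2 sqr_ge0. Qed.

Lemma ips_ae p q p' q': L2s Om p -> L2s Om q -> L2s Om p' -> L2s Om q' ->
 ae_eq_on Om p p' -> ae_eq_on Om q q' -> ips Om p q = ips Om p' q'.
move=> /L2sP lp /L2sP lq /L2sP lp' /L2sP lq' pp qq; rewrite !ipsE; apply: Rintegral_ae.
- exact: measurable_funM lp.1 lq.1.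
- exact: measurable_funM lp'.1 lq'.1.
- apply: (ae_imp2 pp qq)=> x h1 h2; rewrite !patchE; case: ifPn=> // /set_mem Ox.
 by rewrite h1// h2.
Qed.

Lemma L2s_bounded p (M c: R): measurable_fun (Om: set T3) (p: T3 -> R) -> Om `<=` cube M ->
 (forall x, Om x -> `|p x| <= c) -> L2s Om p.
move=> mp OM pc; apply/L2sP; split; first exact/(measurable_restrictT _ mO).
apply: (@le_integrable _ _ _ mu _ measurableT _ (EFin \o (fun x=> (cst (c^+2) \_ Om) x))).
- by apply/measurable_EFinP; apply: measurable_funX; exact/(measurable_restrictT _ mO).
- move=> x _ /=; rewrite lee_fin !patchE; case: ifPn=> [/set_mem Ox|_]; last by rewrite expr0n normr0.
 by rewrite /= !normrX lerXn2r ?nnegrE// (le_trans (pc _ Ox))// ler_norm.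
- rewrite -restrict_EFin; apply/integrable_restrict=> //; rewrite setTI.
 by apply: (integrable_cube (c:= `|c^+2|) mO OM).
Qed.


Section Fields.
Variables m n: nat.
Implicit Types u v w: R3 R -> 'M[R]_(m, n).

Lemma frob_integrable u v: L2 Om u -> L2 Om v ->
 mu.-integrable Om (EFin \o (fun x=> frob (u x) (v x))).
move=> lu lv; rewrite /frob; apply: rintegrable_sum=> // i _.
by apply: rintegrable_sum=> // j _; exact: ips_integrable.
Qed.

Lemma ipE u v: L2 Om u -> L2 Om v ->
 ip Om u v = \sum_i \sum_j ips Om (fun x=> u x i j) (fun x=> v x i j).
move=> lu lv; rewrite /ip /frob Rintegral_sum//; last first.
 by move=> i _; apply: rintegrable_sum=> // j _; exact: ips_integrable.
by apply: eq_bigr=> i _; rewrite Rintegral_sum// => j _; exact: ips_integrable.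
Qed.

Lemma ipC u v: ip Om u v = ip Om v u.
apply: eq_Rintegral=> x _; apply: eq_bigr=> i _; apply: eq_bigr=> j _.
exact: mulrC.
Qed.

Lemma L2_lin a u v: L2 Om u -> L2 Om v -> L2 Om (fun x=> a *: u x+v x).
move=> lu lv i j; apply: eq_L2s (L2sD (L2sZ a (lu i j)) (lv i j))=> x _.
by rewrite !mxE.
Qed.

Lemma L2_0: L2 Om (fun=> 0: 'M[R]_(m, n)).
by move=> i j; apply: eq_L2s L2s0=> x _; rewrite mxE. Qed.

Lemma L2Z a u: L2 Om u -> L2 Om (fun x=> a *: u x).
by move=> lu; have:= L2_lin a lu L2_0; under eq_fun do rewrite addr0. Qed.

Lemma L2D u v: L2 Om u -> L2 Om v -> L2 Om (fun x=> u x+v x).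
by move=> lu lv; have:= L2_lin 1 lu lv; under eq_fun do rewrite scale1r. Qed.

Lemma L2B u v: L2 Om u -> L2 Om v -> L2 Om (fun x=> u x-v x).
move=> lu lv; have:= L2_lin (-1) lv lu.
by under eq_fun do rewrite scaleN1r addrC.
Qed.

Lemma ip_linl a u v w: L2 Om u -> L2 Om v -> L2 Om w ->
 ip Om (fun x=> a *: u x+v x) w = a * ip Om u w+ip Om v w.
move=> lu lv lw; rewrite !ipE//; last exact: L2_lin.
rewrite mulr_sumr -big_split; apply: eq_bigr=> i _ /=.
rewrite mulr_sumr -big_split; apply: eq_bigr=> j _ /=.
by rewrite -ips_linl//; apply: eq_ips=> // x _; rewrite !mxE.
Qed.

Lemma ip_linr a u v w: L2 Om u -> L2 Om v -> L2 Om w ->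
 ip Om w (fun x=> a *: u x+v x) = a * ip Om w u+ip Om w v.
by move=> lu lv lw; rewrite ipC ip_linl// ![ip _ w _]ipC. Qed.

Lemma ip0l v: ip Om (fun=> 0) v = 0.
rewrite /ip; under eq_Rintegral=> x _.
 rewrite /frob big1; last by move=> i _; rewrite big1// => j _; rewrite mxE mul0r.
 over.
by rewrite Rintegral_cst// mul0r.
Qed.

Lemma ipDl u v w: L2 Om u -> L2 Om v -> L2 Om w ->
 ip Om (fun x=> u x+v x) w = ip Om u w+ip Om v w.
move=> lu lv lw; rewrite -[in RHS](mul1r (ip Om u w)) -ip_linl//.
by congr (ip Om _ w); apply/funext=> x; rewrite scale1r.
Qed.

Lemma ipZl a u w: L2 Om u -> L2 Om w -> ip Om (fun x=> a *: u x) w = a * ip Om u w.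
move=> lu lw; rewrite -[RHS]addr0 -(ip0l w) -ip_linl//; last exact: L2_0.
by congr (ip Om _ w); apply/funext=> x; rewrite addr0.
Qed.

Lemma ipBl u v w: L2 Om u -> L2 Om v -> L2 Om w ->
 ip Om (fun x=> u x-v x) w = ip Om u w-ip Om v w.
move=> lu lv lw; rewrite addrC -mulN1r -ip_linl//.
by congr (ip Om _ w); apply/funext=> x; rewrite scaleN1r addrC.
Qed.

Lemma ipDr u v w: L2 Om u -> L2 Om v -> L2 Om w ->
 ip Om w (fun x=> u x+v x) = ip Om w u+ip Om w v.
by move=> lu lv lw; rewrite ipC ipDl// ![ip _ w _]ipC. Qed.

Lemma ipZr a u w: L2 Om u -> L2 Om w -> ip Om w (fun x=> a *: u x) = a * ip Om w u.
by move=> lu lw; rewrite ipC ipZl// ![ip _ w _]ipC. Qed.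

Lemma ipBr u v w: L2 Om u -> L2 Om v -> L2 Om w ->
 ip Om w (fun x=> u x-v x) = ip Om w u-ip Om w v.
by move=> lu lv lw; rewrite ipC ipBl// ![ip _ w _]ipC. Qed.

Lemma ip_ge0 u: 0 <= ip Om u u.
apply: Rintegral_ge0=> x _; apply: sumr_ge0=> i _; apply: sumr_ge0=> j _.
by rewrite -expr2 sqr_ge0.
Qed.

Lemma ip_CS u v: L2 Om u -> L2 Om v -> (ip Om u v)^+2 <= ip Om u u * ip Om v v.
move=> lu lv; apply: psd_form; [exact: ip_ge0|exact: ip_ge0|move=> s t].
have:= ip_ge0 (fun x=> s *: u x+t *: v x).
have ltv:= L2Z t lv; have lsu:= L2Z s lu.
rewrite ip_linl//; last exact: L2D.
rewrite ipDr// [ip Om (fun x=> t *: v x) _]ipDr// !ipZr// !ipZl// (ipC v u).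
by congr (0 <= _); ring.
Qed.

Lemma ip_sum_le u v: L2 Om u -> L2 Om v ->
 ip Om (fun x=> u x+v x) (fun x=> u x+v x) <= 2 * ip Om u u+2 * ip Om v v.
move=> lu lv; have:= ip_ge0 (fun x=> u x-v x).
rewrite (ipBl lu lv (L2B lu lv)) (ipBr lu lv lu) (ipBr lu lv lv).
rewrite (ipDl lu lv (L2D lu lv)) (ipDr lu lv lu) (ipDr lu lv lv); lra.
Qed.

Lemma ip_ae u u' v v': L2 Om u -> L2 Om v -> L2 Om u' -> L2 Om v' ->
 ae_eq_on Om u u' -> ae_eq_on Om v v' -> ip Om u v = ip Om u' v'.
move=> lu lv lu' lv' uu vv; rewrite !ipE//.
apply: eq_bigr=> i _; apply: eq_bigr=> j _.
apply: ips_ae=> //; [apply: (ae_imp uu)|apply: (ae_imp vv)]=> x h Ox; by rewrite h.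
Qed.

Lemma L2_complete (u: nat -> R3 R -> 'M[R]_(m, n)): (forall k, L2 Om (u k)) ->
 (forall eps: R, 0 < eps -> exists N, forall k l, (N <= k)%N -> (N <= l)%N ->
  ip Om (fun x=> u k x-u l x) (fun x=> u k x-u l x) <= eps) ->
 exists w, L2 Om w /\ forall eps: R, 0 < eps -> exists N, forall k, (N <= k)%N ->
  ip Om (fun x=> u k x-w x) (fun x=> u k x-w x) <= eps.
move=> lu cau.
have ex ij: exists g, L2s Om g /\ forall eps: R, 0 < eps -> exists N, forall k, (N <= k)%N ->
  ips Om (fun x=> u k x ij.1 ij.2-g x) (fun x=> u k x ij.1 ij.2-g x) <= eps.
 case: ij=> i j /=.
 have [k||g [sg gP]]:= @sqint_complete _ _ _ mu (fun k=> (fun x=> u k x i j) \_ Om).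
 - by apply/L2sP; exact: lu.
 - move=> eps /cau[N NP]; exists N=> k l Nk Nl; apply: le_trans (NP k l Nk Nl).
  have lkl:= L2B (lu k) (lu l); rewrite (ipE lkl lkl).
  rewrite (bigD1 i)//= (bigD1 j)//=.
  rewrite -[leLHS]addr0 -[leLHS]addr0; apply: lerD; last first.
   by apply: sumr_ge0=> i' _; apply: sumr_ge0=> j' _; exact: ips_ge0.
  apply: lerD; last by apply: sumr_ge0=> j' _; exact: ips_ge0.
  rewrite ipsE le_eqVlt; apply/orP; left; apply/eqP; apply: eq_Rintegral=> x _.
  by rewrite !patchE; case: ifP=> _; rewrite -expr2 ?subrr// !mxE.
 - have sg': L2s Om g.
   apply/L2sP; apply: (le_sqint _ _ sg).
    by apply/(measurable_restrictT _ mO); exact: measurable_funTS sg.1.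
   by move=> x; rewrite patchE; case: ifP; rewrite // normr0.
  exists g; split=> // eps /gP[N NP]; exists N=> k /NP; apply: le_trans.
  have lk: L2s Om (fun x=> u k x i j-g x) by exact: L2sB (lu k i j) sg'.
  rewrite ipsE; apply: le_Rintegral=> //.
  + exact: sqint_mul (iffLR (L2sP _) lk) (iffLR (L2sP _) lk).
  + by apply: (sqintB _ sg).2; exact/L2sP/lu.
  + move=> x _; rewrite !patchE; case: ifP=> _; first by rewrite expr2.
   by rewrite mul0r sqr_ge0.
have [g gP]:= choice ex.
pose G x: 'M[R]_(m, n):= \matrix_(i, j) g (i, j) x.
have lG: L2 Om G by move=> i j; apply: eq_L2s (gP (i, j)).1=> x _; rewrite mxE.
exists G; split=> // eps e0.
have K0: 0 < (m * n).+1%:R :> R by [].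
have [N NP]:= choice (fun ij=> (gP ij).2 (eps/(m * n).+1%:R) (divr_gt0 e0 K0)).
exists (\sum_(ij: 'I_m * 'I_n) N ij)%N=> k Nk.
have lkg:= L2B (lu k) lG; rewrite (ipE lkg lkg).
apply: (@le_trans _ _ (\sum_(i < m) \sum_(j < n) eps/(m * n).+1%:R)).
 apply: ler_sum=> i _; apply: ler_sum=> j _.
 apply: le_trans (NP (i, j) k _); last first.
  by apply: leq_trans Nk; rewrite (bigD1 (i, j))//= leq_addr.
 by rewrite le_eqVlt; apply/orP; left; apply/eqP; apply: eq_ips=> x _; rewrite !mxE.
rewrite !sumr_const !card_ord -mulrnA -[leLHS]mulr_natr mulrAC ler_pdivrMr//.
by rewrite ler_wpM2l ?ltW// ltr_nat mulnC.
Qed.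

End Fields.

End L2Omega.

(** * Differential calculus of smooth functions *)

Section ThreeIndices.
Lemma ord3_ind (Q : 'I_3 -> Prop) : Q 0 -> Q 1 -> Q 2 -> forall i, Q i.
Proof.
move=> q0 q1 q2 [[|[|[|//]]] Hi].
- by have -> : Ordinal Hi = 0 by exact/val_inj.
- by have -> : Ordinal Hi = 1 by exact/val_inj.
- by have -> : Ordinal Hi = 2 by exact/val_inj.
Qed.
End ThreeIndices.

Lemma sum3_bound (R: realType) (u0 u1 u2 d0 d1 d2 e: R) :
 `|d0| <= e -> `|d1| <= e -> `|d2| <= e ->
 `|u0 * d0+u1 * d1+u2 * d2| <= (`|u0| + `|u1| + `|u2|) * e.
move=> h0 h1 h2; rewrite !mulrDl; apply: (le_trans (ler_normD _ _)); apply: lerD.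
 by apply: (le_trans (ler_normD _ _)); apply: lerD; rewrite normrM ler_wpM2l.
by rewrite normrM ler_wpM2l.
Qed.

Section Directional.
Context {R: realType}.
Implicit Types (p q: R3 R -> R) (U: set (R3 R)) (x y v: R3 R).

Lemma ball3P x (r: R) y: ball x r y <-> `|y-x| < r.
by rewrite -ball_normE /ball_/= distrC. Qed.

Lemma nbhs3P x (A: set (R3 R)): nbhs x A <->
 exists2 r: R, 0 < r & forall y, `|y-x| < r -> A y.
split=> [/nbhs_ballP[r /= r0 rA]|[r r0 rA]].
 by exists r=> // y yx; apply: rA; exact/ball3P.
by apply/nbhs_ballP; exists r=> // y /ball3P; exact: rA.
Qed.

Lemma open3P U: open U <-> forall x, U x ->
 exists2 r: R, 0 < r & forall y, `|y-x| < r -> U y.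
rewrite openE; split=> oU x Ux; first by have:= oU x Ux; rewrite /interior=> /nbhs3P.
by apply/nbhs3P; exact: oU.
Qed.

Lemma continuous3P p x: {for x, continuous p} <->
 forall e: R, 0 < e -> exists2 r: R, 0 < r & forall y, `|y-x| < r -> `|p y-p x| < e.
split=> [cp e e0|h].
 move/cvgrPdist_lt: cp=> /(_ e e0) /nbhs3P[r r0 rP].
 by exists r=> // y /rP; rewrite distrC.
apply/cvgrPdist_lt=> e e0; apply/nbhs3P; have [r r0 rP]:= h e e0.
by exists r=> // y /rP; rewrite distrC.
Qed.

Lemma is_derive_line p x v (t d: R) :
 is_derive (x+t *: v) v p d <-> is_derive t (1: R) (fun s: R=> p (x+s *: v)) d.
have E: (fun h: R=> h^-1 *: ((p \o shift (x+t *: v)) (h *: v)-p (x+t *: v))) =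
 (fun h: R=> h^-1 *: (((fun s: R=> p (x+s *: v)) \o shift t) (h *: (1: R))-p (x+t *: v))).
 apply/funext=> h /=; congr (_ *: (p _ - _)).
 by rewrite scalerDl addrCA /GRing.scale/= mulr1.
by split=> -[h1 h2]; split; move: h1 h2; rewrite /derivable /derive E.
Qed.

Lemma MVT_line p x v (s: R): 0 <= s ->
 (forall t: R, 0 <= t <= s -> derivable p (x+t *: v) v) ->
 exists2 t: R, 0 <= t <= s & p (x+s *: v)-p x = s * 'D_v p (x+t *: v).
move=> s0 dp.
have D (t: R): 0 <= t <= s -> is_derive t (1: R) (fun s: R=> p (x+s *: v)) ('D_v p (x+t *: v)).
 by move=> ts; apply/is_derive_line; exact/derivableP/dp.
have [||c]:= @MVT_segment R (fun t=> p (x+t *: v)) (fun t=> 'D_v p (x+t *: v)) 0 s s0.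
- by move=> t; rewrite in_itv/= => /andP[/ltW ? /ltW ?]; apply: D; apply/andP.
- apply: derivable_within_continuous=> t; rewrite in_itv/= => ts.
 by have []:= D t ts.
- rewrite in_itv/= => cs h; exists c=> //.
 by move: h; rewrite scale0r addr0 subr0 mulrC.
Qed.

Lemma norm3E (a b c: R): `|((a, b, c): R3 R)| = Num.max (Num.max `|a| `|b|) `|c|.
by []. Qed.

Lemma norm_e_ i: `|e_ i: R3 R| = 1.
have n01: forall b: bool, `|b%:R: R| = b%:R by move=> []; rewrite ?normr1 ?normr0.
rewrite /e_ norm3E !n01.
case: i=> -[|[|[|//]]] /= _.
- by rewrite /= !maxEle !ler10.
- by rewrite /= !maxEle !ler01 ler10.
- by rewrite /= !maxEle lexx ler01.
Qed.

Definition coord (i: 'I_3) (v: R3 R): R:= coords v 0 i.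

Lemma coordE (v: R3 R): v = coord 0 v *: e_ 0+coord 1 v *: e_ 1+coord 2 v *: e_ 2.
case: v=> -[a b] c; rewrite /coord /coords !mxE /=.
transitivity ((a * 1+b * 0+c * 0, a * 0+b * 1+c * 0, a * 0+b * 0+c * 1): R3 R).
 by rewrite !(mulr1, mulr0, addr0, add0r).
by [].
Qed.

Lemma coord_le i (v: R3 R): `|coord i v| <= `|v|.
case: v=> -[a b] c; rewrite norm3E /coord /coords !mxE /= !le_max.
by case: i=> -[|[|[|//]]] /= _; rewrite lexx ?orbT.
Qed.

Lemma coordD i (v w: R3 R): coord i (v+w) = coord i v+coord i w.
case: v=> -[a b] c; case: w=> -[a' b'] c'; rewrite /coord /coords !mxE /=.
by case: i=> -[|[|[|//]]].
Qed.

Lemma coordZ i (t: R) (v: R3 R): coord i (t *: v) = t * coord i v.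
case: v=> -[a b] c; rewrite /coord /coords !mxE /=.
by case: i=> -[|[|[|//]]].
Qed.

Lemma coord_e i j: coord i (e_ j: R3 R) = (i == j)%:R.
rewrite /coord /coords /e_ !mxE /=.
by case: i=> -[|[|[|//]]] /= ?; case: j=> -[|[|[|//]]].
Qed.

(* the difference quotient along v is telescoped over the three axes *)
Lemma is_derive_dir p x v (r: R): 0 < r ->
 (forall i y, `|y-x| < r -> derivable p y (e_ i)) ->
 (forall i, {for x, continuous (partial i p)}) ->
 is_derive x v p (\sum_i coord i v * partial i p x).
move=> r0 dp cp.
suff h: (fun h: R=> h^-1 *: ((p \o shift x) (h *: v)-p x)) @ 0^' --> \sum_i coord i v * partial i p x.
 by split; [apply/cvg_ex; eexists; exact: h|exact: cvg_lim h].
apply/cvgrPdist_lt=> e e0.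
pose c: R:= \sum_i `|coord i v| + 1.
have c0: 0 < c by rewrite ltr_wpDl// sumr_ge0.
have ec0: 0 < e/c by rewrite divr_gt0.
have dl i: exists2 d: R, 0 < d & forall y, `|y-x| < d -> `|partial i p y-partial i p x| < e/c.
 by have /continuous3P:= cp i; exact.
have [d0 d0p h0]:= dl 0; have [d1 d1p h1]:= dl 1; have [d2 d2p h2]:= dl 2.
pose d:= Num.min r (Num.min d0 (Num.min d1 d2)).
have dp0: 0 < d by rewrite !lt_min r0 d0p d1p.
have key (t: R) (y: R3 R) i: `|y-x| + 2 * `|t| < d -> exists2 g: R,
  `|g-partial i p x| < e/c & p (y+t *: e_ i)-p y = t * g.
 have wl (t': R) y': 0 <= t' -> `|y'-x| + `|t'| < d ->
  (forall s, 0 <= s <= t' -> `|y'+s *: e_ i-x| < d).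
  move=> t'0 yt s /andP[s0 st]; rewrite addrAC (le_lt_trans (ler_normD _ _))//.
  rewrite normrZ norm_e_ mulr1 (le_lt_trans _ yt)// lerD2l ger0_norm//.
  by rewrite ger0_norm.
 have bound y': `|y'-x| < d -> `|partial i p y'-partial i p x| < e/c.
  rewrite !lt_min=> /and4P[_ b0 b1 b2].
  by case: i {wl}=> -[|[|[|//]]] Hi;
  [have ->: Ordinal Hi = 0 by exact/val_inj|have ->: Ordinal Hi = 1 by exact/val_inj
  |have ->: Ordinal Hi = 2 by exact/val_inj]; [exact: h0|exact: h1|exact: h2].
 have pos (t': R) y': 0 <= t' -> `|y'-x| + `|t'| < d -> exists2 g: R,
   `|g-partial i p x| < e/c & p (y'+t' *: e_ i)-p y' = t' * g.
  move=> t'0 yt.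
  have [|s st ->]:= @MVT_line p y' (e_ i) t' t'0.
   move=> s st; apply: dp; have:= wl t' y' t'0 yt s st.
   by rewrite lt_min=> /andP[].
  by eexists; last reflexivity; apply: bound; exact: (wl t').
 move=> yt; have [t0|t0]:= leP 0 t.
  by apply: pos=> //; apply: le_lt_trans yt; rewrite lerD2l ler_peMl// ler1n.
 have [||g hg gE]:= pos (- t) (y+t *: e_ i).
 - by rewrite oppr_ge0 ltW.
 - apply: le_lt_trans yt; rewrite normrN mulr2n mulrDl mul1r addrA lerD2r.
  by rewrite addrAC (le_trans (ler_normD _ _))// normrZ norm_e_ mulr1.
 - exists g=> //; move: gE; rewrite scaleNr addrK=> gE.
  by rewrite -[LHS]opprB gE mulNr opprK.
apply/nbhs_ballP; exists (d/(4 * (`|v| + 1))).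
 by rewrite /= divr_gt0// mulr_gt0// ltr_wpDl.
move=> h /= hd h0n; rewrite /ball/= sub0r normrN in hd.
have hv: 4 * (`|h| * `|v|) < d.
 move: hd; rewrite ltr_pdivlMr; last by rewrite mulr_gt0// ltr_wpDl.
 apply: le_lt_trans; rewrite mulrCA ler_wpM2l// ler_wpM2l// lerDl//.
have ht i: `|h * coord i v| <= `|h| * `|v| by rewrite normrM ler_wpM2l// coord_le.
have hvp: 0 <= `|h| * `|v| by rewrite mulr_ge0.
have lin4 (A B C: R): 0 <= C -> B <= C -> A <= 2 * C -> A+2 * B <= 4 * C by lra.
have alg (u0 u1 u2 a0 a1 a2 b0 b1 b2: R): u0 * a0+u1 * a1+u2 * a2 -
 (u0 * b0+(u1 * b1+u2 * b2)) = u0 * (a0-b0)+u1 * (a1-b1)+u2 * (a2-b2) by ring.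
have alg2 (p3 p2 p1 p0 t u0 u1 u2 a0 a1 a2: R): p1-p0 = t * u0 * a0 ->
 p2-p1 = t * u1 * a1 -> p3-p2 = t * u2 * a2 ->
 p3-p0 = t * (u0 * a0+u1 * a1+u2 * a2).
 move=> e1' e2' e3'; have ->: p3-p0 = (p3-p2)+(p2-p1)+(p1-p0) by ring.
 by rewrite e1' e2' e3'; ring.
pose y1: R3 R:= x+(h * coord 0 v) *: e_ 0.
pose y2: R3 R:= y1+(h * coord 1 v) *: e_ 1.
have n1: `|y1-x| <= `|h| * `|v|.
 by rewrite /y1 addrAC subrr add0r normrZ norm_e_ mulr1.
have n2: `|y2-x| <= 2 * (`|h| * `|v|).
 rewrite /y2 addrAC (le_trans (ler_normD _ _))// mulr2n mulrDl mul1r lerD//.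
 by rewrite normrZ norm_e_ mulr1.
have [g0 g0e E0]: exists2 g: R, `|g-partial 0 p x| < e/c &
  p (x+(h * coord 0 v) *: e_ 0)-p x = h * coord 0 v * g.
 by apply: key; rewrite subrr normr0 add0r (le_lt_trans _ hv)//; have:= ht 0; lra.
have [g1 g1e E1]: exists2 g: R, `|g-partial 1 p x| < e/c &
  p (y1+(h * coord 1 v) *: e_ 1)-p y1 = h * coord 1 v * g.
 apply: key; apply: le_lt_trans hv; apply: lin4 (ht 1) _=> //.
 by apply: (le_trans n1); rewrite ler_peMl// ler1n.
have [g2 g2e E2]: exists2 g: R, `|g-partial 2 p x| < e/c &
  p (y2+(h * coord 2 v) *: e_ 2)-p y2 = h * coord 2 v * g.
 apply: key; apply: le_lt_trans hv; exact: (lin4 _ _ _ hvp (ht 2) n2).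
have ->: h *: v+x = y2+(h * coord 2 v) *: e_ 2.
 by rewrite [in LHS](coordE v) /y2 /y1 !scalerDr !scalerA addrC !addrA.
rewrite (alg2 _ _ _ _ _ _ _ _ _ _ _ E0 E1 E2).
rewrite /GRing.scale/= mulKf// !big_ord_recl big_ord0/= addr0.
have i1: lift ord0 ord0 = 1 :> 'I_3 by exact/val_inj.
have i2: lift ord0 (lift ord0 ord0) = 2 :> 'I_3 by exact/val_inj.
have i0: ord0 = 0 :> 'I_3 by exact/val_inj.
rewrite i1 i2 i0 distrC.
rewrite alg.
have cE: c = `|coord 0 v| + `|coord 1 v| + `|coord 2 v| + 1.
 by rewrite /c !big_ord_recl big_ord0/= addr0 i1 i2 i0 addrA.
apply: (@le_lt_trans _ _ ((`|coord 0 v| + `|coord 1 v| + `|coord 2 v|) * (e/c))).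
 exact: (sum3_bound _ _ _ (ltW g0e) (ltW g1e) (ltW g2e)).
by rewrite mulrCA gtr_pMr// ltr_pdivrMr// mul1r cE ltrDl.
Qed.

Lemma MVT_dir p x v: (forall t: R, 0 <= t <= 1 ->
  exists2 r: R, 0 < r & (forall i y, `|y-(x+t *: v)| < r -> derivable p y (e_ i)) /\
  (forall i, {for x+t *: v, continuous (partial i p)})) ->
 exists2 t: R, 0 <= t <= 1 & p (x+v)-p x = \sum_i coord i v * partial i p (x+t *: v).
move=> h.
have D t: 0 <= t <= 1 -> is_derive (x+t *: v) v p (\sum_i coord i v * partial i p (x+t *: v)).
 by move=> /h[r r0 [dp cp]]; exact: is_derive_dir r0 dp cp.
have [|t t01]:= @MVT_line p x v 1 ler01; first by move=> t /D[].
rewrite scale1r mul1r=> ->; exists t=> //; by have [_ ->]:= D t t01.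
Qed.

End Directional.
Section Smoothness.
Context {R: realType}.
Implicit Types (p q: R3 R -> R) (U: set (R3 R)) (x y v: R3 R).

(** [smooth] quantifies over all iterated partials at once; this form is
  recursive in the order, so that closure properties go by induction, and local. *)
Fixpoint Ck (k: nat) U p: Prop :=
 (forall x, U x -> {for x, continuous p}) /\
 match k with
 | 0%N=> True
 | k'.+1=> forall i, (forall x, U x -> derivable p x (e_ i)) /\ Ck k' U (partial i p)
 end.

Definition smooth_on U p:= forall k, Ck k U p.

Lemma Ck_cont k U p: Ck k U p -> forall x, U x -> {for x, continuous p}.
by case: k=> [|k] []. Qed.

Lemma Ck_der k U p i: Ck k.+1 U p -> forall x, U x -> derivable p x (e_ i).
by move=> [_ /(_ i)[]]. Qed.

Lemma Ck_partial k U p i: Ck k.+1 U p -> Ck k U (partial i p).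
by move=> [_ /(_ i)[]]. Qed.

Lemma smooth_on_partial U p i: smooth_on U p -> smooth_on U (partial i p).
by move=> sp k; exact: Ck_partial (sp k.+1). Qed.

Lemma smooth_on_cont U p: smooth_on U p -> forall x, U x -> {for x, continuous p}.
by move=> /(_ 0%N)/Ck_cont. Qed.

Lemma smooth_on_der U p i: smooth_on U p -> forall x, U x -> derivable p x (e_ i).
by move=> /(_ 1%N)/Ck_der; apply. Qed.

Lemma smoothP p: smooth p <-> smooth_on setT p.
split=> [sp k|].
 elim: k p sp=> [|k IH] p sp /=.
  by split=> // x _; exact: (sp [::]).1.
 split=> [x _|i]; first exact: (sp [::]).1.
 split=> [x _|]; first exact: (sp [::]).2.
 by apply: IH=> s; have:= sp (rcons s i); rewrite /partials foldr_rcons.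
move=> sp s; elim/last_ind: s p sp=> [|s i IH] p sp.
 by split=> [x|i x]; [exact: smooth_on_cont sp _ _|exact: smooth_on_der sp _ _].
by rewrite /partials foldr_rcons; apply: IH; exact: smooth_on_partial.
Qed.

Lemma CkS k U p: Ck k.+1 U p -> Ck k U p.
elim: k p=> [|k IH] p [cp dp]; first by split.
by split=> // i; have [dpi /IH cpi]:= dp i.
Qed.

Lemma Ck_sub k U V p: V `<=` U -> Ck k U p -> Ck k V p.
move=> VU; elim: k p=> [|k IH] p [cp dp].
 by split=> // x /VU; exact: cp.
split=> [x /VU|i]; first exact: cp.
by have [dpi /IH cpi]:= dp i; split=> // x /VU; exact: dpi.
Qed.

Lemma smooth_on_sub U V p: V `<=` U -> smooth_on U p -> smooth_on V p.
by move=> VU sp k; exact: Ck_sub (sp k). Qed.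

Lemma smooth_smooth_on U p: smooth p -> smooth_on U p.
by move=> /smoothP; exact: smooth_on_sub. Qed.

Lemma Ck_local k U p: (forall x, U x -> exists V, V x /\ Ck k V p) -> Ck k U p.
elim: k p=> [|k IH] p h.
 by split=> // x /h[V [Vx [cV _]]]; exact: cV.
split=> [x /h[V [Vx [cV _]]]|i]; first exact: cV.
split=> [x /h[V [Vx [_ cV]]]|]; first by have [+ _]:= cV i; apply.
by apply: IH=> x /h[V [Vx [_ cV]]]; exists V; split=> //; have [_]:= cV i.
Qed.

Lemma smooth_on_local U p: (forall x, U x -> exists V, V x /\ smooth_on V p) -> smooth_on U p.
by move=> h k; apply: Ck_local=> x /h[V [Vx sV]]; exists V; split=> //; exact: sV.
Qed.

Lemma near_open U p q x: open U -> U x -> (forall y, U y -> p y = q y) ->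
 {near x, p =1 q}.
by move=> oU Ux h; apply: filterS (open_nbhs_nbhs (conj oU Ux))=> y /h. Qed.

Lemma near_continuous p q x: {near x, p =1 q} ->
 {for x, continuous p} -> {for x, continuous q}.
move=> pq cp; rewrite /prop_for /continuous_at -(nbhs_singleton pq).
by apply: cvg_trans cp; apply: near_eq_cvg; apply: filterS pq=> y ->.
Qed.

Lemma partial_eq_on U p q i x: open U -> (forall y, U y -> p y = q y) -> U x ->
 partial i p x = partial i q x.
by move=> oU h Ux; apply: near_eq_derive; exact: (near_open oU Ux h). Qed.

Lemma eq_Ck k U p q: open U -> (forall x, U x -> p x = q x) -> Ck k U p -> Ck k U q.
move=> oU; elim: k p q=> [|k IH] p q pq [cp dp].
 by split=> // x Ux; exact: near_continuous (near_open oU Ux pq) (cp x Ux).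
split=> [x Ux|i]; first exact: near_continuous (near_open oU Ux pq) (cp x Ux).
have [dpi cpi]:= dp i; split=> [x Ux|].
 by apply: near_eq_derivable (dpi x Ux); exact: (near_open oU Ux pq).
by apply: IH cpi=> x Ux; exact: partial_eq_on oU pq Ux.
Qed.

Lemma eq_smooth_on U p q: open U -> (forall x, U x -> p x = q x) ->
 smooth_on U p -> smooth_on U q.
by move=> oU pq sp k; exact: eq_Ck (sp k). Qed.

Lemma smooth_on_intro U p (g: 'I_3 -> R3 R -> R): open U ->
 (forall x i, U x -> is_derive x (e_ i) p (g i x)) ->
 (forall x, U x -> {for x, continuous p}) ->
 (forall i, smooth_on U (g i)) -> smooth_on U p.
move=> oU dp cp sg [|k]; first by split.
split=> // i; split=> [x Ux|]; first by have []:= dp x i Ux.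
by apply: eq_Ck (sg i k)=> // x Ux; have [_ h]:= dp x i Ux; rewrite -h.
Qed.

Lemma partialD p q i x: derivable p x (e_ i) -> derivable q x (e_ i) ->
 partial i (fun y=> p y+q y) x = partial i p x+partial i q x.
by move=> dp dq; have [_]:= is_deriveD (derivableP dp) (derivableP dq). Qed.

Lemma partialZ c p i x: derivable p x (e_ i) ->
 partial i (fun y=> c * p y) x = c * partial i p x.
by move=> dp; have [_]:= is_deriveZ c (derivableP dp). Qed.

Lemma partialN p i x: derivable p x (e_ i) ->
 partial i (fun y=> - p y) x = - partial i p x.
by move=> dp; have [_]:= is_deriveN (derivableP dp). Qed.

Lemma partialM p q i x: derivable p x (e_ i) -> derivable q x (e_ i) ->
 partial i (fun y=> p y * q y) x = partial i p x * q x+p x * partial i q x.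
move=> dp dq; have [_ h]:= is_deriveM (derivableP dp) (derivableP dq).
by rewrite -[LHS]/('D_(e_ i) (p * q) x) h /GRing.scale/= addrC mulrC.
Qed.

Lemma Ck_cst k U c: Ck k U (fun=> c).
elim: k c=> [|k IH] c; first by split=> // x _; exact: cst_continuous.
split=> [x _|i]; first exact: cst_continuous.
split=> [x _|]; first exact: derivable_cst.
by have ->: partial i (fun=> c) = (fun=> 0) by apply/funext=> x; exact: derive_cst.
Qed.

Lemma CkD k U p q: open U -> Ck k U p -> Ck k U q -> Ck k U (fun x=> p x+q x).
move=> oU; elim: k p q=> [|k IH] p q [cp dp] [cq dq].
 by split=> // x Ux; apply: cvgD; [exact: cp|exact: cq].
split=> [x Ux|i]; first by apply: cvgD; [exact: cp|exact: cq].
have [dpi cpi]:= dp i; have [dqi cqi]:= dq i; split=> [x Ux|].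
 by apply: derivableD; [exact: dpi|exact: dqi].
apply: eq_Ck (IH _ _ cpi cqi)=> // x Ux.
by rewrite partialD//; [exact: dpi|exact: dqi].
Qed.

Lemma CkM k U p q: open U -> Ck k U p -> Ck k U q -> Ck k U (fun x=> p x * q x).
move=> oU; elim: k p q=> [|k IH] p q cp' cq'.
 by move: cp' cq'=> [cp _] [cq _]; split=> // x Ux; apply: cvgM; [exact: cp|exact: cq].
have [cp dp]:= cp'; have [cq dq]:= cq'.
split=> [x Ux|i]; first by apply: cvgM; [exact: cp|exact: cq].
have [dpi cpi]:= dp i; have [dqi cqi]:= dq i; split=> [x Ux|].
 by apply: derivableM; [exact: dpi|exact: dqi].
apply: eq_Ck (CkD oU (IH _ _ cpi (CkS cq')) (IH _ _ (CkS cp') cqi))=> // x Ux.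
by rewrite partialM//; [exact: dpi|exact: dqi].
Qed.

Lemma smooth_onD U p q: open U -> smooth_on U p -> smooth_on U q -> smooth_on U (fun x=> p x+q x).
by move=> oU sp sq k; exact: CkD. Qed.

Lemma smooth_onM U p q: open U -> smooth_on U p -> smooth_on U q -> smooth_on U (fun x=> p x * q x).
by move=> oU sp sq k; exact: CkM. Qed.

Lemma smooth_on_cst U c: smooth_on U (fun=> c).
by move=> k; exact: Ck_cst. Qed.

Lemma smooth_onZ U c p: open U -> smooth_on U p -> smooth_on U (fun x=> c * p x).
by move=> oU sp; apply: smooth_onM=> //; exact: smooth_on_cst. Qed.

Lemma smooth_onN U p: open U -> smooth_on U p -> smooth_on U (fun x=> - p x).
move=> oU sp; apply: eq_smooth_on (smooth_onZ (-1) oU sp)=> // x _.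
by rewrite mulN1r.
Qed.

Lemma smooth_onB U p q: open U -> smooth_on U p -> smooth_on U q -> smooth_on U (fun x=> p x-q x).
by move=> oU sp sq; apply: smooth_onD=> //; exact: smooth_onN. Qed.

Lemma smooth_on_sum U I (s: seq I) (p: I -> R3 R -> R): open U ->
 (forall i, smooth_on U (p i)) -> smooth_on U (fun x=> \sum_(i <- s) p i x).
move=> oU sp; elim: s=> [|i s IH].
 by apply: eq_smooth_on (smooth_on_cst U 0)=> // x _; rewrite big_nil.
by apply: eq_smooth_on (smooth_onD oU (sp i) IH)=> // x _; rewrite big_cons.
Qed.

Lemma is_derive_coord i j x: is_derive x (e_ j) (coord i) ((i == j)%:R: R).
have e: forall h: R, h != 0 -> h^-1 *: ((coord i \o shift x) (h *: e_ j)-coord i x) = (i == j)%:R :> R.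
 by move=> h h0; rewrite /= coordD coordZ coord_e addrK /GRing.scale/= mulKf.
have c: (fun h: R=> h^-1 *: ((coord i \o shift x) (h *: e_ j)-coord i x)) @ 0^' --> ((i == j)%:R: R).
 apply: cvg_near_cst; apply/nbhs_ballP; exists 1=> //= h _ h0; exact: e.
by split; [apply/cvg_ex; eexists; exact: c|exact: cvg_lim c].
Qed.

Lemma continuous_coord i: continuous (coord i: R3 R -> R).
move=> x; apply/continuous3P=> e e0; exists e=> // y.
by apply: le_lt_trans; rewrite -[- coord i x]mulN1r -coordZ -coordD scaleN1r coord_le.
Qed.

Lemma smooth_on_coord U i: open U -> smooth_on U (coord i).
move=> oU; apply: (@smooth_on_intro _ _ (fun j=> fun=> (i == j)%:R))=> //.
- by move=> x j _; exact: is_derive_coord.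
- by move=> x _; exact: continuous_coord.
- by move=> j; exact: smooth_on_cst.
Qed.

Lemma smooth_on_diff U p x: open U -> smooth_on U p -> U x -> exists2 r: R, 0 < r &
 (forall i y, `|y-x| < r -> derivable p y (e_ i)) /\
  (forall i, {for x, continuous (partial i p)}).
move=> /open3P oU sp Ux; have [r r0 rU]:= oU x Ux; exists r=> //; split.
 by move=> i y /rU Uy; exact: smooth_on_der sp _ Uy.
by move=> i; exact: (smooth_on_cont (smooth_on_partial i sp)).
Qed.

Lemma smooth_on_dir U p x v: open U -> smooth_on U p -> U x ->
 is_derive x v p (\sum_i coord i v * partial i p x).
by move=> oU sp Ux; have [r r0 [d c]]:= smooth_on_diff oU sp Ux; exact: is_derive_dir r0 d c.
Qed.

Lemma smooth_on_MVT U p x v: open U -> smooth_on U p ->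
 (forall t: R, 0 <= t <= 1 -> U (x+t *: v)) ->
 exists2 t: R, 0 <= t <= 1 & p (x+v)-p x = \sum_i coord i v * partial i p (x+t *: v).
by move=> oU sp h; apply: MVT_dir=> t /h; exact: smooth_on_diff. Qed.

Lemma sum3E (V: nmodType) (F: 'I_3 -> V): \sum_i F i = F 0+F 1+F 2.
rewrite !big_ord_recl big_ord0/= addr0 addrA.
by congr (F _ + F _ + F _); exact/val_inj.
Qed.

Lemma smooth_Lipschitz p (M: R): smooth p -> (forall i x, `|partial i p x| <= M) ->
 forall x y, `|p x-p y| <= 3 * M * `|x-y|.
move=> /smoothP sp pM x y.
have [|t _]:= @smooth_on_MVT setT p y (x-y) openT sp; first by [].
rewrite subrKC=> ->; rewrite sum3E.
apply: (le_trans (sum3_bound _ _ _ (pM _ _) (pM _ _) (pM _ _))).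
rewrite [leRHS]mulrAC ler_wpM2r//; first exact: le_trans (normr_ge0 _) (pM 0 0).
have:= coord_le 0 (x-y); have:= coord_le 1 (x-y); have:= coord_le 2 (x-y); lra.
Qed.

End Smoothness.

(** * Mixed partial derivatives and the bump function *)

Section MixedPartials.
Context {R: realType}.
Implicit Types (p q: R3 R -> R) (U: set (R3 R)) (x y v w: R3 R).

Lemma is_derive_shift3 p x v w d: is_derive (x+w) v p d ->
 is_derive x v (fun y=> p (y+w)) d.
have E: (fun h: R=> h^-1 *: (((fun y=> p (y+w)) \o shift x) (h *: v)-p (x+w))) =
 (fun h: R=> h^-1 *: ((p \o shift (x+w)) (h *: v)-p (x+w))).
 by apply/funext=> h /=; rewrite addrA.
by move=> [h1 h2]; split; move: h1 h2; rewrite /derivable /derive E.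
Qed.

Lemma addrAKC (V: zmodType) (x a b: V): x+a+b-x = a+b.
by rewrite addrAC (addrC x) addrK. Qed.

Lemma double_difference U p i j x (h: R): smooth_on U p -> 0 <= h ->
 (forall y, `|y-x| <= 2 * h -> U y) ->
 exists2 y, `|y-x| <= 2 * h &
 p (x+h *: e_ i+h *: e_ j)-p (x+h *: e_ i)-(p (x+h *: e_ j)-p x) =
 h * (h * partial j (partial i p) y).
move=> sp h0 hU.
pose g y:= p (y+h *: e_ j)-p y.
have n1 (t: R) k: 0 <= t <= h -> `|t *: e_ k: R3 R| <= h.
 by move=> /andP[t0 th]; rewrite normrZ norm_e_ mulr1 ger0_norm.
have hh: 0 <= h <= h by rewrite h0 lexx.
have dg (t: R): 0 <= t <= h -> is_derive (x+t *: e_ i) (e_ i) g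
 (partial i p (x+t *: e_ i+h *: e_ j)-partial i p (x+t *: e_ i)).
 move=> th; apply: is_deriveB.
  apply: is_derive_shift3; apply: derivableP; apply: smooth_on_der sp _ _; apply: hU.
  rewrite addrAKC (le_trans (ler_normD _ _))// mulr2n mulrDl mul1r.
  by rewrite lerD// n1.
 apply: derivableP; apply: smooth_on_der sp _ _; apply: hU.
 by rewrite addrAC subrr add0r (le_trans (n1 _ _ th))// ler_peMl// ler1n.
have [|t th gE]:= @MVT_line R g x (e_ i) h h0; first by move=> t /dg[].
have [|t' th' pE]:= @MVT_line R (partial i p) (x+t *: e_ i) (e_ j) h h0.
 move=> t' th'; apply: smooth_on_der (smooth_on_partial i sp) _ _; apply: hU.
 rewrite addrAKC (le_trans (ler_normD _ _))// mulr2n mulrDl mul1r.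
 by rewrite lerD// n1.
exists (x+t *: e_ i+t' *: e_ j).
 rewrite addrAKC (le_trans (ler_normD _ _))// mulr2n mulrDl mul1r.
 by rewrite lerD// n1.
have [_ dgE]:= dg t th.
by move: gE; rewrite /g dgE pE=> ->.
Qed.

Lemma scaled_eq (h a b c d d' A B: R): h != 0 -> d = d' ->
 d-a-(b-c) = h * (h * A) -> d'-b-(a-c) = h * (h * B) -> A = B.
move=> hn <- hA hB; apply: (mulfI hn); apply: (mulfI hn); rewrite -hA -hB; ring.
Qed.

Lemma dist_half (a b c d e: R): a = b -> `|a-c| < e/2 -> `|b-d| < e/2 ->
 `|d-c| <= e.
by move=> <-; rewrite !ltr_norml ler_norml=> /andP[h1 h2] /andP[h3 h4]; apply/andP; split; lra.
Qed.

Lemma quarter_lt (r: R): 0 < r -> 2 * (r/4) < r.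
lra. Qed.

(* the same second difference is computed in both orders *)
Lemma partialC U p i j x: open U -> smooth_on U p -> U x ->
 partial i (partial j p) x = partial j (partial i p) x.
move=> oU sp Ux; apply/eqP; rewrite -subr_eq0 -normr_eq0; apply/eqP/le_anti.
rewrite normr_ge0 andbT; apply/ler_addgt0Pr=> e e0; rewrite add0r.
have e20: 0 < e/2 by rewrite divr_gt0.
have [r0 r0p rU]:= (iffLR (open3P U) oU) x Ux.
have [r1 r1p h1]:= (iffLR (continuous3P _ _) (smooth_on_cont (smooth_on_partial i (smooth_on_partial j sp)) Ux)) _ e20.
have [r2 r2p h2]:= (iffLR (continuous3P _ _) (smooth_on_cont (smooth_on_partial j (smooth_on_partial i sp)) Ux)) _ e20.
pose r:= Num.min r0 (Num.min r1 r2).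
have rp: 0 < r by rewrite !lt_min r0p r1p.
pose h:= r/4.
have hp: 0 < h by rewrite divr_gt0.
have hr y: `|y-x| <= 2 * h -> `|y-x| < r.
 by move=> hy; apply: le_lt_trans hy _; exact: quarter_lt.
have hU y: `|y-x| <= 2 * h -> U y.
 by move=> /hr; rewrite lt_min=> /andP[/rU].
have [y yx yE]:= double_difference i j sp (ltW hp) hU.
have [z zx zE]:= double_difference j i sp (ltW hp) hU.
have E: partial j (partial i p) y = partial i (partial j p) z.
 have hn: h != 0 by rewrite gt_eqF.
 by apply: (scaled_eq hn _ yE zE); rewrite addrAC.
have:= hr _ yx; rewrite !lt_min=> /and3P[_ _ /h2 b2].
have:= hr _ zx; rewrite !lt_min=> /and3P[_ /h1 b1 _].
exact: (dist_half E b2 b1).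
Qed.

End MixedPartials.

Section BumpFunction.
Context {R: realType}.

(** The family is closed under differentiation: [expinv n t] is [t^-n exp (-1/t)] for t > 0. *)
Definition expinv (n: nat) (t: R): R:= if 0 < t then t^-1^+n * expR (- t^-1) else 0.

Lemma expinv_ge0 n t: 0 <= expinv n t.
by rewrite /expinv; case: ifP=> // t0; rewrite mulr_ge0 ?expR_ge0// exprn_ge0// invr_ge0 ltW.
Qed.

Lemma expinv_le n: exists2 C, 0 < C & forall t, expinv n t <= C * t^+2.
exists (n.+2)`!%:R; first by rewrite ltr0n fact_gt0.
move=> t; rewrite /expinv; case: ifPn=> [t0|_]; last by rewrite mulr_ge0 ?sqr_ge0.
have f0: 0 < (n.+2)`!%:R :> R by rewrite ltr0n fact_gt0.
have ti0: 0 < t^-1 by rewrite invr_gt0.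
have:= @expR_ge1Dxn R t^-1 n.+1 (ltW ti0).
rewrite expRN=> h; rewrite ler_pdivrMr ?expR_gt0//.
have {h}: t^-1^+n.+2/(n.+2)`!%:R <= expR t^-1.
 by apply: le_trans h; rewrite lerDr.
rewrite ler_pdivrMr// => h.
have: t^+2 * t^-1^+n.+2 <= t^+2 * (expR t^-1 * (n.+2)`!%:R).
 by rewrite ler_wpM2l// sqr_ge0.
have ->: t^+2 * t^-1^+n.+2 = t^-1^+n.
 by rewrite !exprS expr0 mulr1 -mulrA (mulrA t t^-1) divff ?gt_eqF// mul1r mulrA divff ?gt_eqF// mul1r.
move=> {}h.
apply: (le_trans h); rewrite le_eqVlt; apply/orP; left; apply/eqP; ring.
Qed.

Lemma expinv_pos_derive (n: nat) (t: R): 0 < t ->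
 is_derive t (1: R) (expinv n) (expinv n.+2 t-n%:R * expinv n.+1 t).
move=> t0; have tn: t != 0 by rewrite gt_eqF.
have d1: is_derive t 1 (fun s: R=> s^-1) (- t^-1^+2).
 have:= derivableV tn (@derivable_id _ _ t (1: R)).
 move=> /derivableP h; apply: is_derive_eq h _.
 by rewrite deriveV// derive_id /GRing.scale/= mulr1 exprVn.
have d2: is_derive t 1 (fun s: R=> expR (- s^-1)) (expR (- t^-1) * t^-1^+2).
 have d3: is_derive t 1 (fun s: R=> - s^-1) (t^-1^+2).
  by apply: is_derive_eq (is_deriveN d1) _; rewrite opprK.
 exact: (@is_derive1_comp R expR (fun s=> - s^-1) t _ _ (is_derive_expR _) d3).
have:= is_deriveM (is_deriveX n d1) d2.
move=> h; have {}h: is_derive t 1 (fun s: R=> s^-1^+n * expR (- s^-1))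
 (expinv n.+2 t-n%:R * expinv n.+1 t).
 have ->: (fun s: R=> s^-1^+n * expR (- s^-1)) =
   (fun s: R=> s^-1)^+n * (fun s: R=> expR (- s^-1)).
  by apply/funext=> s; rewrite [RHS]/= exprfctE.
 apply: is_derive_eq h _; rewrite exprfctE /expinv t0 /GRing.scale/=.
 case: n=> [|n]; first by rewrite !mul0r expr0; ring.
 by rewrite /= !exprS; ring.
apply: near_eq_is_derive h; near=> s; rewrite /expinv ifT//.
by near: s; exact: lt_nbhsr.
Unshelve. all: by end_near. Qed.

Lemma expinv_nonpos n t: t <= 0 -> expinv n t = 0.
by rewrite /expinv ltNge=> ->. Qed.

Lemma expinv_derive (n: nat) (t: R): is_derive t (1: R) (expinv n) (expinv n.+2 t-n%:R * expinv n.+1 t).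
have [t0|t0|->]:= ltgtP t 0; last 2 first.
- exact: expinv_pos_derive.
- rewrite !expinv_nonpos// mulr0 subrr.
 have [C C0 hC]:= expinv_le n.
 have c: (fun h: R=> h^-1 *: ((expinv n \o shift 0) (h *: (1: R))-expinv n 0)) @ 0^' --> (0: R).
  apply/cvgrPdist_lt=> e e0; apply/nbhs_ballP; exists (e/C); first by rewrite /= divr_gt0.
  move=> h /=; rewrite /ball/= sub0r normrN=> he hn.
  rewrite sub0r normrN (expinv_nonpos n (lexx 0)) subr0 addr0 /GRing.scale/= mulr1 normrM normfV.
  rewrite (ger0_norm (expinv_ge0 _ _)) mulrC ltr_pdivrMr ?normr_gt0//.
  apply: le_lt_trans (hC h) _; rewrite -real_normK ?num_real// expr2 mulrA.
  by rewrite ltr_pM2r ?normr_gt0// mulrC -ltr_pdivlMr.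
 by split; [apply/cvg_ex; eexists; exact: c|exact: cvg_lim c].
- rewrite !expinv_nonpos ?ltW// mulr0 subrr.
 have h0:= is_derive_cst (0: R) t (1: R).
 apply: near_eq_is_derive h0.
 near=> s; rewrite expinv_nonpos//; apply: ltW.
 by near: s; exact: lt_nbhsl.
Unshelve. all: by end_near. Qed.

Lemma is_derive_comp3 (h: R -> R) (p: R3 R -> R) x v (a b: R) :
 is_derive (p x) (1: R) h a -> is_derive x v p b -> is_derive x v (fun y=> h (p y)) (a * b).
move=> dh dp.
suff: is_derive (x+(0: R) *: v) v (fun y=> h (p y)) (a * b) by rewrite scale0r addr0.
apply/is_derive_line.
have dl: is_derive (0: R) (1: R) (fun s: R=> p (x+s *: v)) b.
 by apply/is_derive_line; rewrite scale0r addr0.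
apply: (@is_derive1_comp R h (fun s: R=> p (x+s *: v)) 0 a b)=> //.
by rewrite scale0r addr0.
Qed.

Lemma continuous_comp3 (h: R -> R) (p: R3 R -> R) x: {for p x, continuous h} ->
 {for x, continuous p} -> {for x, continuous (fun y=> h (p y))}.
by move=> ch cp; exact: (continuous_comp cp ch). Qed.

Lemma expinv_continuous n: continuous (expinv n).
move=> t; apply: differentiable_continuous; apply/derivable1_diffP.
by have []:= expinv_derive n t.
Qed.

Lemma smooth_expinv U n (r: R3 R -> R): open U -> smooth_on U r ->
 smooth_on U (fun x=> expinv n (r x)).
move=> oU sr k; elim: k n=> [|k IH] n.
 split=> // x Ux; apply: continuous_comp3; [exact: expinv_continuous|exact: smooth_on_cont sr _ Ux].
have dn x i: U x -> is_derive x (e_ i) (fun y=> expinv n (r y))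
  ((expinv n.+2 (r x)-n%:R * expinv n.+1 (r x)) * partial i r x).
 move=> Ux; apply: is_derive_comp3; first exact: expinv_derive.
 by apply: derivableP; exact: smooth_on_der sr _ Ux.
split=> [x Ux|i].
 by apply: continuous_comp3; [exact: expinv_continuous|exact: smooth_on_cont sr _ Ux].
split=> [x Ux|]; first by have []:= dn x i Ux.
apply: (@eq_Ck _ _ _ (fun x=> (expinv n.+2 (r x)+(- n%:R) * expinv n.+1 (r x)) * partial i r x))=> //.
 by move=> x Ux; have [_ h]:= dn x i Ux; rewrite mulNr; symmetry; exact: h.
apply: CkM=> //; last exact: smooth_on_partial sr k.
by apply: CkD=> //; apply: CkM=> //; exact: Ck_cst.
Qed.

Definition radial (x: R3 R): R:= 1-(coord 0 x^+2+coord 1 x^+2+coord 2 x^+2).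

Lemma radial_derive x i: is_derive x (e_ i) radial (- 2 * coord i x).
have d j:= @is_derive_coord R j i x.
have:= is_deriveB (is_derive_cst (1: R) x (e_ i))
 (is_deriveD (is_deriveD (is_deriveX 2 (d 0)) (is_deriveX 2 (d 1))) (is_deriveX 2 (d 2))).
move=> h; apply: is_derive_eq h _.
rewrite /GRing.scale/= sub0r.
by case: i {d}=> -[|[|[|//]]] Hi /=; rewrite !(mulr1, mulr0, addr0, add0r) expr1 mulNr;
 congr (- (_ * coord _ x)); apply/val_inj.
Qed.

Lemma smooth_radial U: open U -> smooth_on U radial.
move=> oU; apply: smooth_onB=> //; first exact: smooth_on_cst.
have h i: smooth_on U (fun x=> coord i x^+2).
 by apply: eq_smooth_on (smooth_onM oU (smooth_on_coord i oU) (smooth_on_coord i oU))=> // x _; rewrite expr2.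
by apply: smooth_onD=> //; apply: smooth_onD.
Qed.

(** The unnormalised mollifier and the radial function whose gradient at x is x
  times the mollifier. *)
Definition bump (x: R3 R): R:= expinv 2 (radial x).
Definition bump_potential (x: R3 R): R:= - 2^-1 * expinv 0 (radial x).

Lemma bump_potential_derive x i: is_derive x (e_ i) bump_potential (coord i x * bump x).
have h:= is_deriveZ (- 2^-1) (is_derive_comp3 (expinv_derive 0 (radial x)) (radial_derive x i)).
apply: is_derive_eq h _; rewrite /bump /GRing.scale/= mul0r subr0.
have ->: -2^-1 * (expinv 2 (radial x) * (-2 * coord i x)) =
 2^-1 * 2 * (coord i x * expinv 2 (radial x)) by ring.
by rewrite mulVf// mul1r.
Qed.

Lemma smooth_bump: smooth bump.
by apply/smoothP; apply: smooth_expinv; [exact: openT|exact: smooth_radial openT]. Qed.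

Lemma smooth_bump_potential: smooth bump_potential.
apply/smoothP; apply: smooth_onZ; first exact: openT.
by apply: smooth_expinv; [exact: openT|exact: smooth_radial openT].
Qed.

Lemma radial_supp x: 0 < radial x -> `|x| < 1.
rewrite /radial subr_gt0=> h.
have a b: b^+2 < 1 -> `|b| < 1 :> R.
 by move=> b1; rewrite -(ltr_pXn2r (ltn0Sn 1)) ?nnegrE// real_normK ?num_real// expr1n.
have s0:= sqr_ge0 (coord 0 x); have s1:= sqr_ge0 (coord 1 x); have s2:= sqr_ge0 (coord 2 x).
have h0: `|coord 0 x| < 1 by apply: a; lra.
have h1: `|coord 1 x| < 1 by apply: a; lra.
have h2: `|coord 2 x| < 1 by apply: a; lra.
move: h0 h1 h2; case: (x)=> -[x1 x2] x3; rewrite norm3E /coord /coords !mxE/= => h0 h1 h2.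
by rewrite !gt_max h0 h1 h2.
Qed.

Lemma bump_supp x: bump x != 0 -> `|x| < 1.
by rewrite /bump /expinv; case: ifPn=> [r0 _|_]; [exact: radial_supp|rewrite eqxx].
Qed.

Lemma bump_potential_supp x: bump_potential x != 0 -> `|x| < 1.
rewrite /bump_potential /expinv; case: ifPn=> [r0 _|_]; first exact: radial_supp.
by rewrite mulr0 eqxx.
Qed.

Lemma bump_ge0 x: 0 <= bump x. Proof. exact: expinv_ge0. Qed.

Lemma bump0: 0 < bump 0.
have c i: coord i (0: R3 R) = 0 by rewrite -(scale0r (0: R3 R)) coordZ mul0r.
rewrite /bump /radial !c expr0n/= !addr0 subr0 /expinv ltr01 invr1 expr1n mul1r.
exact: expR_gt0.
Qed.

End BumpFunction.

(** * Test functions and superposition integrals *)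

Section TestFunctions.
Context {R: realType}.
Implicit Types (p q: R3 R -> R) (U Om: set (R3 R)) (x y: R3 R).

Definition bounded_smooth p:= smooth p /\
 forall s: seq 'I_3, exists M: R, forall x, `|partials s p x| <= M.

Lemma affine_derive p (a: R) b x i: smooth p ->
 is_derive x (e_ i) (fun y=> p (a *: y+b)) (a * partial i p (a *: x+b)).
move=> sp.
suff: is_derive (x+(0: R) *: e_ i) (e_ i) (fun y=> p (a *: y+b)) (a * partial i p (a *: x+b)).
 by rewrite scale0r addr0.
apply/is_derive_line.
have E (s: R): a *: (x+s *: e_ i)+b = (a *: x+b)+s *: (a *: e_ i).
 by rewrite scalerDr !scalerA (mulrC s) addrAC.
under eq_fun do rewrite E.
apply/is_derive_line; rewrite scale0r addr0.
have:= @smooth_on_dir _ setT p (a *: x+b) (a *: e_ i) openT (iffLR (smoothP p) sp) I.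
move=> hd; apply: is_derive_eq hd _.
rewrite (bigD1 i)//= big1 ?addr0; first by rewrite coordZ coord_e eqxx mulr1.
by move=> j /negPf ji; rewrite coordZ coord_e ji mulr0 mul0r.
Qed.

Lemma affine_continuous p (a: R) b: continuous p -> continuous (fun y: R3 R=> p (a *: y+b)).
move=> cp x; apply: (@continuous_comp _ _ _ (fun y: R3 R=> a *: y+b) p); last exact: cp.
by apply: cvgD; [apply: cvgZl_tmp; exact: cvg_id|exact: cvg_cst].
Qed.

Lemma affine_partial p (a: R) b x i: smooth p ->
 partial i (fun y=> p (a *: y+b)) x = a * partial i p (a *: x+b).
by move=> sp; have [_]:= affine_derive a b x i sp. Qed.

Lemma affine_smooth p (a: R) b: smooth p -> smooth (fun y=> p (a *: y+b)).
move=> sp; apply/smoothP=> k; elim: k p sp=> [|k IH] p sp.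
 by split=> // x _; apply: affine_continuous; have []:= sp [::].
split=> [x _|i]; first by apply: affine_continuous; have []:= sp [::].
split=> [x _|]; first by have []:= affine_derive a b x i sp.
apply: (@eq_Ck _ _ _ (fun x=> a * partial i p (a *: x+b))); first exact: openT.
 by move=> x _; rewrite affine_partial.
apply: CkM; [exact: openT|exact: Ck_cst|apply: IH].
by move=> s; have:= sp (rcons s i); rewrite /partials -cats1 foldr_cat.
Qed.

Lemma bounded_smooth_bound p: bounded_smooth p -> exists2 M: R, 0 <= M & forall x, `|p x| <= M.
by move=> [_ /(_ [::])[M h]]; exists M=> //; apply: le_trans (h 0). Qed.

Lemma bounded_smooth_partial p i: bounded_smooth p -> bounded_smooth (partial i p).
move=> [sp bp]; split=> [s|s].
 by have:= sp (rcons s i); rewrite /partials -cats1 foldr_cat.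
by have:= bp (rcons s i); rewrite /partials -cats1 foldr_cat.
Qed.

Lemma bounded_smooth_Lipschitz p: bounded_smooth p ->
 exists2 L: R, 0 <= L & forall x y, `|p x-p y| <= L * `|x-y|.
move=> bp.
have [M0 M00 h0]:= bounded_smooth_bound (bounded_smooth_partial 0 bp).
have [M1 M10 h1]:= bounded_smooth_bound (bounded_smooth_partial 1 bp).
have [M2 M20 h2]:= bounded_smooth_bound (bounded_smooth_partial 2 bp).
exists (3 * (M0+M1+M2)); first by rewrite mulr_ge0// !addr_ge0.
move=> x y; apply: smooth_Lipschitz bp.1 _ _ _=> i z.
elim/ord3_ind: i.
- by apply: le_trans (h0 z) _; rewrite -addrA lerDl addr_ge0.
- by apply: le_trans (h1 z) _; rewrite addrAC lerDr addr_ge0.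
- by apply: le_trans (h2 z) _; rewrite lerDr addr_ge0.
Qed.

Lemma smooth_partial p i: smooth p -> smooth (partial i p).
by move=> /smoothP sp; apply/smoothP; exact: smooth_on_partial. Qed.

Lemma smooth_der p i x: smooth p -> derivable p x (e_ i).
by move=> sp; have [_]:= sp [::]; exact. Qed.

Lemma smooth_cont p: smooth p -> continuous p.
by move=> sp; have []:= sp [::]. Qed.

Lemma partial_zero p i x U: open U -> U x -> (forall y, U y -> p y = 0) -> partial i p x = 0.
move=> oU Ux h; rewrite (@partial_eq_on _ U p (fun=> 0) i x)//.
exact: derive_cst.
Qed.

Lemma compact_closed3 (K: set (R3 R)): compact K -> closed K.
by apply: compact_closed; exact: norm_hausdorff. Qed.

Lemma test_sub Om U p: Om `<=` U -> test Om p -> test U p.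
by move=> OU [sp [K [cK KO h]]]; split=> //; exists K; split=> //; exact: subset_trans OU.
Qed.

Lemma test_partial Om p i: test Om p -> test Om (partial i p).
move=> [sp [K [cK KO h]]]; split; first exact: smooth_partial.
exists K; split=> // x nK; apply: (@partial_zero _ _ _ (~` K))=> //.
exact: closed_openC (compact_closed3 cK).
Qed.

Lemma test_bounded Om p: test Om p -> exists2 M: R, 0 <= M & forall x, `|p x| <= M.
move=> [sp [K [cK KO h]]].
have [M [_ hM]]: bounded_set (p @` K).
 by apply: compact_bounded; apply: continuous_compact=> //; apply: continuous_subspaceT; exact: smooth_cont.
exists (`|M| + 1); first by rewrite addr_ge0.
move=> x; have [Kx|nK]:= pselect (K x); last by rewrite h// normr0 addr_ge0.
by apply: hM; [rewrite ltr_pwDr// ler_norm|exists x].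
Qed.

Lemma test_bounded_smooth Om p: test Om p -> bounded_smooth p.
move=> tp; split; first by case: tp.
move=> s; have: test Om (partials s p) by elim: s=> //= i s; exact: test_partial.
by move=> /test_bounded[M _ h]; exists M.
Qed.

Lemma testM Om p q: test Om p -> smooth q -> test Om (fun x=> p x * q x).
move=> [sp [K [cK KO h]]] sq; split.
 by apply/smoothP; apply: smooth_onM; [exact: openT|exact/smoothP|exact/smoothP].
by exists K; split=> // x nK; rewrite h// mul0r.
Qed.

(** Smoothness of the other factor is only needed near the support. *)
Lemma testM_on Om U p q: open U -> test U p -> smooth_on U q -> U `<=` Om ->
 test Om (fun x=> p x * q x).
move=> oU [sp [K [cK KU h]]] sq UO; split; last first.
 by exists K; split=> // [x /KU/UO//|x nK]; rewrite h// mul0r.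
apply/smoothP; apply: smooth_on_local=> x _.
have [Ux|nU]:= pselect (U x).
 by exists U; split=> //; apply: smooth_onM=> //; exact: smooth_smooth_on.
exists (~` K); split; first by move=> /KU.
have oK: open (~` K) by exact: closed_openC (compact_closed3 cK).
by apply: eq_smooth_on (smooth_on_cst _ 0)=> // y nK; rewrite h// mul0r.
Qed.

Lemma testD Om p q: test Om p -> test Om q -> test Om (fun x=> p x+q x).
move=> [sp [K [cK KO h]]] [sq [L [cL LO h']]]; split.
 by apply/smoothP; apply: smooth_onD; [exact: openT|exact/smoothP|exact/smoothP].
exists (K `|` L); split; first exact: compactU.
 by rewrite subUset.
by move=> x nKL; rewrite h ?h' ?addr0// => k; apply: nKL; [right|left].
Qed.

Lemma testZ Om p (c: R): test Om p -> test Om (fun x=> c * p x).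
move=> [sp [K [cK KO h]]]; split.
 by apply/smoothP; apply: smooth_onZ; [exact: openT|exact/smoothP].
by exists K; split=> // x nK; rewrite h// mulr0.
Qed.

Lemma test0 Om: test Om (fun=> 0).
split; first by apply/smoothP; exact: smooth_on_cst.
by exists set0; split=> //; exact: compact0.
Qed.

Lemma test_sum Om I (s: seq I) (p: I -> R3 R -> R): (forall i, test Om (p i)) ->
 test Om (fun x=> \sum_(i <- s) p i x).
move=> tp; elim: s=> [|i s IH].
 by have:= test0 Om; under [X in _ -> test _ X]funext=> x do rewrite big_nil.
have:= testD (tp i) IH.
by under [X in _ -> test _ X]funext=> x do rewrite big_cons.
Qed.

Lemma test_outside Om p x: test Om p -> ~ Om x -> p x = 0.
by move=> [_ [K [_ KO h]]] nO; apply: h=> /KO. Qed.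

Lemma smooth_partialC p i j x: smooth p -> partial i (partial j p) x = partial j (partial i p) x.
by move=> /smoothP sp; apply: (@partialC _ setT)=> //; exact: openT. Qed.

Lemma compact3 (K: set (R3 R)) (M: R): closed K -> K `<=` cube M -> compact K.
move=> cK KM; apply: (subclosed_compact cK _ KM).
by apply: compact_setX; [apply: compact_setX|]; exact: segment_compact.
Qed.

Lemma compact_cube (K: set (R3 R)): compact K -> exists2 M: R, 0 < M & K `<=` cube M.
by move=> /compact_bounded/bounded_cube. Qed.

End TestFunctions.

Section Superposition.
Context {R: realType} d (Y: measurableType d) (nu: {measure set Y -> \bar R}).
Notation T3:= (space3 R).
Variables (h: Y -> R) (m: Y -> T3) (H: R).
Hypothesis mh: measurable_fun setT h.
Hypothesis mm: measurable_fun setT m.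
Hypothesis hH: forall y, `|h y| <= H.
Implicit Types (g: Y -> R) (q: R3 R -> R) (x: R3 R).
Notation intg g:= (nu.-integrable setT (EFin \o g)).

Definition superpose g q x: R:= \int[nu]_y (g y * q (h y *: x+m y)).

Lemma measurable_affine x: measurable_fun setT ((fun y=> h y *: x+m y): Y -> T3).
have m2: measurable_fun setT (fun y=> (m y).2) by exact: measurableT_comp measurable_snd mm.
have m1: measurable_fun setT (fun y=> (m y).1) by exact: measurableT_comp measurable_fst mm.
have m12: measurable_fun setT (fun y=> (m y).1.2) by exact: measurableT_comp measurable_snd m1.
have m11: measurable_fun setT (fun y=> (m y).1.1) by exact: measurableT_comp measurable_fst m1.
case: x=> -[a b] c.
have ->: (fun y=> h y *: ((a, b, c): R3 R)+m y) =
  (fun y=> (h y * a+(m y).1.1, h y * b+(m y).1.2, h y * c+(m y).2)).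
 by apply/funext=> y; case: (m y)=> -[].
have A (t: R) f: measurable_fun setT f -> measurable_fun setT (fun y=> h y * t+f y).
 move=> mf; apply: measurable_funD mf; apply: measurable_funM=> //.
by apply: measurable_fun_pair; [apply: measurable_fun_pair|]; exact: A.
Qed.

Lemma measurable_superpose q x: continuous q ->
 measurable_fun setT (fun y=> q (h y *: x+m y)).
by move=> cq; exact: measurableT_comp (continuous_measurable3 cq) (measurable_affine x). Qed.

Lemma superpose_integrable g q x: intg g -> bounded_smooth q ->
 intg (fun y=> g y * q (h y *: x+m y)).
move=> ig bq; have [M _ hM]:= bounded_smooth_bound bq.
have:= @rintegrable_bmul _ _ _ nu setT measurableT g (fun y=> q (h y *: x+m y)) M
 (measurable_superpose x (smooth_cont bq.1)) (fun y _=> hM _) ig.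
by under [X in _ -> nu.-integrable _ (_ \o X)]funext=> y do rewrite mulrC.
Qed.

Lemma weight_integrable g: intg g -> intg (fun y=> g y * h y).
move=> ig; have:= @rintegrable_bmul _ _ _ nu setT measurableT g h H mh (fun y _=> hH y) ig.
by under [X in _ -> nu.-integrable _ (_ \o X)]funext=> y do rewrite mulrC.
Qed.

Lemma superpose_continuous g q: intg g -> bounded_smooth q -> continuous (superpose g q).
move=> ig bq x; apply/continuous3P=> e e0.
have [L L0 hL]:= bounded_smooth_Lipschitz bq.
have iag: intg (fun y=> `|g y|) by exact: integrable_norm ig.
set C:= \int[nu]_y `|g y| * (L * `|H|).
have C0: 0 <= C by rewrite /C mulr_ge0// ?mulr_ge0//; apply: Rintegral_ge0.
exists (e/(C+1)); first by rewrite divr_gt0// ltr_pwDr.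
move=> z zx; rewrite /superpose -RintegralB//; try exact: superpose_integrable.
have Cz: C * `|z-x| < e.
 move: zx; rewrite ltr_pdivlMr ?ltr_pwDr// mulrC=> h1; apply: le_lt_trans h1.
 by rewrite ler_wpM2r// lerDl.
apply: le_lt_trans Cz.
apply: le_trans (le_normr_Rintegral _ _) _=> //.
 by apply: rintegrableB=> //; exact: superpose_integrable.
have ->: C * `|z-x| = \int[nu]_y (`|g y| * (L * `|H| * `|z-x|)).
 by rewrite RintegralZr// /C -mulrA.
apply: le_Rintegral=> //.
- have i1: intg (fun y=> g y * q (h y *: z+m y)-g y * q (h y *: x+m y)).
  by apply: rintegrableB=> //; exact: superpose_integrable.
 exact: integrable_norm i1.
- have:= rintegrableZ measurableT (L * `|H| * `|z-x|) iag.
 by under [X in _ -> nu.-integrable _ (_ \o X)]funext=> y do rewrite mulrC.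
- move=> y _; rewrite -mulrBr normrM ler_wpM2l//.
 apply: le_trans (hL _ _) _; rewrite -mulrA ler_wpM2l//.
 have ->: h y *: z+m y-(h y *: x+m y) = h y *: (z-x).
  by rewrite opprD addrACA subrr addr0 -scalerBr.
 by rewrite normrZ ler_wpM2r// (le_trans (hH y))// ler_norm.
Qed.

Lemma superpose_derive g q x i: intg g -> bounded_smooth q ->
 is_derive x (e_ i) (superpose g q) (superpose (fun y=> g y * h y) (partial i q) x).
move=> ig bq.
suff: is_derive (x+(0: R) *: e_ i) (e_ i) (superpose g q)
  (superpose (fun y=> g y * h y) (partial i q) x) by rewrite scale0r addr0.
apply/is_derive_line.
pose f (s: R) (y: Y): R:= g y * q (h y *: (x+s *: e_ i)+m y).
have df (s: R) (y: Y): is_derive s (1: R) (f ^~ y) (g y * (h y * partial i q (h y *: (x+s *: e_ i)+m y))).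
 apply: is_deriveZ.
 exact: (iffLR (is_derive_line (fun z=> q (h y *: z+m y)) x (e_ i) s _) (affine_derive _ _ _ _ bq.1)).
have [M M0 hM]:= bounded_smooth_bound (bounded_smooth_partial i bq).
have iag: intg (fun y=> `|g y|) by exact: integrable_norm ig.
have iG: intg (fun y=> (`|H| * M) * `|g y|) by exact: rintegrableZ.
have p1 (s: R) (y: Y): partial1of2 f s y = g y * (h y * partial i q (h y *: (x+s *: e_ i)+m y)).
 by rewrite partial1of2E; have [_ ->]:= df s y.
have I0: [set` `]-1, 1[%R] (0: R) by rewrite /= in_itv/= ltrN10 ltr01.
have c:= @cvg_differentiation_under_integral R _ Y nu f setT measurableT 0 (-1) 1 I0
 (fun s _=> superpose_integrable (x+s *: e_ i) ig bq)
 (fun s y _ _=> @ex_derive _ _ _ _ _ _ _ (df s y))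
 (fun y=> `|H| * M * `|g y|) (fun y=> mulr_ge0 (mulr_ge0 (normr_ge0 _) M0) (normr_ge0 _)) iG.
have {}c: (fun h0: R=> h0^-1 *: (((fun s: R=> superpose g q (x+s *: e_ i)) \o shift 0) (h0 *: (1: R))-superpose g q (x+0 *: e_ i))) @ 0^'
 --> superpose (fun y=> g y * h y) (partial i q) x.
 have ->: superpose (fun y=> g y * h y) (partial i q) x = \int[nu]_y partial1of2 f 0 y.
  by apply: eq_Rintegral=> y _; rewrite p1 scale0r addr0 mulrA.
 have ->: (fun h0: R=> h0^-1 *: (((fun s: R=> superpose g q (x+s *: e_ i)) \o shift 0) (h0 *: (1: R))-superpose g q (x+0 *: e_ i))) =
   (fun t: R=> t^-1 *: (\int[nu]_y f (t+0) y - \int[nu]_y f 0 y)).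
  apply/funext=> t.
  have ->: ((fun s: R=> superpose g q (x+s *: e_ i)) \o shift 0) (t *: (1: R)) = superpose g q (x+(t+0) *: e_ i).
   by congr (superpose g q (x+(_ + 0) *: e_ i)); exact: mulr1.
  by [].
 apply: c=> s y _ _; rewrite p1 !normrM mulrC; apply: ler_pM=> //.
 by apply: ler_pM=> //; rewrite (le_trans (hH y))// ler_norm.
by split; [apply/cvg_ex; eexists; exact: c|exact: cvg_lim c].
Qed.

(** Averages of translates and dilates of a bounded smooth function may be
  differentiated under the integral sign, any number of times. *)
Lemma superpose_smooth g q: intg g -> bounded_smooth q -> smooth (superpose g q).
move=> ig bq; apply/smoothP=> k; elim: k g q ig bq=> [|k IH] g q ig bq.
 by split=> // x _; exact: superpose_continuous.
split=> [x _|i]; first exact: superpose_continuous.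
split=> [x _|]; first by have []:= superpose_derive x i ig bq.
apply: (@eq_Ck _ _ _ (superpose (fun y=> g y * h y) (partial i q)))=> //; first exact: openT.
 by move=> x _; have [_ e]:= superpose_derive x i ig bq; symmetry; exact: e.
by apply: IH; [exact: weight_integrable|exact: bounded_smooth_partial].
Qed.

Lemma superpose_partial g q x i: intg g -> bounded_smooth q ->
 partial i (superpose g q) x = superpose (fun y=> g y * h y) (partial i q) x.
by move=> ig bq; have [_]:= superpose_derive x i ig bq. Qed.

End Superposition.

(** * Averages and the fundamental lemma *)

Section OpenSets.
Context {R: realType}.
Notation T3:= (space3 R).
Notation mu:= (@lebesgue3 R).
Implicit Types (x y c: R3 R) (U Om: set (R3 R)).

Lemma measurable_open3 (A: set (R3 R)): measurable (A: set T3) -> <<s [set U: set (R3 R) | open U] >> A.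
move=> mA.
pose S:= g_sigma_algebraType [set U: set (R3 R) | open U].
have mc (f: R3 R -> R): continuous f -> measurable_fun (setT: set S) (f: S -> measurableTypeR R).
 move=> /continuousP cf; apply: (measurability _ (RGenOpens.measurableE R)).
 move=> _ [_ [a [b ->] <-]]; rewrite setTI; apply: sub_sigma_algebra.
 exact/cf/interval_open.
have m0: measurable_fun (setT: set S) (fun x: S=> (x.1.1, x.1.2, x.2): T3).
 apply: measurable_fun_pair; first apply: measurable_fun_pair.
 - by apply: (mc (fun x=> x.1.1))=> x; apply: continuous_comp; exact: cvg_fst.
 - by apply: (mc (fun x=> x.1.2))=> x; apply: continuous_comp; [exact: cvg_fst|exact: cvg_snd].
 - by apply: (mc (fun x=> x.2))=> x; exact: cvg_snd.
have:= m0 measurableT A mA.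
by rewrite setTI; congr (<<s _ >> _); apply/seteqP; split=> -[[a b] e].
Qed.

Definition inner U (r: R): set (R3 R):= [set x | forall y, `|y-x| < r -> U y].

Lemma inner_closed U r: closed (inner U r).
rewrite -[inner U r]setCK; apply: open_closedC; apply/open3P=> x /existsNP[y].
move=> /not_implyP[yx nU]; exists (r - `|y-x|); first by rewrite subr_gt0.
move=> z zx; apply/existsNP; exists y; apply/not_implyP; split=> //.
by have:= ler_distD x y z; rewrite [`|x-z|]distrC; move: zx yx; lra.
Qed.

Lemma inner_sub U r: 0 < r -> inner U r `<=` U.
by move=> r0 x; apply; rewrite subrr normr0. Qed.

Lemma inner_compact U (r M: R): 0 < r -> U `<=` cube M -> compact (inner U r).
by move=> r0 UM; apply: (@compact3 _ _ M); [exact: inner_closed|exact: subset_trans (inner_sub r0) UM].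
Qed.

End OpenSets.

Lemma ge0_integralZ d (T: measurableType d) (R: realType) (mu: {measure set T -> \bar R})
  (a: R) (g: T -> R): measurable_fun setT g -> 0 <= a -> (forall x, 0 <= g x) ->
 (\int[mu]_x (a * g x)%:E = a%:E * \int[mu]_x (g x)%:E)%E.
move=> mg a0 g0; transitivity (\int[mu]_x (a%:E * (g x)%:E))%E.
 by apply: eq_integral=> x _; rewrite EFinM.
rewrite ge0_integralZl//; first exact/measurable_EFinP.
by move=> x _; rewrite lee_fin.
Qed.

Lemma ge0_integrable_le d (T: measurableType d) (R: realType) (mu: {measure set T -> \bar R})
  (f g: T -> R): measurable_fun setT f -> (forall x, 0 <= f x) -> (forall x, 0 <= g x) ->
 (\int[mu]_x (f x)%:E <= \int[mu]_x (g x)%:E)%E ->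
 mu.-integrable setT (EFin \o g) -> mu.-integrable setT (EFin \o f).
move=> mf f0 g0 fg /integrableP[_ ig]; apply/integrableP; split; first exact/measurable_EFinP.
rewrite (_: (\int[mu]_x _)%E = \int[mu]_x (f x)%:E)%E; last first.
 by apply: eq_integral=> x _; rewrite /= ger0_norm.
apply: le_lt_trans fg _; apply: le_lt_trans ig.
rewrite (_: (\int[mu]_x (g x)%:E)%E = \int[mu]_x `|(EFin \o g) x|)%E//.
by apply: eq_integral=> x _; rewrite /= ger0_norm.
Qed.

Section Averages.
Context {R: realType}.
Notation T3:= (space3 R).
Notation mu:= (@lebesgue3 R).
Implicit Types (x y z c: R3 R) (u k p q: R3 R -> R) (U Om: set (R3 R)) (e: R).
Notation intg f:= (mu.-integrable setT (EFin \o f)).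

Definition averaging c e k:= [/\ test setT k, forall x, 0 <= k x,
 \int[mu]_x k x = 1 & forall x, k x != 0 -> `|x-c| < e].

Lemma test_integrable Om p: test Om p -> intg p.
move=> tp; have [M _ hM]:= test_bounded tp; have [sp [K [cK _ h]]]:= tp.
have [N N0 KN]:= compact_cube cK.
have mp: measurable3 p.
 by apply: continuous_measurable3; exact: smooth_cont.
have ->: p = p \_ (cube N).
 apply/funext=> x; rewrite patchE; case: ifPn=> // /negP xN; rewrite h// => Kx.
 by apply: xN; rewrite inE; exact: KN.
rewrite -restrict_EFin -integrable_mkcond; last exact: measurable_cube.
apply: (@integrable_cube _ N _ _ M)=> //; first exact: measurable_cube.
exact: measurable_funTS.
Qed.

Lemma test_sqint Om p: test Om p -> sqint mu p.
move=> tp; split; first by apply: continuous_measurable3; exact: smooth_cont tp.1.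
apply: test_integrable (_: test Om (fun x=> p x^+2)).
by under eq_fun do rewrite expr2; apply: testM tp tp.1.
Qed.

Lemma cube_measure e: 0 < e -> mu (cube e) = ((2 * e)^+3)%:E.
move=> e0; rewrite /lebesgue3 /= product_measure1E/=; last 2 first.
- by apply: measurableX; exact: measurable_itv.
- exact: measurable_itv.
rewrite product_measure1E/=; [|exact: measurable_itv|exact: measurable_itv].
have ->: lebesgue_measure `[(- e)%R, e] = (2 * e)%:E.
 rewrite lebesgue_measure_itv/= lte_fin ifT; last by lra.
 by rewrite -EFinB; congr (_%:E); lra.
by rewrite -!EFinM !exprS expr0 mulr1 mulrA.
Qed.

Lemma cube_indic e: intg (\1_(cube e): R3 R -> R).
have ->: (\1_(cube e): R3 R -> R) = (fun=> 1: R) \_ (cube e).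
 by apply/funext=> x; rewrite indicE patchE; case: ifP.
rewrite -restrict_EFin -integrable_mkcond; last exact: measurable_cube.
apply: (@integrable_cube _ e _ _ 1)=> //; first exact: measurable_cube.
by move=> x _; rewrite normr1.
Qed.

Lemma affine_test p (a: R) b: a != 0 -> test setT p -> test setT (fun x=> p (a *: x+b)).
move=> a0 [sp [K [cK _ h]]]; split; first exact: affine_smooth.
pose f:= fun y: R3 R=> a^-1 *: y-a^-1 *: b.
exists (f @` K); split=> //.
 apply: continuous_compact=> //; apply: continuous_subspaceT=> x.
 by apply: cvgB; [apply: cvgZl_tmp; exact: cvg_id|exact: cvg_cst].
move=> x nx; apply: h=> Kx; apply: nx; exists (a *: x+b)=> //.
by rewrite /f scalerDr addrK scalerA mulVf// scale1r.
Qed.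

Lemma test_bump: test setT (@bump R).
split; first exact: smooth_bump.
exists (cube 1); split=> //.
 apply: (@compact3 _ _ 1)=> //.
 have ->: cube 1 = [set x: R3 R | `|x| <= 1] by apply/seteqP; split=> x /cubeE.
 apply: (closed_comp (f:= fun x: R3 R=> `|x|) (D:= [set t | t <= 1])); last exact: closed_le.
 by move=> x _; exact: norm_continuous.
move=> x nx; apply/eqP/negPn/negP=> /bump_supp/ltW h; apply: nx; exact/cubeE.
Qed.

Definition mollifier c e x: R:= bump (e^-1 *: (x-c)) / \int[mu]_y bump (e^-1 *: (y-c)).

Lemma averaging_mollifier c e: 0 < e -> averaging c e (mollifier c e).
move=> e0; pose k x:= bump (e^-1 *: (x-c)): R.
have en: e^-1 != 0 by rewrite invr_eq0 gt_eqF.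
have tk: test setT k.
 have:= affine_test (- (e^-1 *: c)) en test_bump.
 by under [X in test _ X -> _]funext=> x do rewrite -scalerBr.
have ik:= test_integrable tk.
have [s s0 hs]:= (iffLR (continuous3P k c) (smooth_cont tk.1 (x:= c))) (k c) ltac:(by rewrite /k subrr scaler0 bump0).
have kc: 0 < k c by rewrite /k subrr scaler0 bump0.
have I0: 0 < \int[mu]_x k x.
 have [e1 e10 he1]: exists2 e1: R, 0 < e1 & forall y, `|y-c| < e1 -> k c/2 < k y.
  have [s' s'0 hs']:= (iffLR (continuous3P k c) (smooth_cont tk.1 (x:= c))) (k c/2) (divr_gt0 kc (ltr0n _ 2)).
  by exists s'=> // y /hs'; rewrite ltr_norml=> /andP[h _]; move: h; lra.
 pose A: set (R3 R):= cube (e1/2).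
 have mA: measurable (A: set T3) by exact: measurable_cube.
 have e12: 0 < e1/2 by rewrite divr_gt0.
 have i1: intg (\1_A: R3 R -> R) by exact: cube_indic.
 have iA: intg (fun x=> (k c/2) * \1_A x) by exact: rintegrableZ.
 have h: \int[mu]_x ((k c/2) * \1_A x) <= \int[mu]_x k (x+c).
  apply: le_Rintegral=> //; first exact: integrable_shift.
  move=> x _; rewrite indicE; case: (boolP (x \in A))=> [/set_mem Ax|_]; rewrite ?mulr1 ?mulr0.
   apply/ltW/he1; rewrite addrK; move/cubeE: Ax=> /le_lt_trans; apply; lra.
  exact: bump_ge0.
 rewrite Rintegral_shift in h; last by case/integrableP: ik=> /measurable_EFinP.
 apply: lt_le_trans h; rewrite RintegralZl//.
 rewrite /Rintegral integral_indic// setIT cube_measure//=.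
 by rewrite !mulr_gt0// exprn_gt0// mulr_gt0.
split.
- by have:= testZ (\int[mu]_x k x)^-1 tk; under [X in test _ X -> _]funext=> x do rewrite mulrC.
- by move=> x; rewrite divr_ge0 ?bump_ge0// ltW.
- by rewrite RintegralZr// divff// gt_eqF.
- move=> x; rewrite mulf_eq0 negb_or=> /andP[/bump_supp h _].
 by move: h; rewrite normrZ normfV gtr0_norm// mulrC ltr_pdivrMr// mul1r.
Qed.

Definition average u k x: R:= \int[mu]_y (u y * k (y-x)).

Lemma average_superpose u k: average u k = superpose mu (fun=> - 1) (fun y=> y) u k.
by apply/funext=> x; apply: eq_Rintegral=> y _; rewrite scaleN1r addrC.
Qed.

Let norm1 (y: T3): `|(- 1: R)| <= 1. Proof. by rewrite normrN1. Qed.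

Lemma average_smooth u k: intg u -> bounded_smooth k -> smooth (average u k).
move=> iu bk; rewrite average_superpose.
exact: (@superpose_smooth _ _ _ mu (fun=> -1) (fun y=> y) 1 _ _ norm1).
Qed.

Lemma average_partial u k i x: intg u -> bounded_smooth k ->
 partial i (average u k) x = - average u (partial i k) x.
move=> iu bk; rewrite average_superpose.
rewrite (@superpose_partial _ _ _ mu (fun=> -1) (fun y=> y) 1 _ _ norm1 u k x i)//.
rewrite average_superpose /superpose -[RHS]mulN1r -RintegralZl//.
 by apply: eq_Rintegral=> y _; rewrite mulrN1 mulN1r mulNr.
apply: (@superpose_integrable _ _ _ mu (fun=> -1) (fun y=> y))=> //.
exact: bounded_smooth_partial.
Qed.

Lemma averageE u k x: measurable3 u -> continuous k ->
 average u k x = \int[mu]_z (u (x+z) * k z).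
move=> mv ck; rewrite /average -(Rintegral_shift x).
 by apply: eq_Rintegral=> y _; rewrite addrK addrC.
apply: measurable_funM=> //; apply: (@measurableT_comp _ _ _ _ _ _ k); first exact: continuous_measurable3.
exact: measurable_shift3.
Qed.

Lemma average_sqint_integrable u k x: sqint mu u -> test setT k ->
 intg (fun y=> u y * k (y-x)).
move=> su tk; apply: sqint_mul=> //; apply: (@test_sqint setT).
by have:= @affine_test k 1 (- x) (oner_neq0 _) tk; under [X in test _ X -> _]funext=> y do rewrite scale1r.
Qed.

Lemma averageB u v k x: sqint mu u -> sqint mu v -> test setT k ->
 average (fun y=> u y-v y) k x = average u k x-average v k x.
move=> su sv tk; rewrite /average -RintegralB//; [|exact: average_sqint_integrable..].
by apply: eq_Rintegral=> y _; rewrite mulrBl.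
Qed.

Lemma average_sqr u c e k x: sqint mu u -> averaging c e k ->
 average u k x^+2 <= \int[mu]_z (u (x+z)^+2 * k z).
move=> su ak; have [tk k0 k1 ks]:= ak.
have ck:= smooth_cont tk.1.
have mk: measurable3 k by exact: continuous_measurable3.
have mu_: measurable3 u:= su.1.
have [M M0 hM]:= test_bounded tk.
have ms: measurable_fun (setT: set T3) (fun z=> Num.sqrt (k z)).
 by apply: continuous_measurable3=> z; apply: (@continuous_comp _ _ _ k Num.sqrt); [exact: ck|exact: sqrt_continuous].
have sux: sqint mu (fun z=> u (x+z)).
 split; last by under [X in _ .-integrable _ (_ \o X)]funext=> z do rewrite addrC; exact: (integrable_shift x su.2).
 under eq_fun do rewrite addrC.
 exact: measurableT_comp mu_ (measurable_shift3 x).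
have s1: sqint mu (fun z=> Num.sqrt (k z) * u (x+z)).
 apply: (@sqint_bmul _ _ _ _ _ _ (Num.sqrt M))=> // z.
 by rewrite ger0_norm ?sqrtr_ge0// ler_wsqrtr// (le_trans (ler_norm _)).
have s2: sqint mu (fun z=> Num.sqrt (k z)).
 split=> //; under [X in _ .-integrable _ (_ \o X)]funext=> z do rewrite sqr_sqrtr//.
 exact: test_integrable tk.
rewrite averageE//.
have:= sqint_CS s1 s2.
under [X in X^+2 <= _]eq_Rintegral=> z _ do rewrite mulrAC -expr2 sqr_sqrtr// mulrC.
under [X in _ <= _ * X]eq_Rintegral=> z _ do rewrite sqr_sqrtr//.
rewrite k1 mulr1.
by under [X in _ <= X]eq_Rintegral=> z _ do rewrite exprMn sqr_sqrtr// mulrC.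
Qed.

Lemma average_measurable u k: sqint mu u -> test setT k -> intg u ->
 measurable_fun (setT: set T3) (average u k: T3 -> R).
move=> su tk iu; apply: continuous_measurable3; apply: smooth_cont.
by apply: average_smooth=> //; exact: test_bounded_smooth tk.
Qed.

(** Averaging does not increase the L2 norm, by the Cauchy-Schwarz inequality
  for the measure with density k and translation invariance. *)
Lemma average_contraction u c e k: sqint mu u -> intg u -> averaging c e k ->
 sqint mu (average u k) /\ \int[mu]_x (average u k x^+2) <= \int[mu]_x (u x^+2).
move=> su iu ak; have [tk k0 k1 ks]:= ak.
have mk: measurable3 k by exact: continuous_measurable3 (smooth_cont tk.1).
have mu_: measurable3 u:= su.1.
have ma:= average_measurable su tk iu.
have msum: measurable_fun (setT: set (T3 * T3)) (fun z: T3 * T3=> z.1+z.2: T3).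
 apply: measurable_fun_pair; first apply: measurable_fun_pair.
 - by apply: measurable_funD; apply: measurableT_comp; try exact: measurable_fst;
   apply: measurableT_comp; try exact: measurable_fst; (exact: measurable_fst || exact: measurable_snd).
 - by apply: measurable_funD; apply: measurableT_comp; try exact: measurable_snd;
   apply: measurableT_comp; try exact: measurable_fst; (exact: measurable_fst || exact: measurable_snd).
 - by apply: measurable_funD; apply: measurableT_comp; try exact: measurable_snd;
  (exact: measurable_fst || exact: measurable_snd).
pose f (w: T3 * T3): \bar R:= (u (w.1+w.2)^+2 * k w.2)%:E.
have mf: measurable_fun setT f.
 apply/measurable_EFinP; apply: measurable_funM.
  by apply: measurable_funX; exact: measurableT_comp mu_ msum.
 exact: measurableT_comp mk measurable_snd.
have f0 w: (0 <= f w)%E by rewrite lee_fin mulr_ge0// sqr_ge0.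
have f1 x: (\int[mu]_z f (x, z) = (\int[mu]_z (u (x+z)^+2 * k z))%:E)%E.
 rewrite /Rintegral fineK//; apply: integrable_fin_num=> //.
 have [M M0 hM]:= test_bounded tk.
 have i3: intg (fun z=> u (x+z)^+2).
  under [X in _ .-integrable _ (_ \o X)]funext=> z do rewrite addrC.
  exact: (integrable_shift x su.2).
 have:= @rintegrable_bmul _ _ _ mu setT measurableT _ k M mk (fun z _=> hM z) i3.
 by congr (_.-integrable _ _); apply/funext=> z /=; rewrite mulrC.
have sw: (\int[mu]_x \int[mu]_z f (x, z) = \int[mu]_x (u x^+2)%:E)%E.
 rewrite -[LHS](@tonelli_swap R _ _ (leb3 R) f mf f0).
 have h z: (\int[mu]_x f (x, z) = (k z)%:E * \int[mu]_x (u x^+2)%:E)%E.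
  rewrite -(@integralE_shift R z (fun x=> (u x^+2)%:E)); last first.
   by apply/measurable_EFinP; exact: measurable_funX.
  have:= @ge0_integralZ _ _ _ mu (k z) (fun x=> u (x+z)^+2) _ (k0 z) (fun x=> sqr_ge0 _).
  move=> <-; last by apply: measurable_funX; exact: measurableT_comp mu_ (measurable_shift3 z).
  by apply: eq_integral=> x _; rewrite /f/= mulrC.
 transitivity (\int[mu]_z ((k z)%:E * \int[mu]_x (u x^+2)%:E))%E.
  by apply: eq_integral=> z _; exact: h.
 have fin: (\int[mu]_x (u x^+2)%:E)%E \is a fin_num by exact: integrable_fin_num su.2.
 rewrite -(fineK fin) ge0_integralZr//.
 - have:= k1; rewrite /Rintegral=> h1.
  have fk: (\int[mu]_x (k x)%:E)%E \is a fin_num by exact: integrable_fin_num (test_integrable tk).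
  by rewrite -(fineK fk) h1 mul1e.
 - exact/measurable_EFinP.
 - by move=> x _; rewrite lee_fin.
 - by rewrite lee_fin fine_ge0// integral_ge0// => x _; rewrite lee_fin sqr_ge0.
have le: (\int[mu]_x (average u k x^+2)%:E <= \int[mu]_x (u x^+2)%:E)%E.
 rewrite -sw; apply: ge0_le_integral=> //.
 - by move=> x _; rewrite lee_fin sqr_ge0.
 - by apply/measurable_EFinP; exact: measurable_funX.
 - exact: (@measurable_fun_fubini_tonelli_F _ _ _ _ _ (leb3 R) f mf f0).
 - by move=> x _; rewrite f1 lee_fin; exact: average_sqr ak.
have i2: intg (fun x=> average u k x^+2).
 apply: ge0_integrable_le le su.2=> //; by [exact: measurable_funX|move=> x; rewrite sqr_ge0].
split; first by split.
rewrite /Rintegral fine_le//; [exact: integrable_fin_num i2|exact: integrable_fin_num su.2].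
Qed.

End Averages.

Lemma cvg_of_sqr (R: realType) (x: nat -> R) (l c: R): 0 <= c ->
 (forall eps: R, 0 < eps -> exists N, forall n, (N <= n)%N -> (x n-l)^+2 <= eps * c) ->
 x n @[n --> \oo] --> l.
move=> c0 h; apply/cvgrPdist_lt=> e e0.
have e1: 0 < e^+2/(c+1) by rewrite divr_gt0 ?exprn_gt0// ltr_pwDr.
have [N hN]:= h _ e1; exists N=> // n /= Nn.
rewrite distrC -(@ltr_pXn2r _ 2)// ?nnegrE ?normr_ge0 ?(ltW e0)// real_normK ?num_real//.
apply: le_lt_trans (hN n Nn) _; rewrite -mulrA gtr_pMr ?exprn_gt0//.
by rewrite mulrC ltr_pdivrMr ?ltr_pwDr// mul1r ltrDl.
Qed.

Lemma cancel_scale (R: realType) (a b e: R): 0 < a -> 0 < b -> a * (e/(24 * a * b)) * b = e/24.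
by move=> a0 b0; field; rewrite !gt_eqF. Qed.

Lemma inv_small (R: realType) (e: R): 0 < e ->
 exists N, forall n, (N <= n)%N -> n.+1%:R^-1 <= e.
move=> e0; have [N _ hN]:= near_infty_natSinv_lt (PosNum e0).
by exists N=> n /hN/ltW.
Qed.

Section Density.
Context {R: realType}.
Notation T3:= (space3 R).
Notation mu:= (@lebesgue3 R).
Implicit Types (x y z c: R3 R) (u k p q: R3 R -> R) (U Om: set (R3 R)) (e: R).
Notation intg f:= (mu.-integrable setT (EFin \o f)).

Lemma cube_integrable M u: sqint mu u -> (forall x, ~ cube M x -> u x = 0) -> intg u.
move=> su h; have c2: sqint mu (\1_(cube M): R3 R -> R).
 split; first exact: measurable_indic (measurable_cube M).
 have ->: (fun x: R3 R=> (\1_(cube M) x: R)^+2) = \1_(cube M).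
  by apply/funext=> x; rewrite indicE; case: (_ \in _); rewrite ?expr1n ?expr0n.
 exact: cube_indic.
have:= sqint_mul su c2; congr (_.-integrable _ _); apply/funext=> x /=; congr (_%:E).
rewrite indicE; case: (boolP (_ \in _))=> [|/negP xM]; rewrite ?mulr1// mulr0 h// => cx.
by apply: xM; rewrite inE.
Qed.

Lemma indic_average_measurable (A: set (R3 R)) M: measurable (A: set T3) -> A `<=` cube M ->
 sqint mu (\1_A: R3 R -> R) /\ intg (\1_A: R3 R -> R).
move=> mA AM; have h: sqint mu (\1_A: R3 R -> R).
 split; first exact: measurable_indic mA.
 have ->: (fun x: R3 R=> (\1_A x: R)^+2) = \1_A.
  by apply/funext=> x; rewrite indicE; case: (_ \in _); rewrite ?expr1n ?expr0n.
 apply: (@le_rintegrable _ _ _ mu setT measurableT (\1_A: R3 R -> R) \1_(cube M)); last exact: cube_indic.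
  exact: measurable_indic mA.
 move=> x _; rewrite !indicE ger0_norm ?ler0n// ler_nat.
 case: (boolP (x \in A))=> // /set_mem /AM Ax.
 by rewrite mem_set.
split=> //; apply: (@cube_integrable M)=> // x nM; rewrite indicE memNset// => /AM.
exact: nM.
Qed.

(** A smooth plateau: average the indicator of the points at distance at least
  2r from the complement over balls of radius r. *)
Lemma plateau U (M r: R): 0 < r -> U `<=` cube M -> exists phi: R3 R -> R,
 [/\ test U phi, forall x, 0 <= phi x <= 1 & forall x, inner U (3 * r) x -> phi x = 1].
move=> r0 UM.
have r20: 0 < 2 * r by rewrite mulr_gt0.
pose A:= inner U (2 * r).
have [k ak]: exists k, averaging (0: R3 R) r k by exists (mollifier 0 r); exact: averaging_mollifier.
have [tk k0 k1 ks]:= ak.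
have mA: measurable (A: set T3) by apply: closed_measurable3; exact: inner_closed.
have AM: A `<=` cube M by exact: subset_trans (inner_sub r20) UM.
have [sA iA]:= indic_average_measurable mA AM.
have ik:= test_integrable tk.
have ck: continuous k:= smooth_cont tk.1.
have mk: measurable3 k:= continuous_measurable3 ck.
have E x: average (\1_A: R3 R -> R) k x = \int[mu]_z (\1_A (x+z) * k z).
 by apply: averageE=> //; exact: measurable_indic.
have i1 x: intg (fun z=> \1_A (x+z) * k z).
 apply: rintegrable_bmul ik=> //; last by move=> z _; rewrite indicE ger0_norm ?ler0n//; case: (_ \in _).
 have ->: (fun z=> \1_A (x+z): R) = (fun z=> (\1_A: R3 R -> R) (z+x)).
  by apply/funext=> z; rewrite addrC.
 exact: measurableT_comp (measurable_indic mA) (measurable_shift3 x).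
exists (average (\1_A: R3 R -> R) k); split.
- split; first by apply: average_smooth=> //; exact: test_bounded_smooth tk.
 exists (inner U r); split; [exact: inner_compact UM|exact: inner_sub|].
 move=> x nx; rewrite E (_: (fun z=> _) = (fun=> 0)) ?/Rintegral ?integral0//.
 apply/funext=> z; rewrite indicE; case: (boolP (x+z \in A))=> [/set_mem Az|]; last by rewrite mul0r.
 rewrite mul1r; apply/eqP/negPn/negP=> /ks; rewrite subr0=> zr; apply: nx=> y yx.
 apply: Az; apply: le_lt_trans (ler_distD x _ _) _.
 by rewrite opprD addNKr normrN mulr2n mulrDl mul1r ltrD.
- move=> x; rewrite E; apply/andP; split.
  by apply: Rintegral_ge0=> z _; rewrite mulr_ge0// indicE ler0n.
 rewrite -k1; apply: le_Rintegral=> // z _.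
 by rewrite ler_piMl// indicE lern1 leq_b1.
- move=> x hx; rewrite E -k1; apply: eq_Rintegral=> z _.
 have [->|/ks]:= eqVneq (k z) 0; first by rewrite mulr0.
 rewrite subr0=> zr; rewrite indicE mem_set ?mul1r// => y yx; apply: hx.
 apply: le_lt_trans (ler_distD (x+z) _ _) _.
 have ->: x+z-x = z by rewrite addrAC subrr add0r.
 by move: yx zr; move: `|_| `|z| => a b; lra.
Qed.

Variables (Om: set (R3 R)) (M: R).
Hypothesis oO: open Om.
Hypothesis OM: Om `<=` cube M.
Let mO: measurable (Om: set T3):= open_measurable3 oO.

Lemma test_L2s p: test Om p -> L2s Om p.
move=> tp; apply/L2sP=> //.
apply: eq_sqint (test_sqint tp)=> x; rewrite patchE.
by case: ifPn=> // /negP nx; rewrite (test_outside tp)// => Ox; apply: nx; rewrite inE.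
Qed.

Lemma L2s_integrable u: L2s Om u -> mu.-integrable Om (EFin \o u).
move=> /L2sP su; rewrite integrable_mkcond// restrict_EFin.
apply: (@cube_integrable M)=> // x nx; rewrite patchE memNset// => /OM; exact: nx.
Qed.

Lemma integral_open_test u V: L2s Om u -> (forall phi, test Om phi -> ips Om u phi = 0) ->
 open V -> (\int[mu]_(x in V `&` Om) (u x)%:E = 0)%E.
move=> lu h oV; pose W:= V `&` Om.
have oW: open W by exact: openI.
have mW: measurable (W: set T3) by exact: open_measurable3.
have WM: W `<=` cube M by move=> x [_ /OM].
have WO: W `<=` Om by move=> x [].
have /choice[phi hphi] n: exists phi: R3 R -> R,
 [/\ test W phi, forall x, 0 <= phi x <= 1 & forall x, inner W (3 * n.+1%:R^-1) x -> phi x = 1].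
 by apply: (@plateau W M)=> //; rewrite invr_gt0 ltr0n.
have iu:= L2s_integrable lu.
have mu_: measurable_fun (Om: set T3) (u: T3 -> R) by case/integrableP: iu=> /measurable_EFinP.
have I0 n: (\int[mu]_(x in Om) (phi n x * u x)%:E = 0)%E.
 have [tp b _]:= hphi n.
 have tO: test Om (phi n) by exact: test_sub tp.
 have:= h _ tO; rewrite ipsC /ips /Rintegral=> hh.
 rewrite -[LHS]fineK ?hh//; apply: integrable_fin_num=> //.
 exact: ips_integrable (test_L2s tO) lu.
have []:= @dominated_convergence _ T3 R mu Om mO (fun n x=> (phi n x * u x)%:E)
 (fun x=> (\1_W x * u x)%:E) (fun x=> `|u x|%:E).
- move=> n; apply/measurable_EFinP; apply: measurable_funM=> //.
 have [[sp _] _ _]:= hphi n.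
 exact: measurable_funTS (continuous_measurable3 (smooth_cont sp)).
- apply/measurable_EFinP; apply: measurable_funM=> //; exact: measurable_funTS (measurable_indic mW).
- apply: ae_all=> x Ox.
 apply: cvg_EFin; first by apply: nearW.
 apply: cvg_near_cst; have [Wx|nW]:= pselect (W x); last first.
  apply: nearW=> n; rewrite /= indicE memNset//; have [tp _ _]:= hphi n.
  by rewrite (test_outside tp).
 have [r r0 rW]:= (iffLR (open3P W) oW) x Wx.
 have r30: 0 < r/3 by rewrite divr_gt0.
 near=> n; have [_ _ p1]:= hphi n.
 rewrite /= indicE mem_set// p1// => y yx; apply: rW; apply: lt_le_trans yx _.
 rewrite mulrC -ler_pdivlMr//; apply: ltW.
 by near: n; exact: near_infty_natSinv_lt (PosNum r30).
- have:= integrable_norm iu; apply: eq_integrable=> //.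
- apply: ae_all=> x n Ox; have [_ /(_ x)/andP[b0 b1] _]:= hphi n.
 by rewrite /= lee_fin normrM ger0_norm// ler_piMl.
move=> _ _; rewrite /mkseq; under eq_fun do rewrite I0.
move=> hc; have:= cvg_unique _ hc (cvg_cst _); rewrite setIC integral_mkcondr=> <-//.
apply: eq_integral=> x /set_mem Ox; rewrite patchE indicE.
case: ifPn=> [Vx|nV]; first by rewrite mem_set ?mul1r//; split=> //; exact: set_mem.
by rewrite memNset ?mul0r// => -[Vx _]; move/negP: nV; apply; exact: mem_set.
Unshelve. all: by end_near. Qed.

(** A square-integrable function orthogonal to all test functions vanishes:
  its integrals over open sets vanish, and a Dynkin argument extends this to
  all measurable sets. *)
Lemma fundamental_lemma u: L2s Om u -> (forall phi, test Om phi -> ips Om u phi = 0) ->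
 ae_eq_on Om u (fun=> 0).
move=> lu h; have iu:= L2s_integrable lu.
have mu_: measurable_fun (Om: set T3) (u: T3 -> R) by case/integrableP: iu=> /measurable_EFinP.
have isub A: measurable (A: set T3) -> mu.-integrable (A `&` Om) (EFin \o u).
 move=> mA; apply: integrableS iu=> //; first exact: measurableI.
have P A: measurable (A: set T3) -> (\int[mu]_(x in A `&` Om) (u x)%:E = 0)%E.
 move=> mA; move: (measurable_open3 mA).
 apply: (@dynkin_induction _ T3 _ (fun A=> \int[mu]_(x in A `&` Om) (u x)%:E = 0)%E).
 - apply/seteqP; split=> B; first exact: measurable_open3.
  by apply: smallest_sub; [exact: sigma_algebra_measurable|exact: open_measurable3].
 - by move=> B C; exact: openI.
 - by apply: integral_open_test=> //; exact: openT.
 - by move=> B oB; exact: integral_open_test.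
 - move=> B mB hB.
  have hO: (\int[mu]_(x in setT `&` Om) (u x)%:E = 0)%E by apply: integral_open_test=> //; exact: openT.
  have E: setT `&` Om = (B `&` Om) `|` (~` B `&` Om) by rewrite -setIUl setUv.
  move: hO; rewrite E integral_setU//=.
  + by rewrite hB add0e.
  + exact: measurableI.
  + by apply: measurableI=> //; exact: measurableC.
  + by rewrite -E setTI; exact/measurable_EFinP.
  + by apply/disj_set2P; rewrite setIACA setICr set0I.
 - move=> F mF tF hF; rewrite setI_bigcupl integral_bigcup//.
  + by rewrite eseries0.
  + exact: trivIset_setIr.
  + by move=> k; exact: measurableI.
  + by rewrite -setI_bigcupl; apply: isub; exact: bigcup_measurable.
pose A: set T3:= Om `&` [set x | 0 <= u x].
have mA: measurable A.
 have:= mu_ mO _ (measurable_itv `[0%R, +oo[).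
 by congr measurable; apply/seteqP; split=> x [Ox] /=; rewrite in_itv/= andbT.
have h0: (\int[mu]_(x in Om) `|(u x)%:E| = 0)%E.
 have ->: Om = (A `&` Om) `|` (~` A `&` Om) by rewrite -setIUl setUv setTI.
 rewrite integral_setU//=.
 + have ->: (\int[mu]_(x in A `&` Om) `|u x|%:E = \int[mu]_(x in A `&` Om) (u x)%:E)%E.
   by apply: eq_integral=> x /set_mem[[_ /= ux] _]; rewrite ger0_norm.
  have ->: (\int[mu]_(x in ~` A `&` Om) `|u x|%:E = \int[mu]_(x in ~` A `&` Om) ((-1)%:E * (u x)%:E))%E.
   apply: eq_integral=> x /set_mem[nA Ox]; rewrite ltr0_norm ?EFinN ?mulN1e//.
   by rewrite ltNge; apply/negP=> ux; apply: nA.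
  have mAC: measurable (~` A) by exact: measurableC.
  by rewrite integralZl ?P ?mule0 ?adde0//; [exact: measurableI|exact: isub].
 + exact: measurableI.
 + by apply: measurableI=> //; exact: measurableC.
 + by rewrite -setIUl setUv setTI; apply/measurable_EFinP; exact: measurableT_comp.
 + by apply/disj_set2P; rewrite setIACA setICr set0I.
have:= iffLR (ae_eq_integral_abs mu mO (iffRL (measurable_EFinP _ _) mu_)) h0.
by move=> h1; apply: (ae_imp h1)=> x hx Ox; have []:= hx Ox.
Qed.

Lemma L2s_complete (v: nat -> R3 R -> R): (forall n, L2s Om (v n)) ->
 (forall eps: R, 0 < eps -> exists N, forall n m, (N <= n)%N -> (N <= m)%N ->
  ips Om (fun x=> v n x-v m x) (fun x=> v n x-v m x) <= eps) ->
 exists w, L2s Om w /\ forall eps: R, 0 < eps -> exists N, forall n, (N <= n)%N ->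
  ips Om (fun x=> v n x-w x) (fun x=> v n x-w x) <= eps.
move=> lv cv.
have E (p q: R3 R -> R): ip Om (fun x=> const_mx (p x): 'M[R]_(1, 1)) (fun x=> const_mx (q x)) = ips Om p q.
 by apply: eq_Rintegral=> x _; rewrite /frob !big_ord1 !mxE.
have [|eps e0|w [lw cw]]:= @L2_complete R Om mO 1 1 (fun n x=> const_mx (v n x)).
- by move=> n i j; under [X in L2s _ X]funext=> x do rewrite mxE.
- have [N hN]:= cv _ e0; exists N=> n m Nn Nm; apply: le_trans (hN n m Nn Nm); rewrite -E.
 by rewrite le_eqVlt; apply/orP; left; apply/eqP; congr ip; apply/funext=> x;
  apply/matrixP=> i j; rewrite !mxE.
exists (fun x=> w x 0 0); split; first exact: lw.
move=> eps e0; have [N hN]:= cw _ e0; exists N=> n Nn; apply: le_trans (hN n Nn).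
rewrite -E le_eqVlt; apply/orP; left; apply/eqP; congr ip; apply/funext=> x;
  by apply/matrixP=> i j; rewrite !mxE !ord1.
Qed.

Lemma ips_CS p q: L2s Om p -> L2s Om q -> (ips Om p q)^+2 <= ips Om p p * ips Om q q.
move=> /L2sP lp /L2sP lq; rewrite !ipsE//.
have:= sqint_CS lp lq.
by under [X in _ <= X * _]eq_Rintegral=> x _ do rewrite expr2;
 under [X in _ <= _ * X]eq_Rintegral=> x _ do rewrite expr2.
Qed.

Lemma ips_cvg (v: nat -> R3 R -> R) w p: (forall n, L2s Om (v n)) -> L2s Om w -> L2s Om p ->
 (forall eps: R, 0 < eps -> exists N, forall n, (N <= n)%N ->
  ips Om (fun x=> v n x-w x) (fun x=> v n x-w x) <= eps) ->
 ips Om (v n) p @[n --> \oo] --> ips Om w p.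
move=> lv lw lp cv; apply: (cvg_of_sqr (ips_ge0 Om p))=> eps e0.
have [N hN]:= cv _ e0; exists N=> n Nn.
have lvw: L2s Om (fun x=> v n x-w x) by exact: L2sB.
have ->: ips Om (v n) p-ips Om w p = ips Om (fun x=> v n x-w x) p.
 have:= ips_linl mO (-1) lw (lv n) lp; rewrite mulN1r addrC=> <-.
 by apply: eq_ips=> // x _; rewrite mulN1r addrC.
by apply: le_trans (ips_CS lvw lp) _; rewrite ler_wpM2r ?ips_ge0// hN.
Qed.

Lemma test_dense u: L2s Om u -> forall eps: R, 0 < eps ->
 exists2 phi, test Om phi & ips Om (fun x=> u x-phi x) (fun x=> u x-phi x) <= eps.
move=> lu.
have [v [tv cv bv]]:= @variational_minimum R (R3 R -> R) (test Om) (ips Om) (ips Om u) (ips Om u u)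
 (ips_ge0 _ _) (test0 Om) (fun a p q tp tq=> testD (testZ a tp) tq) (fun p q _ _=> ipsC Om p q)
 (fun a p q w tp tq tw=> ips_linl mO a (test_L2s tp) (test_L2s tq) (test_L2s tw))
 (fun p _=> ips_ge0 Om p)
 (fun a p q tp tq=> ltac:(by rewrite ipsC (ips_linl mO a (test_L2s tp) (test_L2s tq) lu) !(ipsC Om u)))
 (fun p tp=> ips_CS lu (test_L2s tp)).
have lv n:= test_L2s (tv n).
have [eps e0|w [lw cw]]:= L2s_complete lv.
 have [N hN]:= inv_small (divr_gt0 e0 (ltr0n R 4)).
 exists N=> n m Nn Nm; apply: le_trans (cv n m) _.
 by have:= hN _ Nn; have:= hN _ Nm; move: (n.+1%:R^-1) (m.+1%:R^-1)=> a b; lra.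
have lwu: L2s Om (fun x=> u x-w x) by exact: L2sB.
have z: ae_eq_on Om (fun x=> u x-w x) (fun=> 0).
 apply: fundamental_lemma=> // phi tp; have lp := test_L2s tp.
 have c1:= ips_cvg lv lw lp cw.
 have c2: ips Om (v n) phi @[n --> \oo] --> ips Om u phi.
  apply: (cvg_of_sqr (ips_ge0 Om phi))=> eps e0; have [N hN]:= inv_small e0.
  by exists N=> n Nn; apply: le_trans (bv n _ tp) _; rewrite ler_wpM2r ?ips_ge0// hN.
 have E: ips Om w phi = ips Om u phi by apply: (cvg_unique _ c1 c2).
 have:= ips_linl mO (-1) lw lu lp; rewrite E mulN1r addNr=> <-.
 by apply: eq_ips=> // x _; rewrite mulN1r addrC.
move=> eps e0; have [N hN]:= cw _ e0.
exists (v N)=> //; apply: le_trans (hN N (leqnn _)).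
have lh: L2s Om (fun x=> u x-v N x) by exact: L2sB.
have lh': L2s Om (fun x=> (-1) * (v N x-w x)) by apply: L2sZ=> //; exact: L2sB.
have zz: ae_eq_on Om (fun x=> u x-v N x) (fun x=> (-1) * (v N x-w x)).
 by apply: (ae_imp z)=> x hx Ox; have:= hx Ox; move/eqP; rewrite subr_eq0=> /eqP ->; rewrite mulN1r opprB.
rewrite (ips_ae lh lh lh' lh' zz zz).
by rewrite le_eqVlt; apply/orP; left; apply/eqP/eq_Rintegral=> x _; rewrite !mulN1r mulrNN.
Qed.

End Density.

Section AverageConvergence.
Context {R: realType}.
Notation T3:= (space3 R).
Notation mu:= (@lebesgue3 R).
Implicit Types (x y z c: R3 R) (u k p q: R3 R -> R) (e: R).

Lemma cube_integral e: 0 < e -> \int[mu]_x (\1_(cube e) x: R) = (2 * e)^+3.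
move=> e0; rewrite /Rintegral integral_indic//; last exact: measurable_cube.
by rewrite setIT cube_measure.
Qed.

Lemma average_lipschitz p (L d e: R) c k: smooth p -> (forall x y, `|p x-p y| <= L * `|x-y|) ->
 0 <= L -> averaging c e k -> `|c| + e <= d -> test setT p ->
 forall x, `|average p k x-p x| <= L * d.
move=> sp hL L0 ak ced tp x; have [tk k0 k1 ks]:= ak.
have ik:= test_integrable tk; have ck: continuous k:= smooth_cont tk.1.
have mp: measurable3 p by exact: continuous_measurable3 (smooth_cont sp).
have mpx: measurable3 (fun z=> p (x+z)).
 under eq_fun do rewrite addrC; exact: measurableT_comp mp (measurable_shift3 x).
have [M M0 hM]:= test_bounded tp.
have i1: mu.-integrable setT (EFin \o (fun z=> p (x+z) * k z)).
 by apply: (@rintegrable_bmul _ _ _ _ _ _ _ _ M).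
have i2: mu.-integrable setT (EFin \o (fun z=> p x * k z)) by exact: rintegrableZ.
rewrite averageE// -[X in _ - X]mulr1 -k1 -RintegralZl// -RintegralB//.
have i3:= rintegrableB measurableT i1 i2.
apply: le_trans (le_normr_Rintegral _ i3) _=> //.
rewrite -[leRHS]mulr1 -k1 -RintegralZl//; apply: le_Rintegral=> //.
- exact: integrable_norm i3.
- exact: rintegrableZ.
- move=> z _; rewrite -mulrBl normrM (ger0_norm (k0 z)).
 have [->|/ks zc]:= eqVneq (k z) 0; first by rewrite !mulr0.
 rewrite ler_wpM2r//; apply: le_trans (hL _ _) _; rewrite ler_wpM2l//.
 rewrite addrAC subrr add0r; apply: le_trans ced.
 by rewrite -[z](subrK c) (le_trans (ler_normD _ _))// addrC lerD2l ltW.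
Qed.

Lemma average_outside u (M d e: R) c k x: averaging c e k -> (forall x, M < `|x| -> u x = 0) ->
 measurable3 u ->
 `|c| + e <= d -> M+d < `|x| -> average u k x = 0.
move=> [tk k0 k1 ks] h mu_ ced Mx; rewrite averageE//; last exact: smooth_cont tk.1.
rewrite (_: (fun z=> _) = (fun=> 0)) ?/Rintegral ?integral0//; apply/funext=> z.
have [->|/ks zc]:= eqVneq (k z) 0; first by rewrite mulr0.
rewrite h ?mul0r//.
have: `|z| < d.
 apply: lt_le_trans ced; rewrite -[z](subrK c) (le_lt_trans (ler_normD _ _))// addrC ltrD2l//.
have:= ler_normD (x+z) (- z); rewrite addrK normrN.
by move: Mx; move: `|x+z| `|z| `|x| => a1 a2 a3; lra.
Qed.

(** Averages over small balls (not necessarily centred at the origin) converge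
  in L2. *)
Lemma average_cvg u (M: R): sqint mu u -> (forall x, M < `|x| -> u x = 0) ->
 forall eps: R, 0 < eps -> exists2 d: R, 0 < d & forall c e k, averaging c e k ->
  `|c| + e <= d -> \int[mu]_x ((average u k x-u x)^+2) <= eps.
move=> su uM eps e0.
pose N:= `|M| + 1; have N0: 0 < N by rewrite ltr_wpDl.
have MN: M < N by rewrite (le_lt_trans (ler_norm M))// ltrDl.
pose O: set (R3 R):= [set x | `|x| < N].
have oO: open O.
 apply/open3P=> x xN; exists (N - `|x|); first by rewrite subr_gt0.
 move=> y yx; have:= ler_normD (y-x) x; rewrite subrK /O/= => h.
 by apply: le_lt_trans h _; rewrite -ltrBrDr.
have ON: O `<=` cube N by move=> x /ltW xN; exact/cubeE.
have mO:= open_measurable3 oO.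
have uO: u \_ O = u.
 apply/funext=> x; rewrite patchE; case: ifPn=> // /negP nx; rewrite uM//.
 by apply: lt_le_trans MN _; rewrite leNgt; apply/negP=> xN; apply: nx; exact: mem_set.
have lu: L2s O u by apply/L2sP; rewrite uO.
have e24: 0 < eps/24 by rewrite divr_gt0.
have [phi tp hphi]:= test_dense oO ON lu e24.
have tpT: test setT phi by exact: test_sub tp.
have sp:= test_sqint tp.
have iu: mu.-integrable setT (EFin \o u).
 apply: (@cube_integrable _ N)=> // x nx; apply: uM; apply: lt_le_trans MN _.
 by rewrite leNgt; apply/negP=> /ltW/cubeE.
have sup:= sqintB su sp.
have hsup: \int[mu]_x ((u x-phi x)^+2) <= eps/24.
 apply: le_trans hphi; rewrite ipsE le_eqVlt; apply/orP; left; apply/eqP/eq_Rintegral=> x _.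
 rewrite -expr2; congr (_ ^+ 2); rewrite patchE; case: ifPn=> // /negP nx.
 rewrite -uO patchE ifN; last exact/negP.
 by rewrite (test_outside tp) ?subr0// => Ox; apply: nx; exact: mem_set.
have isup:= rintegrableB measurableT iu (test_integrable tp).
have [L L0 hL]:= bounded_smooth_Lipschitz (test_bounded_smooth tp).
pose V:= (2 * (N+1))^+3.
have V0: 0 < V by rewrite exprn_gt0// mulr_gt0// ltr_pwDr// ltW.
pose d0:= eps/(24 * (L^+2+1) * V).
have L1: 0 < L^+2+1 by rewrite ltr_pwDr// sqr_ge0.
have d00: 0 < d0:= divr_gt0 e0 (mulr_gt0 (mulr_gt0 (ltr0n R 24) L1) V0).
pose d:= Num.min 1 d0.
have dp: 0 < d by rewrite lt_min ltr01.
exists d=> // c e k ak ced.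
have [tk k0 k1 ks]:= ak.
have d1: d <= 1 by rewrite ge_min lexx.
have hd: (L * d)^+2 * V <= eps/24.
 have dd0: d^+2 <= d0.
  rewrite expr2; apply: le_trans (_: 1 * d <= _); first by rewrite ler_wpM2r// ltW.
  by rewrite mul1r ge_min lexx orbT.
 rewrite exprMn; apply: le_trans (_: (L^+2+1) * d0 * V <= _).
  apply: ler_wpM2r; [exact: ltW|apply: ler_pM=> //; [exact: sqr_ge0..|by rewrite lerDl]].
 rewrite /d0 le_eqVlt; apply/orP; left; apply/eqP.
 exact: cancel_scale L1 V0.
have [sa ha]:= average_contraction sup isup ak.
have [sau _]:= average_contraction su iu ak.
have [sap _]:= average_contraction sp (test_integrable tp) ak.
have h2: \int[mu]_x ((average phi k x-phi x)^+2) <= eps/24.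
 apply: le_trans hd.
 have pl:= average_lipschitz tp.1 hL L0 ak ced tpT.
 have out x: N+1 < `|x| -> average phi k x = 0.
  move=> xN; apply: (@average_outside phi N d e c k)=> //.
  - by move=> y yN; apply: (test_outside tp); rewrite /O/=; apply/negP; rewrite -leNgt ltW.
  - exact: sp.1.
  - by apply: le_lt_trans xN; rewrite lerD2l.
 apply: le_trans (_: \int[mu]_x ((L * d)^+2 * \1_(cube (N+1)) x) <= _).
  apply: le_Rintegral=> //; first exact: (sqintB sap sp).2.
   by apply: rintegrableZ=> //; exact: cube_indic.
  move=> x _; rewrite indicE; case: (boolP (x \in _))=> [_|/negP nx].
   by rewrite mulr1 -real_normK ?num_real// ler_pXn2r ?nnegrE// ?mulr_ge0// ltW.
  have xN: N+1 < `|x| by rewrite ltNge; apply/negP=> /cubeE h; apply: nx; exact: mem_set.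
  rewrite out// (test_outside tp) ?subrr ?expr0n ?mulr0//.
  by rewrite /O/=; apply/negP; rewrite -leNgt ltW// (lt_trans _ xN)// ltrDl.
 rewrite RintegralZl//; last exact: cube_indic.
 have N10: 0 < N+1 by rewrite addr_gt0.
 by rewrite cube_integral.
apply: le_trans (sqint_dist sau sap su) _.
have h1: \int[mu]_x ((average u k x-average phi k x)^+2) <= eps/24.
 apply: le_trans hsup; apply: le_trans ha.
 by under eq_Rintegral=> x _ do rewrite -averageB//.
have h3:= sqint_dist sap sp su.
have h4: \int[mu]_x ((phi x-u x)^+2) <= eps/24.
 by under eq_Rintegral=> x _ do rewrite -sqrrN opprB.
by move: h1 h2 h3 h4; move: (\int[mu]_x _) (\int[mu]_x _) (\int[mu]_x _) (\int[mu]_x _)=> a b a' b'; lra.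
Qed.

End AverageConvergence.

(** * Integration by parts *)

Section VectorFields.
Context {R: realType}.
Notation T3:= (space3 R).
Notation mu:= (@lebesgue3 R).
Implicit Types (x y z c: R3 R) (p q phi psi: R3 R -> R) (u v eta: vfield R) (U Om: set (R3 R)).

Lemma integral_partial_test i phi: test setT phi -> \int[mu]_x partial i phi x = 0.
move=> tp; have bp:= test_bounded_smooth tp.
have [sp [K [cK _ h]]]:= tp.
have [N N0 KN]:= compact_cube cK.
have i1:= @cube_indic R (N+1).
have tdp:= test_partial i tp.
have E q x: test setT q -> (forall y, ~ K y -> q y = 0) -> `|x| < 1 ->
  average \1_(cube (N+1)) q x = \int[mu]_y q y.
 move=> tq hq x1; rewrite -(Rintegral_shift (- x)); last exact: continuous_measurable3 (smooth_cont tq.1).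
 apply: eq_Rintegral=> y _; have [Ky|nK]:= pselect (K (y-x)); last by rewrite hq// mulr0.
 rewrite indicE mem_set ?mul1r//; apply/cubeE; have /KN/cubeE yx:= Ky.
 by rewrite -[y](subrK x) (le_trans (ler_normD _ _))// lerD// ltW.
have oB: open [set x: R3 R | `|x| < 1].
 apply/open3P=> x x1; exists (1 - `|x|); first by rewrite subr_gt0.
 move=> y yx /=; have:= ler_normD (y-x) x; rewrite subrK=> hh.
 by apply: le_lt_trans hh _; rewrite -ltrBrDr.
have B0: [set x: R3 R | `|x| < 1] 0 by rewrite /= normr0.
have hdp y: ~ K y -> partial i phi y = 0.
 move=> nK; apply: (@partial_zero _ _ _ _ (~` K))=> //; exact: closed_openC (compact_closed3 cK).
have:= average_partial i 0 i1 bp.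
rewrite (E _ _ tdp hdp B0) (@partial_eq_on _ _ _ (fun=> \int[mu]_y phi y) i 0 oB _ B0); last first.
 by move=> y y1; exact: E.
have ->: partial i (fun=> \int[mu]_y phi y) 0 = 0 :> R by exact: derive_cst.
by move=> /esym/eqP; rewrite oppr_eq0=> /eqP.
Qed.

Lemma integration_by_parts i phi psi: test setT phi -> smooth psi ->
 \int[mu]_x (partial i phi x * psi x) = - \int[mu]_x (phi x * partial i psi x).
move=> tp sp; apply/eqP; rewrite -addr_eq0 -RintegralD//.
- rewrite -(integral_partial_test i (testM tp sp)); apply/eqP/eq_Rintegral=> x _.
 by rewrite partialM//; apply: smooth_der=> //; exact: tp.1.
- exact: test_integrable (testM (test_partial i tp) sp).
- exact: test_integrable (testM tp (smooth_partial i sp)).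
Qed.

Lemma vcomp_row3 i (a b c: R3 R -> R) :
 vcomp (fun x=> row3 (a x) (b x) (c x)) i = [:: a; b; c]`_i.
apply/funext=> x; rewrite /vcomp /row3 mxE.
by case: i=> -[|[|[|//]]].
Qed.

Lemma vtest_row3 Om (a b c: R3 R -> R): test Om a -> test Om b -> test Om c ->
 vtest Om (fun x=> row3 (a x) (b x) (c x)).
by move=> ta tb tc i; rewrite vcomp_row3; case: i=> -[|[|[|//]]]. Qed.

Lemma testB Om p q: test Om p -> test Om q -> test Om (fun x=> p x-q x).
move=> tp tq; have:= testD tp (testZ (-1) tq).
by under [X in test _ X -> _]funext=> x do rewrite mulN1r.
Qed.

Lemma vtest_ccurl Om eta: vtest Om eta -> vtest Om (ccurl eta).
by move=> te; apply: vtest_row3; apply: testB; exact: test_partial. Qed.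

Lemma vtest_cgrad Om phi: test Om phi -> vtest Om (cgrad phi).
by move=> te; apply: vtest_row3; exact: test_partial. Qed.

Lemma vtest_lin Om (a: R) eta zeta: vtest Om eta -> vtest Om zeta ->
 vtest Om (fun x=> a *: eta x+zeta x).
move=> te tz i; have:= testD (testZ a (te i)) (tz i).
by congr test; apply/funext=> x; rewrite /vcomp !mxE.
Qed.

Lemma vtest0 Om: vtest Om (fun=> 0).
by move=> i; have:= test0 Om; congr test; apply/funext=> x; rewrite /vcomp mxE. Qed.

Definition cdiv eta: R3 R -> R:= fun x=> \sum_i partial i (vcomp eta i) x.

Lemma cyclic_cancel (a b c d e f: R): d = a -> e = b -> f = c -> a-b+(c-d)+(e-f) = 0.
by move=> -> -> ->; ring. Qed.

Lemma row3_cancel (a b c d e f: R): a = b -> c = d -> e = f -> row3 (a-b) (c-d) (e-f) = 0.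
by move=> -> -> ->; rewrite !subrr; apply/rowP=> i; rewrite !mxE; case: i=> -[|[|[|//]]].
Qed.

Lemma cdiv_ccurl eta: (forall i, smooth (vcomp eta i)) -> cdiv (ccurl eta) =1 fun=> 0.
move=> se x; rewrite /cdiv sum3E /ccurl !vcomp_row3 /=.
have B i j k l m: partial m (fun y=> partial i (vcomp eta j) y-partial k (vcomp eta l) y) x =
 partial m (partial i (vcomp eta j)) x-partial m (partial k (vcomp eta l)) x.
 have sd a b: derivable (partial a (vcomp eta b)) x (e_ m) by exact: smooth_der (smooth_partial _ (se _)).
 by rewrite partialD ?partialN//; exact: derivableN.
by rewrite !B; apply: cyclic_cancel; exact: smooth_partialC.
Qed.

Lemma ccurl_cgrad phi: smooth phi -> ccurl (cgrad phi) =1 fun=> 0.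
move=> sp x; rewrite /ccurl /cgrad !vcomp_row3 /=.
by apply: row3_cancel; exact: smooth_partialC.
Qed.

Lemma ccurl_lin (a: R) eta zeta x: (forall i, smooth (vcomp eta i)) -> (forall i, smooth (vcomp zeta i)) ->
 ccurl (fun y=> a *: eta y+zeta y) x = a *: ccurl eta x+ccurl zeta x.
move=> se sz.
have P i j: partial i (vcomp (fun y=> a *: eta y+zeta y) j) x =
  a * partial i (vcomp eta j) x+partial i (vcomp zeta j) x.
 have ->: vcomp (fun y=> a *: eta y+zeta y) j = (fun y=> a * vcomp eta j y+vcomp zeta j y).
  by apply/funext=> y; rewrite /vcomp !mxE.
 rewrite partialD ?partialZ//; try exact: smooth_der.
 by apply: derivableM=> //; exact: smooth_der.
apply/rowP=> i; rewrite /ccurl !P !mxE.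
by case: i=> -[|[|[|//]]] Hi /=; ring.
Qed.

Lemma smooth_FTC p x (v: R3 R): smooth p ->
 p (x+v)-p x = \int[@lebesgue_measure R]_(s in `[0, 1]) (\sum_i coord i v * partial i p (x+s *: v)).
move=> /smoothP sp.
have cl (q: R3 R -> R): continuous q -> continuous (fun s: R=> q (x+s *: v)).
 move=> cq s; apply: (@continuous_comp _ _ _ (fun s: R=> x+s *: v) q); last exact: cq.
 by apply: cvgD; [exact: cvg_cst|apply: cvgZr_tmp; exact: cvg_id].
have cD: continuous (fun s: R=> \sum_i coord i v * partial i p (x+s *: v)).
 apply: (cl (fun y=> \sum_i coord i v * partial i p y))=> y.
 have h: smooth_on setT (fun y=> \sum_i coord i v * partial i p y).
  apply: smooth_on_sum; [exact: openT|move=> i].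
  by apply: smooth_onZ; [exact: openT|exact: smooth_on_partial].
 exact: smooth_on_cont h _ I.
have dF (s: R): is_derive s (1: R) (fun s: R=> p (x+s *: v)) (\sum_i coord i v * partial i p (x+s *: v)).
 by apply/is_derive_line; exact: (@smooth_on_dir _ setT p (x+s *: v) v openT sp I).
have:= @continuous_FTC2 R (fun s: R=> \sum_i coord i v * partial i p (x+s *: v)) (fun s: R=> p (x+s *: v)) 0 1 ltr01.
rewrite scale1r scale0r addr0=> h.
rewrite /Rintegral h//.
- exact: continuous_subspaceT.
- by split=> [s _| |]; [case: (dF s)|apply: cvg_at_right_filter; exact: cl (smooth_cont (iffRL (smoothP p) sp)) 0|
 apply: cvg_at_left_filter; exact: cl (smooth_cont (iffRL (smoothP p) sp)) 1].
- by move=> s _; rewrite derive1E; have [_ ->]:= dF s.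
Qed.

Lemma unit_interval_measure: @lebesgue_measure R `[0, 1]%classic = 1%E.
by rewrite lebesgue_measure_itv/= lte_fin ltr01 sube0. Qed.

Lemma unit_interval_jensen (f: R -> R): continuous f ->
 (\int[@lebesgue_measure R]_(s in `[0, 1]) f s)^+2 <= \int[@lebesgue_measure R]_(s in `[0, 1]) (f s^+2).
move=> cf; have mI: measurable (`[0, 1]%classic: set (measurableTypeR R)) by exact: measurable_itv.
have mf: measurable_fun setT f by exact: continuous_measurable_fun.
have cI: compact (`[0, 1]%classic: set R) by exact: segment_compact.
have ci g: continuous g -> (@lebesgue_measure R).-integrable `[0, 1] (EFin \o g).
 by move=> cg; apply: continuous_compact_integrable=> //; exact: continuous_subspaceT.
have cf2: continuous (fun s=> f s^+2).
 by move=> s; under eq_fun do rewrite expr2; apply: cvgM; exact: cf.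
have sf: sqint (@lebesgue_measure R) (f \_ `[0, 1]).
 split; first by apply/(measurable_restrictT _ mI); exact: measurable_funTS.
 have:= ci _ cf2; rewrite (integrable_mkcond _ mI) restrict_EFin; congr (_.-integrable _ _).
 by apply/funext=> s /=; rewrite !patchE; case: ifP; rewrite ?expr0n.
have s1: sqint (@lebesgue_measure R) ((fun=> 1: R) \_ `[0, 1]).
 split; first by apply/(measurable_restrictT _ mI).
 have:= ci _ (@cst_continuous _ _ (1: R)); rewrite (integrable_mkcond _ mI) restrict_EFin; congr (_.-integrable _ _).
 by apply/funext=> s /=; rewrite !patchE; case: ifP; rewrite ?expr0n ?expr1n.
have:= sqint_CS sf s1.
have ->: \int[@lebesgue_measure R]_x ((f \_ `[0, 1]) x * ((fun=> 1: R) \_ `[0, 1]) x) =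
  \int[@lebesgue_measure R]_(s in `[0, 1]) f s.
 by rewrite [RHS]Rintegral_mkcond; apply: eq_Rintegral=> s _; rewrite !patchE; case: ifP; rewrite ?mulr1 ?mulr0.
have ->: \int[@lebesgue_measure R]_x ((f \_ `[0, 1]) x^+2) = \int[@lebesgue_measure R]_(s in `[0, 1]) (f s^+2).
 by rewrite [RHS]Rintegral_mkcond; apply: eq_Rintegral=> s _; rewrite !patchE; case: ifP; rewrite ?expr0n.
have ->: \int[@lebesgue_measure R]_x (((fun=> 1: R) \_ `[0, 1]) x^+2) = 1.
 transitivity (\int[@lebesgue_measure R]_(s in `[0, 1]) (1: R)).
  by rewrite [RHS]Rintegral_mkcond; apply: eq_Rintegral=> s _; rewrite !patchE; case: ifP; rewrite ?expr0n ?expr1n.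
 rewrite Rintegral_cst// mul1r -[RHS]/(fine 1%E); congr fine; exact: unit_interval_measure.
by rewrite mulr1.
Qed.

Lemma unit_interval_jensenE (f: R -> R): continuous f ->
 (((\int[@lebesgue_measure R]_(s in `[0%R, 1%R]) f s)^+2)%:E <=
 \int[@lebesgue_measure R]_s (\1_(`[0%R, 1%R]%classic: set R) s * f s^+2)%:E)%E.
move=> cf; have ->: (\int[@lebesgue_measure R]_s (\1_(`[0%R, 1%R]%classic: set R) s * f s^+2)%:E =
  \int[@lebesgue_measure R]_(s in `[0%R, 1%R]) (f s^+2)%:E)%E.
 rewrite [RHS]integral_mkcond; apply: eq_integral=> s _; rewrite patchE indicE.
 by case: ifP; rewrite ?mul1r ?mul0r.
have:= unit_interval_jensen cf; rewrite -lee_fin; congr (_ <= _)%E.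
rewrite /Rintegral fineK//; apply: integrable_fin_num=> //.
apply: continuous_compact_integrable; first exact: segment_compact.
by apply: continuous_subspaceT=> s; under eq_fun do rewrite expr2; apply: cvgM; exact: cf.
Qed.

Definition dirder (v: R3 R) p x: R:= \sum_i coord i v * partial i p x.

Lemma smooth_dirder (v: R3 R) p: smooth p -> smooth (dirder v p).
move=> sp; apply/smoothP; apply: smooth_on_sum; [exact: openT|move=> i].
by apply: smooth_onZ; [exact: openT|apply/smoothP; exact: smooth_partial].
Qed.

Definition ray_average (v: R3 R) p x: R:= \int[@lebesgue_measure R]_(s in `[0, 1]) p (x+s *: v).

(** By Jensen and Tonelli, averaging along segments is bounded in L2. *)
Lemma ray_bound p (A A': set (R3 R)) (v: R3 R): continuous p ->
 measurable_fun (setT: set T3) (ray_average v p: T3 -> R) ->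
 measurable (A: set T3) -> measurable (A': set T3) ->
 (forall x (s: R), A x -> 0 <= s <= 1 -> A' (x+s *: v)) ->
 (\int[mu]_(x in A) (ray_average v p x^+2)%:E <= \int[mu]_(x in A') (p x^+2)%:E)%E.
move=> cd mp mA mA' AA'.
pose q: R3 R -> R:= fun x=> p x^+2.
have cq: continuous q by move=> y; rewrite /q; under eq_fun do rewrite expr2; apply: cvgM; exact: cd.
have mq: measurable3 q by exact: continuous_measurable3.
pose w: R3 R -> R:= fun x=> \1_A' x * q x.
have mw: measurable3 w by apply: measurable_funM=> //; exact: measurable_indic.
have w0 x: 0 <= w x by rewrite mulr_ge0// ?sqr_ge0// indicE ler0n.
have mI: measurable (`[0%R, 1%R]%classic: set (measurableTypeR R)) by exact: measurable_itv.
pose f (z: T3 * measurableTypeR R): \bar R:= (\1_(`[0%R, 1%R]%classic: set R) z.2 * w (z.1+z.2 *: v))%:E.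
have msh: measurable_fun (setT: set (T3 * measurableTypeR R)) (fun z: T3 * measurableTypeR R=> (z.1+z.2 *: v): T3).
 have E: (fun z: T3 * measurableTypeR R=> (z.1+z.2 *: v): T3) =
   (fun z: T3 * measurableTypeR R=> (z.1.1.1+z.2 * v.1.1, z.1.1.2+z.2 * v.1.2, z.1.2+z.2 * v.2)).
  by apply/funext=> -[[[a b] e] s]; case: (v)=> -[].
 rewrite E; have m2: measurable_fun (setT: set (T3 * measurableTypeR R)) (fun z: T3 * measurableTypeR R=> z.2) by exact: measurable_snd.
 have m1: measurable_fun (setT: set (T3 * measurableTypeR R)) (fun z: T3 * measurableTypeR R=> z.1) by exact: measurable_fst.
 have m12:= measurableT_comp (@measurable_snd _ _ _ _) m1.
 have m11:= measurableT_comp (@measurable_fst _ _ _ _) m1.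
 have m112:= measurableT_comp (@measurable_snd _ _ _ _) m11.
 have m111:= measurableT_comp (@measurable_fst _ _ _ _) m11.
 have A1 (g: T3 * measurableTypeR R -> measurableTypeR R) (t: R): measurable_fun setT g -> measurable_fun setT (fun z: T3 * measurableTypeR R=> g z+z.2 * t).
  by move=> mg; apply: measurable_funD=> //; apply: measurable_funM.
 by apply: measurable_fun_pair; [apply: measurable_fun_pair|]; apply: A1.
have mf: measurable_fun setT f.
 apply/measurable_EFinP; apply: measurable_funM; last exact: measurableT_comp mw msh.
 exact: measurableT_comp (measurable_indic mI) measurable_snd.
have f0 (z: T3 * measurableTypeR R): (0 <= f z)%E by rewrite lee_fin mulr_ge0// indicE ler0n.
have cline x: continuous (fun s: R=> p (x+s *: v)).
 move=> s; apply: (@continuous_comp _ _ _ (fun s: R=> x+s *: v) (p)); last exact: cd.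
 by apply: cvgD; [exact: cvg_cst|apply: cvgZr_tmp; exact: cvg_id].
have h1 x: A x -> ((ray_average v p x^+2)%:E <= \int[@lebesgue_measure R]_s f (x, s))%E.
 move=> Ax; rewrite /ray_average.
 have ->: (\int[@lebesgue_measure R]_s f (x, s) = \int[@lebesgue_measure R]_s
   (\1_(`[0%R, 1%R]%classic: set R) s * (p (x+s *: v))^+2)%:E)%E.
  apply: eq_integral=> s _; rewrite /f /w /= !indicE.
  case: (boolP (s \in `[0%R, 1%R]%classic))=> [/set_mem s01|]; last by rewrite !mul0r.
  by rewrite mem_set ?mul1r//; apply: AA'=> //; move: s01; rewrite /= in_itv.
 exact: unit_interval_jensenE (cline x).
have H1: (\int[mu]_(x in A) (ray_average v p x^+2)%:E <= \int[mu]_x \int[@lebesgue_measure R]_s f (x, s))%E.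
 rewrite integral_mkcond; apply: ge0_le_integral=> //.
 - by move=> x _; rewrite patchE; case: ifP=> //; rewrite lee_fin sqr_ge0.
 - apply/(measurable_restrictT _ mA); apply: measurable_funTS; apply/measurable_EFinP; apply: measurable_funX.
  exact: mp.
 - exact: (@measurable_fun_fubini_tonelli_F _ _ _ _ _ (@lebesgue_measure R) f mf f0).
 - move=> x _; rewrite patchE; case: ifPn=> [/set_mem|_]; first exact: h1.
  by rewrite integral_ge0.
move: H1; rewrite -(@tonelli_swap R _ _ (@lebesgue_measure R) f mf f0).
have h2 (s: R): (\int[mu]_x f (x, s) = (\1_(`[0%R, 1%R]%classic: set R) s)%:E * \int[mu]_x (w x)%:E)%E.
 rewrite -(@integralE_shift R (s *: v) (fun x=> (w x)%:E)); last exact/measurable_EFinP.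
 apply: (@ge0_integralZ _ _ _ mu (\1_(`[0%R, 1%R]%classic: set R) s) (fun x=> w (x+s *: v)))=> //.
  exact: measurableT_comp mw (measurable_shift3 _).
have ->: (\int[@lebesgue_measure R]_y \int[leb3 R]_x f (x, y) = \int[@lebesgue_measure R]_s
  ((\1_(`[0%R, 1%R]%classic: set R) s)%:E * \int[mu]_x (w x)%:E))%E.
 by apply: eq_integral=> s _; exact: h2.
have E: (\int[mu]_x (w x)%:E = \int[mu]_(x in A') (p x^+2)%:E)%E.
 rewrite [RHS]integral_mkcond; apply: eq_integral=> x _; rewrite patchE /w indicE.
 by case: ifP; rewrite ?mul1r ?mul0r.
rewrite ge0_integralZr//; first last.
- by apply: integral_ge0=> x _; rewrite lee_fin.
- by apply/measurable_EFinP; exact: measurable_indic.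
by rewrite integral_indic//= setIT unit_interval_measure mul1e E.
Qed.

(** Increments are controlled in L2 by the derivative along the way. *)
Lemma increment_bound p (A A': set (R3 R)) (v: R3 R): smooth p ->
 measurable (A: set T3) -> measurable (A': set T3) ->
 (forall x (s: R), A x -> 0 <= s <= 1 -> A' (x+s *: v)) ->
 (\int[mu]_(x in A) ((p (x+v)-p x)^+2)%:E <= \int[mu]_(x in A') (dirder v p x^+2)%:E)%E.
move=> sp mA mA' AA'.
have E x: p (x+v)-p x = ray_average v (dirder v p) x:= smooth_FTC x v sp.
have cp:= smooth_cont sp.
have mr: measurable_fun (setT: set T3) (ray_average v (dirder v p): T3 -> R).
 rewrite (_: (ray_average v (dirder v p): T3 -> R) = fun x=> p (x+v)-p x); last by apply/funext=> x.
 apply: measurable_funB; last exact: continuous_measurable3.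
 exact: measurableT_comp (continuous_measurable3 cp) (measurable_shift3 v).
under eq_integral do rewrite E.
exact: ray_bound (smooth_cont (smooth_dirder v sp)) mr mA mA' AA'.
Qed.

End VectorFields.

(** * Weak derivatives and the Helmholtz decomposition *)

Section WeakDerivatives.
Context {R: realType}.
Notation T3:= (space3 R).
Notation mu:= (@lebesgue3 R).
Variables (Om: set (R3 R)) (M: R).
Hypothesis oO: open Om.
Hypothesis OM: Om `<=` cube M.
Let mO: measurable (Om: set T3):= open_measurable3 oO.
Implicit Types (x y z: R3 R) (p q phi psi: R3 R -> R) (u v w c eta: vfield R).

Lemma vL2P u: L2 Om u <-> forall i, L2s Om (vcomp u i).
by split=> [lu i|h i j]; [exact: lu|rewrite (ord1 i); exact: h]. Qed.

Lemma vtest_L2 eta: vtest Om eta -> L2 Om eta.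
by move=> te; apply/vL2P=> i; exact: test_L2s (te i). Qed.

Lemma vipE u v: L2 Om u -> L2 Om v -> ip Om u v = \sum_i ips Om (vcomp u i) (vcomp v i).
by move=> lu lv; rewrite ipE// big_ord1. Qed.

Lemma ae_vcomp u v: (forall i, ae_eq_on Om (vcomp u i) (vcomp v i)) -> ae_eq_on Om u v.
move=> h; apply: (ae_imp (ae_finite h))=> x hx Ox; apply/rowP=> i; exact: hx.
Qed.

Lemma ips_diff p q r: L2s Om p -> L2s Om q -> L2s Om r ->
 ips Om (fun x=> p x-q x) r = ips Om p r-ips Om q r.
move=> lp lq lr; have:= ips_linl mO (-1) lq lp lr; rewrite mulN1r addrC=> <-.
by apply: eq_ips=> // x _; rewrite mulN1r addrC.
Qed.

Lemma weak_unique p q: L2s Om p -> L2s Om q ->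
 (forall phi, test Om phi -> ips Om p phi = ips Om q phi) -> ae_eq_on Om p q.
move=> lp lq h; have z: ae_eq_on Om (fun x=> p x-q x) (fun=> 0).
 apply: (fundamental_lemma oO OM)=> [|phi tp]; first exact: L2sB.
 by rewrite ips_diff ?h ?subrr//; exact: test_L2s.
by apply: (ae_imp z)=> x hx Ox; apply/eqP; rewrite -subr_eq0 hx.
Qed.

Definition single (i: 'I_3) p: vfield R:= fun x=> p x *: delta_mx 0 i.

Lemma vcomp_single i p j: vcomp (single i p) j = (fun x=> (i == j)%:R * p x).
by apply/funext=> x; rewrite /vcomp /single !mxE eqxx/= mulrC eq_sym. Qed.

Lemma vtest_single U i p: test U p -> vtest U (single i p).
by move=> tp j; rewrite vcomp_single; exact: testZ. Qed.

Lemma ip_single u i p: L2 Om u -> test Om p -> ip Om u (single i p) = ips Om (vcomp u i) p.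
move=> lu tp; rewrite vipE//; last by apply: vtest_L2; exact: vtest_single.
rewrite (bigD1 i)//= vcomp_single eqxx big1 ?addr0; first by apply: eq_ips=> // x _; rewrite mul1r.
move=> j ji; rewrite vcomp_single eq_sym (negPf ji).
by rewrite /ips /Rintegral (_: (fun x=> _) = (fun=> 0%E)) ?integral0//; apply/funext=> x; rewrite mul0r mulr0.
Qed.

Lemma vweak_unique u v: L2 Om u -> L2 Om v ->
 (forall eta, vtest Om eta -> ip Om u eta = ip Om v eta) -> ae_eq_on Om u v.
move=> lu lv h; apply: ae_vcomp=> i; apply: weak_unique; [exact: (iffLR (vL2P u))|exact: (iffLR (vL2P v))|].
by move=> phi tp; rewrite -!ip_single// h//; exact: vtest_single.
Qed.

Definition L2cvg (U: nat -> vfield R) u:= forall eps: R, 0 < eps -> exists N, forall n, (N <= n)%N ->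
 ip Om (fun x=> U n x-u x) (fun x=> U n x-u x) <= eps.

Lemma ip_cvg U u v: (forall n, L2 Om (U n)) -> L2 Om u -> L2 Om v -> L2cvg U u ->
 ip Om (U n) v @[n --> \oo] --> ip Om u v.
move=> lU lu lv cU; apply: (cvg_of_sqr (ip_ge0 Om v))=> eps e0.
have [N hN]:= cU _ e0; exists N=> n Nn; have lUu:= L2B mO (lU n) lu.
rewrite -(ipBl mO (lU n) lu lv); apply: le_trans (ip_CS mO lUu lv) _.
by rewrite ler_wpM2r ?ip_ge0// hN.
Qed.

(* limits *)
Lemma weak_grad_xget p: H1 Om p -> L2 Om (grad Om p) /\ weak_grad Om p (grad Om p).
by move=> [_ [g hg]]; have:= @xgetPex _ (fun=> 0) [set g | L2 Om g /\ weak_grad Om p g] (ex_intro _ g hg).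
Qed.

Lemma gradP p g: L2s Om p -> L2 Om g -> weak_grad Om p g -> ae_eq_on Om (grad Om p) g.
move=> lp lg wg; have [l w]: L2 Om (grad Om p) /\ weak_grad Om p (grad Om p).
 by apply: weak_grad_xget; split=> //; exists g.
by apply: ae_vcomp=> i; apply: weak_unique; [exact: (iffLR (vL2P _))..|move=> phi tp; rewrite w// wg].
Qed.

Lemma curl_xget u: Hcurl Om u -> L2 Om (curl Om u) /\ weak_curl Om u (curl Om u).
by move=> [_ [g hg]]; have:= @xgetPex _ (fun=> 0) [set g | L2 Om g /\ weak_curl Om u g] (ex_intro _ g hg).
Qed.

Lemma curlP u c: L2 Om u -> L2 Om c -> weak_curl Om u c -> ae_eq_on Om (curl Om u) c.
move=> lu lc wc; have [l w]: L2 Om (curl Om u) /\ weak_curl Om u (curl Om u).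
 by apply: curl_xget; split=> //; exists c.
by apply: vweak_unique=> // eta te; rewrite w// wc.
Qed.

Lemma ips_test_full p phi: test Om phi -> ips Om p phi = \int[mu]_x (p x * phi x).
move=> tp; rewrite /ips Rintegral_mkcond; apply: eq_Rintegral=> x _; rewrite patchE.
by case: ifPn=> // /negP nx; rewrite (test_outside tp) ?mulr0// => Ox; apply: nx; exact: mem_set.
Qed.

Lemma ips_partial p phi i: smooth p -> test Om phi -> ips Om (partial i p) phi = - ips Om p (partial i phi).
move=> sp tp; rewrite !ips_test_full//; last exact: test_partial.
have:= integration_by_parts i (test_sub (@subsetT _ _) tp) sp.
by under eq_Rintegral do rewrite mulrC; move=> ->; rewrite opprK; apply: eq_Rintegral=> x _; rewrite mulrC.
Qed.

Lemma vcomp_cgrad p i: vcomp (cgrad p) i = partial i p.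
rewrite /cgrad vcomp_row3; case: i=> -[|[|[|//]]] Hi /=; congr (partial _ p); exact/val_inj.
Qed.

Lemma weak_grad_test phi: test Om phi -> weak_grad Om phi (cgrad phi).
by move=> tp i psi tps; rewrite vcomp_cgrad ips_partial//; exact: tp.1. Qed.

Lemma ae_refl T (u: R3 R -> T): ae_eq_on Om u u.
exact: ae_all. Qed.

Lemma ae_trans T (u v w: R3 R -> T): ae_eq_on Om u v -> ae_eq_on Om v w -> ae_eq_on Om u w.
by move=> h h'; apply: (ae_imp2 h h')=> x hx hx' Ox; rewrite hx// hx'. Qed.

Lemma vcomp_ccurl eta: [/\ vcomp (ccurl eta) 0 = (fun x=> partial 1 (vcomp eta 2) x-partial 2 (vcomp eta 1) x),
 vcomp (ccurl eta) 1 = (fun x=> partial 2 (vcomp eta 0) x-partial 0 (vcomp eta 2) x) &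
 vcomp (ccurl eta) 2 = (fun x=> partial 0 (vcomp eta 1) x-partial 1 (vcomp eta 0) x)].
by rewrite /ccurl !vcomp_row3. Qed.

Lemma ip_ccurl u eta: L2 Om u -> vtest Om eta -> ip Om u (ccurl eta) =
 (ips Om (vcomp u 0) (partial 1 (vcomp eta 2))-ips Om (vcomp u 0) (partial 2 (vcomp eta 1))) +
 (ips Om (vcomp u 1) (partial 2 (vcomp eta 0))-ips Om (vcomp u 1) (partial 0 (vcomp eta 2))) +
 (ips Om (vcomp u 2) (partial 0 (vcomp eta 1))-ips Om (vcomp u 2) (partial 1 (vcomp eta 0))).
move=> lu te; have lc:= vtest_L2 (vtest_ccurl te); rewrite vipE// sum3E.
have [-> -> ->]:= vcomp_ccurl eta.
have lp i j: L2s Om (partial i (vcomp eta j)) by exact: test_L2s (test_partial _ (te _)).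
have ul:= iffLR (vL2P u) lu.
by rewrite !(ipsC Om (vcomp u _)) !ips_diff// !(ipsC Om _ (vcomp u _)).
Qed.

Lemma vL2_row3 (a b d: R3 R -> R): L2s Om a -> L2s Om b -> L2s Om d ->
 L2 Om (fun x=> row3 (a x) (b x) (d x)).
by move=> la lb ld; apply/vL2P=> i; rewrite vcomp_row3; case: i=> -[|[|[|//]]]. Qed.

Lemma ip_row3 (a b d: R3 R -> R) v: L2s Om a -> L2s Om b -> L2s Om d -> L2 Om v ->
 ip Om (fun x=> row3 (a x) (b x) (d x)) v =
 ips Om a (vcomp v 0)+ips Om b (vcomp v 1)+ips Om d (vcomp v 2).
by move=> la lb ld lv; rewrite vipE ?sum3E ?vcomp_row3//; exact: vL2_row3. Qed.

(** A field with components in H1 has a curl, formed of the weak gradients. *)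
Lemma H1_weak_curl v (g: 'I_3 -> vfield R): (forall j, L2s Om (vcomp v j)) -> (forall j, L2 Om (g j)) ->
 (forall j, weak_grad Om (vcomp v j) (g j)) ->
 let c:= fun x=> row3 (vcomp (g 2) 1 x-vcomp (g 1) 2 x) (vcomp (g 0) 2 x-vcomp (g 2) 0 x)
  (vcomp (g 1) 0 x-vcomp (g 0) 1 x) in L2 Om c /\ weak_curl Om v c.
move=> lv lg wg c; have lgc j i: L2s Om (vcomp (g j) i) by exact: (iffLR (vL2P (g j))).
have lB i j k l: L2s Om (fun x=> vcomp (g j) i x-vcomp (g k) l x) by exact: L2sB.
split; first exact: vL2_row3.
move=> eta te; rewrite /c ip_row3//; last exact: vtest_L2.
have le i:= test_L2s (te i).
rewrite ip_ccurl//; last exact/vL2P.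
rewrite !ips_diff// !wg//.
by move: (ips Om (vcomp v 0)) (ips Om (vcomp v 1)) (ips Om (vcomp v 2))=> f0 f1 f2;
move: (f0 _) (f0 _) (f1 _) (f1 _) (f2 _) (f2 _)=> *; ring.
Qed.

Lemma weak_curl_vtest eta: vtest Om eta -> weak_curl Om eta (ccurl eta).
move=> te; have []:= @H1_weak_curl eta (fun j=> cgrad (vcomp eta j)).
- by move=> j; exact: test_L2s (te j).
- by move=> j; exact: vtest_L2 (vtest_cgrad (te j)).
- by move=> j; exact: weak_grad_test (te j).
- by rewrite !vcomp_cgrad.
Qed.

Lemma Hcurl_vtest eta: vtest Om eta -> Hcurl Om eta.
move=> te; split; first exact: vtest_L2.
by exists (ccurl eta); split; [exact: vtest_L2 (vtest_ccurl te)|exact: weak_curl_vtest].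
Qed.

Lemma curl_vtest eta: vtest Om eta -> ae_eq_on Om (curl Om eta) (ccurl eta).
by move=> te; apply: curlP; [exact: vtest_L2|exact: vtest_L2 (vtest_ccurl te)|exact: weak_curl_vtest].
Qed.

Lemma H1_Hcurl v: (forall i, H1 Om (vcomp v i)) -> Hcurl Om v.
move=> hv; split; first by apply/vL2P=> i; case: (hv i).
have []:= @H1_weak_curl v (fun j=> grad Om (vcomp v j)).
- by move=> j; case: (hv j).
- by move=> j; have []:= weak_grad_xget (hv j).
- by move=> j; have []:= weak_grad_xget (hv j).
- by move=> l w; eexists; split; [exact: l|exact: w].
Qed.

Lemma ip_aer u v w: L2 Om u -> L2 Om v -> L2 Om w -> ae_eq_on Om v w -> ip Om u v = ip Om u w.
by move=> lu lv lw h; apply: ip_ae=> //; exact: ae_refl. Qed.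

Lemma ip_ael u v w: L2 Om u -> L2 Om v -> L2 Om w -> ae_eq_on Om v w -> ip Om v u = ip Om w u.
by move=> lu lv lw h; rewrite ![ip _ _ u]ipC; exact: ip_aer. Qed.

Lemma H0curl_vtest eta: vtest Om eta -> H0curl Om eta.
move=> te; split; first exact: Hcurl_vtest.
move=> v hv; have hcv:= H1_Hcurl hv; have [lc wc]:= curl_xget hcv.
have [lce _]:= curl_xget (Hcurl_vtest te).
have lte:= vtest_L2 (vtest_ccurl te).
rewrite /tangential_trace (ip_ael hcv.1 lce lte (curl_vtest te)) ipC -wc// ipC subrr//.
Qed.

(** Closedness of H0(curl) under convergence of the fields and of their curls. *)
Lemma H0curl_closed (U C: nat -> vfield R) u c :
 (forall n, H0curl Om (U n)) -> L2 Om u -> L2 Om c -> L2cvg U u -> L2cvg (fun n=> curl Om (U n)) c ->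
 H0curl Om u /\ ae_eq_on Om (curl Om u) c.
move=> hU lu lc cu cc.
have lU n: L2 Om (U n):= (hU n).1.1.
have lcU n: L2 Om (curl Om (U n)) by have []:= curl_xget (hU n).1.
have wc: weak_curl Om u c.
 move=> eta te; have le:= vtest_L2 te; have lce:= vtest_L2 (vtest_ccurl te).
 have c1:= ip_cvg lcU lc le cc; have c2:= ip_cvg lU lu lce cu.
 apply: (cvg_unique _ c1); first exact: norm_hausdorff.
 apply: cvg_trans c2; apply: near_eq_cvg; apply: nearW=> n.
 by have [_ ->]:= curl_xget (hU n).1.
have hu: Hcurl Om u by split=> //; exists c.
have ec:= curlP lu lc wc; split=> //; split=> // v hv.
have hcv:= H1_Hcurl hv; have [lcv _]:= curl_xget hcv; have lv:= hcv.1.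
have [lcu _]:= curl_xget hu.
rewrite /tangential_trace (ip_ael lv lcu lc ec).
have c1:= ip_cvg lcU lc lv cc; have c2:= ip_cvg lU lu lcv cu.
have c3: (0: R) @[_ --> \oo] --> ip Om c v-ip Om u (curl Om v).
 apply: cvg_trans (cvgB c1 c2); apply: near_eq_cvg; apply: nearW=> n.
 by have [_ /(_ v hv)]:= hU n.
exact: (cvg_unique (@norm_hausdorff _ _) c3 (cvg_cst _)).
Qed.

(** The Poincare inequality on test functions: the translate of phi in the first
  direction by more than the diameter vanishes on the support of phi. *)
Lemma poincare_test phi: test Om phi ->
 ips Om phi phi <= (2 * `|M| + 1)^+2 * ip Om (cgrad phi) (cgrad phi).
move=> tp; pose L:= 2 * `|M| + 1; pose v: R3 R:= L *: e_ 0.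
have L0: 0 < L by rewrite ltr_wpDl// mulr_ge0.
have mT: measurable (setT: set T3) by [].
have:= @increment_bound R phi Om setT v tp.1 mO mT (fun _ _ _ _=> I).
have E1: (\int[mu]_(x in Om) ((phi (x+v)-phi x)^+2)%:E = (ips Om phi phi)%:E)%E.
 rewrite /ips /Rintegral fineK; last by apply: integrable_fin_num=> //; exact: ips_integrable (test_L2s tp) (test_L2s tp).
 apply: eq_integral=> x /set_mem Ox; rewrite (test_outside tp (x:= x+v)) ?sub0r ?sqrrN//.
 move=> /OM/cubeE h; have /OM/cubeE h':= Ox.
 have:= coord_le 0 (x+v); have:= coord_le 0 x; rewrite coordD coordZ coord_e eqxx mulr1.
 move=> h1 h2; have:= le_trans h1 h'; have:= le_trans h2 h.
 rewrite !ler_norml /L=> /andP[_ a1] /andP[a2 _].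
 have:= ler_norm M; move: a1 a2; move: (coord 0 x) `|M| => a b; lra.
have lcg:= vtest_L2 (vtest_cgrad tp).
have E2: (\int[mu]_(x in setT) (dirder v phi x^+2)%:E = (L^+2 * ips Om (partial 0 phi) (partial 0 phi))%:E)%E.
 have E x: dirder v phi x = L * partial 0 phi x.
  rewrite /dirder sum3E /v !coordZ !coord_e eqxx /=.
  by rewrite mulr1 !mulr0 !mul0r !addr0.
 have td:= test_partial 0 tp.
 rewrite ips_test_full// -RintegralZl//; last first.
  by apply: test_integrable (_: test Om (fun x=> partial 0 phi x * partial 0 phi x)); apply: testM td td.1.
 rewrite /Rintegral fineK; first by apply: eq_integral=> x _; rewrite E exprMn expr2.
 apply: integrable_fin_num=> //; apply: test_integrable (_: test Om _).
 by apply: testZ; apply: testM td td.1.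
rewrite E1 E2 lee_fin=> h; apply: le_trans h _; rewrite ler_wpM2l ?sqr_ge0//.
rewrite (vipE lcg lcg) sum3E !vcomp_cgrad -addrA lerDl addr_ge0// ips_ge0//.
Qed.

Lemma cgrad_lin (a: R) phi psi x: smooth phi -> smooth psi ->
 cgrad (fun y=> a * phi y+psi y) x = a *: cgrad phi x+cgrad psi x.
move=> sp sq; have E i q: cgrad q x 0 i = partial i q x by rewrite -vcomp_cgrad.
have F (A B: 'rV[R]_3) i: (a *: A+B) 0 i = a * A 0 i+B 0 i by rewrite !mxE.
apply/rowP=> i; rewrite F !E partialD ?partialZ//; try exact: smooth_der.
by apply: derivableM=> //; exact: smooth_der.
Qed.

Lemma L2cvg_cauchy (U: nat -> vfield R): (forall n, L2 Om (U n)) ->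
 (exists2 C: R, 0 <= C & forall n m, ip Om (fun x=> U n x-U m x) (fun x=> U n x-U m x) <=
  C * (n.+1%:R^-1+m.+1%:R^-1)) -> exists2 u, L2 Om u & L2cvg U u.
move=> lU [C C0 hC]; have [|u [lu cu]]:= L2_complete mO lU; last by exists u.
move=> eps e0; have d0: 0 < eps/(2 * (C+1)) by rewrite divr_gt0// mulr_gt0// ltr_pwDr.
have [N hN]:= inv_small d0; exists N=> n m Nn Nm; apply: le_trans (hC n m) _.
have:= hN _ Nn; have:= hN _ Nm; move: (n.+1%:R^-1) (m.+1%:R^-1)=> a b ha hb.
apply: le_trans (_: C * (eps/(2 * (C+1))+eps/(2 * (C+1))) <= _).
 by rewrite ler_wpM2l// lerD.
have C1: 0 < C+1 by rewrite ltr_pwDr.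
have ->: C * (eps/(2 * (C+1))+eps/(2 * (C+1))) = eps * (C/(C+1)) by field; rewrite gt_eqF.
by rewrite ler_piMr ?(ltW e0)// ler_pdivrMr// mul1r lerDl.
Qed.

Lemma cgradB phi psi x: smooth phi -> smooth psi ->
 cgrad (fun y=> phi y-psi y) x = cgrad phi x-cgrad psi x.
move=> sp sq; have:= @cgrad_lin (-1) psi phi x sq sp; rewrite scaleN1r addrC=> <-.
by congr (cgrad _ x); apply/funext=> y; rewrite mulN1r addrC.
Qed.

Lemma ip_eq u u' v v': (forall x, u x = u' x) -> (forall x, v x = v' x) -> ip Om u v = ip Om u' v'.
by move=> /funext -> /funext ->. Qed.

(** Every square-integrable field is the sum of the gradient of a function in
  H10 and of a divergence-free field. *)
Lemma helmholtz a: L2 Om a -> exists q b,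
 [/\ H10 Om q, L2 Om b, weak_div Om b (fun=> 0) & ae_eq_on Om a (fun x=> grad Om q x+b x)].
move=> la; have lg phi: test Om phi -> L2 Om (cgrad phi) by move=> tp; exact: vtest_L2 (vtest_cgrad tp).
have lin (al: R) p q w: test Om p -> test Om q -> L2 Om w ->
  ip Om (cgrad (al *: p+q)) w = al * ip Om (cgrad p) w+ip Om (cgrad q) w.
 move=> tp tq lw; rewrite -(ip_linl mO al (lg _ tp) (lg _ tq) lw).
 by apply: ip_eq=> // x; exact: cgrad_lin tp.1 tq.1.
have lin' (al: R) p q: test Om p -> test Om q ->
  ip Om a (cgrad (al *: p+q)) = al * ip Om a (cgrad p)+ip Om a (cgrad q).
 by move=> tp tq; rewrite !(ipC Om a); exact: lin.
have [v [tv cv bv]]:= @variational_minimum R (R3 R -> R) (test Om) (fun p q=> ip Om (cgrad p) (cgrad q))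
 (fun p=> ip Om a (cgrad p)) (ip Om a a) (ip_ge0 Om a) (test0 Om)
 (fun a p q tp tq=> testD (testZ a tp) tq) (fun p q _ _=> ipC Om (cgrad p) (cgrad q))
 (fun al p q (w: R3 R -> R) tp tq tw=> lin al p q _ tp tq (lg _ tw))
 (fun p _=> ip_ge0 Om (cgrad p))
 lin'
 (fun p tp=> ip_CS mO la (lg _ tp)).
have lv n:= lg _ (tv n).
have tvv n m: test Om (fun x=> v n x-v m x) by exact: testB.
have cv' n m: ip Om (fun x=> cgrad (v n) x-cgrad (v m) x) (fun x=> cgrad (v n) x-cgrad (v m) x)
  <= 2 * (n.+1%:R^-1+m.+1%:R^-1).
 apply: le_trans (cv n m); rewrite le_eqVlt; apply/orP; left; apply/eqP.
 by apply: ip_eq=> x; rewrite -cgradB//; [exact: (tv n).1|exact: (tv m).1|exact: (tv n).1|exact: (tv m).1].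
have [g lgg cg]:= L2cvg_cauchy lv (ex_intro2 _ _ 2 (ler0n R 2) cv').
have [eps e0|q [lq cq]]:= L2s_complete oO (fun n=> test_L2s (tv n)).
 set K:= (2 * `|M| + 1)^+2; have K0: 0 < K by rewrite exprn_gt0// ltr_wpDl// mulr_ge0.
 have e1: 0 < eps/(4 * K) by rewrite divr_gt0// mulr_gt0.
 have [N hN]:= inv_small e1; exists N=> n m Nn Nm.
 apply: le_trans (poincare_test (tvv n m)) _; rewrite -/K.
 apply: le_trans (_: K * (2 * (n.+1%:R^-1+m.+1%:R^-1)) <= _).
  rewrite ler_wpM2l ?(ltW K0)//; apply: le_trans (cv' n m).
  rewrite le_eqVlt; apply/orP; left; apply/eqP; apply: ip_eq=> x;
  by rewrite cgradB//; [exact: (tv n).1|exact: (tv m).1].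
 have:= hN _ Nn; have:= hN _ Nm; rewrite !ler_pdivlMr ?mulr_gt0//.
 by move: (n.+1%:R^-1) (m.+1%:R^-1)=> x y; lra.
have wg: weak_grad Om q g.
 move=> i phi tp; have tip:= test_partial i tp.
 have c1:= ip_cvg lv lgg (vtest_L2 (vtest_single i tp)) cg.
 have c2:= ips_cvg oO (fun n=> test_L2s (tv n)) lq (test_L2s tip) cq.
 rewrite -ip_single//; apply: (cvg_unique (@norm_hausdorff _ _) c1).
 apply: cvg_trans (cvgN c2); apply: near_eq_cvg; apply: nearW=> n.
 by rewrite /= ip_single// vcomp_cgrad ips_partial//; exact: (tv n).1.
have hq: H1 Om q by split=> //; exists g.
have [lgq _]:= weak_grad_xget hq.
have eg:= gradP lq lgg wg.
exists q, (fun x=> a x-g x); split.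
- split=> // eps e0; have e2: 0 < eps/3 by rewrite divr_gt0.
 have [N1 h1]:= cg _ e2; have [N2 h2]:= cq _ e2.
 pose n:= maxn N1 N2; exists (v n)=> //.
 have:= h1 n (leq_maxl _ _); have:= h2 n (leq_maxr _ _).
 have E1: ips Om (q \- v n) (q \- v n) = ips Om (fun x=> v n x-q x) (fun x=> v n x-q x).
  by apply: eq_Rintegral=> x _ /=; rewrite -mulrNN !opprB.
 have lb: L2 Om (fun x=> grad Om q x-cgrad (v n) x) by exact: L2B.
 have lb': L2 Om (fun x=> (-1) *: (cgrad (v n) x-g x)) by apply: L2Z=> //; exact: L2B.
 have ee: ae_eq_on Om (fun x=> grad Om q x-cgrad (v n) x) (fun x=> (-1) *: (cgrad (v n) x-g x)).
  by apply: (ae_imp eg)=> x hx Ox; rewrite hx// scaleN1r opprB.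
 have E2: ip Om (fun x=> grad Om q x-cgrad (v n) x) (fun x=> grad Om q x-cgrad (v n) x) =
   ip Om (fun x=> cgrad (v n) x-g x) (fun x=> cgrad (v n) x-g x).
  have lc: L2 Om (fun x=> cgrad (v n) x-g x) by exact: L2B.
  by rewrite (ip_ae mO lb lb lb' lb' ee ee) ipZl// ipZr// mulN1r mulN1r opprK.
 by rewrite E1 E2; move: e0; lra.
- exact: L2B.
- move=> phi tp; rewrite /ips; under eq_Rintegral do rewrite mul0r.
 rewrite /Rintegral integral0 /=.
 have c1:= ip_cvg lv lgg (lg _ tp) cg.
 have c2: ip Om (cgrad (v n)) (cgrad phi) @[n --> \oo] --> ip Om a (cgrad phi).
  apply: (cvg_of_sqr (ip_ge0 Om (cgrad phi)))=> eps e0; have [N hN]:= inv_small e0.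
  by exists N=> n Nn; apply: le_trans (bv n _ tp) _; rewrite ler_wpM2r ?ip_ge0// hN.
 have E: ip Om g (cgrad phi) = ip Om a (cgrad phi) by exact: (cvg_unique (@norm_hausdorff _ _) c1 c2).
 by rewrite (ipBl mO la lgg (lg _ tp)) E subrr oppr0.
- by apply: (ae_imp eg)=> x hx Ox; rewrite hx// addrC subrK.
Qed.

End WeakDerivatives.

(** * Localization and boundary charts *)

Section Localization.
Context {R: realType}.
Implicit Types (x y z: R3 R) (theta psi: R3 R -> R).

Definition oball x (r: R): set (R3 R):= [set y | `|y-x| < r].

Lemma oball_open x r: open (oball x r).
apply/open3P=> y yx; exists (r - `|y-x|); first by rewrite subr_gt0.
move=> z zy; rewrite /oball/= (le_lt_trans (ler_distD y _ _))//.
by move: zy; rewrite ltrBrDr.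
Qed.

Lemma oball_self x (r: R): 0 < r -> oball x r x.
by rewrite /oball/= subrr normr0. Qed.

Lemma plateau_ball x (r: R): 0 < r -> exists psi: R3 R -> R,
 [/\ test (oball x r) psi, forall y, 0 <= psi y <= 1 & forall y, `|y-x| < r/2 -> psi y = 1].
move=> r0; have r6: 0 < r/6 by rewrite divr_gt0.
have sub: oball x r `<=` cube (`|x| + r).
 move=> y yx; apply/cubeE; rewrite -[y](subrK x) addrC (le_trans (ler_normD _ _))// lerD2l.
 exact: ltW.
have [psi [tp b h]]:= plateau r6 sub; exists psi; split=> // y yx; apply: h=> z zy.
rewrite /oball/= (le_lt_trans (ler_distD y _ _))//.
have ->: r = 3 * (r/6)+r/2 by field.
by rewrite ltrD.
Qed.

Lemma compact_finite_cover (K: set (R3 R)) (r: R3 R -> R): (forall x, 0 < r x) -> compact K ->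
 exists s: seq (R3 R), forall y, K y -> exists2 x, x \in s & oball x (r x) y.
move=> r0 /compact_near_coveringP cK.
pose F: set_system (seq (R3 R)):= [set A | exists s0: seq (R3 R), forall s: seq (R3 R), {subset s0 <= s} -> A s].
have FF: Filter F.
 split=> [|A B [a hA] [b hB]|A B AB [a hA]]; first by exists [::].
  exists (a ++ b)=> s hs; split; [apply: hA|apply: hB]=> x xa; apply: hs; rewrite mem_cat xa ?orbT//.
 by exists a=> s /hA/AB.
have [|s0 hs0]:= cK _ F (fun s y=> exists2 x, x \in s & oball x (r x) y) FF.
 move=> x Kx; exists (oball x (r x), [set s: seq (R3 R) | x \in s])=> /=.
  split; last by exists [:: x]=> s; apply; rewrite mem_head.
  by apply: open_nbhs_nbhs; split; [exact: oball_open|rewrite /oball/= subrr normr0].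
 by move=> [y s] [/= yx xs]; exists x.
by exists s0; exact: hs0.
Qed.

(** The use of partitions of unity: a property of cutoff functions that is
  additive and holds for functions supported in small balls holds for some
  cutoff equal to 1 on a given bounded set. *)
Lemma local_to_global (P: (R3 R -> R) -> Prop) (M: R) :
 P (fun=> 0) -> (forall t s, P t -> P s -> P (fun y=> t y+s y)) ->
 (forall x, exists2 r: R, 0 < r & forall t, test (oball x r) t -> P t) ->
 exists theta, [/\ P theta, test setT theta & forall y, cube M y -> theta y = 1].
move=> P0 PD h.
have /choice[r0 hr0] x: exists r: R, 0 < r /\ forall t, test (oball x r) t -> P t.
 by have [r]:= h x; exists r.
have r0p x: 0 < r0 x by case: (hr0 x).
have r0p' x: 0 < r0 x/2 by rewrite divr_gt0.
have cM: compact (cube M: set (R3 R)).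
 by apply: compact_setX; [apply: compact_setX|]; exact: segment_compact.
have [s cov]:= compact_finite_cover r0p' cM.
suff [theta [Pt tt ht]]: exists theta, [/\ P theta, test setT theta &
  forall y, (exists2 x, x \in s & oball x (r0 x/2) y) -> theta y = 1].
 by exists theta; split=> // y /cov/ht.
elim: s {cov}=> [|x s [theta [Pt tt ht]]].
 by exists (fun=> 0); split=> //; [exact: test0|move=> y []].
have [psi [tp b hpsi]]:= plateau_ball x (r0p x).
have tpt: test (oball x (r0 x)) (fun y=> psi y * (1-theta y)).
 apply: testM=> //; apply/smoothP; apply: smooth_onB; [exact: openT|exact: smooth_on_cst|].
 by apply/smoothP; case: tt.
exists (fun y=> theta y+psi y * (1-theta y)); split.
- by apply: PD=> //; have [_]:= hr0 x; apply.
- by apply: testD=> //; exact: test_sub tpt.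
- move=> y [x']; rewrite inE=> /predU1P[-> /hpsi ->|x's yx']; first by rewrite mul1r addrC subrK.
 by rewrite ht ?subrr ?mulr0 ?addr0//; exists x'.
Qed.

End Localization.

Section Charts.
Context {R: realType}.
Variable Om: set (R3 R).
Implicit Types (x y z d: R3 R).

(** What is used of the boundary: near each of its points the domain is
  the positivity set of a Lipschitz function growing at unit rate in a fixed direction. *)
Definition chart x0 (G: R3 R -> R) d (L r: R) :=
 [/\ 0 < r, 1 <= L, forall x y, `|G x-G y| <= L * `|x-y|,
   forall x (t: R), G (x+t *: d) = G x+t &
   forall x, `|x-x0| < r -> (Om x <-> 0 < G x)].

Lemma coordB i x y: coord i (x-y) = coord i x-coord i y.
by rewrite -scaleN1r coordD coordZ mulN1r. Qed.

Lemma coords_lin x y (t: R): coords (x+t *: y) = coords x+t *: coords y.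
by apply/rowP=> i; rewrite -[LHS]/(coord i (x+t *: y)) coordD coordZ [RHS]mxE [X in _ = _ + X]mxE.
Qed.

Lemma lipschitz_const (g: R * R -> R): [lipschitz g p | p in setT] ->
 exists2 K: R, 0 <= K & forall p q, `|g p-g q| <= K * `|p-q|.
move=> [K0 [_ hK]]; exists (`|K0| + 1); first by rewrite addr_ge0.
move=> p q; apply: (hK (`|K0| + 1) _ (p, q))=> //.
by rewrite ltr_pwDr// ler_norm.
Qed.

Lemma lipschitz_chart: lipschitz_boundary Om -> forall x0, boundary Om x0 ->
 exists G d L r, chart x0 G d L r.
move=> hL x0 /hL[Q [g [r [QQ /lipschitz_const[K K0 hK] r0 hr]]]].
have QQ': Q^T *m Q = 1%:M by exact: mulmx1C.
pose d0: 'rV[R]_3:= delta_mx 0 2 *m Q^T.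
pose d: R3 R:= (d0 0 0, d0 0 1, d0 0 2).
have dE: coords d = d0.
 by apply/rowP=> i; rewrite [LHS]mxE; case: i=> -[|[|[|//]]] Hi /=; congr (d0 0 _); exact/val_inj.
pose Y x j: R:= (coords x *m Q) 0 j.
have YD x (t: R) j: Y (x+t *: d) j = Y x j+t * (j == 2)%:R.
 rewrite /Y coords_lin mulmxDl -scalemxAl dE /d0 -mulmxA QQ' mulmx1 !mxE.
 by rewrite eqxx /=.
pose B:= \sum_i \sum_j `|Q i j|.
have B0: 0 <= B by apply: sumr_ge0=> i _; apply: sumr_ge0.
have YL x y j: `|Y x j-Y y j| <= B * `|x-y|.
 have ->: Y x j-Y y j = \sum_i coord i (x-y) * Q i j.
  rewrite /Y !mxE -sumrB; apply: eq_bigr=> i _; rewrite -mulrBl; congr (_ * _).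
  by rewrite coordB.
 apply: le_trans (ler_norm_sum _ _ _) _; rewrite mulr_suml; apply: ler_sum=> i _.
 rewrite normrM mulrC ler_pM// ?coord_le//.
 by rewrite (bigD1 j)//= lerDl; apply: sumr_ge0.
pose G x:= Y x 2-g (Y x 0, Y x 1).
exists G, d, (1+B+K * B), r; split=> //.
- by rewrite -addrA lerDl addr_ge0// mulr_ge0.
- move=> x y; rewrite /G; apply: le_trans (_: B * `|x-y| + K * (B * `|x-y|) <= _); last first.
  by rewrite mulrA -mulrDl ler_wpM2r// -addrA lerDr.
 have ->: Y x 2-g (Y x 0, Y x 1)-(Y y 2-g (Y y 0, Y y 1)) =
  (Y x 2-Y y 2)+(g (Y y 0, Y y 1)-g (Y x 0, Y x 1)) by ring.
 apply: le_trans (ler_normD _ _) _; apply: lerD; first exact: YL.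
 apply: le_trans (hK _ _) _; rewrite ler_wpM2l//.
 by rewrite /Num.norm/= ge_max -![_ - _]/(_ - _) !(distrC (Y y _)) !YL.
- by move=> x t; rewrite /G !YD /= !mulr0 !addr0 mulr1; ring.
- by move=> x xr; rewrite hr ?subr_gt0//; exact/ball3P.
Qed.

Lemma interior_open: open Om -> Om° = Om.
by move=> oO; apply/seteqP; split=> [x /interior_subset//|x Ox]; exact: open_nbhs_nbhs. Qed.

Lemma closure3P (A: set (R3 R)) x: closure A x <-> forall e: R, 0 < e -> exists y, A y /\ `|y-x| < e.
split=> [cA e e0|h U /nbhs3P[r r0 rU]].
 by have [y [Ay xy]]:= cA (oball x e) (open_nbhs_nbhs (conj (@oball_open _ x e) (oball_self x e0)));
  exists y.
by have [y [Ay yx]]:= h r r0; exists y; split=> //; exact: rU.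
Qed.

Lemma chart_boundary x0 G d L r: open Om -> boundary Om x0 -> chart x0 G d L r -> G x0 = 0.
move=> oO [cO]; rewrite interior_open// => nO [r0 L1 GL Gd GO].
have L0: 0 < L by apply: lt_le_trans L1.
have G0: G x0 <= 0.
 by rewrite leNgt; apply/negP=> Gp; apply: nO; apply/(GO x0)=> //; rewrite subrr normr0.
apply/eqP; rewrite eq_le G0 /= leNgt; apply/negP=> Gn.
pose e:= Num.min r (- G x0/L).
have e0: 0 < e by rewrite lt_min r0 divr_gt0// oppr_gt0.
have [y [Oy]]:= iffLR (closure3P _ _) cO e e0; rewrite lt_min=> /andP[yr yL].
have:= iffLR (GO y yr) Oy; have:= GL y x0; move: yL; rewrite ltr_pdivlMr// mulrC=> h1 h2 h3.
by have:= le_lt_trans (le_trans (ler_norm _) h2) h1; move: h3; lra.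
Qed.

End Charts.

Section Shifts.
Context {R: realType}.
Notation T3:= (space3 R).
Notation mu:= (@lebesgue3 R).
Variables (Om: set (R3 R)) (M: R).
Hypothesis oO: open Om.
Hypothesis OM: Om `<=` cube M.
Hypothesis LO: lipschitz_boundary Om.
Implicit Types (x y z d: R3 R) (w k: R3 R -> R).

(** Averages over a small ball centred at a point c, inward when seen from the
  boundary, turn functions vanishing outside the domain into test functions. *)
Definition inward x0 (rho: R):= forall delta: R, 0 < delta -> exists c e k,
 [/\ averaging c e k, `|c| + e <= delta & forall w, mu.-integrable setT (EFin \o w) ->
  (forall x, w x != 0 -> (closure Om) x /\ `|x-x0| <= rho) -> test Om (average w k)].

Lemma average_neq0 c e k w x: averaging c e k -> mu.-integrable setT (EFin \o w) -> average w k x != 0 ->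
 exists2 z, `|z-c| < e & w (x+z) != 0.
move=> [tk _ _ ks] iw nz; apply: contrapT=> h; move/eqP: nz; apply.
have mw: measurable3 w by case/integrableP: iw=> /measurable_EFinP.
rewrite averageE//; last exact: smooth_cont tk.1.
rewrite (_: (fun z=> _) = (fun=> 0)) ?/Rintegral ?integral0//; apply/funext=> z.
have [->|/ks zc]:= eqVneq (k z) 0; first by rewrite mulr0.
have [->|wz]:= eqVneq (w (x+z)) 0; first by rewrite mul0r.
by exfalso; apply: h; exists z.
Qed.

Lemma average_test c e k w (U K: set (R3 R)): averaging c e k -> mu.-integrable setT (EFin \o w) ->
 compact K -> K `<=` U -> (forall x, average w k x != 0 -> K x) -> test U (average w k).
move=> [tk _ _ _] iw cK KU h; split; first by apply: average_smooth=> //; exact: test_bounded_smooth tk.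
by exists K; split=> // x nK; apply/eqP/negPn/negP=> /h.
Qed.

Lemma closed_ball_compact x0 (r: R): compact [set x: R3 R | `|x-x0| <= r].
apply: (@compact3 _ _ (`|x0| + r))=> [|x /= xr].
 apply: (closed_comp (f:= fun x: R3 R=> `|x-x0|) (D:= [set t | t <= r])); last exact: closed_le.
 move=> x _; apply: (@continuous_comp _ _ _ (fun x: R3 R=> x-x0) (fun x=> `|x|)); last exact: norm_continuous.
 by apply: cvgB; [exact: cvg_id|exact: cvg_cst].
by apply/cubeE; rewrite -[x](subrK x0) addrC (le_trans (ler_normD _ _))// lerD2l.
Qed.

Lemma inward_chart x0 G d L r: boundary Om x0 -> chart Om x0 G d L r -> inward x0 (r/2).
move=> bx ch; have Gx0:= chart_boundary oO bx ch; have [r0 L1 GL Gd GO]:= ch.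
move=> delta d0; have L0: 0 < L by apply: lt_le_trans L1.
pose D:= `|d| + 1; have D0: 0 < D by rewrite ltr_wpDl.
pose s:= Num.min delta (r/4)/(2 * D).
have m0: 0 < Num.min delta (r/4) by rewrite lt_min d0 divr_gt0.
have s0: 0 < s by rewrite divr_gt0// mulr_gt0.
have sD: 2 * (s * D) = Num.min delta (r/4) by rewrite /s; field; rewrite gt_eqF.
pose e:= s/(2 * L).
have e0: 0 < e by rewrite divr_gt0// mulr_gt0.
have es: e <= s.
 rewrite /e ler_pdivrMr ?mulr_gt0// ler_peMr ?(ltW s0)//.
 by apply: le_trans L1 _; rewrite ler_peMl ?(ltW L0)// ler1n.
have Le: L * e = s/2 by rewrite /e; field; rewrite gt_eqF.
have ce: `|(- s) *: d| + e <= Num.min delta (r/4).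
 rewrite normrZ normrN gtr0_norm// -sD; have dD: `|d| <= D by rewrite lerDl.
 have s1: s * `|d| <= s * D by apply: ler_wpM2l=> //; exact: ltW.
 have s2: s <= s * D by rewrite ler_peMr ?(ltW s0)// lerDr.
 by apply: (le_trans (lerD s1 (le_trans es s2))); rewrite mulr_natl mulr2n.
exists ((- s) *: d), e, (mollifier ((- s) *: d) e).
have ak:= averaging_mollifier ((- s) *: d) e0.
split=> //; first by apply: le_trans ce _; rewrite ge_min lexx.
move=> w iw hw.
have cG: continuous G.
 move=> x; apply/continuous3P=> eps eps0; exists (eps/L); first by rewrite divr_gt0.
 by move=> y yx; apply: le_lt_trans (GL y x) _; rewrite mulrC -ltr_pdivlMr.
have clG x: closure Om x -> `|x-x0| < r -> 0 <= G x.
 move=> cx xr; rewrite leNgt; apply/negP=> Gn.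
 pose e':= Num.min (r - `|x-x0|) (- G x/L).
 have e'0: 0 < e' by rewrite lt_min subr_gt0 xr divr_gt0// oppr_gt0.
 have [y [Oy]]:= iffLR (closure3P _ _) cx e' e'0; rewrite lt_min=> /andP[y1 y2].
 have yr: `|y-x0| < r.
  by apply: le_lt_trans (ler_distD x _ _) _; rewrite -ltrBrDr.
 have:= iffLR (GO y yr) Oy; have:= GL y x; move: y2; rewrite ltr_pdivlMr// mulrC=> h1 h2 h3.
 by have:= le_lt_trans (le_trans (ler_norm _) h2) h1; move: h3; lra.
pose K: set (R3 R):= [set x | `|x-x0| <= r/2+r/4] `&` [set x | s/2 <= G x].
apply: (@average_test ((- s) *: d) e _ w _ K)=> //.
- apply: compact_closedI; first exact: closed_ball_compact.
 by apply: (closed_comp (f:= G) (D:= [set t | s/2 <= t])); [move=> x _; exact: cG|exact: closed_ge].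
- move=> x [/= xr Gx]; apply/GO; first by apply: le_lt_trans xr _; move: r0; lra.
 by apply: lt_le_trans Gx; rewrite divr_gt0.
- move=> x /(average_neq0 ak iw)[z zc /hw[cxz xzr]].
 have zn: `|z| <= r/4.
  apply: le_trans (_: `|(- s) *: d| + e <= _); last by apply: le_trans ce _; rewrite ge_min lexx orbT.
  by rewrite -[z](subrK ((- s) *: d)) addrC (le_trans (ler_normD _ _))// lerD2l ltW.
 have xr: `|x-x0| <= r/2+r/4.
  have ->: x-x0 = (x+z-x0)-z by rewrite addrAC addrK.
  by apply: le_trans (ler_normB _ _) _; exact: lerD.
 split=> //=.
 have Gxz: 0 <= G (x+z) by apply: clG=> //; apply: le_lt_trans xzr _; move: r0; lra.
 have:= GL x (x+z+s *: d); rewrite Gd.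
 have ->: x-(x+z+s *: d) = - (z-(- s) *: d).
  by rewrite opprD addrA opprD addrA subrr sub0r scaleNr opprK opprD.
 rewrite normrN=> h; have h2: L * `|z-(- s) *: d| <= s/2 by rewrite -Le ler_wpM2l ?ltW.
 by have:= le_trans h h2; rewrite ler_norml=> /andP[h3 _]; move: h3 Gxz; lra.
Qed.

Lemma inward_all x0: exists2 rho: R, 0 < rho & inward x0 rho.
have [cx|ncx]:= pselect (closure Om x0); last first.
 have [rho rho0 hrho]: exists2 rho: R, 0 < rho & forall y, `|y-x0| <= rho -> ~ closure Om y.
  have oc: open (~` closure Om) by apply: closed_openC; exact: closed_closure.
  have [r r0 hr]:= iffLR (open3P _) oc x0 ncx.
  by exists (r/2); [rewrite divr_gt0|move=> y yr; apply: hr; apply: le_lt_trans yr _; move: r0; lra].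
 exists rho=> // delta d0; exists 0, delta, (mollifier 0 delta).
 split; [exact: averaging_mollifier|by rewrite normr0 add0r|move=> w iw hw].
 have ->: average w (mollifier 0 delta) = fun=> 0.
  apply/funext=> x; apply: (_: forall w, (forall x, w x = 0) -> average w (mollifier 0 delta) x = 0)=> [w' hw'|y].
   by rewrite /average (_: (fun y=> _) = (fun=> 0)) ?/Rintegral ?integral0//; apply/funext=> y; rewrite hw' mul0r.
  by apply/eqP/negPn/negP=> /hw[c /hrho].
 exact: test0.
have [Ox|nOx]:= pselect (Om x0); last first.
 have bx: boundary Om x0 by split=> //; rewrite interior_open.
 have [G [d [L [r ch]]]]:= lipschitz_chart LO bx.
 exists (r/2); first by case: ch=> r0 *; rewrite divr_gt0.
 exact: inward_chart ch.
have [r r0 hr]:= iffLR (open3P _) oO x0 Ox.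
exists (r/2); first by rewrite divr_gt0.
move=> delta d0; pose e:= Num.min delta (r/4).
have e0: 0 < e by rewrite lt_min d0 divr_gt0.
have ak:= averaging_mollifier 0 e0.
exists 0, e, (mollifier 0 e); split=> //; first by rewrite normr0 add0r ge_min lexx.
move=> w iw hw; apply: (@average_test 0 e _ w _ [set x | `|x-x0| <= r/2+r/4])=> //.
- exact: closed_ball_compact.
- by move=> x /= xr; apply: hr; apply: le_lt_trans xr _; move: r0; lra.
- move=> x /(average_neq0 ak iw)[z]; rewrite subr0=> ze /hw[_ xz] /=.
 have ->: x-x0 = (x+z-x0)-z by rewrite addrAC addrK.
 apply: le_trans (ler_normB _ _) _; apply: lerD=> //.
 by apply: le_trans (ltW ze) _; rewrite ge_min lexx orbT.
Qed.

End Shifts.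

(** * Density of test fields in H0(curl) *)

Section DensityHcurl.
Context {R: realType}.
Notation T3:= (space3 R).
Notation mu:= (@lebesgue3 R).
Variables (Om: set (R3 R)) (M: R).
Hypothesis oO: open Om.
Hypothesis OM: Om `<=` cube M.
Let mO: measurable (Om: set T3):= open_measurable3 oO.
Implicit Types (x y z: R3 R) (p q phi theta k: R3 R -> R) (u v w e c eta V: vfield R).

Definition cross (a b: 'rV[R]_3): 'rV[R]_3 :=
 row3 (a 0 1 * b 0 2-a 0 2 * b 0 1) (a 0 2 * b 0 0-a 0 0 * b 0 2) (a 0 0 * b 0 1-a 0 1 * b 0 0).

Lemma test_L2s_all U p: test U p -> L2s Om p.
move=> tp; have [B _ hB]:= test_bounded tp.
apply: (L2s_bounded mO _ OM (fun x _=> hB x)).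
exact: measurable_funTS (continuous_measurable3 (smooth_cont tp.1)).
Qed.

Lemma vtest_L2_all U eta: vtest U eta -> L2 Om eta.
by move=> te; apply/vL2P=> i; exact: test_L2s_all (te i). Qed.

Lemma weak_grad_smooth U p: test U p -> weak_grad Om p (cgrad p).
by move=> tp i phi tphi; rewrite vcomp_cgrad ips_partial//; case: tp. Qed.

Lemma weak_curl_smooth U V: vtest U V -> weak_curl Om V (ccurl V).
move=> tV; have []:= @H1_weak_curl R Om oO V (fun j=> cgrad (vcomp V j)).
- by move=> j; exact: test_L2s_all (tV j).
- by move=> j; exact: vtest_L2_all (vtest_cgrad (tV j)).
- by move=> j; exact: weak_grad_smooth (tV j).
- by rewrite !vcomp_cgrad.
Qed.

(** The extension of u by zero has the extension of e as its curl on the whole space. *)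
Definition zero_ext_curl u e:= [/\ L2 Om u, L2 Om e &
 forall V, vtest setT V -> ip Om e V = ip Om u (ccurl V)].

Lemma H0curl_zero_ext u: H0curl Om u -> zero_ext_curl u (curl Om u).
move=> [hu tr]; have [lc _]:= curl_xget hu; split=> // [|V tV]; first by case: hu.
have lV:= vtest_L2_all tV; have lcV:= vtest_L2_all (vtest_ccurl tV).
have:= tr V; rewrite /tangential_trace=> h.
have ec:= curlP oO OM lV lcV (weak_curl_smooth tV).
have lcuV: L2 Om (curl Om V).
 by have []:= @curl_xget R Om V (conj lV (ex_intro _ _ (conj lcV (weak_curl_smooth tV)))).
rewrite -(ip_aer oO hu.1 lcuV lcV ec); apply/eqP; rewrite -subr_eq0; apply/eqP/h=> i.
split; first exact: (iffLR (vL2P _ _)).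
by exists (cgrad (vcomp V i)); split; [exact: vtest_L2_all (vtest_cgrad (tV i))|exact: weak_grad_smooth (tV i)].
Qed.

Lemma vcomp_scale theta u i: vcomp (fun x=> theta x *: u x) i = fun x=> theta x * vcomp u i x.
by apply/funext=> x; rewrite /vcomp mxE. Qed.

Lemma L2_scale U theta u: test U theta -> L2 Om u -> L2 Om (fun x=> theta x *: u x).
move=> tt /vL2P lu; apply/vL2P=> i; rewrite vcomp_scale; have [B _ hB]:= test_bounded tt.
apply: (L2s_bmul mO _ (fun x _=> hB x))=> //.
exact: measurable_funTS (continuous_measurable3 (smooth_cont tt.1)).
Qed.

Lemma cross_L2 U theta u: test U theta -> L2 Om u -> L2 Om (fun x=> cross (cgrad theta x) (u x)).
move=> tt lu; have ul:= iffLR (vL2P Om u) lu.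
have h i j: L2s Om (fun x=> cgrad theta x 0 i * u x 0 j).
 have tp:= test_partial i tt; have [B _ hB]:= test_bounded tp.
 have ->: (fun x=> cgrad theta x 0 i * u x 0 j) = (fun x=> partial i theta x * vcomp u j x).
  by apply/funext=> x; rewrite -[cgrad theta x 0 i]/(vcomp (cgrad theta) i x) vcomp_cgrad.
 apply: (L2s_bmul mO _ (fun x _=> hB x))=> //.
 exact: measurable_funTS (continuous_measurable3 (smooth_cont tp.1)).
by apply: vL2_row3; apply: L2sB.
Qed.

Lemma vtest_scale U theta V: test U theta -> (forall i, smooth (vcomp V i)) -> vtest U (fun x=> theta x *: V x).
by move=> tt sV i; rewrite vcomp_scale; exact: testM. Qed.

Lemma ccurl_scale theta V x: smooth theta -> (forall i, smooth (vcomp V i)) ->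
 ccurl (fun y=> theta y *: V y) x = theta x *: ccurl V x+cross (cgrad theta x) (V x).
move=> st sV.
have P i j: partial i (vcomp (fun y=> theta y *: V y) j) x =
  partial i theta x * V x 0 j+theta x * partial i (vcomp V j) x.
 by rewrite vcomp_scale partialM//; exact: smooth_der.
have G i: cgrad theta x 0 i = partial i theta x by rewrite -vcomp_cgrad.
rewrite /ccurl /cross !P !G.
apply/rowP=> i; rewrite !mxE; case: i=> -[|[|[|//]]] Hi /=; rewrite mulrBr opprD addrACA addrC; congr (_ + _).
Qed.

Lemma crossD (a b c: 'rV[R]_3): cross (a+b) c = cross a c+cross b c.
by apply/rowP=> i; rewrite !mxE; case: i=> -[|[|[|//]]] Hi /=; ring. Qed.

Lemma cross0 (c: 'rV[R]_3): cross 0 c = 0.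
by apply/rowP=> i; rewrite !mxE; case: i=> -[|[|[|//]]] Hi /=; ring. Qed.

Lemma frob_cross (a b c: 'rV[R]_3): frob (cross a b) c = - frob b (cross a c).
rewrite /frob !big_ord1 !sum3E !mxE /=; ring.
Qed.

Lemma frobZ (t: R) (a c: 'rV[R]_3): frob (t *: a) c = t * frob a c.
by rewrite /frob mulr_sumr; apply: eq_bigr=> i _; rewrite mulr_sumr; apply: eq_bigr=> j _; rewrite mxE mulrA. Qed.

Lemma frobC (a c: 'rV[R]_3): frob a c = frob c a.
by rewrite /frob; apply: eq_bigr=> i _; apply: eq_bigr=> j _; rewrite mulrC. Qed.

Lemma zero_ext_curl_scale U theta u e: test U theta -> zero_ext_curl u e ->
 zero_ext_curl (fun x=> theta x *: u x) (fun x=> theta x *: e x+cross (cgrad theta x) (u x)).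
move=> tt [lu le h]; split; first exact: L2_scale tt lu.
 by apply: L2D=> //; [exact: L2_scale tt le|exact: cross_L2 tt lu].
move=> V tV; have sV i: smooth (vcomp V i) by case: (tV i).
have tT: test setT theta by exact: test_sub tt.
have ttV:= vtest_scale tT sV.
have lV:= vtest_L2_all tV; have lcV:= vtest_L2_all (vtest_ccurl tV).
have lte:= L2_scale tt le; have lcr:= cross_L2 tt lu; have ltu:= L2_scale tt lu.
have lcrV:= cross_L2 tt lV; have ltcV:= L2_scale tt lcV.
rewrite ipDl//.
have ->: ip Om (fun x=> theta x *: e x) V = ip Om e (fun x=> theta x *: V x).
 by apply: eq_Rintegral=> x _; rewrite frobZ [in RHS]frobC frobZ frobC.
rewrite h//.
have ->: ip Om u (ccurl (fun x=> theta x *: V x)) =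
  ip Om u (fun x=> theta x *: ccurl V x+cross (cgrad theta x) (V x)).
 by apply: ip_eq=> // x; exact: ccurl_scale tt.1 sV.
rewrite ipDr//.
have ->: ip Om (fun x=> cross (cgrad theta x) (u x)) V = - ip Om u (fun x=> cross (cgrad theta x) (V x)).
 rewrite -[RHS]mulN1r -(ipZl mO)//.
 by apply: eq_Rintegral=> x _; rewrite frob_cross frobZ mulN1r.
rewrite addrK; apply: eq_Rintegral=> x _.
by rewrite frobZ frobC frobZ frobC.
Qed.

Definition vaverage u k: vfield R :=
 fun x=> \row_j average (vcomp u j \_ Om) k x.

Lemma vcomp_vaverage u k i: vcomp (vaverage u k) i = average (vcomp u i \_ Om) k.
by apply/funext=> x; rewrite /vcomp mxE. Qed.

Lemma restrict_integrable p: L2s Om p -> mu.-integrable setT (EFin \o (p \_ Om)).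
move=> /L2sP lp; apply: (@cube_integrable _ M)=> // x nx; rewrite patchE memNset// => /OM; exact: nx.
Qed.

Lemma averageEips p k x: average (p \_ Om) k x = ips Om p (fun y=> k (y-x)).
rewrite /ips Rintegral_mkcond; apply: eq_Rintegral=> y _; rewrite !patchE.
by case: ifP=> _; rewrite ?mul0r.
Qed.

Lemma test_translate k x: test setT k -> test setT (fun y=> k (y-x)).
move=> tk; have:= @affine_test R k 1 (- x) (oner_neq0 _) tk.
by under [X in test _ X -> _]funext=> y do rewrite scale1r.
Qed.

Lemma partial_translate k x i y: smooth k -> partial i (fun z=> k (z-x)) y = partial i k (y-x).
move=> sk; have:= affine_partial 1 (- x) y i sk; rewrite mul1r scale1r=> <-.
by congr (partial i _ y); apply/funext=> z; rewrite scale1r.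
Qed.

Lemma ips_scaler p q (a: R): L2s Om p -> L2s Om q -> ips Om p (fun x=> a * q x) = a * ips Om p q.
move=> lp lq; have i:= ips_integrable mO lp lq.
by rewrite /ips -RintegralZl//; apply: eq_Rintegral=> x _; rewrite mulrCA.
Qed.

Lemma ip_ccurl_all U u eta: L2 Om u -> vtest U eta -> ip Om u (ccurl eta) =
 (ips Om (vcomp u 0) (partial 1 (vcomp eta 2))-ips Om (vcomp u 0) (partial 2 (vcomp eta 1))) +
 (ips Om (vcomp u 1) (partial 2 (vcomp eta 0))-ips Om (vcomp u 1) (partial 0 (vcomp eta 2))) +
 (ips Om (vcomp u 2) (partial 0 (vcomp eta 1))-ips Om (vcomp u 2) (partial 1 (vcomp eta 0))).
move=> lu te; have lc:= vtest_L2_all (vtest_ccurl te); rewrite vipE// sum3E.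
have [-> -> ->]:= vcomp_ccurl eta.
have lp i j: L2s Om (partial i (vcomp eta j)) by exact: test_L2s_all (test_partial _ (te _)).
have ul:= iffLR (vL2P Om u) lu.
by rewrite !(ipsC Om (vcomp u _)) !ips_diff// !(ipsC Om _ (vcomp u _)).
Qed.

Let T: R:= true%:R.
Let F: R:= false%:R.

Lemma swap0 (a b x y z t: R): - a - - b = F * x-F * y+(T * b-F * z)+(F * t-T * a).
by rewrite /T /F -[true%:R]/(1: R) -[false%:R]/(0: R); ring. Qed.
Lemma swap1 (a b x y z t: R): - a - - b = F * x-T * a+(F * y-F * z)+(T * b-F * t).
by rewrite /T /F -[true%:R]/(1: R) -[false%:R]/(0: R); ring. Qed.
Lemma swap2 (a b x y z t: R): - a - - b = T * b-F * x+(F * y-T * a)+(F * z-F * t).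
by rewrite /T /F -[true%:R]/(1: R) -[false%:R]/(0: R); ring. Qed.

(** The curl of an average is the curl in the sense of distributions, tested
  against the translated kernel. *)
Lemma ccurl_vaverage_dual u k x m: L2 Om u -> test setT k ->
 ccurl (vaverage u k) x 0 m = ip Om u (ccurl (single m (fun y=> k (y-x)))).
move=> lu tk; have bk:= test_bounded_smooth tk.
have ul:= iffLR (vL2P Om u) lu.
have P i j: partial i (vcomp (vaverage u k) j) x = - ips Om (vcomp u j) (fun y=> partial i k (y-x)).
 by rewrite vcomp_vaverage average_partial//; [rewrite averageEips|exact: restrict_integrable].
pose kx:= fun y=> k (y-x); have tkx: test setT kx:= test_translate x tk.
have pk i: partial i kx = fun y=> partial i k (y-x).
 by apply/funext=> y; exact: partial_translate tk.1.
have pz i j n: partial i (vcomp (single n kx) j) = fun y=> (n == j)%:R * partial i k (y-x).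
 rewrite vcomp_single; apply/funext=> y; rewrite partialZ ?pk//; exact: smooth_der tkx.1.
have lpk i: L2s Om (fun y=> partial i k (y-x)) by rewrite -pk; exact: test_L2s_all (test_partial i tkx).
have S i j n b: ips Om (vcomp u j) (partial i (vcomp (single n kx) b)) =
  (n == b)%:R * ips Om (vcomp u j) (fun y=> partial i k (y-x)).
 by rewrite pz ips_scaler.
rewrite (@ip_ccurl_all setT)//; last exact: vtest_single.
rewrite !S -[LHS]/(vcomp (ccurl (vaverage u k)) m x).
have [c0 c1 c2]:= vcomp_ccurl (vaverage u k).
elim/ord3_ind: m.
- rewrite c0 !P -[(0 == 0 :> 'I_3)]/true -[(0 == 1 :> 'I_3)]/false -[(0 == 2 :> 'I_3)]/false.
 exact: swap0.
- rewrite c1 !P -[(1 == 0 :> 'I_3)]/false -[(1 == 1 :> 'I_3)]/true -[(1 == 2 :> 'I_3)]/false.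
 exact: swap1.
- rewrite c2 !P -[(2 == 0 :> 'I_3)]/false -[(2 == 1 :> 'I_3)]/false -[(2 == 2 :> 'I_3)]/true.
 exact: swap2.
Qed.

(** Averaging commutes with the curl of the extension by zero. *)
Lemma ccurl_vaverage u e k x: test setT k -> zero_ext_curl u e ->
 ccurl (vaverage u k) x = vaverage e k x.
move=> tk [lu le h]; have el:= iffLR (vL2P Om e) le.
pose kx:= fun y=> k (y-x); have tkx: test setT kx:= test_translate x tk.
apply/rowP=> m; rewrite ccurl_vaverage_dual// -h; last exact: vtest_single.
rewrite -[RHS]/(vcomp (vaverage e k) m x) vcomp_vaverage averageEips -/kx.
rewrite vipE//; last by apply: (@vtest_L2_all setT); exact: vtest_single.
rewrite (bigD1 m)//= vcomp_single eqxx big1 ?addr0.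
 by apply: eq_ips=> // y _; rewrite mul1r.
move=> j /negPf jm; rewrite vcomp_single eq_sym jm ips_scaler; [exact: mul0r|exact: el|exact: test_L2s_all tkx].
Qed.

Lemma eq_ip_on u u' v v': (forall x, Om x -> u x = u' x) -> (forall x, Om x -> v x = v' x) -> ip Om u v = ip Om u' v'.
by move=> h h'; apply: eq_Rintegral=> x /set_mem Ox; rewrite h// h'. Qed.

Lemma ip_zero u: (forall x, u x = 0) -> ip Om u u = 0.
by move=> h; rewrite (ip_eq Om h h) ip0l. Qed.

Lemma ip_symB u v: ip Om (fun x=> u x-v x) (fun x=> u x-v x) = ip Om (fun x=> v x-u x) (fun x=> v x-u x).
apply: eq_Rintegral=> x _; apply: eq_bigr=> i _; apply: eq_bigr=> j _.
by rewrite -(opprB (v x)) !mxE mulrNN.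
Qed.

Lemma vaverage_cvg u: L2 Om u -> forall eps: R, 0 < eps -> exists2 d: R, 0 < d &
 forall (c: R3 R) (r: R) k, averaging c r k -> `|c| + r <= d -> L2 Om (vaverage u k) /\
  ip Om (fun x=> vaverage u k x-u x) (fun x=> vaverage u k x-u x) <= eps.
move=> /vL2P lu eps e0; have e3: 0 < eps/3 by rewrite divr_gt0.
have su i: sqint mu (vcomp u i \_ Om):= iffLR (L2sP _ _) (lu i).
have zu i x: M < `|x| -> (vcomp u i \_ Om) x = 0.
 by move=> Mx; rewrite patchE memNset// => /OM/cubeE; rewrite leNgt Mx.
have /choice[d hd] i: exists d: R, 0 < d /\ forall (c: R3 R) (r: R) k, averaging c r k -> `|c| + r <= d ->
  \int[mu]_x ((average (vcomp u i \_ Om) k x-(vcomp u i \_ Om) x)^+2) <= eps/3.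
 by have [d d0 hd]:= average_cvg (su i) (zu i) e3; exists d.
exists (Num.min (d 0) (Num.min (d 1) (d 2))); first by rewrite !lt_min !(hd _).1.
move=> c r k ak; rewrite !le_min=> /and3P[h0 h1 h2].
have hi i: `|c| + r <= d i.
 by case: i=> -[|[|[|//]]] Hi; [move: h0|move: h1|move: h2]; congr (_ <= d _); exact/val_inj.
have la i: L2s Om (average (vcomp u i \_ Om) k).
 have [sa _]:= average_contraction (su i) (restrict_integrable (lu i)) ak.
 apply/L2sP; apply: (le_sqint _ _ sa); first by apply/(measurable_restrictT _ mO); exact: measurable_funTS sa.1.
 by move=> x; rewrite patchE; case: ifP=> // _; rewrite normr0.
have lv: L2 Om (vaverage u k) by apply/vL2P=> i; rewrite vcomp_vaverage.
split=> //; have lu': L2 Om u by exact/vL2P.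
have ld:= L2B mO lv lu'.
have H i: ips Om (vcomp (fun x=> vaverage u k x-u x) i) (vcomp (fun x=> vaverage u k x-u x) i) <= eps/3.
 have [sa _]:= average_contraction (su i) (restrict_integrable (lu i)) ak.
 have li:= iffLR (vL2P Om _) ld i.
 apply: le_trans ((hd i).2 c r k ak (hi i)); rewrite ipsE; apply: le_Rintegral=> //.
 - exact: sqint_mul (iffLR (L2sP _ _) li) (iffLR (L2sP _ _) li).
 - exact: (sqintB sa (su i)).2.
 - move=> x _; rewrite !patchE; case: ifPn=> Ox; last by rewrite mul0r sqr_ge0.
  by rewrite /vcomp !mxE expr2.
rewrite vipE// sum3E; have:= H 0; have:= H 1; have:= H 2; move: (ips _ _ _) (ips _ _ _) (ips _ _ _)=> a b f; lra.
Qed.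

Definition test_approx u e:= forall eps: R, 0 < eps -> exists2 eta, vtest Om eta &
 ip Om (fun x=> u x-eta x) (fun x=> u x-eta x) +
 ip Om (fun x=> e x-ccurl eta x) (fun x=> e x-ccurl eta x) <= eps.

Lemma test_approxD u e u' e': L2 Om u -> L2 Om e -> L2 Om u' -> L2 Om e' ->
 test_approx u e -> test_approx u' e' -> test_approx (fun x=> u x+u' x) (fun x=> e x+e' x).
move=> lu le lu' le' h h' eps e0; have e4: 0 < eps/4 by rewrite divr_gt0.
have [eta te he]:= h _ e4; have [zeta tz hz]:= h' _ e4.
have tez: vtest Om (fun x=> 1 *: eta x+zeta x) by exact: vtest_lin.
exists (fun x=> 1 *: eta x+zeta x)=> //.
have l1:= vtest_L2 te; have l2:= vtest_L2 tz.
have l3:= vtest_L2 (vtest_ccurl te); have l4:= vtest_L2 (vtest_ccurl tz).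
have:= ip_sum_le mO (L2B mO lu l1) (L2B mO lu' l2).
have:= ip_sum_le mO (L2B mO le l3) (L2B mO le' l4).
have ->: ip Om (fun x=> (e x-ccurl eta x)+(e' x-ccurl zeta x)) (fun x=> (e x-ccurl eta x)+(e' x-ccurl zeta x)) =
 ip Om (fun x=> e x+e' x-ccurl (fun x=> 1 *: eta x+zeta x) x) (fun x=> e x+e' x-ccurl (fun x=> 1 *: eta x+zeta x) x).
 have E x: (e x-ccurl eta x)+(e' x-ccurl zeta x) = e x+e' x-ccurl (fun x=> 1 *: eta x+zeta x) x.
  have:= ccurl_lin 1 x (fun i=> (te i).1) (fun i=> (tz i).1); rewrite scale1r=> ->.
  by rewrite opprD addrACA.
 exact: ip_eq.
have ->: ip Om (fun x=> (u x-eta x)+(u' x-zeta x)) (fun x=> (u x-eta x)+(u' x-zeta x)) =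
 ip Om (fun x=> u x+u' x-(1 *: eta x+zeta x)) (fun x=> u x+u' x-(1 *: eta x+zeta x)).
 have E x: (u x-eta x)+(u' x-zeta x) = u x+u' x-(1 *: eta x+zeta x).
  by rewrite scale1r opprD addrACA.
 exact: ip_eq.
by move: he hz; move: (ip _ _ _) (ip _ _ _) (ip _ _ _) (ip _ _ _) (ip _ _ _) (ip _ _ _)=> *; lra.
Qed.

(** Test fields are dense in H0(curl): localize by cutoffs, then average over
  small balls shifted inwards. *)
Lemma H0curl_dense u: lipschitz_boundary Om -> H0curl Om u -> test_approx u (curl Om u).
move=> LO hu; have zu:= H0curl_zero_ext hu; have [lu le _]:= zu.
set e:= curl Om u in zu le *.
pose P theta:= test setT theta /\ test_approx (fun x=> theta x *: u x) (fun x=> theta x *: e x+cross (cgrad theta x) (u x)).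
have lP theta: test setT theta -> L2 Om (fun x=> theta x *: u x) /\ L2 Om (fun x=> theta x *: e x+cross (cgrad theta x) (u x)).
 by move=> tt; have []:= zero_ext_curl_scale tt zu.
have [|t s [tt ht] [ts hs]|x|theta [[tt ht] _ h1]]:= @local_to_global R P M.
- split; first exact: test0.
 move=> eps e0; exists (fun=> 0); first exact: vtest0.
 have E1 x: 0 *: u x-0 = 0 :> 'rV[R]_3 by rewrite scale0r subr0.
 have E2 x: 0 *: e x+cross (cgrad (fun=> 0) x) (u x)-ccurl (fun=> 0) x = 0 :> 'rV[R]_3.
  have z i y: partial i (fun=> 0: R) y = 0 by exact: derive_cst.
  have zc j: vcomp (fun=> 0: 'rV[R]_3) j = fun=> 0 by apply/funext=> y; rewrite /vcomp mxE.
  have row0: row3 0 0 0 = 0 :> 'rV[R]_3.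
   by apply/rowP=> i; rewrite !mxE; case: i=> -[|[|[|//]]].
  by rewrite scale0r add0r /ccurl !zc !z /cgrad !z !subrr row0 cross0 subr0.
 by rewrite (ip_zero E1) (ip_zero E2) addr0 ltW.
- split; first exact: testD.
 have [l1 l2]:= lP t tt; have [l3 l4]:= lP s ts.
 have:= test_approxD l1 l2 l3 l4 ht hs; congr test_approx; apply/funext=> x; first by rewrite -scalerDl.
 have ->: cgrad (fun y=> t y+s y) x = cgrad t x+cgrad s x.
  by have:= cgrad_lin 1 x tt.1 ts.1; rewrite scale1r=> <-; congr (cgrad _ x); apply/funext=> y; rewrite mul1r.
 by rewrite scalerDl addrACA crossD.
- have [rho rho0 hin]:= inward_all oO LO x.
 exists rho=> // t tt; have tT: test setT t by exact: test_sub tt.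
 split=> // eps e0; have e2: 0 < eps/2 by rewrite divr_gt0.
 have zt:= zero_ext_curl_scale tT zu; have [l1 l2 _]:= zt.
 have [d1 d10 h1]:= vaverage_cvg l1 e2; have [d2 d20 h2]:= vaverage_cvg l2 e2.
 have [|c [r [k [ak cr hk]]]]:= hin (Num.min d1 d2); first by rewrite lt_min d10.
 have:= cr; rewrite le_min=> /andP[c1 c2].
 have [m1 b1]:= h1 c r k ak c1; have [m2 b2]:= h2 c r k ak c2.
 exists (vaverage (fun x=> t x *: u x) k).
  move=> i; rewrite vcomp_vaverage; apply: hk.
   exact: restrict_integrable (iffLR (vL2P Om _) l1 i).
  move=> y; rewrite patchE; case: ifPn=> [/set_mem Oy|]; last by rewrite eqxx.
  rewrite vcomp_scale mulf_eq0 negb_or=> /andP[ty _]; split; first exact: subset_closure.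
  apply: contrapT=> /negP; rewrite -ltNge=> ry; move/negP: ty; apply.
  by rewrite (test_outside tt)// /oball/=; apply/negP; rewrite -leNgt ltW.
 rewrite (ip_symB (fun x=> t x *: u x)) [X in _ + X]ip_symB.
 rewrite (@ip_eq _ Om (fun y=> ccurl (vaverage (fun x=> t x *: u x) k) y - _)
  (fun y=> vaverage (fun x=> t x *: e x+cross (cgrad t x) (u x)) k y-(t y *: e y+cross (cgrad t y) (u y))) _
  (fun y=> vaverage (fun x=> t x *: e x+cross (cgrad t x) (u x)) k y-(t y *: e y+cross (cgrad t y) (u y)))).
 + by rewrite [leRHS]splitr lerD.
 + by move=> y; rewrite (ccurl_vaverage y _ zt)//; case: ak.
 + by move=> y; rewrite (ccurl_vaverage y _ zt)//; case: ak.
move=> eps e0; have [eta te he]:= ht eps e0; exists eta=> //; apply: le_trans he.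
have z x: Om x -> cgrad theta x = 0.
 move=> Ox; apply/rowP=> i; rewrite -[LHS]/(vcomp (cgrad theta) i x) vcomp_cgrad mxE.
 rewrite (@partial_eq_on _ Om theta (fun=> 1) i x)//; first exact: derive_cst.
 by move=> y /OM/h1.
have z1 x: Om x -> u x-eta x = theta x *: u x-eta x by move=> /OM/h1 ->; rewrite scale1r.
have z2 x: Om x -> e x-ccurl eta x = theta x *: e x+cross (cgrad theta x) (u x)-ccurl eta x.
 move=> Ox; rewrite z// (h1 x (OM Ox)) scale1r (_: cross 0 (u x) = 0) ?addr0//.
 by rewrite /cross; apply/rowP=> i; rewrite !mxE; case: i=> -[|[|[|//]]] Hi /=; ring.
by rewrite (eq_ip_on z1 z1) (eq_ip_on z2 z2).
Qed.

End DensityHcurl.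

(** * Potentials along rays *)

Lemma lin3_sqr (R: realType) (a b c x y z t: R): `|x| <= t -> `|y| <= t -> `|z| <= t ->
 (x * (- a)+y * (- b)+z * (- c))^+2 <= 3 * t^+2 * (a^+2+b^+2+c^+2).
move=> hx hy hz.
have sq u (w: R): `|u| <= t -> u^+2 * w^+2 <= t^+2 * w^+2.
 move=> ut; rewrite ler_wpM2r ?sqr_ge0// -real_normK ?num_real// ler_pXn2r ?nnegrE//.
 exact: le_trans ut.
have:= sq x a hx; have:= sq y b hy; have:= sq z c hz.
have:= sqr_ge0 (x * a-y * b); have:= sqr_ge0 (x * a-z * c); have:= sqr_ge0 (y * b-z * c).
nra.
Qed.

Lemma sqr_le_shift (R: realType) (a b: R): a^+2 <= 2 * b^+2+2 * (b-a)^+2.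
have:= sqr_ge0 (2 * b-a); nra. Qed.

Lemma sum3_last (R: realType) (c f: 'I_3 -> R): c 0 = 0 -> c 1 = 0 -> \sum_j c j * f j = c 2 * f 2.
by move=> c0 c1; rewrite sum3E c0 c1 !mul0r !add0r. Qed.

Lemma sub0_mulN (R: realType) (a b c: R): 0-a = - b * c -> b * c = a.
by rewrite sub0r mulNr=> /oppr_inj. Qed.

Lemma mul_subK (R: realType) (l x y p: R): l * y = p -> l * x = p-l * (y-x).
by move=> <-; ring. Qed.

Lemma mul_oppsubK (R: realType) (l x y p: R): l * y = p -> l * x = p - - (l * (x-y)).
by move=> <-; ring. Qed.

Lemma lee_pmul2l_le (R: realType) (a b c: \bar R): (0 <= a -> b <= c -> a * b <= a * c)%E.
by move=> a0; exact: lee_wpmul2l. Qed.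

Section RayPotential.
Context {R: realType}.
Notation T3:= (space3 R).
Notation mu:= (@lebesgue3 R).
Notation leb1:= (@lebesgue_measure R).
Implicit Types (x y z v: R3 R) (p q: R3 R -> R).

Let mI: measurable (`[0, 1]%classic: set (measurableTypeR R)). Proof. exact: measurable_itv. Qed.

Lemma ray_average_superpose v q: ray_average v q =
 superpose leb1 (fun=> 1) (fun s: measurableTypeR R=> s *: v) \1_(`[0, 1]%classic: set R) q.
apply/funext=> x; rewrite /ray_average /superpose Rintegral_mkcond; apply: eq_Rintegral=> s _.
by rewrite patchE indicE scale1r; case: ifP; rewrite ?mul1r ?mul0r.
Qed.

Let mray v: measurable_fun (setT: set (measurableTypeR R)) ((fun s: measurableTypeR R=> s *: v): _ -> T3).
case: v=> -[a b] c.
have A (t: R): measurable_fun (setT: set (measurableTypeR R)) (fun s: measurableTypeR R=> s * t) by apply: measurable_funM.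
by apply: (@measurable_fun_pair _ _ _ _ _ _ (fun s: measurableTypeR R=> (s * a, s * b))); [apply: measurable_fun_pair|]; exact: A.
Qed.

Let i01: leb1.-integrable setT (EFin \o (\1_(`[0, 1]%classic: set R): R -> R)).
exact: integrable_indic_itv. Qed.

Let n1 (s: measurableTypeR R): `|(1: R)| <= 1. Proof. by rewrite normr1. Qed.

Lemma ray_average_smooth v q: bounded_smooth q -> smooth (ray_average v q).
move=> bq; rewrite ray_average_superpose.
exact: (superpose_smooth (measurable_cst _) (mray v) n1 i01 bq).
Qed.

Lemma ray_average_partial v q i x: bounded_smooth q ->
 partial i (ray_average v q) x = ray_average v (partial i q) x.
move=> bq; rewrite ray_average_superpose (superpose_partial (measurable_cst _) (mray v) n1)//.
by rewrite ray_average_superpose; apply: eq_Rintegral=> s _; rewrite mulr1.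
Qed.

Lemma ray_integrable v q x: continuous q -> leb1.-integrable `[0, 1] (EFin \o (fun s: R=> q (x+s *: v))).
move=> cq; apply: continuous_compact_integrable; first exact: segment_compact.
apply: continuous_subspaceT=> s.
apply: (@continuous_comp _ _ _ (fun s: R=> x+s *: v) q); last exact: cq.
by apply: cvgD; [exact: cvg_cst|apply: cvgZr_tmp; exact: cvg_id].
Qed.

Lemma ray_averageB v p q x: continuous p -> continuous q ->
 ray_average v (fun y=> p y-q y) x = ray_average v p x-ray_average v q x.
by move=> cp cq; rewrite /ray_average -RintegralB//; exact: ray_integrable. Qed.

Lemma ray_averageZ v p (a: R) x: continuous p ->
 ray_average v (fun y=> a * p y) x = a * ray_average v p x.
by move=> cp; rewrite /ray_average -RintegralZl//; exact: ray_integrable. Qed.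

Lemma ray_average0 v p x: (forall s: R, 0 <= s <= 1 -> p (x+s *: v) = 0) -> ray_average v p x = 0.
move=> h; rewrite /ray_average (_: \int[_]_(s in _) _ = \int[leb1]_(s in `[0, 1]) (0: R)).
 by rewrite /Rintegral integral0.
by apply: eq_Rintegral=> s /set_mem; rewrite /= in_itv/= => /h.
Qed.

Lemma ray_FTC U p (a: R) x: test U p ->
 p (x+a *: e_ 2)-p x = a * ray_average (a *: e_ 2) (partial 2 p) x.
move=> tp; rewrite (smooth_FTC x (a *: e_ 2) tp.1) -ray_averageZ; last first.
 exact: smooth_cont (bounded_smooth_partial 2 (test_bounded_smooth tp)).1.
apply: eq_Rintegral=> s _; rewrite sum3_last; last 2 first.
- by rewrite coordZ coord_e mulr0.
- by rewrite coordZ coord_e mulr0.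
by rewrite coordZ coord_e mulr1.
Qed.

Variables (Om: set (R3 R)) (M: R).
Hypothesis oO: open Om.
Hypothesis M0: 0 < M.
Hypothesis OM: Om `<=` cube M.
Let mO: measurable (Om: set T3):= open_measurable3 oO.
Let N:= 3 * M+3.
Let L:= 2 * N.
Let down: R3 R:= (- L) *: e_ 2.

(** For a test field eta with curl c, integration along the downward
  vertical gives eta = a+grad p near the domain, where a is bounded by c. *)
Definition pot (eta: vfield R): R3 R -> R:= fun x=> L * ray_average down (vcomp eta 2) x.
Definition remn (c: vfield R): vfield R:= fun x =>
 row3 (L * ray_average down (vcomp c 1) x) (- (L * ray_average down (vcomp c 0) x)) 0.

Lemma pot_smooth eta: vtest Om eta -> smooth (pot eta).
move=> te; apply/smoothP; apply: smooth_onZ; first exact: openT.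
by apply/smoothP; apply: ray_average_smooth; exact: test_bounded_smooth (te 2).
Qed.

Lemma below_out x: coord 2 x < - M -> ~ Om x.
move=> h /OM/cubeE xM; have:= le_trans (coord_le 2 x) xM.
by rewrite ler_norml=> /andP[h1 _]; move: h h1; lra.
Qed.

Lemma pot_partial eta x i: vtest Om eta -> `|x| <= N -> partial i (pot eta) x = vcomp eta i x-vcomp (remn (ccurl eta)) i x.
move=> te xN.
have be j:= test_bounded_smooth (te j).
have cp j k: continuous (partial j (vcomp eta k)):= smooth_cont (bounded_smooth_partial j (be k)).1.
have rs k: derivable (ray_average down (vcomp eta k)) x (e_ i) by exact: smooth_der (ray_average_smooth down (be k)).
have E1: partial i (pot eta) x = L * ray_average down (partial i (vcomp eta 2)) x.
 by rewrite /pot partialZ// ray_average_partial.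
have FT k: L * ray_average down (partial 2 (vcomp eta k)) x = vcomp eta k x.
 have:= ray_FTC (- L) x (te k); rewrite (test_outside (te k) (x:= x+down)); last first.
  apply: below_out; rewrite coordD coordZ coord_e eqxx mulr1.
  have:= le_trans (coord_le 2 x) xN; rewrite ler_norml=> /andP[_ h2].
  by move: h2; rewrite /L /N; move: M0; lra.
 exact: sub0_mulN.
have [c0 c1 _]:= vcomp_ccurl eta.
rewrite E1 /remn vcomp_row3; case: i {rs E1}=> -[|[|[|//]]] Hi /=.
- have ->: Ordinal Hi = 0 by exact/val_inj.
 rewrite c1 (ray_averageB _ _ (cp 2 0) (cp 0 2)); exact: mul_subK.
- have ->: Ordinal Hi = 1 by exact/val_inj.
 rewrite c0 (ray_averageB _ _ (cp 1 2) (cp 2 1)); exact: mul_oppsubK.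
- have ->: Ordinal Hi = 2 by exact/val_inj.
 by rewrite FT subr0.
Qed.

Lemma ray_average_L2 q v: test setT q ->
 sqint mu (ray_average v q) /\ \int[mu]_x (ray_average v q x^+2) <= \int[mu]_x (q x^+2).
move=> tq; have sq:= test_sqint tq; have sr:= ray_average_smooth v (test_bounded_smooth tq).
have mr: measurable_fun (setT: set T3) (ray_average v q: T3 -> R) by exact: continuous_measurable3 (smooth_cont sr).
have mT: measurable (setT: set T3) by [].
have le:= ray_bound (smooth_cont tq.1) mr mT mT (fun _ _ _ _=> I).
have i2: mu.-integrable setT (EFin \o (fun x=> ray_average v q x^+2)).
 by apply: ge0_integrable_le le sq.2=> [|x|x]; [exact: measurable_funX|exact: sqr_ge0|exact: sqr_ge0].
split; first by split.
rewrite /Rintegral fine_le//; [exact: integrable_fin_num i2|exact: integrable_fin_num sq.2].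
Qed.

Lemma remn_bound eta j: vtest Om eta ->
 sqint mu (vcomp (remn (ccurl eta)) j) /\
 \int[mu]_x (vcomp (remn (ccurl eta)) j x^+2) <= L^+2 * ip Om (ccurl eta) (ccurl eta).
move=> te; have tc:= vtest_ccurl te; have lc:= vtest_L2 tc.
have F q: test Om q -> \int[mu]_x (q x^+2) = ips Om q q.
 by move=> tq; rewrite ips_test_full//; apply: eq_Rintegral=> x _; rewrite expr2.
have B k: ips Om (vcomp (ccurl eta) k) (vcomp (ccurl eta) k) <= ip Om (ccurl eta) (ccurl eta).
 by rewrite vipE// (bigD1 k)//= lerDl; apply: sumr_ge0=> i _; exact: ips_ge0.
have H k (a: R): a^+2 = L^+2 -> sqint mu (fun x=> a * ray_average down (vcomp (ccurl eta) k) x) /\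
 \int[mu]_x ((a * ray_average down (vcomp (ccurl eta) k) x)^+2) <= L^+2 * ip Om (ccurl eta) (ccurl eta).
 move=> aL; have [s le]:= ray_average_L2 down (test_sub (@subsetT _ _) (tc k)).
 split; first exact: sqintZ.
 under eq_Rintegral=> x _ do rewrite exprMn aL.
 rewrite RintegralZl//; last exact: s.2.
 by rewrite ler_wpM2l ?sqr_ge0//; apply: le_trans le _; rewrite F.
rewrite /remn vcomp_row3; case: j=> -[|[|[|//]]] Hi /=.
- exact: H.
- have:= H 0 (- L) (sqrrN _); under eq_fun do rewrite mulNr.
 by under eq_Rintegral=> x _ do rewrite mulNr.
- split; last first.
  under eq_Rintegral=> x _ do rewrite expr0n /=.
  by rewrite /Rintegral integral0 /= mulr_ge0 ?sqr_ge0 ?ip_ge0.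
 split; first exact: measurable_cst.
 by under [X in _.-integrable _ (_ \o X)]eq_fun do rewrite expr0n /=; exact: integrable0.
Qed.

(** Sets outside the domain on which the potential is bounded by the curl. *)
Definition good_set (B: set (R3 R)):= measurable (B: set T3) /\
 exists2 C: R, 0 <= C & forall eta, vtest Om eta ->
  (\int[mu]_(x in B) (pot eta x^+2)%:E <= (C * ip Om (ccurl eta) (ccurl eta))%:E)%E.

Lemma good_transport (B B': set (R3 R)) v: measurable (B: set T3) -> good_set B' ->
 (forall x (s: R), B x -> 0 <= s <= 1 -> `|x+s *: v| <= N /\ ~ Om (x+s *: v)) ->
 (forall x, B x -> B' (x+v)) -> good_set B.
move=> mB [mB' [C C0 hC]] seg BB'.
have q0: 0 <= 18 * `|v| ^+ 2 * L^+2 by apply: mulr_ge0; [apply: mulr_ge0=> //; exact: sqr_ge0|exact: sqr_ge0].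
split=> //; exists (2 * C+18 * `|v| ^+ 2 * L^+2); first by rewrite addr_ge0// mulr_ge0.
move=> eta te; set p:= pot eta; have sp: smooth p:= pot_smooth te.
set I2:= ip Om _ _; have I20: 0 <= I2 by exact: ip_ge0.
have mp: measurable3 p by exact: continuous_measurable3 (smooth_cont sp).
have mps: measurable3 (fun x=> p (x+v)) by exact: measurableT_comp mp (measurable_shift3 v).
pose A: set (R3 R):= [set x | `|x| <= N] `\` Om.
have mA: measurable (A: set T3).
 apply: measurableD=> //; apply: closed_measurable3.
 apply: (closed_comp (f:= fun x: R3 R=> `|x|) (D:= [set t | t <= N])); last exact: closed_le.
 by move=> x _; exact: norm_continuous.
have inc:= increment_bound (A:= B) (A':= A) sp mB mA (v:= v) (fun x s Bx s01=> seg x s Bx s01).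
pose a j:= vcomp (remn (ccurl eta)) j.
have sa j: sqint mu (a j) /\ \int[mu]_x (a j x^+2) <= L^+2 * I2:= remn_bound j te.
have le1: (\int[mu]_(x in A) (dirder v p x^+2)%:E <= (9 * `|v| ^+ 2 * L^+2 * I2)%:E)%E.
 pose w x:= 3 * `|v| ^+ 2 * (a 0 x^+2+a 1 x^+2+a 2 x^+2).
 have iw: mu.-integrable setT (EFin \o w).
  apply: rintegrableZ=> //; apply: rintegrableD=> //; last exact: (sa 2).1.2.
  by apply: rintegrableD=> //; [exact: (sa 0).1.2|exact: (sa 1).1.2].
 have w0 x: 0 <= w x by rewrite !mulr_ge0// ?sqr_ge0// !addr_ge0 ?sqr_ge0.
 have mw: measurable3 w by case/integrableP: iw=> /measurable_EFinP.
 have E: \int[mu]_x w x <= 9 * `|v| ^+ 2 * L^+2 * I2.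
  have i3:= rintegrableD measurableT (sa 0).1.2 (sa 1).1.2.
  have i4:= rintegrableD measurableT i3 (sa 2).1.2.
  rewrite /w RintegralZl// RintegralD//; last exact: (sa 2).1.2.
  rewrite RintegralD//; [|exact: (sa 0).1.2|exact: (sa 1).1.2].
  have v0: 0 <= 3 * `|v| ^+ 2 by rewrite mulr_ge0 ?sqr_ge0.
  have:= lerD (lerD (sa 0).2 (sa 1).2) (sa 2).2=> /(ler_wpM2l v0) hh.
  by apply: le_trans hh _; rewrite le_eqVlt; apply/orP; left; apply/eqP; ring.
 apply: (@le_trans _ _ (\int[mu]_x (w x)%:E)%E); last first.
  by rewrite -lee_fin in E; apply: le_trans E; rewrite /Rintegral fineK//; exact: integrable_fin_num.
 rewrite integral_mkcond; apply: ge0_le_integral=> //.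
 - by move=> x _; rewrite patchE; case: ifP=> //; rewrite lee_fin sqr_ge0.
 - apply/(measurable_restrictT _ mA); apply: measurable_funTS; apply/measurable_EFinP; apply: measurable_funX.
  exact: continuous_measurable3 (smooth_cont (smooth_dirder v sp)).
 - exact/measurable_EFinP.
 - move=> x _; rewrite patchE; case: ifPn=> [/set_mem[xN nO]|_]; last by rewrite lee_fin.
  rewrite lee_fin /dirder sum3E !(pot_partial _ te xN).
  have z j: vcomp eta j x = 0:= test_outside (te j) nO.
  rewrite !z !sub0r /w -/(a 0) -/(a 1) -/(a 2).
  have b j:= coord_le j v.
  exact: lin3_sqr (b 0) (b 1) (b 2).
have le2: (\int[mu]_(x in B) (p (x+v)^+2)%:E <= \int[mu]_(x in B') (p x^+2)%:E)%E.
 rewrite [leRHS]integral_mkcond -[leRHS](@integralE_shift R v); last first.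
  apply/(measurable_restrictT _ mB'); apply: measurable_funTS; apply/measurable_EFinP; exact: measurable_funX.
 rewrite integral_mkcond; apply: ge0_le_integral=> //.
 - by move=> x _; rewrite patchE; case: ifP=> //; rewrite lee_fin sqr_ge0.
 - apply/(measurable_restrictT _ mB); apply: measurable_funTS; apply/measurable_EFinP; exact: measurable_funX.
 - apply: (@measurableT_comp _ _ _ _ _ _ (((fun x=> (p x^+2)%:E) \_ B'): T3 -> \bar R) _ (fun x: T3=> x+v)); last exact: measurable_shift3.
  apply/(measurable_restrictT _ mB'); apply: measurable_funTS; apply/measurable_EFinP; exact: measurable_funX.
 - move=> x _; rewrite !patchE; case: ifPn=> [/set_mem Bx|_]; first by rewrite mem_set//; exact: BB'.
  by case: ifP=> _ //; rewrite lee_fin sqr_ge0.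
have le3:= le_trans le2 (hC eta te).
have le4:= le_trans inc le1.
apply: (@le_trans _ _ (\int[mu]_(x in B) (2 * p (x+v)^+2+2 * (p (x+v)-p x)^+2)%:E)%E).
 apply: ge0_le_integral=> //.
 - by move=> x _; rewrite lee_fin sqr_ge0.
 - by apply: measurable_funTS; apply/measurable_EFinP; exact: measurable_funX.
 - apply: measurable_funTS; apply/measurable_EFinP; apply: measurable_funD; apply: measurable_funM=> //; apply: measurable_funX=> //.
  exact: measurable_funB.
 - move=> x _; rewrite lee_fin; exact: sqr_le_shift.
under eq_integral=> x _ do rewrite EFinD EFinM [X in (_ + X)%E]EFinM.
rewrite ge0_integralD//; first last.
- apply: measurable_funTS; apply: measurable_funeM; apply/measurable_EFinP; apply: measurable_funX; exact: measurable_funB.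
- by move=> x _; rewrite -EFinM lee_fin mulr_ge0// sqr_ge0.
- by apply: measurable_funTS; apply: measurable_funeM; apply/measurable_EFinP; exact: measurable_funX.
- by move=> x _; rewrite -EFinM lee_fin mulr_ge0// sqr_ge0.
rewrite !ge0_integralZl//; first last.
- by move=> x _; rewrite lee_fin sqr_ge0.
- by apply: measurable_funTS; apply/measurable_EFinP; exact: measurable_funX.
- by move=> x _; rewrite lee_fin sqr_ge0.
- by apply: measurable_funTS; apply/measurable_EFinP; apply: measurable_funX; exact: measurable_funB.
have t0: (0 <= 2%:E :> \bar R)%E by rewrite lee_fin.
apply: le_trans (leeD (lee_pmul2l_le t0 le3) (lee_pmul2l_le t0 le4)) _.
rewrite -/I2 -!EFinM -EFinD lee_fin le_eqVlt; apply/orP; left; apply/eqP; ring.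
Qed.

Definition good x:= exists2 r: R, 0 < r & good_set (oball x r `\` Om).

Let mdiff x r: measurable (oball x r `\` Om: set T3).
by apply: measurableD=> //; exact: open_measurable3 (@oball_open _ x r). Qed.

(** The potential is zero near a point lying strictly below the domain. *)
Lemma good_low m x: (forall y, Om y -> m <= coord 2 y) -> coord 2 x < m -> good x.
move=> hm xm; exists (m-coord 2 x); first by rewrite subr_gt0.
split=> //; exists 0=> // eta te; rewrite mul0r integral0_eq// => y [yx _].
rewrite /pot ray_average0 ?mulr0 ?expr0n// => s /andP[s0 s1].
rewrite (test_outside (te 2))// => /hm.
rewrite coordD coordZ /down coordZ coord_e eqxx mulr1 mulrN.
have: 0 <= s * L by rewrite mulr_ge0// /L /N; move: M0; lra.
have:= le_lt_trans (coord_le 2 (y-x)) yx; rewrite coordB=> /ltr_normlW.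
by move: (coord _ _) (coord _ _) (s * L)=> *; lra.
Qed.

Lemma boundary_norm x: boundary Om x -> `|x| <= M.
case=> cx _; apply/ler_addgt0Pl=> e e0.
have [y [/OM/cubeE yM yx]]:= iffLR (closure3P _ _) cx e e0.
have: `|x| <= `|y| + `|y-x| by rewrite -{1}(subKr y x); exact: ler_normB.
by move: yM yx; move: `|y| `|y-x| `|x| => *; lra.
Qed.

Let Dif (B: set (R3 R)) v: set (R3 R):= [set z | B (z-v)].

Let measurable_Dif (B: set (R3 R)) v: measurable (B: set T3) -> measurable (Dif B v: set T3).
move=> mB; have:= @measurable_shift3 R (- v) measurableT _ mB; rewrite setTI.
by congr (measurable _); apply/seteqP; split.
Qed.

(** Near a boundary point any two boundary points are joined by a three-leg
  path outside the domain: down along the chart, across, and back up. *)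
Lemma good_near x0: lipschitz_boundary Om -> boundary Om x0 -> exists2 rho: R, 0 < rho &
 forall x y, oball x0 rho x -> oball x0 rho y -> ~ Om x -> ~ Om y -> good y -> good x.
move=> LO bx0; have [G [d [K [r [r0 K1 GK Gd GO]]]]]:= lipschitz_chart LO bx0.
have x0M:= boundary_norm bx0.
pose q:= 1+K * `|d|; have q0: 0 < q by rewrite ltr_pwDl// mulr_ge0//; apply: le_trans K1.
pose rho:= Num.min r 1/(8 * q).
have m0: 0 < Num.min r 1 by rewrite lt_min r0 ltr01.
have rho0: 0 < rho by rewrite divr_gt0// mulr_gt0.
exists rho=> // x y xx yx nOx nOy [ry ry0 gy].
have small z: `|z-x0| <= 4 * rho * q -> `|z-x0| < r /\ `|z| <= N.
 have ->: 4 * rho * q = Num.min r 1/2 by rewrite /rho; field; rewrite gt_eqF.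
 move=> h; have: `|z-x0| < Num.min r 1 by apply: le_lt_trans h _; move: m0; lra.
 rewrite lt_min=> /andP[h1 h2]; split=> //.
 have: `|z| <= `|z-x0| + `|x0| by rewrite -{1}(subrK x0 z); exact: ler_normD.
 by rewrite /N; move: h2 x0M M0; move: `|z| `|z-x0| `|x0| => *; lra.
have oGx z: `|z-x0| <= 4 * rho * q -> G z <= 0 -> `|z| <= N /\ ~ Om z.
 by move=> /small[h1 h2] Gz; split=> // /(GO z h1); rewrite ltNge Gz.
have K0: 0 <= K by apply: le_trans K1.
have Kd0: 0 <= K * `|d| by rewrite mulr_ge0.
have q1: 1 <= q by rewrite lerDl.
have Gneg z: `|z-x0| <= 2 * rho -> ~ Om z -> G z <= 0.
 move=> zx nOz; rewrite leNgt; apply/negP=> hG; apply: nOz.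
 have [h1 _]: `|z-x0| < r /\ `|z| <= N.
  by apply: small; apply: le_trans zx _; have:= ler_wpM2l (ltW rho0) q1; move: rho0; lra.
 exact/(GO z h1).
have rr: rho <= 2 * rho by move: rho0; lra.
have Gy: G y <= 0 by apply: Gneg=> //; exact: le_trans (ltW yx) rr.
pose s:= Num.min rho (ry/(2 * q)).
have s0: 0 < s by rewrite lt_min rho0 divr_gt0// mulr_gt0.
have srho: s <= rho by rewrite ge_min lexx.
have sry: s * (2 * q) <= ry.
 by rewrite -ler_pdivlMr ?mulr_gt0// ge_min lexx orbT.
pose h:= 2 * K * rho.
have h0: 0 <= h by apply: mulr_ge0; [exact: mulr_ge0|exact: ltW].
pose v1: R3 R:= (- h) *: d; pose v2: R3 R:= y-x; pose v3: R3 R:= (h-K * s) *: d.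
have hd: h * `|d| <= 2 * rho * (K * `|d|) by rewrite /h le_eqVlt; apply/orP; left; apply/eqP; ring.
have Ks: K * s <= h by rewrite /h; have:= ler_wpM2l K0 srho; have:= mulr_ge0 K0 (ltW rho0); lra.
have Ks0: 0 <= K * s by rewrite mulr_ge0// ltW.
have v2n: `|v2| <= 2 * rho.
 have:= ler_distD x0 y x; rewrite (distrC x0).
 by move: (ltW xx) (ltW yx); move: `|y-x0| `|x-x0| `|y-x| => *; lra.
have v1n (t: R): 0 <= t <= 1 -> `|t *: v1| <= 2 * rho * (K * `|d|).
 move=> /andP[t0 t1]; rewrite scalerA normrZ; apply: le_trans hd.
 by rewrite normrM normrN !ger0_norm// ler_wpM2r// ler_piMl.
have v2n' (t: R): 0 <= t <= 1 -> `|t *: v2| <= 2 * rho.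
 by move=> /andP[t0 t1]; rewrite normrZ ger0_norm//; apply: le_trans v2n; rewrite ler_piMl.
have v3n (t: R): 0 <= t <= 1 -> `|t *: v3| <= 2 * rho * (K * `|d|).
 move=> /andP[t0 t1]; rewrite scalerA normrZ; apply: le_trans hd.
 rewrite normrM !ger0_norm ?subr_ge0// ler_wpM2r//.
 by apply: le_trans (_: h-K * s <= h); [rewrite ler_piMl ?subr_ge0//|lra].
have i1: 0 <= (1: R) <= 1 by rewrite ler01 lexx.
have i0: 0 <= (0: R) <= 1 by rewrite ler01 lexx.
have near0 z: (oball x s `\` Om) z -> [/\ `|z-x| < s, `|z-x0| <= 2 * rho & G z <= 0].
 case=> zs nOz; have zx0: `|z-x0| <= 2 * rho.
  apply: le_trans (ler_distD x _ _) _; move: (ltW zs) (ltW xx) srho.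
  by move: `|z-x| `|x-x0| => *; lra.
 by split=> //; exact: Gneg.
have tri z (t1 t2 t3: R): `|z-x0| <= 2 * rho -> 0 <= t1 <= 1 -> 0 <= t2 <= 1 -> 0 <= t3 <= 1 ->
  `|z+t1 *: v1+t2 *: v2+t3 *: v3-x0| <= 4 * rho * q.
 move=> zx h1 h2 h3; rewrite !(addrAC _ _ (- x0)).
 have ->: 4 * rho * q = 2 * rho+2 * rho * (K * `|d|)+2 * rho+2 * rho * (K * `|d|).
  by rewrite /q; ring.
 apply: le_trans (ler_normD _ _) _; apply: lerD; last exact: v3n.
 apply: le_trans (ler_normD _ _) _; apply: lerD; last exact: v2n'.
 by apply: le_trans (ler_normD _ _) _; apply: lerD=> //; exact: v1n.
have G1 z (t: R): G (z+t *: v1) = G z-t * h by rewrite /v1 scalerA Gd mulrN.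
have G3 z (t: R): G (z+t *: v3) = G z+t * (h-K * s) by rewrite /v3 scalerA Gd.
have leg1 z (t: R): (oball x s `\` Om) z -> 0 <= t <= 1 -> `|z+t *: v1| <= N /\ ~ Om (z+t *: v1).
 case/near0=> _ zx Gz t01; apply: oGx.
  by have:= tri z t 0 0 zx t01 i0 i0; rewrite !scale0r !addr0.
 by rewrite G1; case/andP: t01=> t0 _; have:= mulr_ge0 t0 h0; move: Gz; move: (t * h) (G z)=> *; lra.
have leg2 z (t: R): (oball x s `\` Om) z -> 0 <= t <= 1 -> `|z+v1+t *: v2| <= N /\ ~ Om (z+v1+t *: v2).
 case/near0=> _ zx Gz t01; apply: oGx.
  by have:= tri z 1 t 0 zx i1 t01 i0; rewrite scale0r addr0 scale1r.
 have:= GK (z+v1+t *: v2) (z+v1); rewrite [_ - (z+v1)]addrC addKr.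
 have:= G1 z 1; rewrite scale1r mul1r=> ->; have:= ler_wpM2l K0 (v2n' t t01).
 rewrite /h (_: 2 * K * rho = K * (2 * rho)); last by ring.
 move=> k1 /ler_normlW k2; move: Gz k1 k2.
 by move: (G (_ + _)) (G z) (K * `|_|) (K * (2 * rho))=> *; lra.
have leg3 z (t: R): (oball x s `\` Om) z -> 0 <= t <= 1 -> `|z+v1+v2+t *: v3| <= N /\ ~ Om (z+v1+v2+t *: v3).
 case/near0=> zs zx Gz t01; apply: oGx.
  by have:= tri z 1 1 t zx i1 i1 t01; rewrite !scale1r.
 rewrite G3 (addrAC z); have:= G1 (z+v2) 1; rewrite scale1r mul1r=> ->.
 have:= GK (z+v2) y; rewrite (_: z+v2-y = z-x); last first.
  by rewrite /v2 addrAC addrA subrK.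
 have:= ler_wpM2l K0 (ltW zs); case/andP: t01=> t0 t1 k1 /ler_normlW k2.
 have: 0 <= (1-t) * (h-K * s) by rewrite mulr_ge0 ?subr_ge0.
 rewrite mulrBl mul1r; move: Gy k1 k2.
 by move: (t * (h-K * s)) (G y) (G (z+v2)) (K * `|z-x|) (K * s)=> *; lra.
have B0m:= mdiff x s.
have g3: good_set (oball y ry `\` Om) by [].
have g2: good_set (Dif (Dif (oball x s `\` Om) v1) v2).
 apply: (@good_transport _ _ v3 _ g3); first by do 2 apply: measurable_Dif.
 - move=> w t Bw t01; have:= leg3 (w-v2-v1) t Bw t01.
  by rewrite subrK subrK.
 - move=> w Bw; have [zs _ _]:= near0 _ Bw.
  have [_]:= leg3 (w-v2-v1) 1 Bw i1; rewrite !subrK scale1r=> nO; split=> //.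
  rewrite /oball/= (_: _ - y = (w-v2-v1-x)+(- (K * s)) *: d); last first.
   rewrite /v3 scalerBl /v1 /v2 !scaleNr opprK opprB.
   move: (h *: d) ((K * s) *: d)=> e k.
   rewrite (addrAC _ e (- x)) !addrA (addrAC _ (- y) (- x)) addrK.
   by rewrite (addrAC _ (- k) (- y)) (addrAC _ e (- y)).
  apply: le_lt_trans (ler_normD _ _) _; rewrite normrZ normrN ger0_norm//.
  have: s * q < ry by move: sry ry0; lra.
  by rewrite /q mulrDr mulr1 mulrCA mulrA; move: zs; move: `|_ - x| (K * s * `|d|)=> *; lra.
have g1: good_set (Dif (oball x s `\` Om) v1).
 apply: (@good_transport _ _ v2 _ g2); first exact: measurable_Dif.
 - by move=> w t Bw t01; have:= leg2 (w-v1) t Bw t01; rewrite subrK.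
 - by move=> w Bw; rewrite /Dif/= addrK.
exists s=> //; apply: (@good_transport _ _ v1 B0m g1).
- by move=> w t Bw t01; exact: leg1.
- by move=> w Bw; rewrite /Dif/= addrK.
Qed.

Lemma small_e i (r: R): 0 < r -> `|(r/2) *: e_ i: R3 R| < r.
move=> r0; rewrite normrZ ger0_norm ?divr_ge0 ?ltW//.
have e1: `|e_ i: R3 R| <= 1.
 by rewrite /e_ /Num.norm/= /Num.norm/= !ge_max !normr_nat !lern1 !leq_b1.
by have:= ler_wpM2l (ltW r0) e1; move: r0; move: `|e_ i: R3 R| => *; lra.
Qed.

Lemma boundary_good: Om !=set0 -> lipschitz_boundary Om -> connected (boundary Om) ->
 forall x, boundary Om x -> good x.
case=> o Oo LO cO.
have nOb x: boundary Om x -> ~ Om x by case=> _ nI; rewrite -(interior_open oO).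
have near x0: boundary Om x0 -> exists rho: R, 0 < rho /\
 forall x y, oball x0 rho x -> oball x0 rho y -> ~ Om x -> ~ Om y -> good y -> good x.
 by move=> /(good_near LO)[rho r0 h]; exists rho.
have [x0 bx0 gx0]: exists2 x0, boundary Om x0 & good x0.
 have cl: compact (closure Om).
  apply: (@compact3 R _ M); first exact: closed_closure.
  move=> x cx; apply/cubeE; apply/ler_addgt0Pl=> e e0.
  have [y [/OM/cubeE yM yx]]:= iffLR (closure3P _ _) cx e e0.
  have: `|x| <= `|y| + `|y-x| by rewrite -{1}(subKr y x); exact: ler_normB.
  by move: yM yx; move: `|y| `|y-x| `|x| => *; lra.
 have [||x0 /set_mem cx0 hx0]:= @compact_EVT_min _ R (coord 2) _ _ cl.
 - by exists o; exact: subset_closure.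
 - by apply: continuous_subspaceT; exact: continuous_coord.
 have low y: Om y -> coord 2 x0 <= coord 2 y by move=> Oy; apply: hx0; apply/mem_set; exact: subset_closure.
 have out (t: R): 0 < t -> coord 2 (x0-t *: e_ 2) < coord 2 x0.
  by move=> t0; rewrite coordB coordZ coord_e mulr1; move: t0; lra.
 have nO: ~ Om x0.
  move=> Ox; have [r r0 hr]:= iffLR (open3P Om) oO x0 Ox.
  have /low: Om (x0-(r/2) *: e_ 2).
   by apply: hr; rewrite addrAC subrr sub0r normrN; exact: small_e.
  by rewrite leNgt out// divr_gt0.
 have bx0: boundary Om x0 by split=> // /interior_subset.
 exists x0=> //; have [rho [r0 h]]:= near x0 bx0.
 pose y:= x0-(rho/2) *: e_ 2.
 have yl: coord 2 y < coord 2 x0 by apply: out; rewrite divr_gt0.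
 apply: (h x0 y); [exact: oball_self| |by []| |exact: good_low low yl].
 - by rewrite /oball/= /y addrAC subrr sub0r normrN; exact: small_e.
 - by move=> /low; rewrite leNgt yl.
have NP x: boundary Om x -> exists rho: R, boundary Om x /\ 0 < rho /\
 forall z y, oball x rho z -> oball x rho y -> ~ Om z -> ~ Om y -> good y -> good z.
 by move=> bx; have [rho [? ?]]:= near x bx; exists rho.
pose U (S: set (R3 R)):= \bigcup_(xr in [set xr: R3 R * R | [/\ boundary Om xr.1, S xr.1, 0 < xr.2 &
 forall z y, oball xr.1 xr.2 z -> oball xr.1 xr.2 y -> ~ Om z -> ~ Om y -> good y -> good z]]) oball xr.1 xr.2.
have oU S: open (U S) by apply: bigcup_open=> xr _; exact: oball_open.
have inU (S: set (R3 R)) x: boundary Om x -> S x -> U S x.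
 move=> bx Sx; have [rho [_ [r0 h]]]:= NP x bx.
 by exists (x, rho); [split|exact: oball_self].
have E: boundary Om `&` good = boundary Om.
 apply: cO; first by exists x0.
 - exists (U good)=> //; apply/seteqP; split=> x [bx gx]; split=> //; first exact: inU.
  case: gx=> -[z rho] [/= bz gz r0 h] xz.
  by apply: (h x z)=> //; [exact: oball_self|exact: nOb|exact: nOb].
 - exists (~` U (~` good)); first exact: open_closedC.
  apply/seteqP; split=> x [bx gx]; split=> //.
   case=> -[z rho] [/= bz gz r0 h] xz; apply: gz.
   by apply: (h z x)=> //; [exact: oball_self|exact: nOb|exact: nOb].
  by apply: contrapT=> ngx; apply: gx; exact: inU.
by move=> x bx; move: (bx); rewrite -E=> -[].
Qed.

End RayPotential.

(** * Reflection across the boundary *)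

Section Disintegration.
Context {R: realType}.
Notation T3:= (space3 R).
Notation T1:= (measurableTypeR R).
Notation mu:= (@lebesgue3 R).
Notation leb1:= (@lebesgue_measure R).
Implicit Types (x y z d: R3 R).

Lemma measurable_line dZ (Z: measurableType dZ) (g: Z -> T3) (h: Z -> T1) d :
 measurable_fun setT g -> measurable_fun setT h -> measurable_fun setT ((fun p=> g p+h p *: d): Z -> T3).
move=> mg mh; case: d=> -[a b] c.
have A (f: Z -> T1) (t: R): measurable_fun setT f -> measurable_fun setT ((fun p=> f p+h p * t): Z -> T1).
 by move=> mf; apply: measurable_funD=> //; exact: measurable_funM.
have g1:= measurableT_comp (f:= fst) measurable_fst mg.
apply: (@measurable_fun_pair _ _ _ _ _ _ (fun p: Z=> ((g p).1.1+h p * a, (g p).1.2+h p * b))).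
 apply: measurable_fun_pair.
 - exact: (A (fun p=> (g p).1.1) a (measurableT_comp (f:= fst) measurable_fst g1)).
 - exact: (A (fun p=> (g p).1.2) b (measurableT_comp (f:= snd) measurable_snd g1)).
exact: (A (fun p=> (g p).2) c (measurableT_comp (f:= snd) measurable_snd mg)).
Qed.

Variables (G: R3 R -> R) (d: R3 R).
Hypothesis mG: measurable_fun (setT: set T3) (G: T3 -> T1).
Hypothesis Gd: forall x (t: R), G (x+t *: d) = G x+t.

(** Space is foliated by the lines of direction d, each parametrized by the
  value of G and counted by the points where G lies in the unit interval. *)
Lemma disintegration (F: R3 R -> \bar R): measurable_fun (setT: set T3) (F: T3 -> \bar R) ->
 (forall x, 0 <= F x)%E ->
 (\int[mu]_x F x = \int[mu]_x \int[leb1]_t ((\1_(`[0%R, 1%R[%classic: set R) (G x))%:E * F (x+(t-G x)%R *: d)%R))%E.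
move=> mF F0; pose I: R -> R:= \1_(`[0%R, 1%R[%classic: set R).
have mI: measurable_fun (setT: set T1) (I: T1 -> R) by apply: measurable_indic; exact: measurable_itv.
have I0 t: (0 <= (I t)%:E)%E by rewrite lee_fin /I indicE.
have mIG: measurable_fun (setT: set T3) (fun x: T3=> (I (G x))%:E).
 apply/measurable_EFinP; exact: measurableT_comp mI mG.
have ms: measurable_fun (setT: set (T3 * T1)) ((fun p=> p.1+p.2 *: d): T3 * T1 -> T3).
 by apply: measurable_line; [exact: measurable_fst|exact: measurable_snd].
have S x: (\int[leb1]_t ((I (G x))%:E * F (x+(t-G x)%R *: d)%R) =
      \int[leb1]_t ((I (G x))%:E * F (x+t *: d)%R))%E.
 rewrite -(@integral_shift1 R (- G x) (fun t=> ((I (G x))%:E * F (x+t *: d)%R)%E))//.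
  apply: measurable_funeM; apply: (@measurableT_comp _ _ _ _ _ _ (F: T3 -> \bar R) _ (fun t: T1=> (x+t *: d: T3)))=> //.
  by apply: measurable_line.
 by move=> t; rewrite mule_ge0.
under [RHS]eq_integral=> x _ do rewrite S.
have mFs: measurable_fun (setT: set (T3 * T1)) (fun p: T3 * T1=> ((I (G p.1))%:E * F (p.1+p.2 *: d)%R)%E).
 apply: emeasurable_funM; first exact: measurableT_comp mIG measurable_fst.
 exact: measurableT_comp mF ms.
rewrite -(@tonelli_swap R _ _ leb1 (fun p=> ((I (G p.1))%:E * F (p.1+p.2 *: d)%R)%E)) /=; last 2 first.
- exact: mFs.
- by move=> p; rewrite mule_ge0.
have S2 (s: R): (\int[mu]_x ((I (G x))%:E * F (x+s *: d)%R) = \int[mu]_x ((I (G x-s)%R)%:E * F x))%E.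
 rewrite -(@integralE_shift R (s *: d) (fun x=> ((I (G x-s)%R)%:E * F x)%E)); last first.
  apply: emeasurable_funM=> //; apply/measurable_EFinP; apply: measurableT_comp mI _.
  exact: measurable_funB.
 by apply: eq_integral=> x _; rewrite Gd addrK.
under [RHS]eq_integral=> s _ do rewrite S2.
rewrite (@tonelli_swap R _ _ leb1 (fun p=> ((I (G p.1-p.2)%R)%:E * F p.1)%E)) /=; last 2 first.
- apply: emeasurable_funM; last exact: measurableT_comp mF measurable_fst.
 apply/measurable_EFinP; apply: measurableT_comp mI _; apply: measurable_funB; last exact: measurable_snd.
 exact: measurableT_comp mG measurable_fst.
- by move=> p; rewrite mule_ge0.
apply: eq_integral=> x _.
have mIs: measurable_fun (setT: set T1) (fun s: T1=> (I (G x-s)%R)%:E).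
 apply/measurable_EFinP; apply: measurableT_comp mI _; exact: measurable_funB.
under eq_integral=> s _ do rewrite muleC.
rewrite ge0_integralZl//.
have ->: (\int[leb1]_s (I (G x-s)%R)%:E = \int[leb1]_s (I s)%:E)%E.
 rewrite -(@integral_reflect1 R (fun s=> (I s)%:E))//; last exact/measurable_EFinP.
 rewrite -(@integral_shift1 R (- G x) (fun s=> (I (- s))%:E))//.
  by apply: eq_integral=> s _; rewrite opprD opprK addrC.
 by apply/measurable_EFinP; apply: measurableT_comp mI _; exact: measurable_funN.
rewrite integral_indic//.
have l1: (leb1 (`[0%R, 1%R[%classic: set R) = 1)%E by rewrite lebesgue_measure_itv/= lte_fin ltr01 sube0.
by rewrite setIT [X in (_ * X)%E](_: _ = 1%E) ?mule1.
Qed.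

Let mshift (h: R3 R -> R): measurable3 h ->
 measurable_fun (setT: set T3) ((fun x=> x+h x *: d): T3 -> T3).
by move=> mh; apply: measurable_line.
Qed.

Lemma measurable_pos: measurable ([set x | 0 < G x]: set T3).
have:= mG measurableT (measurable_itv `]0, +oo[); rewrite setTI; congr (measurable _).
by apply/seteqP; split=> x; rewrite /= in_itv/= andbT.
Qed.

Lemma measurable_neg: measurable ([set x | G x < 0]: set T3).
have:= mG measurableT (measurable_itv `]-oo, 0[); by rewrite setTI; congr (measurable _).
Qed.

(** Reflection in the level set of G preserves volume. *)
Lemma reflection (f: R3 R -> R): measurable3 f -> (forall x, 0 <= f x) ->
 (\int[mu]_(x in [set x | (0 < G x)%R]) (f (x+(- 2 * G x) *: d)%R)%:E = \int[mu]_(x in [set x | (G x < 0)%R]) (f x)%:E)%E.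
move=> mf f0.
have mP:= measurable_pos; have mN:= measurable_neg.
have m2: measurable_fun (setT: set T3) ((fun x=> f (x+(- 2 * G x) *: d)): T3 -> R).
 by apply: measurableT_comp mf (mshift _); exact: measurable_funM.
rewrite [LHS]integral_mkcond [RHS]integral_mkcond.
rewrite (disintegration (F:= _ \_ [set x | 0 < G x])); last 2 first.
- by apply/(measurable_restrictT _ mP); apply: measurable_funTS; exact/measurable_EFinP.
- by move=> x; rewrite patchE; case: ifP=> // _; rewrite lee_fin.
rewrite (disintegration (F:= _ \_ [set x | G x < 0])); last 2 first.
- by apply/(measurable_restrictT _ mN); apply: measurable_funTS; exact/measurable_EFinP.
- by move=> x; rewrite patchE; case: ifP=> // _; rewrite lee_fin.
apply: eq_integral=> x _; set J:= (_ (G x))%:E.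
pose h (t: R):= (J * ((fun y=> (f y)%:E) \_ [set y | (G y < 0)%R]) (x+(t-G x)%R *: d)%R)%E.
rewrite -[RHS](@integral_reflect1 R h); last 2 first.
- rewrite /h; apply: measurable_funeM.
 apply: (@measurableT_comp _ _ _ _ _ _ (((fun y=> (f y)%:E) \_ [set y | (G y < 0)%R]): T3 -> \bar R) _ (fun t: T1=> x+(t-G x) *: d)).
  by apply/(measurable_restrictT _ mN); apply: measurable_funTS; exact/measurable_EFinP.
 by apply: measurable_line=> //; exact: measurable_funB.
- move=> t; rewrite /h mule_ge0//; first by rewrite /J lee_fin indicE.
 by rewrite patchE; case: ifP=> // _; rewrite lee_fin.
apply: eq_integral=> t _; rewrite /h; congr (_ * _)%E.
have E (s: R): G (x+(s-G x) *: d) = s by rewrite Gd addrC subrK.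
rewrite !patchE; have ->: (x+(t-G x) *: d \in [set y | 0 < G y]) = (0 < t).
 by apply/idP/idP=> [/set_mem|h0]; [|apply/mem_set]; rewrite /= E.
have ->: (x+(- t-G x) *: d \in [set y | G y < 0]) = (0 < t).
 by apply/idP/idP=> [/set_mem|h0]; [|apply/mem_set]; rewrite /= E oppr_lt0.
case: ifP=> // _; rewrite E -addrA -scalerDl; congr (f (x + _ *: d))%:E.
by ring.
Qed.

End Disintegration.

Section DerivativeBound.
Context {R: realType}.
Notation T3:= (space3 R).
Notation mu:= (@lebesgue3 R).
Implicit Types (x y z c: R3 R) (Q k m: R3 R -> R).

Lemma average_le f (b: R) c e k: averaging c e k -> measurable3 f ->
 (exists B: R, forall z, `|f z| <= B) -> (forall z, k z != 0 -> `|f z| <= b) ->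
 `|\int[mu]_z (f z * k z)| <= b.
move=> [tk k0 k1 ks] mf [B hB] hb; have ik:= test_integrable tk.
have i1: mu.-integrable setT (EFin \o (fun z=> f z * k z)) by apply: (@rintegrable_bmul _ _ _ _ _ _ _ _ B).
apply: le_trans (le_normr_Rintegral _ i1) _=> //.
rewrite -[leRHS]mulr1 -k1 -RintegralZl//; apply: le_Rintegral=> //.
- exact: integrable_norm i1.
- exact: rintegrableZ.
- move=> z _; rewrite normrM (ger0_norm (k0 z)).
 by have [->|/hb h]:= eqVneq (k z) 0; [rewrite !mulr0|rewrite ler_wpM2r].
Qed.

(** The derivative of a smooth average is controlled by the difference
  quotients of the averaged function, even if that is not differentiable. *)
Lemma average_derivative Q m (A B delta e: R) c k i: averaging c e k -> `|c| + e <= delta ->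
 mu.-integrable setT (EFin \o Q) -> (forall z, `|Q z| <= B) -> 0 <= A ->
 (forall y (t: R), `|Q (y+t *: e_ i)-Q y| <= `|t| * (m y+A * `|t|)) ->
 (forall x y, `|m x-m y| <= A * `|x-y|) ->
 forall x, `|partial i (average Q k) x| <= m x+A * delta.
move=> ak ced iQ QB A0 hQ hm x; have [tk k0 k1 ks]:= ak.
have mQ: measurable3 Q by case/integrableP: iQ=> /measurable_EFinP.
have mQx y: measurable3 (fun z=> Q (y+z)).
 under eq_fun do rewrite addrC; exact: measurableT_comp mQ (measurable_shift3 y).
have ck: continuous k:= smooth_cont tk.1.
have ik:= test_integrable tk.
have i1 y: mu.-integrable setT (EFin \o (fun z=> Q (y+z) * k z)).
 by apply: (@rintegrable_bmul _ _ _ _ _ _ _ _ B).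
have sw:= average_smooth iQ (test_bounded_smooth tk).
have quot (t: R): t != 0 -> `|t^-1 *: (average Q k (t *: e_ i+x)-average Q k x)| <= m x+A * delta+A * `|t|.
 move=> t0; rewrite normrZ normrV ?unitfE// mulrC ler_pdivrMr ?normr_gt0//.
 rewrite !averageE// -RintegralB//.
 under eq_Rintegral=> z _ do rewrite -mulrBl.
 apply: (average_le ak); first exact: measurable_funB.
  by exists (B+B)=> z; apply: le_trans (ler_normB _ _) _; exact: lerD.
 move=> z /ks zc; rewrite (addrC (t *: _)) addrAC mulrC; apply: le_trans (hQ _ _) _.
 rewrite ler_wpM2l// lerD2r.
 have:= hm (x+z) x; rewrite addrAC subrr add0r=> /ler_normlW.
 have: A * `|z| <= A * delta.
  rewrite ler_wpM2l//; apply: le_trans ced.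
  by rewrite -[z](subrK c) (le_trans (ler_normD _ _))// addrC lerD2l ltW.
 by move: (m x) (m _) (A * _) (A * delta)=> *; lra.
have dv: derivable (average Q k) x (e_ i) by exact: smooth_der sw.
have cv: `|t^-1 *: (average Q k (t *: e_ i+x)-average Q k x)| @[t --> (0:R)^'] --> `|partial i (average Q k) x|.
 by apply: cvg_norm; exact: dv.
have cv2: m x+A * delta+A * `|t| @[t --> (0:R)^'] --> m x+A * delta.
 rewrite -[X in _ --> X]addr0 -[X in _ --> _ + X](mulr0 A); apply: cvgD; first exact: cvg_cst.
 apply: cvgM; [exact: cvg_cst|apply/cvgrPdist_lt=> r r0; near=> t].
 by rewrite sub0r normrN normr_id; near: t; exact: dnbhs0_lt.
apply: (ler_cvg_to cv cv2); near=> t; apply: quot; near: t; exact: nbhs_dnbhs_neq.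
Unshelve. all: by end_near.
Qed.

Lemma average_partial_test P k i x: test setT P -> test setT k ->
 partial i (average P k) x = average (partial i P) k x.
move=> tP tk; rewrite average_partial; [|exact: test_integrable tP|exact: test_bounded_smooth tk].
rewrite /average; have tkx:= test_translate x tk.
have F: \int[mu]_y (P y * partial i (fun z=> k (z-x)) y) = \int[mu]_y (P y * partial i k (y-x)).
 by apply: eq_Rintegral=> y _; rewrite partial_translate//; exact: tk.1.
rewrite -F; exact: (esym (@integration_by_parts R i P (fun z=> k (z-x)) tP tkx.1)).
Qed.

End DerivativeBound.
Section BoundaryExtension.
Context {R: realType}.
Notation T3:= (space3 R).
Notation mu:= (@lebesgue3 R).
Variables (Om: set (R3 R)) (M: R).
Hypothesis oO: open Om.
Hypothesis OM: Om `<=` cube M.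
Let mO: measurable (Om: set T3):= open_measurable3 oO.
Implicit Types (x y z d: R3 R) (f g p: R3 R -> R).

Lemma le_integral_support (A B: set (R3 R)) f g: measurable (A: set T3) -> measurable (B: set T3) ->
 measurable3 f -> measurable3 g ->
 (forall x, 0 <= f x) -> (forall x, 0 <= g x) ->
 (forall x, A x -> f x != 0 -> B x /\ f x <= g x) ->
 (\int[mu]_(x in A) (f x)%:E <= \int[mu]_(x in B) (g x)%:E)%E.
move=> mA mB mf mg f0 g0 h; rewrite integral_mkcond [leRHS]integral_mkcond.
apply: ge0_le_integral=> //.
- by move=> x _; rewrite patchE; case: ifP=> //; rewrite lee_fin.
- by apply/(measurable_restrictT _ mA); apply: measurable_funTS; exact/measurable_EFinP.
- by apply/(measurable_restrictT _ mB); apply: measurable_funTS; exact/measurable_EFinP.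
- move=> x _; rewrite !patchE; case: ifPn=> [/set_mem Ax|_]; last by case: ifP=> _ //; rewrite lee_fin.
 have [->|/(h x Ax)[Bx fg]]:= eqVneq (f x) 0; first by case: ifP=> _ //; rewrite lee_fin.
 by rewrite mem_set// lee_fin.
Qed.

Lemma ips_le_integral p f: L2s Om p -> measurable3 f ->
 (forall x, 0 <= f x) -> (forall x, Om x -> p x^+2 <= f x) ->
 ((ips Om p p)%:E <= \int[mu]_(x in Om) (f x)%:E)%E.
move=> lp mf f0 pf; have ip:= ips_integrable mO lp lp; have mp:= L2s_measurable mO lp.
rewrite /ips /Rintegral fineK; last exact: integrable_fin_num ip.
apply: ge0_le_integral=> //.
- by move=> x _; rewrite -expr2 lee_fin sqr_ge0.
- by apply/measurable_EFinP; exact: measurable_funM.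
- by apply: measurable_funTS; exact/measurable_EFinP.
Qed.

Lemma measure_bounded: exists2 V: R, 0 <= V & (mu Om <= V%:E)%E.
have fc:= cube_finite M; exists (fine (mu (cube M))); first exact: fine_ge0.
rewrite fineK; last by rewrite ge0_fin_numE.
by apply: le_measure=> //; rewrite inE//; exact: measurable_cube.
Qed.

Lemma test_average U P (c: R3 R) e k: test U P -> averaging c e k -> test setT (average P k).
move=> tP ak; have ik:= test_integrable tP.
have [sp [K [cK _ hK]]]:= tP; have [N N0 KN]:= compact_cube cK.
have mP: measurable3 P by exact: continuous_measurable3 (smooth_cont sp).
have cc: compact (cube (N+(`|c| + e)): set (R3 R)).
 by apply: compact_setX; [apply: compact_setX|]; exact: segment_compact.
apply: (average_test ak ik cc)=> // x nz; apply: contrapT=> nx; move/eqP: nz; apply.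
apply: (average_outside (M:= N) (d:= `|c| + e) ak _ mP (lexx _)).
 by move=> y Ny; apply: hK=> /KN/cubeE; rewrite leNgt Ny.
by rewrite ltNge; apply/negP=> /cubeE.
Qed.

Lemma sqr_sum_le (a b: R): (a+b)^+2 <= 2 * a^+2+2 * b^+2.
have:= sqr_ge0 (a-b); nra. Qed.

Lemma sqr3_le (a b c: R): (a+b+c)^+2 <= 3 * (a^+2+b^+2+c^+2).
have:= sqr_ge0 (a-b); have:= sqr_ge0 (a-c); have:= sqr_ge0 (b-c); nra. Qed.

Lemma abs3_sqr_le (l a b c: R): (l * (`|a| + `|b| + `|c|))^+2 <= 3 * l^+2 * (a^+2+b^+2+c^+2).
rewrite exprMn mulrC.
have:= sqr3_le `|a| `|b| `|c|; rewrite !real_normK ?num_real// => h.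
rewrite [X in X <= _]mulrC [X in _ <= X](_: _ = l^+2 * (3 * (a^+2+b^+2+c^+2))); last by ring.
by rewrite ler_wpM2l// sqr_ge0.
Qed.

Lemma sqr_le_of_norm (a b: R): `|a| <= b -> a^+2 <= b^+2.
move=> h; rewrite -real_normK ?num_real// ler_pXn2r ?nnegrE//.
exact: le_trans h.
Qed.

Lemma lipschitz_continuous3 p (K: R): 0 <= K -> (forall x y, `|p x-p y| <= K * `|x-y|) -> continuous p.
move=> K0 h x; apply/continuous3P=> e e0; exists (e/(K+1)); first by rewrite divr_gt0// ltr_wpDl.
move=> y; rewrite ltr_pdivlMr ?ltr_wpDl// => yx; apply: le_lt_trans (h _ _) _; apply: le_lt_trans yx.
by rewrite mulrC ler_wpM2l// lerDl.
Qed.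

Lemma ips_le_const p f (V b c: R): (mu Om <= V%:E)%E -> L2s Om p ->
 measurable3 f -> (forall x, Om x -> `|p x| <= f x+c) ->
 (\int[mu]_(x in Om) (f x^+2)%:E <= b%:E)%E -> ips Om p p <= 2 * b+2 * c^+2 * V.
move=> hV lp mf pf fb.
have c0: (0 <= (2 * c^+2)%:E)%E by rewrite lee_fin mulr_ge0// sqr_ge0.
have t0: (0 <= 2%:E :> \bar R)%E by rewrite lee_fin.
have m2: measurable3 (fun x=> f x^+2) by exact: measurable_funX.
rewrite -lee_fin; apply: le_trans (ips_le_integral (f:= fun x=> 2 * f x^+2+2 * c^+2) lp _ _ _) _.
- by apply: measurable_funD=> //; exact: measurable_funM.
- by move=> x; rewrite addr_ge0// mulr_ge0// sqr_ge0.
- by move=> x /pf/sqr_le_of_norm/le_trans; apply; exact: sqr_sum_le.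
under eq_integral=> x _ do rewrite EFinD EFinM.
have mE: measurable_fun (Om: set T3) (fun x: T3=> (f x^+2)%:E).
 by apply: measurable_funTS; exact/measurable_EFinP.
rewrite ge0_integralD//; first last.
- exact: measurable_funeM.
- by move=> x _; rewrite mule_ge0// lee_fin sqr_ge0.
rewrite ge0_integralZl//; last by move=> x _; rewrite lee_fin sqr_ge0.
have ->: ((2 * b+2 * c^+2 * V)%:E = 2%:E * b%:E+(2 * c^+2)%:E * V%:E)%E by rewrite -!EFinM -EFinD.
rewrite integral_cst//.
by apply: leeD; apply: lee_wpmul2l.
Qed.

Lemma ip_split (v a b c: vfield R) (B1 B2: R): L2 Om v -> L2 Om a -> L2 Om b -> L2 Om c -> ip Om v c = 0 ->
 ip Om (fun x=> a x-b x) (fun x=> a x-b x) <= B1 ->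
 ip Om (fun x=> b x-c x) (fun x=> b x-c x) <= B2 ->
 ip Om v a^+2 <= 2 * ip Om v v * (B1+B2).
move=> lv la lb lc z h1 h2; have l1:= L2B mO la lb; have l2:= L2B mO lb lc.
have ->: ip Om v a = ip Om v (fun x=> a x-b x)+ip Om v (fun x=> b x-c x).
 by rewrite (ipBr mO la lb lv) (ipBr mO lb lc lv) z subr0 subrK.
apply: le_trans (sqr_sum_le _ _) _; rewrite -mulrA -mulrDr ler_wpM2l// mulrDr; apply: lerD.
 by apply: le_trans (ip_CS mO lv l1) _; rewrite ler_wpM2l// ip_ge0.
by apply: le_trans (ip_CS mO lv l2) _; rewrite ler_wpM2l// ip_ge0.
Qed.

Lemma max0_dist (a b: R): `|Num.max a 0-Num.max b 0| <= `|a-b|.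
have:= ler_norm (a-b); have:= ler_norm (- (a-b)); rewrite normrN; have:= normr_ge0 (a-b).
move: `|a-b| => n n0 h1 h2; rewrite ler_norml.
by case: (leP a 0)=> ha; case: (leP b 0)=> hb; apply/andP; split; lra.
Qed.

Lemma le_eps_sqr (a b K: R): 0 <= K -> (forall delta: R, 0 < delta -> delta <= 1 -> a <= b+K * delta^+2) -> a <= b.
move=> K0 h; apply/ler_addgt0Pr=> e e0; pose t:= Num.min 1 (e/(K+1)).
have K1: 0 < K+1 by rewrite ltr_wpDl.
have t0: 0 < t by rewrite lt_min ltr01 divr_gt0.
have t1: t <= 1 by rewrite ge_min lexx.
apply: le_trans (h t t0 t1) _; rewrite lerD2l.
have te: t * (K+1) <= e by rewrite -ler_pdivlMr// ge_min lexx orbT.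
apply: le_trans te; have: t^+2 <= t by rewrite expr2 ler_piMl// ltW.
by move=> /(ler_wpM2l K0); move: t0; lra.
Qed.

Lemma cubic_bound (v: R3 R) (a t: 'I_3 -> R): `|\sum_j coord j v * (a j+t j)| <=
 `|v| * (\sum_j `|a j| + \sum_j `|t j|).
rewrite -big_split/= mulr_sumr; apply: le_trans (ler_norm_sum _ _ _) _; apply: ler_sum=> j _.
by rewrite normrM ler_pM// ?coord_le// ler_normD.
Qed.

Lemma smooth_increment P (K2: R) x v: smooth P -> (forall j x y, `|partial j P x-partial j P y| <= K2 * `|x-y|) ->
 `|P (x+v)-P x| <= `|v| * (\sum_j `|partial j P x| + 3 * K2 * `|v|).
move=> /smoothP sP hK.
have [|t /andP[t0 t1] ->]:= @smooth_on_MVT R setT P x v openT sP; first by [].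
rewrite (eq_bigr (fun j=> coord j v * (partial j P x+(partial j P (x+t *: v)-partial j P x)))); last first.
 by move=> j _; rewrite subrKC.
apply: le_trans (cubic_bound _ _ _) _; rewrite ler_wpM2l// lerD2l.
apply: (@le_trans _ _ (\sum_(j < 3) (K2 * `|v|))); last first.
 by rewrite sumr_const card_ord -[_ *+ 3]mulr_natl mulrA.
apply: ler_sum=> j _; apply: le_trans (hK _ _ _) _; rewrite addrAC subrr add0r normrZ ger0_norm//.
have K20: 0 <= K2 * `|v|.
 by have:= le_trans (normr_ge0 _) (hK j (x+v) x); rewrite addrAC subrr add0r.
by rewrite mulrCA ler_piMl.
Qed.

(** A smooth function near the boundary is compared with its reflection into
  the domain: the difference vanishes outside, hence is invisible to a
  divergence-free field, and the reflection only sees the exterior. *)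
Lemma boundary_extension x0 G d L r: boundary Om x0 -> chart Om x0 G d L r ->
 exists2 rho: R, 0 < rho & exists2 C: R, 0 <= C & forall P v (B: R),
  test (oball x0 rho) P -> L2 Om v -> weak_div Om v (fun=> 0) -> 0 <= B ->
  (forall j, (\int[mu]_(x in oball x0 rho `\` Om) (partial j P x^+2)%:E <= B%:E)%E) ->
  (ip Om v (cgrad P))^+2 <= C * ip Om v v * B.
move=> bx ch; have inw:= inward_chart oO bx ch; have Gx0:= chart_boundary oO bx ch.
have [r0 L1 GL Gd GO]:= ch; have L0: 0 <= L by apply: le_trans L1.
pose La:= 1+2 * L * `|d|.
have La1: 1 <= La by rewrite lerDl !mulr_ge0.
have La0: 0 < La by apply: lt_le_trans La1.
have La0': 0 <= La by exact: ltW.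
pose rho:= r/2/La.
have rho0: 0 < rho by rewrite !divr_gt0.
have rhoLa: rho * La = r/2 by rewrite /rho divfK// gt_eqF.
have rhor: rho <= r/2 by rewrite -rhoLa ler_peMr// ltW.
have r2r: r/2 < r by move: r0; lra.
exists rho=> //; exists (108 * La^+2); first by rewrite mulr_ge0// sqr_ge0.
move=> P v B tP lv dv B0 hB.
have sP:= tP.1; have tPT: test setT P by exact: test_sub tP.
have [V V0 hV]:= measure_bounded.
have [K2 K20 hK2]: exists2 K2: R, 0 <= K2 & forall j x y, `|partial j P x-partial j P y| <= K2 * `|x-y|.
 have bp j:= bounded_smooth_Lipschitz (bounded_smooth_partial j (test_bounded_smooth tPT)).
 have [k0 k00 h0]:= bp 0; have [k1 k10 h1]:= bp 1; have [k2 k20 h2]:= bp 2.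
 exists (k0+k1+k2)=> [|j x y]; first by rewrite !addr_ge0.
 have n0:= normr_ge0 (x-y).
 case: j=> -[|[|[|//]]] Hj.
 - have ->: Ordinal Hj = 0 by exact/val_inj.
  by apply: le_trans (h0 x y) _; rewrite ler_wpM2r// -addrA lerDl addr_ge0.
 - have ->: Ordinal Hj = 1 by exact/val_inj.
  by apply: le_trans (h1 x y) _; rewrite ler_wpM2r// addrAC lerDr addr_ge0.
 - have ->: Ordinal Hj = 2 by exact/val_inj.
  by apply: le_trans (h2 x y) _; rewrite ler_wpM2r// lerDr addr_ge0.
have cG:= lipschitz_continuous3 L0 GL.
have mG:= continuous_measurable3 cG.
pose Gp x:= Num.max (G x) 0; pose Phi x:= x+(- 2 * Gp x) *: d; pose Q x:= P (Phi x).
have GpL x y: `|Gp x-Gp y| <= L * `|x-y|.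
 by apply: le_trans (GL x y); exact: max0_dist.
have PhiL x y: `|Phi x-Phi y| <= La * `|x-y|.
 have ->: Phi x-Phi y = (x-y)+(- 2 * (Gp x-Gp y)) *: d.
  by rewrite /Phi (opprD y) addrACA -scalerBl mulrBr.
 apply: le_trans (ler_normD _ _) _; rewrite normrZ normrM normrN (ger0_norm (ler0n R 2)).
 have ->: La * `|x-y| = `|x-y| + 2 * (L * `|x-y| * `|d|) by rewrite /La; ring.
 by rewrite lerD2l -(mulrA 2) ler_wpM2l// ler_wpM2r.
pose A:= 3 * K2 * La^+2; have A0: 0 <= A by apply: mulr_ge0; [exact: mulr_ge0|exact: sqr_ge0].
pose m x:= La * \sum_j `|partial j P (Phi x)|.
have hm x y: `|m x-m y| <= A * `|x-y|.
 rewrite /m -mulrBr -sumrB normrM gtr0_norm// /A.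
 have ->: 3 * K2 * La^+2 * `|x-y| = La * (\sum_(j < 3) K2 * (La * `|x-y|)).
  by rewrite sumr_const card_ord -[_ *+ 3]mulr_natl; ring.
 rewrite ler_wpM2l//; apply: le_trans (ler_norm_sum _ _ _) _; apply: ler_sum=> j _.
 apply: le_trans (ler_dist_dist _ _) _; apply: le_trans (hK2 _ _ _) _.
 by rewrite ler_wpM2l.
have hQ i y (t: R): `|Q (y+t *: e_ i)-Q y| <= `|t| * (m y+A * `|t|).
 rewrite /Q -[Phi (_ + _)](subrKC (Phi y)); apply: le_trans (smooth_increment _ _ sP hK2) _.
 set w:= Phi (_ + _) - _.
 have wt: `|w| <= La * `|t|.
  apply: le_trans (PhiL _ _) _; rewrite addrAC subrr add0r normrZ ler_wpM2l//.
  by rewrite ler_piMr// norm_e_.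
 have s0: 0 <= \sum_j `|partial j P (Phi y)| by apply: sumr_ge0.
 apply: le_trans (ler_wpM2r _ wt) _; first by rewrite addr_ge0// !mulr_ge0.
 rewrite (mulrC La) -(mulrA `|t|) ler_wpM2l// mulrDr lerD2l /A.
 have ->: 3 * K2 * La^+2 * `|t| = La * (3 * K2 * (La * `|t|)) by ring.
 by rewrite ler_wpM2l// ler_wpM2l// mulr_ge0.
have mP: measurable3 P by exact: continuous_measurable3 (smooth_cont sP).
have cGp:= lipschitz_continuous3 L0 GpL.
have mm:= continuous_measurable3 (lipschitz_continuous3 A0 hm).
have mPhi: measurable_fun (setT: set T3) (Phi: T3 -> T3).
 by apply: measurable_line=> //; apply: measurable_funM=> //; exact: continuous_measurable3.
have mQ: measurable3 Q by exact: measurableT_comp mP mPhi.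
have [PB PB0 hPB]:= test_bounded tP.
have Phi_neg x: G x <= 0 -> Phi x = x by move=> Gx; rewrite /Phi /Gp max_r// mulr0 scale0r addr0.
have Phi_pos x: 0 <= G x -> Phi x = x+(- 2 * G x) *: d by move=> Gx; rewrite /Phi /Gp max_l.
have Psup x: oball x0 rho (Phi x) -> `|x-x0| <= r/2.
 move=> h; have GPhi: G (Phi x) = - `|G x|.
  case: (leP (G x) 0)=> Gx; first by rewrite Phi_neg// ler0_norm// opprK.
  by rewrite Phi_pos ?ltW// Gd gtr0_norm//; ring.
 have Gr: `|G x| <= L * rho.
  have:= GL (Phi x) x0; rewrite Gx0 subr0 GPhi normrN normr_id=> /le_trans; apply.
  by rewrite ler_wpM2l// ltW.
 have ->: x-x0 = (Phi x-x0)-(- 2 * Gp x) *: d by rewrite /Phi addrAC addrK.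
 apply: le_trans (ler_normB _ _) _; rewrite normrZ normrM normrN (ger0_norm (ler0n R 2)).
 have Gpx: `|Gp x| <= `|G x| by have:= max0_dist (G x) 0; rewrite maxxx !subr0.
 have ->: r/2 = rho+2 * (L * rho) * `|d| by rewrite -rhoLa /La; ring.
 apply: lerD; first exact: ltW.
 by rewrite ler_wpM2r// ler_wpM2l//; exact: le_trans Gpx Gr.
have Qsup x: Q x != 0 -> `|x-x0| <= r/2.
 move=> Qn; apply: Psup; apply: contrapT=> h; move/eqP: Qn; apply; exact: test_outside tP h.
have sqP:= test_sqint tP; have iP:= test_integrable tP.
have cub x: `|x-x0| <= r/2 -> cube (`|x0| + r/2) x.
 move=> h; apply/cubeE; rewrite -{1}(subrK x0 x) addrC.
 by apply: le_trans (ler_normD _ _) _; rewrite lerD2l.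
have mc:= measurable_cube (`|x0| + r/2).
have iQ: mu.-integrable setT (EFin \o Q).
 rewrite (_: Q = Q \_ (cube (`|x0| + r/2))); last first.
  apply/funext=> x; rewrite patchE; case: ifPn=> // nx; apply/eqP/negPn/negP=> /Qsup/cub h.
  by move/negP: nx; apply; exact/mem_set.
 rewrite -restrict_EFin -integrable_mkcond//.
 by apply: (integrable_cube (M:= `|x0| + r/2) (c:= PB))=> //; try exact: measurable_funTS; move=> x _; exact: hPB.
have sqQ: sqint mu Q.
 split=> //; under [X in _.-integrable _ (_ \o X)]eq_fun do rewrite expr2.
 by apply: (@rintegrable_bmul _ _ _ _ _ _ _ _ PB)=> // x; rewrite /Q.
pose g x:= P x-Q x.
have ig: mu.-integrable setT (EFin \o g) by exact: rintegrableB.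
have hg x: g x != 0 -> closure Om x /\ `|x-x0| <= r/2.
 move=> gn; have xr: `|x-x0| <= r/2.
  have [Q0|/Qsup//]:= eqVneq (Q x) 0; move: gn; rewrite /g Q0 subr0=> Pn.
  apply: le_trans rhor; apply: contrapT=> h; move/eqP: Pn; apply; apply: (test_outside tP)=> h'.
  by apply: h; exact: ltW.
 split=> //; apply: subset_closure; apply/GO; first exact: le_lt_trans xr r2r.
 by rewrite ltNge; apply/negP=> Gx; move/eqP: gn; apply; rewrite /g /Q Phi_neg// subrr.
have hm2: (\int[mu]_(x in Om) (m x^+2)%:E <= (9 * La^+2 * B)%:E)%E.
 pose q j x:= partial j P x^+2.
 have mq j: measurable_fun (setT: set T3) (q j: T3 -> R).
  by apply: measurable_funX; exact: continuous_measurable3 (smooth_cont (smooth_partial j sP)).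
 have mqP j: measurable3 (fun x=> q j (Phi x)) by exact: measurableT_comp (mq j) mPhi.
 have q0 j x: 0 <= q j x by exact: sqr_ge0.
 have mP0:= measurable_pos mG; have mN0:= measurable_neg mG.
 have mD: measurable (oball x0 rho `\` Om: set T3).
  by apply: measurableD=> //; exact: open_measurable3 (@oball_open _ x0 rho).
 have qz j x: q j x != 0 -> oball x0 rho x.
  move=> qn; apply: contrapT=> h; move/eqP: qn; apply.
  by rewrite /q (test_outside (test_partial j tP) h) expr0n.
 have qB j: (\int[mu]_(x in Om) (q j (Phi x))%:E <= B%:E)%E.
  apply: le_trans (hB j).
  apply: (@le_trans _ _ (\int[mu]_(x in [set x | (0 < G x)%R]) (q j (x+(- 2 * G x) *: d)%R)%:E)%E).
   have mR: measurable_fun (setT: set T3) ((fun x=> q j (x+(- 2 * G x) *: d)): T3 -> R).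
    by apply: (measurableT_comp (mq j)); apply: measurable_line=> //; exact: measurable_funM.
   apply: le_integral_support=> //.
   move=> x Ox qn; have Gx: 0 < G x.
    rewrite ltNge; apply/negP=> Gx; move: qn; rewrite Phi_neg// => /qz xr.
    have:= iffLR (GO x (lt_le_trans xr (le_trans rhor (ltW r2r)))) Ox.
    by rewrite ltNge Gx.
   by split=> //; rewrite Phi_pos//; exact: ltW.
  rewrite (reflection mG Gd)//; apply: (@le_integral_support _ _ (q j) (q j))=> //  x Gx /qz xr; split=> //.
  split=> // /(GO x (lt_le_trans xr (le_trans rhor (ltW r2r)))).
  by rewrite ltNge ltW.
 have mE j: measurable_fun (Om: set T3) (fun x: T3=> (q j (Phi x))%:E).
  by apply: measurable_funTS; exact/measurable_EFinP.
 apply: (@le_trans _ _ (\int[mu]_(x in Om) ((3 * La^+2)%:E * ((q 0 (Phi x))%:E+(q 1 (Phi x))%:E+(q 2 (Phi x))%:E)))%E).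
  apply: ge0_le_integral=> //.
  - by move=> x _; rewrite lee_fin sqr_ge0.
  - by apply: measurable_funTS; apply/measurable_EFinP; exact: measurable_funX.
  - by apply: measurable_funeM; do !apply: emeasurable_funD.
  - by move=> x _; rewrite -!EFinD -EFinM lee_fin /m sum3E; exact: abs3_sqr_le.
 have la0: (0 <= (3 * La^+2)%:E)%E by rewrite lee_fin mulr_ge0// sqr_ge0.
 rewrite ge0_integralZl//; first last.
 - by move=> x _; rewrite !adde_ge0// lee_fin.
 - by do !apply: emeasurable_funD.
 rewrite ge0_integralD//; first last.
 - by move=> x _; rewrite lee_fin.
 - by apply: emeasurable_funD.
 - by move=> x _; rewrite !adde_ge0// lee_fin.
 rewrite ge0_integralD//; try by move=> x _; rewrite lee_fin.
 apply: le_trans (lee_wpmul2l la0 (leeD (leeD (qB 0) (qB 1)) (qB 2))) _.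
 rewrite -!EFinD -EFinM lee_fin le_eqVlt; apply/orP; left; apply/eqP; ring.
pose v2:= ip Om v v; have v20: 0 <= v2 by exact: ip_ge0.
apply: (@le_eps_sqr _ _ (2 * v2 * (6 * K2^+2 * V+6 * A^+2 * V))).
 by rewrite mulr_ge0// ?addr_ge0// ?mulr_ge0// ?sqr_ge0.
move=> delta d0 d1; have [c [e [k [ak ced hk]]]]:= inw delta d0.
have tk: test setT k by case: ak.
have tg: test Om (average g k) by apply: hk.
have tA: test setT (average P k):= test_average tPT ak.
have tgT: test setT (average g k):= test_sub (@subsetT _ _) tg.
have vP:= vtest_L2_all oO OM (vtest_cgrad tPT).
have vA:= vtest_L2_all oO OM (vtest_cgrad tA).
have vg:= vtest_L2_all oO OM (vtest_cgrad tgT).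
have vD:= L2B mO vP vA; have vW:= L2B mO vA vg.
have gz: ip Om v (cgrad (average g k)) = 0.
 have:= dv _ tg; rewrite /ips; under eq_Rintegral=> x _ do rewrite mul0r.
 by rewrite /Rintegral integral0=> /eqP; rewrite eq_sym oppr_eq0=> /eqP.
have vcB (a b: vfield R) i: vcomp (fun x=> a x-b x) i = (fun x=> vcomp a i x-vcomp b i x).
 by apply/funext=> x; rewrite /vcomp mxE [X in _ + X]mxE.
have z0: (\int[mu]_(x in Om) ((0: R)^+2)%:E <= 0%:E)%E.
 by under eq_integral=> x _ do rewrite expr0n/=; rewrite integral0.
have sum_le (w: vfield R) (b: R): L2 Om w -> (forall i, ips Om (vcomp w i) (vcomp w i) <= b) -> ip Om w w <= 3 * b.
 move=> lw hb; rewrite vipE// sum3E.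
 by have:= hb 0; have:= hb 1; have:= hb 2; move: (ips _ _ _) (ips _ _ _) (ips _ _ _)=> *; lra.
have hD: ip Om (fun x=> cgrad P x-cgrad (average P k) x) (fun x=> cgrad P x-cgrad (average P k) x) <=
  3 * (2 * 0+2 * (K2 * delta)^+2 * V).
 apply: sum_le=> // i; have li:= iffLR (vL2P _ _) vD i.
 apply: (ips_le_const (f:= fun=> 0) hV li _ _ z0); first exact: measurable_cst.
 move=> x _; rewrite vcB !vcomp_cgrad add0r average_partial_test// distrC.
 have tpi: test setT (partial i P):= test_partial i tPT.
 exact: (average_lipschitz tpi.1 (hK2 i) K20 ak ced tpi).
have hW: ip Om (fun x=> cgrad (average P k) x-cgrad (average g k) x) (fun x=> cgrad (average P k) x-cgrad (average g k) x) <=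
  3 * (2 * (9 * La^+2 * B)+2 * (A * delta)^+2 * V).
 apply: sum_le=> // i; have li:= iffLR (vL2P _ _) vW i.
 apply: (ips_le_const (f:= m) hV li mm _ hm2)=> x _.
 have ->: vcomp (fun x=> cgrad (average P k) x-cgrad (average g k) x) i x = partial i (average Q k) x.
  rewrite -(vcomp_cgrad (average Q k)) /vcomp -cgradB; [|exact: tA.1|exact: tgT.1].
  congr (cgrad _ x 0 i); apply/funext=> y; rewrite /g averageB//; ring.
 exact: (average_derivative ak ced iQ (fun z=> hPB (Phi z)) A0 (hQ i) hm).
have:= ip_split lv vP vA vg gz hD hW; rewrite -/v2=> /le_trans; apply.
rewrite le_eqVlt; apply/orP; left; apply/eqP; ring.
Qed.

End BoundaryExtension.

(** * Friedrichs' inequality *)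

Section Friedrichs.
Context {R: realType}.
Notation T3:= (space3 R).
Notation mu:= (@lebesgue3 R).
Variables (Om: set (R3 R)) (M: R).
Hypothesis oO: open Om.
Hypothesis M0: 0 < M.
Hypothesis OM: Om `<=` cube M.
Let mO: measurable (Om: set T3):= open_measurable3 oO.
Implicit Types (x y z d: R3 R) (t theta: R3 R -> R).

Lemma friedrichs_scalar (a x y p q I J C e: R): 0 <= a -> 0 <= C -> 0 <= p -> 0 <= q ->
 x^+2 <= a * p -> y^+2 <= C * a * I -> I <= 2 * J+2 * q -> p+q <= e ->
 2 * x^+2+2 * y^+2 <= a * (4 * C * J+(4 * e+4 * C * e)).
move=> a0 C0 p0 q0 hx hy hI he.
have Ca: 0 <= C * a by exact: mulr_ge0.
have h1: a * p <= a * e by rewrite ler_wpM2l//; lra.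
have h2: C * a * I <= C * a * (2 * J+2 * q) by exact: ler_wpM2l.
have h3: C * a * q <= C * a * e by rewrite ler_wpM2l//; lra.
have e0: 0 <= a * e by rewrite mulr_ge0//; lra.
lra.
Qed.

Lemma product_sqr_le (a b p w K: R): `|a| <= K -> `|b| <= K ->
 (a * p+b * (- w))^+2 <= 2 * K^+2 * p^+2+2 * K^+2 * w^+2.
move=> /sqr_le_of_norm h1 /sqr_le_of_norm h2; apply: le_trans (sqr_sum_le _ _) _.
rewrite !exprMn sqrrN -(mulrA _ _ (p^+2)) -(mulrA _ _ (w^+2)).
by apply: lerD; rewrite ler_wpM2l// ler_wpM2r// sqr_ge0.
Qed.

Lemma sqr_ip_add (v a b: vfield R) (A B: R): L2 Om v -> L2 Om a -> L2 Om b ->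
 ip Om v a^+2 <= A -> ip Om v b^+2 <= B ->
 ip Om v (fun x=> a x+b x)^+2 <= 2 * A+2 * B.
move=> lv la lb h1 h2; rewrite (ipDr mO la lb lv); apply: le_trans (sqr_sum_le _ _) _.
by apply: lerD; rewrite ler_wpM2l.
Qed.

Lemma cgradD p q x: smooth p -> smooth q -> cgrad (fun y=> p y+q y) x = cgrad p x+cgrad q x.
move=> sp sq; have:= @cgrad_lin R 1 p q x sp sq; rewrite scale1r=> <-.
by congr (cgrad _ x); apply/funext=> y; rewrite mul1r.
Qed.

Local Notation pot:= (@pot R M).
Local Notation rem:= (@remn R M).
Let energy eta:= ip Om (ccurl eta) (ccurl eta).

(** The estimate of which a cutoff function admits to localize it. *)
Definition controlled theta:= test setT theta /\ exists2 C: R, 0 <= C &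
 forall v eta, L2 Om v -> weak_div Om v (fun=> 0) -> vtest Om eta ->
  ip Om v (cgrad (fun x=> theta x * pot eta x))^+2 <= C * ip Om v v * energy eta.

Let tpot theta eta: test setT theta -> vtest Om eta -> test setT (fun x=> theta x * pot eta x).
by move=> tt te; apply: testM=> //; exact: (pot_smooth M te). Qed.

Lemma weak_div0 v phi: weak_div Om v (fun=> 0) -> test Om phi -> ip Om v (cgrad phi) = 0.
move=> dv tp; have:= dv _ tp; rewrite /ips; under eq_Rintegral=> x _ do rewrite mul0r.
by rewrite /Rintegral integral0=> /eqP; rewrite eq_sym oppr_eq0=> /eqP.
Qed.

Lemma controlled_boundary x0: lipschitz_boundary Om -> boundary Om x0 -> good Om M x0 ->
 exists2 r: R, 0 < r & forall theta, test (oball x0 r) theta -> controlled theta.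
move=> LO bx [r1 r10 [mB [C1 C10 hC1]]]; have [G [d [L [r ch]]]]:= lipschitz_chart LO bx.
have [rho rho0 [C C0 hC]]:= boundary_extension oO OM bx ch.
exists (Num.min rho (Num.min r1 1)); first by rewrite !lt_min rho0 r10 ltr01.
move=> theta tt; have ttT: test setT theta by exact: test_sub tt.
split=> //.
have [K K0 hK]: exists2 K: R, 0 <= K & (forall x, `|theta x| <= K) /\ forall j x, `|partial j theta x| <= K.
 have [k k0 hk]:= test_bounded ttT.
 have [a a0 ha]:= test_bounded (test_partial 0 ttT).
 have [b b0 hb]:= test_bounded (test_partial 1 ttT).
 have [c c0 hc]:= test_bounded (test_partial 2 ttT).
 exists (k+a+b+c); first by rewrite !addr_ge0.
 split=> [x|j x]; first by have:= hk x; move: k0 a0 b0 c0; lra.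
 case: j=> -[|[|[|//]]] Hj.
 - have ->: Ordinal Hj = 0 by exact/val_inj.
  by have:= ha x; move: k0 a0 b0 c0; lra.
 - have ->: Ordinal Hj = 1 by exact/val_inj.
  by have:= hb x; move: k0 a0 b0 c0; lra.
 - have ->: Ordinal Hj = 2 by exact/val_inj.
  by have:= hc x; move: k0 a0 b0 c0; lra.
have [hK0 hK1]:= hK.
pose N: R:= 3 * M+3.
pose C2:= 2 * K^+2 * C1+2 * K^+2 * (2 * N)^+2.
have k20: 0 <= 2 * K^+2 by rewrite mulr_ge0// sqr_ge0.
have C20: 0 <= C2.
 by rewrite /C2; apply: addr_ge0; apply: mulr_ge0=> //; exact: sqr_ge0.
exists (C * C2)=> [|v eta lv dv te]; first exact: mulr_ge0.
pose p x:= theta x * pot eta x.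
have tp: test (oball x0 (Num.min rho (Num.min r1 1))) p.
 by apply: testM=> //; exact: (pot_smooth M te).
have tp': test (oball x0 rho) p.
 by apply: test_sub tp=> x /= h; apply: lt_le_trans h _; rewrite ge_min lexx.
have I0: 0 <= energy eta by exact: ip_ge0.
have sp:= pot_smooth M te.
have ->: C * C2 * ip Om v v * energy eta = C * ip Om v v * (C2 * energy eta).
 by move: (ip _ _ _) (energy _)=> a b; ring.
apply: (hC p v (C2 * energy eta) tp' lv dv); first exact: mulr_ge0.
move=> j.
pose w:= vcomp (rem (ccurl eta)) j.
have [sw wle]:= remn_bound M oO j te.
have mq: measurable_fun (setT: set T3) ((pot eta): T3 -> R) by exact: continuous_measurable3 (smooth_cont sp).
have mw: measurable3 w by case: sw.
pose f x:= 2 * K^+2 * pot eta x^+2+2 * K^+2 * w x^+2.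
apply: (@le_trans _ _ (\int[mu]_(x in oball x0 r1 `\` Om) (f x)%:E)%E).
 apply: le_integral_support=> //.
 - by apply: measurableD=> //; exact: open_measurable3 (@oball_open _ x0 rho).
 - by apply: measurable_funX; exact: continuous_measurable3 (smooth_cont (smooth_partial j tp.1)).
 - by apply: measurable_funD; apply: measurable_funM=> //; exact: measurable_funX.
 - by move=> x; exact: sqr_ge0.
 - by move=> x; rewrite addr_ge0// mulr_ge0// sqr_ge0.
 move=> x [xr nO] nz.
 have: oball x0 (Num.min rho (Num.min r1 1)) x.
  apply: contrapT=> h; move/eqP: nz; apply.
  by rewrite (test_outside (test_partial j tp) h) expr0n.
 rewrite /oball/= !lt_min=> /and3P[_ xr1 x1]; split=> //.
 have xN: `|x| <= N.
  have:= boundary_norm OM bx; have: `|x| <= `|x-x0| + `|x0| by rewrite -{1}(subrK x0 x); exact: ler_normD.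
  by rewrite /N; move: x1 M0; move: `|x| `|x-x0| `|x0| => *; lra.
 have E: partial j p x = partial j theta x * pot eta x+theta x * (- w x).
  rewrite /p partialM; [|exact: smooth_der ttT.1|exact: smooth_der sp].
  by rewrite (pot_partial M0 OM j te xN) (test_outside (te j) nO) sub0r.
 by rewrite E; exact: product_sqr_le (hK1 j x) (hK0 x).
rewrite /f; under eq_integral=> x _ do rewrite EFinD EFinM [X in (_ + X)%E]EFinM.
have mE (q: R3 R -> R): measurable3 q ->
  measurable_fun (oball x0 r1 `\` Om: set T3) (fun x: T3=> (q x^+2)%:E).
 by move=> mq'; apply: measurable_funTS; apply/measurable_EFinP; exact: measurable_funX.
have s0 (q: R3 R -> R) x: (0 <= (q x^+2)%:E)%E by rewrite lee_fin sqr_ge0.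
have k20E: (0 <= (2 * K^+2)%:E)%E by rewrite lee_fin.
rewrite ge0_integralD//; first last.
- by apply: measurable_funeM; exact: mE.
- by move=> x _; rewrite mule_ge0// s0.
- by apply: measurable_funeM; exact: mE.
- by move=> x _; rewrite mule_ge0// s0.
rewrite !ge0_integralZl//; first last.
- exact: mE.
- exact: mE.
have le2: (\int[mu]_(x in oball x0 r1 `\` Om) (w x^+2)%:E <= ((2 * N)^+2 * energy eta)%:E)%E.
 rewrite -lee_fin in wle; apply: le_trans wle.
 rewrite /Rintegral fineK; last exact: integrable_fin_num sw.2.
 apply: ge0_subset_integral=> //; apply/measurable_EFinP; exact: measurable_funX.
apply: le_trans (leeD (lee_wpmul2l k20E (hC1 eta te)) (lee_wpmul2l k20E le2)) _.
rewrite -!EFinM -EFinD lee_fin le_eqVlt; apply/orP; left; apply/eqP; rewrite /C2 /energy; ring.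
Qed.

Lemma controlled_local x0: Om !=set0 -> lipschitz_boundary Om -> connected (boundary Om) ->
 exists2 r: R, 0 < r & forall theta, test (oball x0 r) theta -> controlled theta.
move=> ne LO cO; have [Ox|nOx]:= pselect (Om x0).
 have [r r0 hr]:= iffLR (open3P _) oO x0 Ox.
 exists r=> // theta tt; split; first exact: test_sub tt.
 exists 0=> // v eta lv dv te; rewrite weak_div0// ?expr0n ?mul0r//.
 by apply: test_sub (_: test (oball x0 r) _)=> //; apply: testM=> //; exact: pot_smooth te.
have [cx|ncx]:= pselect (closure Om x0).
 by apply: controlled_boundary=> //; [split=> //; rewrite interior_open|apply: boundary_good=> //; split=> //; rewrite interior_open].
have oc: open (~` closure Om) by apply: closed_openC; exact: closed_closure.
have [r r0 hr]:= iffLR (open3P _) oc x0 ncx.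
exists r=> // theta tt; split; first exact: test_sub tt.
exists 0=> // v eta lv dv te; rewrite !mul0r.
have ->: ip Om v (cgrad (fun x=> theta x * pot eta x)) = ip Om v (fun=> 0).
 apply: eq_ip_on=> // x Ox; apply/rowP=> i.
 have tp: test (oball x0 r) (fun x=> theta x * pot eta x) by apply: testM=> //; exact: pot_smooth te.
 rewrite -[LHS]/(vcomp (cgrad _) i x) vcomp_cgrad mxE.
 by apply: (test_outside (test_partial i tp))=> /hr; apply; exact: subset_closure.
have ->: ip Om v (fun=> 0) = 0 by rewrite ipC ip0l.
by rewrite expr0n.
Qed.

Lemma friedrichs_test: Om !=set0 -> lipschitz_boundary Om -> connected (boundary Om) ->
 exists2 C: R, 0 <= C & forall v eta, L2 Om v -> weak_div Om v (fun=> 0) -> vtest Om eta ->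
  ip Om v eta^+2 <= C * ip Om v v * ip Om (ccurl eta) (ccurl eta).
move=> ne LO cO.
have [|||theta [[_ [C C0 hC]] tt t1]]:= @local_to_global R controlled M.
- split; first exact: test0.
 exists 0=> // v eta lv dv te; rewrite weak_div0// ?expr0n ?mul0r//.
 by under [X in test _ X]funext=> x do rewrite mul0r; exact: test0.
- move=> t s [tt [C C0 hC]] [ts [D D0 hD]]; split; first exact: testD.
 exists (2 * C+2 * D)=> [|v eta lv dv te]; first by rewrite addr_ge0// mulr_ge0.
 have t1:= tpot tt te; have t2:= tpot ts te.
 have l1:= vtest_L2_all oO OM (vtest_cgrad t1).
 have l2:= vtest_L2_all oO OM (vtest_cgrad t2).
 have ->: ip Om v (cgrad (fun x=> (t x+s x) * pot eta x)) =
  ip Om v (fun x=> cgrad (fun x=> t x * pot eta x) x+cgrad (fun x=> s x * pot eta x) x).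
  apply: eq_ip_on=> // x _; rewrite -cgradD; [|exact: t1.1|exact: t2.1].
  by congr (cgrad _ x); apply/funext=> y; rewrite mulrDl.
 have:= sqr_ip_add lv l1 l2 (hC v eta lv dv te) (hD v eta lv dv te)=> /le_trans; apply.
 by rewrite le_eqVlt; apply/orP; left; apply/eqP; move: (ip _ _ _) (energy _)=> a b; ring.
- by move=> x; exact: controlled_local.
exists (2 * C+6 * (2 * (3 * M+3))^+2)=> [|v eta lv dv te].
 by rewrite addr_ge0// mulr_ge0// sqr_ge0.
have tp:= tpot tt te; have l1:= vtest_L2_all oO OM (vtest_cgrad tp).
have rb j:= remn_bound M oO j te.
have lr: L2 Om (rem (ccurl eta)).
 apply/vL2P=> j; apply/L2sP; have [[m1 i1] _]:= rb j.
 have mm: measurable_fun (setT: set T3) ((vcomp (rem (ccurl eta)) j) \_ Om: T3 -> R).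
  by apply/(measurable_restrictT _ mO); exact: measurable_funTS.
 split=> //; apply: ge0_integrable_le i1=> //.
 + exact: measurable_funX.
 + by move=> x; exact: sqr_ge0.
 + by move=> x; exact: sqr_ge0.
 apply: ge0_le_integral=> //.
 + by move=> x _; rewrite lee_fin sqr_ge0.
 + by apply/measurable_EFinP; exact: measurable_funX.
 + by apply/measurable_EFinP; exact: measurable_funX.
 + by move=> x _; rewrite lee_fin patchE; case: ifP=> // _; rewrite expr0n/= sqr_ge0.
have E: ip Om v eta = ip Om v (fun x=> cgrad (fun x=> theta x * pot eta x) x+rem (ccurl eta) x).
 apply: eq_ip_on=> // x Ox; apply/rowP=> i; rewrite [RHS]mxE.
 rewrite -[X in _ = X + _]/(vcomp (cgrad _) i x) vcomp_cgrad.
 rewrite (partial_eq_on (U:= Om) (q:= pot eta) i oO _ Ox); last first.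
  by move=> y /OM/t1 ->; rewrite mul1r.
 have xN: `|x| <= 3 * M+3 by have /cubeE:= OM Ox; move: M0=> *; lra.
 by rewrite (pot_partial M0 OM i te xN) subrK.
have hr: ip Om v (rem (ccurl eta))^+2 <= ip Om v v * (3 * ((2 * (3 * M+3))^+2 * energy eta)).
 apply: le_trans (ip_CS mO lv lr) _; rewrite ler_wpM2l ?ip_ge0// vipE// sum3E.
 have B j: ips Om (vcomp (rem (ccurl eta)) j) (vcomp (rem (ccurl eta)) j) <= (2 * (3 * M+3))^+2 * energy eta.
  have [s le]:= rb j; rewrite -lee_fin.
  have lj:= iffLR (vL2P _ _) lr j.
  apply: le_trans (ips_le_integral oO lj (f:= fun x=> vcomp (rem (ccurl eta)) j x^+2) _ _ _) _=> //.
  - by apply: measurable_funX; case: s.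
  - by move=> x; exact: sqr_ge0.
  rewrite -lee_fin in le; apply: le_trans le; rewrite /Rintegral fineK; last exact: integrable_fin_num s.2.
  apply: ge0_subset_integral=> //; first by apply/measurable_EFinP; apply: measurable_funX; case: s.
  by move=> x _; rewrite lee_fin sqr_ge0.
 by have:= B 0; have:= B 1; have:= B 2; move: (ips _ _ _) (ips _ _ _) (ips _ _ _) (_ * energy _)=> *; lra.
rewrite E; have:= sqr_ip_add lv l1 lr (hC v eta lv dv te) hr=> /le_trans; apply.
rewrite -/(energy eta) le_eqVlt; apply/orP; left; apply/eqP; move: (ip _ _ _) (energy _)=> a b; ring.
Qed.

(** The curl controls the L2 norm on divergence-free fields with zero
  tangential trace. *)
Lemma friedrichs: Om !=set0 -> lipschitz_boundary Om -> connected (boundary Om) ->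
 exists2 C: R, 0 <= C & forall v, K0c Om v -> ip Om v v <= C * ip Om (curl Om v) (curl Om v).
move=> ne LO cO; have [C C0 hC]:= friedrichs_test ne LO cO.
exists (4 * C); first exact: mulr_ge0.
move=> v [hv dv]; have lv: L2 Om v by case: hv=> -[].
have lc: L2 Om (curl Om v) by case: (curl_xget hv.1).
have a0:= ip_ge0 Om v.
have [->|an0]:= eqVneq (ip Om v v) 0; first by rewrite !mulr_ge0// ip_ge0.
have ap: 0 < ip Om v v by rewrite lt_def an0.
apply/ler_addgt0Pr=> e e0; pose e':= e/(4 * (C+1)).
have e'0: 0 < e' by rewrite divr_gt0// mulr_gt0// ltr_wpDl.
have [eta te he]:= H0curl_dense oO OM LO hv e'0.
have leta:= vtest_L2 te; have lce:= vtest_L2 (vtest_ccurl te).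
have l1:= L2B mO lv leta; have l2:= L2B mO lc lce.
have h1:= ip_CS mO lv l1; have h2:= hC v eta lv dv te.
have E: ip Om v v = ip Om v (fun x=> v x-eta x)+ip Om v eta by rewrite (ipBr mO lv leta lv) subrK.
have h3: ip Om (ccurl eta) (ccurl eta) <= 2 * ip Om (curl Om v) (curl Om v) +
  2 * ip Om (fun x=> curl Om v x-ccurl eta x) (fun x=> curl Om v x-ccurl eta x).
 have:= ip_sum_le mO lc (L2B mO lce lc); rewrite (ip_symB Om (ccurl eta)).
 by apply: le_trans; rewrite le_eqVlt; apply/orP; left; apply/eqP; apply: ip_eq=> x; rewrite subrKC.
have Ee: e = 4 * e'+4 * C * e' by rewrite /e'; field; rewrite gt_eqF// ltr_wpDl.
rewrite -(ler_pM2l ap) -expr2 {1}E; apply: le_trans (sqr_sum_le _ _) _; rewrite Ee.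
apply: friedrichs_scalar (ip_ge0 _ _) (ip_ge0 _ _) h1 h2 h3 he=> //.
Qed.

Lemma curl_lin (a: R) u v: Hcurl Om u -> Hcurl Om v ->
 ae_eq_on Om (curl Om (fun x=> a *: u x+v x)) (fun x=> a *: curl Om u x+curl Om v x).
move=> hu hv; have [lcu wcu]:= curl_xget hu; have [lcv wcv]:= curl_xget hv.
have lu:= hu.1; have lv:= hv.1.
apply: (curlP oO OM); [exact (L2_lin mO a lu lv)|exact (L2_lin mO a lcu lcv)|move=> eta te].
have lc:= vtest_L2 (vtest_ccurl te); have le:= vtest_L2 te.
by rewrite (ip_linl mO a lcu lcv le) (ip_linl mO a lu lv lc) wcu// wcv.
Qed.

Lemma tangential_trace_lin (a: R) u v w: Hcurl Om u -> Hcurl Om v -> Hcurl Om w ->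
 tangential_trace Om (fun x=> a *: u x+v x) w = a * tangential_trace Om u w+tangential_trace Om v w.
move=> hu hv hw; have [lcu _]:= curl_xget hu; have [lcv _]:= curl_xget hv; have [lcw _]:= curl_xget hw.
have hl: Hcurl Om (fun x=> a *: u x+v x).
 split; first exact (L2_lin mO a hu.1 hv.1).
 exists (fun x=> a *: curl Om u x+curl Om v x); split; first exact (L2_lin mO a lcu lcv).
 move=> eta te; have lc:= vtest_L2 (vtest_ccurl te); have le:= vtest_L2 te.
 rewrite (ip_linl mO a lcu lcv le) (ip_linl mO a hu.1 hv.1 lc).
 by rewrite (curl_xget hu).2// (curl_xget hv).2.
rewrite /tangential_trace (ip_ael oO hw.1 (curl_xget hl).1 (L2_lin mO a lcu lcv) (curl_lin a hu hv)).
have e1:= ip_linl mO a lcu lcv hw.1; have e2:= ip_linl mO a hu.1 hv.1 lcw.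
rewrite e1 e2; move: (ip _ (curl Om u) w) (ip _ (curl Om v) w) (ip _ u (curl Om w)) (ip _ v (curl Om w))=> *; ring.
Qed.

Lemma Hcurl_lin (a: R) u v: Hcurl Om u -> Hcurl Om v -> Hcurl Om (fun x=> a *: u x+v x).
move=> hu hv; have [lcu wcu]:= curl_xget hu; have [lcv wcv]:= curl_xget hv.
split; first exact (L2_lin mO a hu.1 hv.1).
exists (fun x=> a *: curl Om u x+curl Om v x); split; first exact (L2_lin mO a lcu lcv).
move=> eta te; have lc:= vtest_L2 (vtest_ccurl te); have le:= vtest_L2 te.
by rewrite (ip_linl mO a lcu lcv le) (ip_linl mO a hu.1 hv.1 lc) wcu// wcv.
Qed.

Lemma H0curl_lin (a: R) u v: H0curl Om u -> H0curl Om v -> H0curl Om (fun x=> a *: u x+v x).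
move=> [hu tu] [hv tv]; split; first exact: Hcurl_lin.
move=> w hw; have hw':= H1_Hcurl oO hw.
by rewrite tangential_trace_lin// tu// tv// mulr0 addr0.
Qed.

Lemma K0c_lin (a: R) u v: K0c Om u -> K0c Om v -> K0c Om (fun x=> a *: u x+v x).
move=> [hu du] [hv dv]; split; first exact: H0curl_lin.
move=> phi tp; have lp := vtest_L2 (vtest_cgrad tp).
rewrite (ip_linl mO a hu.1.1 hv.1.1 lp) (weak_div0 du tp) (weak_div0 dv tp) mulr0 addr0 oppr0.
by rewrite /ips; under eq_Rintegral=> x _ do rewrite mul0r; rewrite /Rintegral integral0.
Qed.

Lemma K0c0: K0c Om (fun=> 0).
have tz: vtest Om (fun=> 0: 'rV[R]_3).
 by move=> i; rewrite (_: vcomp _ i = fun=> 0); [exact: test0|apply/funext=> x; rewrite /vcomp mxE].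
split; first exact (H0curl_vtest oO OM tz).
move=> phi tp; have ->: ip Om (fun=> 0) (cgrad phi) = 0 by exact: ip0l.
rewrite oppr0 /ips; under eq_Rintegral=> x _ do rewrite mul0r.
by rewrite /Rintegral integral0.
Qed.

(** By Friedrichs' inequality the bilinear form of the curls represents every
  bounded functional on the divergence-free fields. *)
Lemma curl_riesz (F: vfield R -> R) (K: R): Om !=set0 -> lipschitz_boundary Om -> connected (boundary Om) ->
 (forall a u v, K0c Om u -> K0c Om v -> F (fun x=> a *: u x+v x) = a * F u+F v) ->
 (forall u, K0c Om u -> `|F u| <= K * Hcurl_norm Om u) ->
 exists2 w, K0c Om w & forall v, K0c Om v -> ip Om (curl Om w) (curl Om v) = F v.
move=> ne LO cO FL FB; have [C C0 hC]:= friedrichs ne LO cO.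
have lc u: K0c Om u -> L2 Om (curl Om u) by move=> [[h _] _]; case: (curl_xget h).
have lu u: K0c Om u -> L2 Om u by move=> [[[h _] _] _].
have []:= @variational_minimum R (R3 R -> 'rV[R]_3) (K0c Om) (fun u v=> ip Om (curl Om u) (curl Om v)) F (K^+2 * (C+1)).
- by rewrite mulr_ge0 ?sqr_ge0// addr_ge0.
- exact: K0c0.
- by move=> a u v; exact: K0c_lin.
- by move=> u v _ _; exact: ipC.
- move=> a u v w ku kv kw.
 have kl:= K0c_lin a ku kv.
 rewrite (ip_ael oO (lc _ kw) (lc _ kl) (L2_lin mO a (lc _ ku) (lc _ kv)) (curl_lin a ku.1.1 kv.1.1)).
 by rewrite (ip_linl mO a (lc _ ku) (lc _ kv) (lc _ kw)).
- by move=> u _; exact: ip_ge0.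
- exact: FL.
- move=> u ku; have:= sqr_le_of_norm (FB u ku).
 rewrite exprMn /Hcurl_norm sqr_sqrtr; last by rewrite addr_ge0 ?ip_ge0.
 move=> /le_trans; apply; rewrite -mulrA ler_wpM2l ?sqr_ge0// mulrDl mul1r lerD2r.
 exact: hC.
move=> v [kv cv bv].
have dif n m: K0c Om (v n-v m).
 have:= K0c_lin (-1) (kv m) (kv n); rewrite (_: (fun x=> _) = v n-v m)//.
 by apply/funext=> x; rewrite scaleN1r addrC.
have cd n m: ae_eq_on Om (curl Om (v n-v m)) (fun x=> curl Om (v n) x-curl Om (v m) x).
 have:= curl_lin (-1) (kv m).1.1 (kv n).1.1.
 rewrite (_: (fun x=> -1 *: v m x+v n x) = v n-v m); last by apply/funext=> x; rewrite scaleN1r addrC.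
 by rewrite (_: (fun x=> -1 *: curl Om (v m) x + _) = (fun x=> curl Om (v n) x-curl Om (v m) x))//; apply/funext=> x; rewrite scaleN1r addrC.
have cd2 n m: ip Om (fun x=> curl Om (v n) x-curl Om (v m) x) (fun x=> curl Om (v n) x-curl Om (v m) x) <=
  2 * (n.+1%:R^-1+m.+1%:R^-1).
 have l1:= lc _ (dif n m); have l2:= L2B mO (lc _ (kv n)) (lc _ (kv m)).
 by rewrite -(ip_ael oO l2 l1 l2 (cd n m)) -(ip_aer oO l1 l1 l2 (cd n m)); exact: cv.
have [|w lw cw]:= L2cvg_cauchy oO (fun n=> lu _ (kv n)).
 exists (C * 2)=> [|n m]; first by rewrite mulr_ge0.
 rewrite -mulrA; apply: le_trans (hC _ (dif n m)) _.
 by rewrite ler_wpM2l//; exact: cv.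
have [|c lcc cc]:= L2cvg_cauchy oO (fun n=> lc _ (kv n)); first by exists 2.
have [hw cwc]:= H0curl_closed oO OM (fun=> fun=> 0) (fun n=> (kv n).1) lw lcc cw cc.
exists w.
- split=> // phi tp; have lp := vtest_L2 (vtest_cgrad tp).
 have:= ip_cvg oO (fun n=> lu _ (kv n)) lw lp cw.
 rewrite (_: (fun n=> _) = (fun=> 0)); last by apply/funext=> n; exact: weak_div0 (kv n).2 tp.
 move=> /(cvg_unique (@norm_hausdorff _ _) (cvg_cst 0)) <-.
 by rewrite oppr0 /ips; under eq_Rintegral=> x _ do rewrite mul0r; rewrite /Rintegral integral0.
- move=> s ks; rewrite (ip_ael oO (lc _ ks) (curl_xget hw.1).1 lcc cwc).
 have c1:= ip_cvg oO (fun n=> lc _ (kv n)) lcc (lc _ ks) cc.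
 apply: (cvg_unique (@norm_hausdorff _ _) c1).
 apply: (cvg_of_sqr (ip_ge0 Om (curl Om s)))=> eps e0.
 have [N hN]:= inv_small e0; exists N=> n Nn; apply: le_trans (bv n s ks) _.
 by rewrite ler_wpM2r ?ip_ge0// hN.
Qed.

End Friedrichs.

(** * Fields with vanishing double curl *)

Section RadialKernels.
Context {R: realType}.
Notation T3:= (space3 R).
Notation T1:= (measurableTypeR R).
Notation mu:= (@lebesgue3 R).
Notation leb1:= (@lebesgue_measure R).
Implicit Types (x y z: R3 R).

Lemma segment_FTC (F f: R -> R) (a b: R): a < b ->
 (forall s, a <= s <= b -> is_derive s (1: R) F (f s)) -> {within `[a, b], continuous f} ->
 \int[leb1]_(s in `[a, b]) f s = F b-F a.
move=> ab dF cf; rewrite /Rintegral (@continuous_FTC2 R f F a b ab cf)//.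
- have cF s: a <= s <= b -> {for s, continuous F}.
  by move=> /dF[d _]; apply: differentiable_continuous; exact/derivable1_diffP.
 split=> [s|  |]; first by rewrite in_itv/= => /andP[/ltW as_ /ltW sb]; have []:= dF s; rewrite ?as_ ?sb.
 + by apply: cvg_at_right_filter; apply: cF; rewrite lexx ltW.
 + by apply: cvg_at_left_filter; apply: cF; rewrite lexx ltW.
- move=> s; rewrite in_itv/= => /andP[/ltW as_ /ltW sb]; rewrite derive1E.
 by case: (dF s)=> [|_ ->]; rewrite ?as_ ?sb.
Qed.

Lemma unit_weight (t a b c: R): 1 * t * t * a+1 * t * t * b+1 * t * t * c = t^+2 * (a+b+c).
ring. Qed.

Lemma zero_weight (t a b c: R): 0 * t * t * a+0 * t * t * b+0 * t * t * c = 0.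
ring. Qed.

Definition kern (t: R) x: R:= t^+3 * bump (t *: x).

Variables t1 t2: R.
Hypothesis t10: 0 < t1.
Hypothesis t12: t1 < t2.

Let ind (t: R): R:= \1_(`[t1, t2]%classic: set R) t.
Let h (t: T1): R:= t * ind t.

Let mind: measurable_fun (setT: set T1) (ind: T1 -> R).
by apply: measurable_indic; exact: measurable_itv. Qed.

Let mh: measurable_fun (setT: set T1) h.
exact: measurable_funM. Qed.

Let hH t: `|h t| <= t2.
rewrite /h /ind indicE; case: (boolP (t \in _))=> [/set_mem/=|_]; last first.
 by rewrite mulr0 normr0; apply: ltW; exact: lt_trans t12.
by rewrite in_itv/= => /andP[h1 h2]; rewrite mulr1 ger0_norm// (le_trans (ltW t10)).
Qed.

Let iind: leb1.-integrable setT (EFin \o ind).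
exact: integrable_indic_itv. Qed.

(** Its Laplacian is the difference of two rescaled kernels: the derivative
  of the kernels in the scale is the Laplacian of a rescaled potential. *)
Definition scale_potential: R3 R -> R:= superpose leb1 h (fun=> 0) ind (@bump_potential R).

Lemma test_bump_potential: test setT (@bump_potential R).
split; first exact: smooth_bump_potential.
exists (cube 1); split=> //.
 by apply: compact_setX; [apply: compact_setX|]; exact: segment_compact.
move=> x nx; apply/eqP/negPn/negP=> /bump_potential_supp/ltW x1; apply: nx; exact/cubeE.
Qed.

Let bW:= test_bounded_smooth test_bump_potential.

Lemma scale_potential_smooth: smooth scale_potential.
exact: (superpose_smooth mh (measurable_cst _) hH iind bW). Qed.

Lemma scale_potential_outside x: t1^-1 <= `|x| -> scale_potential x = 0.
move=> hx; rewrite /scale_potential /superpose (_: (fun t=> _) = (fun=> 0)) ?/Rintegral ?integral0//.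
apply/funext=> t; rewrite /h /ind indicE; case: (boolP (t \in _))=> [/set_mem/=|_]; last by rewrite mul0r.
rewrite in_itv/= => /andP[ht _]; rewrite mulr1 mul1r addr0.
apply/eqP/negPn/negP=> /bump_potential_supp; rewrite normrZ ltNge; apply/negP/negPn.
have t0: 0 < t:= lt_le_trans t10 ht.
rewrite gtr0_norm//; have: t1 * t1^-1 <= t * `|x| by apply: ler_pM=> //; [exact: ltW|rewrite invr_ge0; exact: ltW].
by rewrite mulfV// gt_eqF.
Qed.

Lemma scale_potential_test: test setT scale_potential.
split; first exact: scale_potential_smooth.
exists (cube t1^-1); split=> //.
 by apply: compact_setX; [apply: compact_setX|]; exact: segment_compact.
move=> x nx; apply: scale_potential_outside; rewrite leNgt; apply/negP=> /ltW/cubeE; exact: nx.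
Qed.

Lemma partial2_bump_potential i x :
 partial i (partial i (@bump_potential R)) x = bump x+coord i x * partial i (@bump R) x.
have ->: partial i (@bump_potential R) = fun y=> coord i y * bump y.
 by apply/funext=> y; have [_]:= bump_potential_derive y i.
have [dc ec]:= is_derive_coord i i x.
rewrite partialM//; last exact: smooth_der (@smooth_bump R).
by rewrite /partial ec eqxx mul1r.
Qed.

Let weighted: leb1.-integrable setT (EFin \o (fun t=> ind t * h t)).
under [X in _.-integrable _ (_ \o X)]funext=> t do rewrite mulrC.
by apply: (@rintegrable_bmul _ _ _ _ _ _ _ _ t2).
Qed.

Lemma kern_scale_derive x (t: R): is_derive t (1: R) (fun t=> kern t x)
 (t^+2 * \sum_i partial i (partial i (@bump_potential R)) (t *: x)).
have sb: smooth_on setT (@bump R) by apply/smoothP; exact: smooth_bump.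
have d1: is_derive t (1: R) (fun s: R=> bump (s *: x)) (\sum_i coord i x * partial i (@bump R) (t *: x)).
 have:= @smooth_on_dir R setT (@bump R) (0+t *: x) x openT sb I=> /is_derive_line.
 by under eq_fun do rewrite add0r; rewrite add0r.
have d2: is_derive t (1: R) (fun s: R=> s^+3) (3 * t^+2).
 rewrite (_: (fun s: R=> s^+3) = (id: R -> R)^+3); last by apply/funext=> s; rewrite fctE.
 apply: is_derive_eq (is_deriveX 3 (is_derive_id t (1: R))) _.
 by rewrite /= /GRing.scale/= mulr1.
apply: is_derive_eq (is_deriveM d2 d1) _.
rewrite !sum3E !partial2_bump_potential !coordZ /GRing.scale/=.
move: (bump _) (partial 0 _ _) (partial 1 _ _) (partial 2 _ _)=> *; ring.
Qed.

Lemma scale_potential_laplacian x :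
 \sum_i partial i (partial i scale_potential) x = kern t2 x-kern t1 x.
have P i: partial i (partial i scale_potential) x =
  superpose leb1 h (fun=> 0) (fun t=> ind t * h t * h t) (partial i (partial i (@bump_potential R))) x.
 rewrite (_: partial i scale_potential = superpose leb1 h (fun=> 0) (fun t=> ind t * h t) (partial i (@bump_potential R))).
  by rewrite (superpose_partial mh (measurable_cst _) hH)//; exact: bounded_smooth_partial.
 by apply/funext=> y; rewrite (superpose_partial mh (measurable_cst _) hH).
have w2: leb1.-integrable setT (EFin \o (fun t=> ind t * h t * h t)).
 under [X in _.-integrable _ (_ \o X)]funext=> t do rewrite mulrC.
 by apply: (@rintegrable_bmul _ _ _ _ _ _ _ _ t2).
have bi i:= bounded_smooth_partial i (bounded_smooth_partial i bW).
rewrite (eq_bigr _ (fun i _=> P i)) sum3E /superpose.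
pose J i (t: T1): R:= ind t * h t * h t * partial i (partial i (@bump_potential R)) (h t *: x+0).
have I i: leb1.-integrable setT (EFin \o J i):= superpose_integrable mh (measurable_cst _) x w2 (bi i).
have I01:= rintegrableD measurableT (I 0) (I 1).
transitivity (\int[leb1]_t (J 0 t+J 1 t+J 2 t)).
 by rewrite (RintegralD measurableT I01 (I 2)) (RintegralD measurableT (I 0) (I 1)).
rewrite /J.
have:= @segment_FTC (fun t=> kern t x) (fun t=> t^+2 * \sum_i partial i (partial i (@bump_potential R)) (t *: x)) t1 t2 t12
 (fun s _=> kern_scale_derive x s)=> <-.
 rewrite [RHS]Rintegral_mkcond; apply: eq_Rintegral=> t _.
 rewrite patchE sum3E; case: (boolP (t \in _))=> ht.
  have i1: ind t = 1 by rewrite /ind indicE ht.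
  have h1: h t = t by rewrite /h i1 mulr1.
  rewrite i1 h1 addr0; exact: unit_weight.
 have i0: ind t = 0 by rewrite /ind indicE (negPf ht).
 rewrite i0; exact: zero_weight.
apply: continuous_subspaceT=> s; apply: cvgM; first exact: exprn_continuous.
have cs: smooth_on setT (fun y=> \sum_i partial i (partial i (@bump_potential R)) y).
 by apply: smooth_on_sum; [exact: openT|move=> i; apply/smoothP; case: (bi i)].
apply: (@continuous_comp _ _ _ (fun s: R=> s *: x) (fun y=> \sum_i partial i (partial i (@bump_potential R)) y)).
 by apply: cvgZr_tmp; exact: cvg_id.
by apply: (smooth_on_cont cs).
Qed.

End RadialKernels.

Section CurlRegularity.
Context {R: realType}.
Notation T3:= (space3 R).
Notation mu:= (@lebesgue3 R).
Variables (Om: set (R3 R)) (M: R).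
Hypothesis oO: open Om.
Hypothesis OM: Om `<=` cube M.
Let mO: measurable (Om: set T3):= open_measurable3 oO.
Implicit Types (x y z: R3 R) (psi: R3 R -> R).

Definition laplacian psi x: R:= \sum_i partial i (partial i psi) x.

Lemma laplacian_test U psi: test U psi -> test U (laplacian psi).
by move=> tp; apply: test_sum=> i; do 2 apply: test_partial. Qed.

Lemma partial_lin2 (a b: R) i j k psi x: smooth psi ->
 partial k (fun y=> a * partial i psi y-b * partial j psi y) x =
 a * partial k (partial i psi) x-b * partial k (partial j psi) x.
move=> sp; have sd n:= smooth_partial n sp.
have D n l: derivable (partial n psi) x (e_ l) by exact: smooth_der (sd n).
have s2 (c: R) n: smooth (fun y=> c * partial n psi y).
 by apply/smoothP; apply: smooth_onZ; [exact: openT|exact/smoothP].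
have sN: smooth (fun y=> - (b * partial j psi y)).
 by apply/smoothP; apply: smooth_onN; [exact: openT|exact/smoothP].
rewrite partialD; [|exact: smooth_der (s2 _ _)|exact: smooth_der sN].
by rewrite partialN; [rewrite !partialZ|exact: smooth_der (s2 _ _)].
Qed.

Lemma ord3_pick (f: 'I_3 -> R) m: f m = (m == 0)%:R * f 0+(m == 1)%:R * f 1+(m == 2)%:R * f 2.
elim/ord3_ind: m.
- by rewrite -[(0 == 0 :> 'I_3)]/true -[(0 == 1 :> 'I_3)]/false -[(0 == 2 :> 'I_3)]/false mul1r !mul0r !addr0.
- by rewrite -[(1 == 0 :> 'I_3)]/false -[(1 == 1 :> 'I_3)]/true -[(1 == 2 :> 'I_3)]/false mul1r !mul0r addr0 add0r.
- by rewrite -[(2 == 0 :> 'I_3)]/false -[(2 == 1 :> 'I_3)]/false -[(2 == 2 :> 'I_3)]/true mul1r !mul0r !add0r.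
Qed.

Lemma partial_lin2_pair (U: vfield R) k l i j (a b c d: R) i1 i2 j1 j2 psi x: smooth psi ->
 vcomp U i = (fun y=> a * partial i1 psi y-b * partial i2 psi y) ->
 vcomp U j = (fun y=> c * partial j1 psi y-d * partial j2 psi y) ->
 partial k (vcomp U i) x-partial l (vcomp U j) x =
 a * partial k (partial i1 psi) x-b * partial k (partial i2 psi) x -
 (c * partial l (partial j1 psi) x-d * partial l (partial j2 psi) x).
by move=> sp -> ->; rewrite !partial_lin2. Qed.

Lemma double_curl0 (a b c p p' q r s s' t: R): p = p' -> s = s' ->
 b * p-a * q-(a * r-c * s) = a * t+b * p'+c * s'-a * (t+q+r).
by move=> -> ->; ring. Qed.
Lemma double_curl1 (a b c p p' q r s s' t: R): p = p' -> s = s' ->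
 c * p-b * q-(b * r-a * s) = a * s'+b * t+c * p'-b * (r+t+q).
by move=> -> ->; ring. Qed.
Lemma double_curl2 (a b c p p' q r s s' t: R): p = p' -> s = s' ->
 a * p-c * q-(c * r-b * s) = a * p'+b * s'+c * t-c * (q+r+t).
by move=> -> ->; ring. Qed.

Lemma ccurl2_single m psi x: smooth psi ->
 ccurl (ccurl (single m psi)) x = cgrad (partial m psi) x-single m (laplacian psi) x.
move=> sp; have C i j: partial i (partial j psi) x = partial j (partial i psi) x:= smooth_partialC i j x sp.
have pz (c: R) i: partial i (fun y=> c * psi y) = fun y=> c * partial i psi y.
 by apply/funext=> y; rewrite partialZ//; exact: smooth_der.
apply/rowP=> k; rewrite -[LHS]/(vcomp (ccurl (ccurl (single m psi))) k x) [RHS]mxE.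
rewrite -[X in _ = X + _]/(vcomp (cgrad (partial m psi)) k x) vcomp_cgrad.
rewrite [X in _ = _ + X]mxE -[X in _ = _ - X]/(vcomp (single m (laplacian psi)) k x) vcomp_single /laplacian sum3E.
have [c0 c1 c2]:= vcomp_ccurl (ccurl (single m psi)).
have [d0 d1 d2]:= vcomp_ccurl (single m psi).
move: d0 d1 d2; rewrite !vcomp_single !pz=> d0 d1 d2.
have em: partial k (partial m psi) x = (m == 0)%:R * partial k (partial 0 psi) x +
  (m == 1)%:R * partial k (partial 1 psi) x+(m == 2)%:R * partial k (partial 2 psi) x.
 exact: (ord3_pick (fun j=> partial k (partial j psi) x)).
rewrite em {em}; elim/ord3_ind: k.
- apply: etrans (congr1 (@^~ x) c0) _; apply: etrans (partial_lin2_pair 1 2 x sp d2 d1) _.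
 exact: (double_curl0 _ _ _ _ _ _ (C 1 0) (C 2 0)).
- apply: etrans (congr1 (@^~ x) c1) _; apply: etrans (partial_lin2_pair 2 0 x sp d0 d2) _.
 exact: (double_curl1 _ _ _ _ _ _ (C 2 1) (C 0 1)).
- apply: etrans (congr1 (@^~ x) c2) _; apply: etrans (partial_lin2_pair 0 1 x sp d1 d0) _.
 exact: (double_curl2 _ _ _ _ _ _ (C 0 2) (C 1 2)).
Qed.

(** Hence the Laplacian of a test field is invisible to a field whose double
  curl vanishes weakly, tested through a curl. *)
Lemma ccurl_laplacian a m psi: L2 Om a -> (forall eta, vtest Om eta -> ip Om a (ccurl (ccurl eta)) = 0) ->
 test Om psi -> ip Om a (ccurl (single m (laplacian psi))) = 0.
move=> la ha tp; have te:= vtest_single m tp.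
have tg: vtest Om (cgrad (partial m psi)) by apply: vtest_cgrad; exact: test_partial.
have tl: vtest Om (single m (laplacian psi)) by apply: vtest_single; exact: laplacian_test.
have s1 i: smooth (vcomp (cgrad (partial m psi)) i) by case: (tg i).
have s2 i: smooth (vcomp (single m (laplacian psi)) i) by case: (tl i).
have ->: ip Om a (ccurl (single m (laplacian psi))) = - ip Om a (ccurl (ccurl (ccurl (single m psi)))).
 have l3:= vtest_L2 (vtest_ccurl (vtest_ccurl (vtest_ccurl te))).
 rewrite -mulN1r -(ipZr mO)//; apply: eq_ip_on=> // x _.
 have ->: ccurl (ccurl (single m psi)) = fun y=> -1 *: single m (laplacian psi) y+cgrad (partial m psi) y.
  by apply/funext=> y; rewrite ccurl2_single; [rewrite scaleN1r addrC|case: tp].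
 rewrite ccurl_lin// ccurl_cgrad; last by case: (test_partial m tp).
 by rewrite addr0 scalerA mulN1r opprK scale1r.
by rewrite ha ?oppr0//; exact: vtest_ccurl.
Qed.

End CurlRegularity.
Section CurlRegularity2.
Context {R: realType}.
Notation T3:= (space3 R).
Notation mu:= (@lebesgue3 R).
Variables (Om: set (R3 R)) (M: R).
Hypothesis oO: open Om.
Hypothesis OM: Om `<=` cube M.
Let mO: measurable (Om: set T3):= open_measurable3 oO.
Implicit Types (x y z: R3 R) (psi k: R3 R -> R).

Lemma add3_eq0 (p q r: R): p = 0 -> q = 0 -> r = 0 -> p+q+r = 0.
by move=> -> -> ->; rewrite !addr0. Qed.

Lemma lin_eq0 (c p q: R): p = 0 -> c * p+q = q.
by move=> ->; rewrite mulr0 add0r. Qed.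

Lemma kern_test (t: R): 0 < t -> test setT (@kern R t).
move=> t0; apply: testZ (_: test setT (fun x=> bump (t *: x))); have:= @affine_test R (@bump R) t 0 (lt0r_neq0 t0) (@test_bump R).
by under [X in test _ X -> _]funext=> y do rewrite addr0.
Qed.

Lemma mollifier_kern (e: R) x: 0 < e -> mollifier 0 e x = kern e^-1 x / \int[mu]_y kern e^-1 y.
move=> e0; have t0: 0 < e^-1 by rewrite invr_gt0.
have tn: e^-1^+3 != 0 by rewrite expf_neq0// gt_eqF.
have ib: mu.-integrable setT (EFin \o (fun y=> bump (e^-1 *: y))).
 have:= @affine_test R (@bump R) e^-1 0 (lt0r_neq0 t0) (@test_bump R).
 under [X in test _ X -> _]funext=> y do rewrite addr0.
 exact: test_integrable.
rewrite /kern RintegralZl// /mollifier subr0; under eq_Rintegral=> y _ do rewrite subr0.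
by rewrite invfM mulrACA mulfV// mul1r.
Qed.

Local Opaque mollifier kern scale_potential average.

Lemma laplacian_integral psi: test setT psi -> \int[mu]_x laplacian psi x = 0.
move=> tp; have t2 i: test setT (partial i (partial i psi)) by do 2 apply: test_partial.
have I i:= test_integrable (t2 i).
rewrite /laplacian; under eq_Rintegral=> x _ do rewrite sum3E.
have I01:= rintegrableD measurableT (I 0) (I 1).
rewrite (RintegralD measurableT I01 (I 2)) (RintegralD measurableT (I 0) (I 1)).
have E i: \int[mu]_x partial i (partial i psi) x = 0:= integral_partial_test i (test_partial i tp).
exact: (add3_eq0 (E 0) (E 1) (E 2)).
Qed.

Lemma kern_integral (t1 t2: R): 0 < t1 -> t1 < t2 -> \int[mu]_x kern t1 x = \int[mu]_x kern t2 x.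
move=> t10 t12; have:= laplacian_integral (scale_potential_test t10 t12).
have i1:= test_integrable (kern_test t10); have i2:= test_integrable (kern_test (lt_trans t10 t12)).
rewrite /laplacian; under eq_Rintegral=> x _ do rewrite (scale_potential_laplacian t10 t12).
move=> h; have /subr0_eq E:= etrans (esym (RintegralB measurableT i2 i1)) h; exact: esym E.
Qed.

Lemma mollifier_laplacian (e1 e2: R): 0 < e1 -> e1 < e2 -> exists (c: R),
 forall x, mollifier 0 e1 x = c * laplacian (scale_potential e2^-1 e1^-1) x+mollifier 0 e2 x.
move=> e10 e12; have e20:= lt_trans e10 e12.
have t10: 0 < e2^-1 by rewrite invr_gt0.
have t12: e2^-1 < e1^-1 by rewrite ltf_pV2.
exists (\int[mu]_y kern e1^-1 y)^-1=> x.
rewrite !mollifier_kern// (kern_integral t10 t12) /laplacian (scale_potential_laplacian t10 t12).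
by rewrite mulrBr [X in _ = _ + X]mulrC subrK mulrC.
Qed.

Lemma laplacian_translate psi x y: smooth psi -> laplacian (fun z=> psi (z-x)) y = laplacian psi (y-x).
move=> sp; apply: eq_bigr=> i _; rewrite -partial_translate; last exact: smooth_partial.
by congr (partial i _ y); apply/funext=> z; rewrite partial_translate.
Qed.

Lemma scale_potential_translate_test (e1 e2 rho: R) x: 0 < e1 -> e1 < e2 -> e2 < rho -> oball x rho `<=` Om ->
 test Om (fun y=> scale_potential e2^-1 e1^-1 (y-x)).
move=> e10 e12 e2r xO; have e20:= lt_trans e10 e12.
have t10: 0 < e2^-1 by rewrite invr_gt0.
have t12: e2^-1 < e1^-1 by rewrite ltf_pV2.
split; first exact: (test_translate x (scale_potential_test t10 t12)).1.
exists [set y | `|y-x| <= e2]; split; first exact: closed_ball_compact.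
- by move=> y /= yx; apply: xO; exact: le_lt_trans yx e2r.
- move=> y yx; apply: scale_potential_outside; [exact: t10|rewrite invrK].
 by rewrite leNgt; apply/negP=> /ltW.
Qed.

Variable a: vfield R.
Hypothesis la: L2 Om a.
Hypothesis ha: forall eta, vtest Om eta -> ip Om a (ccurl (ccurl eta)) = 0.

Let moll_test (e: R): 0 < e -> test setT (@mollifier R 0 e).
by move=> e0; case: (averaging_mollifier 0 e0). Qed.

Lemma ccurl_vaverage_lt x (e1 e2 rho: R): oball x rho `<=` Om -> 0 < e1 -> e1 < e2 -> e2 < rho ->
 ccurl (vaverage Om a (mollifier 0 e1)) x = ccurl (vaverage Om a (mollifier 0 e2)) x.
move=> xO e10 e12 e2r; have e20:= lt_trans e10 e12.
have [c hc]:= mollifier_laplacian e10 e12.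
have tp:= scale_potential_translate_test e10 e12 e2r xO.
set psi:= (fun y=> scale_potential e2^-1 e1^-1 (y-x)) in tp.
have t10: 0 < e2^-1 by rewrite invr_gt0.
have t12: e2^-1 < e1^-1 by rewrite ltf_pV2.
have sS:= (scale_potential_test t10 t12).1.
apply/rowP=> m.
apply: etrans (ccurl_vaverage_dual oO OM x m la (moll_test e10)) _.
apply: etrans (esym (ccurl_vaverage_dual oO OM x m la (moll_test e20))).
have tl:= vtest_single m (laplacian_test tp).
have tk:= test_translate x (moll_test e20); have tsk:= vtest_single m tk.
have tl': vtest setT (single m (laplacian psi)) by move=> i; exact: test_sub (tl i).
have E y: ccurl (single m (fun y=> mollifier 0 e1 (y-x))) y =
  c *: ccurl (single m (laplacian psi)) y+ccurl (single m (fun y=> mollifier 0 e2 (y-x))) y.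
 rewrite -ccurl_lin; [|by move=> i; case: (tl i)|by move=> i; case: (tsk i)].
 congr (ccurl _ y); apply/funext=> z.
 apply: etrans (congr1 (fun t: R=> t *: delta_mx 0 m) (hc (z-x))) _.
 by rewrite -(laplacian_translate x z sS) scalerDl -scalerA.
have l1:= vtest_L2_all oO OM (vtest_ccurl tl'); have l2:= vtest_L2_all oO OM (vtest_ccurl tsk).
apply: etrans (eq_ip_on (fun x _=> erefl) (fun y _=> E y)) _.
apply: etrans (ip_linr mO c l1 l2 la) _; exact: lin_eq0 (ccurl_laplacian oO m la ha tp).
Qed.

Lemma ccurl_vaverage_radius x (e1 e2 rho rho': R): oball x rho `<=` Om -> oball x rho' `<=` Om ->
 0 < e1 -> 0 < e2 -> e1 < rho -> e2 < rho' ->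
 ccurl (vaverage Om a (mollifier 0 e1)) x = ccurl (vaverage Om a (mollifier 0 e2)) x.
move=> xO xO' e10 e20 e1r e2r; case: (ltgtP e1 e2)=> [h|h|-> //].
 exact: ccurl_vaverage_lt xO' e10 h e2r.
by symmetry; exact: ccurl_vaverage_lt xO e20 h e1r.
Qed.

Lemma sub_signs (p q: R): -1 * p - -1 * q = - (p-q).
ring. Qed.

Lemma smooth_ccurl (U: vfield R): (forall i, smooth (vcomp U i)) -> forall i, smooth (vcomp (ccurl U) i).
move=> sU; have B i j p l: smooth (fun x=> partial i (vcomp U j) x-partial p (vcomp U l) x).
 by apply/smoothP; apply: smooth_onB; [exact: openT|apply/smoothP; exact: smooth_partial..].
have [c0 c1 c2]:= vcomp_ccurl U.
case=> -[|[|[|//]]] Hm.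
- by have ->: Ordinal Hm = 0 by [exact/val_inj]; rewrite c0.
- by have ->: Ordinal Hm = 1 by [exact/val_inj]; rewrite c1.
- by have ->: Ordinal Hm = 2 by [exact/val_inj]; rewrite c2.
Qed.

Lemma smooth_vaverage k: test setT k -> forall i, smooth (vcomp (vaverage Om a k) i).
move=> tk i; rewrite vcomp_vaverage; apply: average_smooth (test_bounded_smooth tk).
by apply: (restrict_integrable OM); exact: (iffLR (vL2P _ _) la i).
Qed.

Lemma partial_vaverage k i j: test setT k ->
 partial i (vcomp (vaverage Om a k) j) = fun x=> -1 * vcomp (vaverage Om a (partial i k)) j x.
move=> tk; apply/funext=> x; rewrite !vcomp_vaverage average_partial ?mulN1r//.
- by apply: (restrict_integrable OM); exact: (iffLR (vL2P _ _) la j).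
- exact: test_bounded_smooth tk.
Qed.

Lemma partial_ccurl_vaverage k i m x: test setT k ->
 partial i (vcomp (ccurl (vaverage Om a k)) m) x = - ip Om a (ccurl (single m (fun y=> partial i k (y-x)))).
move=> tk; have tki: test setT (partial i k):= test_partial i tk.
rewrite -(ccurl_vaverage_dual oO OM)// -[X in _ = - X]/(vcomp (ccurl (vaverage Om a (partial i k))) m x).
have sA:= smooth_vaverage tk; have sB:= smooth_vaverage tki.
have P p q r s: partial i (fun z=> partial p (vcomp (vaverage Om a k) q) z-partial r (vcomp (vaverage Om a k) s) z) x =
  - (partial p (vcomp (vaverage Om a (partial i k)) q) x-partial r (vcomp (vaverage Om a (partial i k)) s) x).
 have sp j l:= smooth_partial j (sA l).
 have sN j l: smooth (fun z=> - partial j (vcomp (vaverage Om a k) l) z).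
  by apply/smoothP; apply: smooth_onN; [exact: openT|exact/smoothP].
 rewrite partialD; [|exact: smooth_der (sp _ _)|exact: smooth_der (sN _ _)].
 rewrite partialN; last exact: smooth_der (sp _ _).
 rewrite (smooth_partialC i p x (sA q)) (smooth_partialC i r x (sA s)) (partial_vaverage i q tk) (partial_vaverage i s tk).
 have D j l: derivable (vcomp (vaverage Om a (partial i k)) j) x (e_ l) by exact: smooth_der (sB j).
 by rewrite !partialZ//; exact: sub_signs.
have [c0 c1 c2]:= vcomp_ccurl (vaverage Om a k).
have [d0 d1 d2]:= vcomp_ccurl (vaverage Om a (partial i k)).
elim/ord3_ind: m.
- apply: etrans (congr1 (fun f=> partial i f x) c0) _; apply: etrans (P 1 2 2 1) _.
 exact: (congr1 (fun f: R3 R -> R=> - f x) (esym d0)).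
- apply: etrans (congr1 (fun f=> partial i f x) c1) _; apply: etrans (P 2 0 0 2) _.
 exact: (congr1 (fun f: R3 R -> R=> - f x) (esym d1)).
- apply: etrans (congr1 (fun f=> partial i f x) c2) _; apply: etrans (P 0 1 1 0) _.
 exact: (congr1 (fun f: R3 R -> R=> - f x) (esym d2)).
Qed.

Lemma ccurl_single f y: smooth f ->
 [/\ ccurl (single 0 f) y = -1 *: single 2 (partial 1 f) y+single 1 (partial 2 f) y,
   ccurl (single 1 f) y = -1 *: single 0 (partial 2 f) y+single 2 (partial 0 f) y &
   ccurl (single 2 f) y = -1 *: single 1 (partial 0 f) y+single 0 (partial 1 f) y].
move=> sf; have pz (c: R) i: partial i (fun y=> c * f y) = fun y=> c * partial i f y.
 by apply/funext=> z; rewrite partialZ//; exact: smooth_der.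
have red m p q: (forall i, vcomp (ccurl (single m f)) i y = -1 * ((q == i)%:R * partial p f y)+(p == i)%:R * partial q f y) ->
  ccurl (single m f) y = -1 *: single q (partial p f) y+single p (partial q f) y.
 move=> h; apply/rowP=> i; apply: etrans (h i) _; rewrite [RHS]mxE [X in _ = X + _]mxE.
 by rewrite -[X in _ = -1 * X + _]/(vcomp (single q (partial p f)) i y) -[X in _ = _ + X]/(vcomp (single p (partial q f)) i y) !vcomp_single.
have e00: (0 == 0 :> 'I_3)%:R = 1 :> R by []. have e01: (0 == 1 :> 'I_3)%:R = 0 :> R by [].
have e02: (0 == 2 :> 'I_3)%:R = 0 :> R by []. have e10: (1 == 0 :> 'I_3)%:R = 0 :> R by [].
have e11: (1 == 1 :> 'I_3)%:R = 1 :> R by []. have e12: (1 == 2 :> 'I_3)%:R = 0 :> R by [].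
have e20: (2 == 0 :> 'I_3)%:R = 0 :> R by []. have e21: (2 == 1 :> 'I_3)%:R = 0 :> R by [].
have e22: (2 == 2 :> 'I_3)%:R = 1 :> R by [].
pose ordE:= (e00, e01, e02, e10, e11, e12, e20, e21, e22).
split; apply: red.
- have [d0 d1 d2]:= vcomp_ccurl (single 0 f); move: d0 d1 d2; rewrite !vcomp_single !pz=> d0 d1 d2.
 by apply: ord3_ind; [apply: etrans (congr1 (@^~ y) d0) _|apply: etrans (congr1 (@^~ y) d1) _|apply: etrans (congr1 (@^~ y) d2) _];
  rewrite /= !ordE; move: (partial 0 f y) (partial 1 f y) (partial 2 f y)=> *; ring.
- have [d0 d1 d2]:= vcomp_ccurl (single 1 f); move: d0 d1 d2; rewrite !vcomp_single !pz=> d0 d1 d2.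
 by apply: ord3_ind; [apply: etrans (congr1 (@^~ y) d0) _|apply: etrans (congr1 (@^~ y) d1) _|apply: etrans (congr1 (@^~ y) d2) _];
  rewrite /= !ordE; move: (partial 0 f y) (partial 1 f y) (partial 2 f y)=> *; ring.
- have [d0 d1 d2]:= vcomp_ccurl (single 2 f); move: d0 d1 d2; rewrite !vcomp_single !pz=> d0 d1 d2.
 by apply: ord3_ind; [apply: etrans (congr1 (@^~ y) d0) _|apply: etrans (congr1 (@^~ y) d1) _|apply: etrans (congr1 (@^~ y) d2) _];
  rewrite /= !ordE; move: (partial 0 f y) (partial 1 f y) (partial 2 f y)=> *; ring.
Qed.

(** The double curl of an average, tested against the translated kernel. *)
Lemma ccurl2_vaverage k x m: test setT k ->
 ccurl (ccurl (vaverage Om a k)) x 0 m = ip Om a (ccurl (ccurl (single m (fun y=> k (y-x))))).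
move=> tk; set f:= fun y=> k (y-x); have tf: test setT f:= test_translate x tk.
have pf i: (fun y=> partial i k (y-x)) = partial i f.
 by apply/funext=> y; rewrite /f partial_translate//; exact: tk.1.
have P i j: partial i (vcomp (ccurl (vaverage Om a k)) j) x = - ip Om a (ccurl (single j (partial i f))).
 by rewrite -pf; exact: partial_ccurl_vaverage.
have key p q p' q': ip Om a (ccurl (fun y=> -1 *: single q (partial p f) y+single p' (partial q' f) y)) =
  - ip Om a (ccurl (single q (partial p f))) - - ip Om a (ccurl (single p' (partial q' f))).
 have s1:= vtest_single q (test_partial p tf); have s2:= vtest_single p' (test_partial q' tf).
 have l1:= vtest_L2_all oO OM (vtest_ccurl s1); have l2:= vtest_L2_all oO OM (vtest_ccurl s2).
 have E y:= @ccurl_lin R (-1) _ _ y (fun i=> (s1 i).1) (fun i=> (s2 i).1).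
 apply: etrans (eq_ip_on (fun x _=> erefl) (fun y _=> E y)) _.
 by apply: etrans (ip_linr mO (-1) l1 l2 la) _; rewrite mulN1r opprK.
have [c0 c1 c2]:= vcomp_ccurl (ccurl (vaverage Om a k)).
have S y:= @ccurl_single f y tf.1.
have F0: ccurl (single 0 f) = fun y=> -1 *: single 2 (partial 1 f) y+single 1 (partial 2 f) y.
 by apply/funext=> y; case: (S y).
have F1: ccurl (single 1 f) = fun y=> -1 *: single 0 (partial 2 f) y+single 2 (partial 0 f) y.
 by apply/funext=> y; case: (S y).
have F2: ccurl (single 2 f) = fun y=> -1 *: single 1 (partial 0 f) y+single 0 (partial 1 f) y.
 by apply/funext=> y; case: (S y).
rewrite -[LHS]/(vcomp (ccurl (ccurl (vaverage Om a k))) m x).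
elim/ord3_ind: m.
- apply: etrans (congr1 (@^~ x) c0) _; rewrite F0 /= (P 1 2) (P 2 1); exact: esym (key 1 2 1 2).
- apply: etrans (congr1 (@^~ x) c1) _; rewrite F1 /= (P 2 0) (P 0 2); exact: esym (key 2 0 2 0).
- apply: etrans (congr1 (@^~ x) c2) _; rewrite F2 /= (P 0 1) (P 1 0); exact: esym (key 0 1 0 1).
Qed.

Lemma ccurl_eq_on U (A B: vfield R) x: open U -> (forall y, U y -> A y = B y) -> U x -> ccurl A x = ccurl B x.
move=> oU h Ux; have P i j: partial i (vcomp A j) x = partial i (vcomp B j) x.
 by apply: (partial_eq_on i oU _ Ux)=> y Uy; rewrite /vcomp h.
by rewrite /ccurl !P.
Qed.

Lemma frob0r (u: 'rV[R]_3): frob u 0 = 0.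
by rewrite /frob big1// => i _; rewrite big1// => j _; rewrite mxE mulr0. Qed.

Lemma compact_margin (K: set (R3 R)): compact K -> K `<=` Om -> exists2 e: R, 0 < e & forall y, K y -> oball y e `<=` Om.
move=> cK KO; have oK: open (~` K) by exact: closed_openC (compact_closed3 cK).
have /choice[r hr] x: exists r: R, 0 < r /\ ((oball x r `<=` Om) \/ (oball x r `<=` ~` K)).
 have [Kx|nK]:= pselect (K x).
  by have [r r0 h]:= iffLR (open3P _) oO x (KO x Kx); exists r; split=> //; left.
 by have [r r0 h]:= iffLR (open3P _) oK x nK; exists r; split=> //; right.
have r20 x: 0 < r x/2 by rewrite divr_gt0// (hr x).1.
have [s hs]:= compact_finite_cover r20 cK.
have [e e0 he]: exists2 e: R, 0 < e & forall x, x \in s -> e <= r x/2.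
 elim: {hs} s=> [|x s [e e0 he]]; first by exists 1.
 exists (Num.min e (r x/2)); first by rewrite lt_min e0 r20.
 move=> y; rewrite inE=> /predU1P[->|/he]; first by rewrite ge_min lexx orbT.
 by apply: le_trans; rewrite ge_min lexx.
exists e=> // y Ky z zy; have [x xs yx]:= hs y Ky.
have rp:= r20 x; have [h|h]:= (hr x).2.
 apply: h; rewrite /oball/=; apply: le_lt_trans (ler_distD y _ _) _.
 have:= ltrD (lt_le_trans zy (he x xs)) yx.
 by move: (`|z-y| + `|y-x|)=> t; lra.
by exfalso; apply: (h y)=> //; rewrite /oball/=; apply: lt_trans yx _; move: rp; lra.
Qed.

Lemma vtest_vaverage c e k: averaging c e k -> vtest setT (vaverage Om a k).
move=> ak i; rewrite vcomp_vaverage.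
have li:= iffLR (vL2P _ _) la i; have iu:= restrict_integrable OM li.
have mu_: measurable_fun (setT: set T3) (vcomp a i \_ Om: T3 -> R) by case/integrableP: iu=> /measurable_EFinP.
have cc: compact (cube (M+(`|c| + e)): set (R3 R)).
 by apply: compact_setX; [apply: compact_setX|]; exact: segment_compact.
apply: (average_test ak iu cc)=> // x nz; apply: contrapT=> nx; move/eqP: nz; apply.
apply: (average_outside (M:= M) (d:= `|c| + e) ak _ mu_ (lexx _)).
 by move=> y My; rewrite patchE memNset// => /OM/cubeE; rewrite leNgt My.
by rewrite ltNge; apply/negP=> /cubeE.
Qed.

(** A field whose double curl vanishes weakly has a smooth curl; it is given by
  averages over balls of any radius. *)
Lemma curl_regular: exists T: vfield R, [/\ forall i, smooth_on Om (vcomp T i),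
 forall x (rho e: R), oball x rho `<=` Om -> 0 < e -> e < rho -> T x = ccurl (vaverage Om a (mollifier 0 e)) x,
 forall x, Om x -> ccurl T x = 0 &
 forall eta, vtest Om eta -> ip Om T eta = ip Om a (ccurl eta)].
have /choice[r hr] x: exists r: R, 0 < r /\ (Om x -> oball x r `<=` Om).
 have [Ox|nO]:= pselect (Om x); last by exists 1.
 by have [r r0 h]:= iffLR (open3P _) oO x Ox; exists r.
pose T x:= ccurl (vaverage Om a (mollifier 0 (r x/2))) x.
have hT x (rho e: R): oball x rho `<=` Om -> 0 < e -> e < rho -> T x = ccurl (vaverage Om a (mollifier 0 e)) x.
 move=> xO e0 er; have [r0 rO]:= hr x.
 have Ox: Om x by apply: xO; apply: oball_self; exact: lt_trans er.
 by apply: (ccurl_vaverage_radius (rO Ox) xO)=> //; [rewrite divr_gt0|move: r0; lra].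
have loc x: Om x -> exists V: set (R3 R), exists2 k, test setT k & [/\ open V, V x, V `<=` Om &
  (forall y, V y -> T y = ccurl (vaverage Om a k) y) /\ ccurl (ccurl (vaverage Om a k)) x = 0].
 move=> Ox; have [r0 rO]:= hr x; pose s:= r x/2.
 have s0: 0 < s by rewrite divr_gt0.
 have yO y: oball x s y -> oball y s `<=` Om.
  move=> yx z zy; apply: (rO Ox); rewrite /oball/=; apply: le_lt_trans (ler_distD y _ _) _.
  by have:= ltrD zy yx; rewrite /s; move: (`|z-y| + `|y-x|)=> t; lra.
 have e0: 0 < s/2 by rewrite divr_gt0.
 have es: s/2 < s by move: s0; lra.
 have tk:= moll_test e0.
 exists (oball x s); exists (mollifier 0 (s/2)); first exact: tk.
 split; [exact: oball_open|exact: oball_self| |split].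
 + by move=> y /yO; apply; exact: oball_self.
 + by move=> y /yO h; exact: hT h e0 es.
 apply/rowP=> m; rewrite (ccurl2_vaverage x m tk) ha ?mxE//; apply: vtest_single.
 split; first exact: (test_translate x tk).1.
 exists [set y | `|y-x| <= s/2]; split; first exact: closed_ball_compact.
 - by move=> y /= yx; apply: (yO x (oball_self x s0)); exact: le_lt_trans yx es.
 - move=> y /= yx; apply/eqP/negPn/negP=> nz; apply: yx.
  by have [_ _ _ ks]:= averaging_mollifier 0 e0; have:= ks _ nz; rewrite subr0=> /ltW.
exists T; split=> //.
- move=> i; apply: smooth_on_local=> x Ox; have [V [k tk [oV Vx VO [hV _]]]]:= loc x Ox.
 exists V; split=> //; apply: (eq_smooth_on oV (p:= vcomp (ccurl (vaverage Om a k)) i)).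
  by move=> y Vy; rewrite /vcomp hV.
 by apply: smooth_smooth_on; apply: smooth_ccurl; exact: smooth_vaverage.
- move=> x Ox; have [V [k tk [oV Vx VO [hV z]]]]:= loc x Ox.
 by rewrite (ccurl_eq_on oV hV Vx).
move=> eta te; apply/eqP; rewrite -subr_eq0 -sqrf_eq0 eq_le sqr_ge0 andbT.
have lce:= vtest_L2 (vtest_ccurl te); have I0:= ip_ge0 Om (ccurl eta).
have [e0 e00 hm]: exists2 e0: R, 0 < e0 & forall y, eta y != 0 -> oball y e0 `<=` Om.
 have /choice[m hm] i: exists m: R, 0 < m /\ forall y, vcomp eta i y != 0 -> oball y m `<=` Om.
  have [_ [K [cK KO hK]]]:= te i; have [m m0 mK]:= compact_margin cK KO.
  exists m; split=> // y nz; apply: mK; apply: contrapT=> nK; move/eqP: nz; apply; exact: hK.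
 exists (Num.min (m 0) (Num.min (m 1) (m 2))); first by rewrite !lt_min !(hm _).1.
 move=> y nz; have [i ni]: exists i, vcomp eta i y != 0.
  apply/existsP; apply: contraNT nz=> /existsPn h; apply/eqP/rowP=> i; rewrite [RHS]mxE.
  by apply/eqP; have:= h i; rewrite negbK.
 move=> z; rewrite /oball/= !lt_min=> /and3P[z0 z1 z2]; apply: ((hm i).2 y ni z).
 by case: i {ni}=> -[|[|[|//]]] Hi; [move: z0|move: z1|move: z2]; rewrite /oball/=; congr (_ < m _); exact/val_inj.
apply: (le_eps_sqr I0)=> delta d0 d1; rewrite add0r.
have dd: 0 < delta^+2 by rewrite exprn_gt0.
have [d dp hd]:= vaverage_cvg oO OM la dd.
pose e:= Num.min d (e0/2).
have ep: 0 < e by rewrite lt_min dp divr_gt0.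
have ee: e < e0 by apply: (@le_lt_trans _ _ (e0/2)); [rewrite ge_min lexx orbT|move: e00; lra].
have ak:= averaging_mollifier (0: R3 R) ep; have tk:= moll_test ep.
have ed: `|0: R3 R| + e <= d by rewrite normr0 add0r ge_min lexx.
have [lA hA]:= hd _ _ _ ak ed.
set A:= vaverage Om a (mollifier 0 e) in lA hA.
have tA:= vtest_vaverage ak.
have ->: ip Om T eta = ip Om A (ccurl eta).
 rewrite -(weak_curl_smooth oO OM tA te); apply: eq_Rintegral=> x /set_mem Ox.
 have [->|nz]:= eqVneq (eta x) 0.
  exact: etrans (frob0r _) (esym (frob0r _)).
 exact: (congr1 (fun t=> frob t (eta x)) (hT x e0 e (hm x nz) ep ee)).
have lD:= L2B mO lA la.
have ->: ip Om A (ccurl eta)-ip Om a (ccurl eta) = ip Om (fun x=> A x-a x) (ccurl eta).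
 exact: esym (ipBl mO lA la lce).
apply: le_trans (ip_CS mO lD lce) _.
by rewrite mulrC ler_wpM2l.
Qed.

End CurlRegularity2.

(** * Curl-free fields on simply connected domains *)

Section StarPotential.
Context {R: realType}.
Notation T3:= (space3 R).
Notation T1:= (measurableTypeR R).
Notation leb1:= (@lebesgue_measure R).
Variables (Om: set (R3 R)) (T: vfield R).
Hypothesis oO: open Om.
Hypothesis sT: forall i, smooth_on Om (vcomp T i).
Hypothesis cT: forall x, Om x -> ccurl T x = 0.
Implicit Types (x y z c: R3 R).

Lemma partial_sym i j x: Om x -> partial i (vcomp T j) x = partial j (vcomp T i) x.
move=> Ox; have z:= cT Ox; have [c0 c1 c2]:= vcomp_ccurl T.
have Z m: vcomp (ccurl T) m x = 0 by rewrite /vcomp z mxE.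
have h0: partial 1 (vcomp T 2) x = partial 2 (vcomp T 1) x by apply: subr0_eq; rewrite -(Z 0) c0.
have h1: partial 2 (vcomp T 0) x = partial 0 (vcomp T 2) x by apply: subr0_eq; rewrite -(Z 1) c1.
have h2: partial 0 (vcomp T 1) x = partial 1 (vcomp T 0) x by apply: subr0_eq; rewrite -(Z 2) c2.
by elim/ord3_ind: i; elim/ord3_ind: j=> *; [exact: erefl|exact: h2|exact: (esym h1)|exact: (esym h2)|exact: erefl|exact: h0|exact: h1|exact: (esym h0)|exact: erefl].
Qed.

Let ind (t: R): R:= \1_(`[0%R, 1%R]%classic: set R) t.
Let h (t: T1): R:= t * ind t.
Let iind: leb1.-integrable setT (EFin \o ind). Proof. exact: integrable_indic_itv. Qed.
Let mh: measurable_fun (setT: set T1) h.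
by apply: measurable_funM=> //; apply: measurable_indic; exact: measurable_itv. Qed.
Let hH t: `|h t| <= 1.
rewrite /h /ind indicE; case: (boolP (t \in _))=> [/set_mem/=|_]; last by rewrite mulr0 normr0.
by rewrite in_itv/= => /andP[h1 h2]; rewrite mulr1 ger0_norm.
Qed.

Lemma seg_weight (t q a b d p0 p1 p2: R): 1 * q+(a * (1 * t * p0)+b * (1 * t * p1)+d * (1 * t * p2)) =
 q+t * (a * p0+b * p1+d * p2).
ring. Qed.

Lemma star_shift (q a b d s0 s1 s2: R) (j: 'I_3) (S: 'I_3 -> R) :
 (coord 0 (e_ j: R3 R) * S 0+a * s0)+(coord 1 (e_ j: R3 R) * S 1+b * s1)+(coord 2 (e_ j: R3 R) * S 2+d * s2) =
 S j+(a * s0+b * s1+d * s2).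
rewrite (ord3_pick S j) !coord_e ![(_ == j)]eq_sym; ring. Qed.

(** On a ball a curl-free field is the gradient of its integral along the
  segments issued from the centre. *)
Lemma local_potential c (e: R): 0 < e -> oball c e `<=` Om ->
 exists2 Phi: R3 R -> R, smooth Phi & forall i y, `|y-c| < e/2 -> is_derive y (e_ i) Phi (vcomp T i y).
move=> e0 cO; have [psi [tpsi _ psi1]]:= plateau_ball c e0.
pose q i y:= psi y * vcomp T i y.
have tq i: test setT (q i).
 exact: (testM_on (@oball_open _ c e) tpsi (smooth_on_sub cO (sT i))).
have bq i:= test_bounded_smooth (tq i).
pose m (s: T1): T3:= (1-s) *: c.
have mm: measurable_fun setT m.
 have:= @measurable_line R _ T1 (fun=> 0) (fun s=> 1-s) c; rewrite /m.
 by under [X in _ -> _ -> measurable_fun _ X]eq_fun do rewrite add0r; apply=> //; exact: measurable_funB.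
pose S i:= superpose leb1 h m ind (q i).
have dS i j y: is_derive y (e_ j) (S i) (superpose leb1 h m (fun t=> ind t * h t) (partial j (q i)) y).
 exact: (superpose_derive mh mm hH).
pose k i y: R:= coord i y-coord i c.
have dk i j y: is_derive y (e_ j) (k i) (coord i (e_ j)).
 by rewrite coord_e; apply: is_derive_eq (is_deriveB (is_derive_coord i j y) (is_derive_cst _ _ _)) _; rewrite subr0.
pose D i j y:= superpose leb1 h m (fun t=> ind t * h t) (partial j (q i)) y.
have sS i: smooth (S i) by exact: (superpose_smooth mh mm hH).
have sk i: smooth (fun y=> k i y * S i y).
 apply/smoothP; apply: smooth_onM; [exact: openT| |exact/smoothP].
 by apply: smooth_onB; [exact: openT|apply: smooth_on_coord; exact: openT|exact: smooth_on_cst].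
exists (fun y=> k 0 y * S 0 y+k 1 y * S 1 y+k 2 y * S 2 y)=> [|j y yc].
 by apply/smoothP; apply: smooth_onD; [exact: openT|apply: smooth_onD; [exact: openT|exact/smoothP|exact/smoothP]|exact/smoothP].
have dM i: is_derive y (e_ j) (fun y=> k i y * S i y) (coord i (e_ j) * S i y+k i y * D i j y).
 by apply: is_derive_eq (is_deriveM (dk i j y) (dS i j y)) _; rewrite addrC mulrC.
apply: is_derive_eq (is_deriveD (is_deriveD (dM 0) (dM 1)) (dM 2)) _.
rewrite (@star_shift 0 (k 0 y) (k 1 y) (k 2 y) (D 0 j y) (D 1 j y) (D 2 j y) j (fun i=> S i y)).
pose z (s: R):= c+s *: (y-c).
have zE (s: R): 0 <= s <= 1 -> `|z s-c| < e/2.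
 move=> /andP[s0 s1]; rewrite /z addrAC subrr add0r normrZ ger0_norm//.
 by apply: le_lt_trans yc; rewrite ler_piMl.
have qT i u: `|u-c| < e/2 -> q i u = vcomp T i u by move=> uc; rewrite /q psi1// mul1r.
have oB: open (oball c (e/2)) by exact: oball_open.
have pq i l u: `|u-c| < e/2 -> partial l (q i) u = partial i (q l) u.
 move=> uc; rewrite (partial_eq_on l oB (qT i) uc) (partial_eq_on i oB (qT l) uc); apply: partial_sym.
 by apply: cO; rewrite /oball/=; apply: lt_le_trans uc _; move: e0; lra.
pose f (s: R):= q j (z s)+s * (k 0 y * partial 0 (q j) (z s)+k 1 y * partial 1 (q j) (z s)+k 2 y * partial 2 (q j) (z s)).
have zm (s: R): s *: y+(1-s) *: c = z s.
 by rewrite /z scalerBr scalerBl scale1r addrCA addrA -addrA [_ - _]addrC addrA addrC addrA.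
have sq i: smooth (q i):= (tq i).1.
transitivity (\int[leb1]_(s in `[0, 1]) f s).
 have iw: leb1.-integrable setT (EFin \o (fun t=> ind t * h t)).
  under [X in _.-integrable _ (_ \o X)]funext=> t do rewrite mulrC.
  by apply: (@rintegrable_bmul _ _ _ _ _ _ _ _ 1).
 pose A (t: T1): R:= ind t * q j (h t *: y+m t).
 pose B i (t: T1): R:= ind t * h t * partial j (q i) (h t *: y+m t).
 have iA: leb1.-integrable setT (EFin \o A):= superpose_integrable mh mm y iind (bq j).
 have iB i: leb1.-integrable setT (EFin \o B i):= superpose_integrable mh mm y iw (bounded_smooth_partial j (bq i)).
 have ikB i: leb1.-integrable setT (EFin \o (fun t=> k i y * B i t)):= rintegrableZ measurableT (k i y) (iB i).
 have i01:= rintegrableD measurableT (ikB 0) (ikB 1).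
 have i012:= rintegrableD measurableT i01 (ikB 2).
 have Z i: k i y * D i j y = \int[leb1]_t (k i y * B i t).
  by rewrite RintegralZl.
 rewrite !Z -[S j y]/(\int[leb1]_t A t).
 transitivity (\int[leb1]_t (A t+(k 0 y * B 0 t+k 1 y * B 1 t+k 2 y * B 2 t))).
  by rewrite (RintegralD measurableT iA i012) (RintegralD measurableT i01 (ikB 2)) (RintegralD measurableT (ikB 0) (ikB 1)).
 rewrite [RHS]Rintegral_mkcond; apply: eq_Rintegral=> t _; rewrite patchE /A /B.
 case: (boolP (t \in _))=> [ht|nt].
  have h1: h t = t by rewrite /h /ind indicE ht mulr1.
  have i1: ind t = 1 by rewrite /ind indicE ht.
  have t01: 0 <= t <= 1 by move/set_mem: ht; rewrite /= in_itv.
  rewrite h1 i1 /m zm /f -(pq 0 j _ (zE t t01)) -(pq 1 j _ (zE t t01)) -(pq 2 j _ (zE t t01)).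
  exact: seg_weight.
 have i0: ind t = 0 by rewrite /ind indicE (negPf nt).
 by rewrite i0 !mul0r !mulr0 !addr0.
have kE i: coord i (y-c) = k i y by rewrite coordB.
have H1 (s: R): 0 <= s <= 1 -> is_derive s (1: R) (fun s=> s * q j (z s)) (f s).
 move=> _; have d1: is_derive s (1: R) (fun s=> q j (z s)) (\sum_i coord i (y-c) * partial i (q j) (z s)).
  apply/is_derive_line; apply: (@smooth_on_dir R setT)=> //; [exact: openT|exact/smoothP].
 apply: is_derive_eq (is_deriveM (is_derive_id s (1: R)) d1) _.
 by rewrite sum3E !kE [LHS]addrC; exact: (congr1 (fun u=> u + _) (mulr1 _)).
have H2: {within `[0%R, 1%R], continuous f}.
 apply: continuous_subspaceT=> s.
 have cz (p: R3 R -> R): smooth p -> {for s, continuous (fun s=> p (z s))}.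
  move=> sp; apply: (@continuous_comp _ _ _ z p); last exact: (smooth_cont sp).
  by apply: cvgD; [exact: cvg_cst|apply: cvgZr_tmp; exact: cvg_id].
 have sp i: smooth (partial i (q j)):= smooth_partial i (sq j).
 apply: cvgD; first exact: (cz _ (sq j)).
 apply: cvgM; first exact: cvg_id.
 by apply: cvgD; [apply: cvgD|]; apply: cvgM; try exact: cvg_cst; exact: (cz _ (sp _)).
apply: etrans (segment_FTC ltr01 H1 H2) _.
by rewrite mul1r mul0r subr0 /z scale1r subrKC qT.
Qed.

End StarPotential.

Section Monodromy.
Context {R: realType}.
Notation leb1:= (@lebesgue_measure R).
Variables (Om: set (R3 R)) (T: vfield R).
Hypothesis oO: open Om.
Hypothesis sT: forall i, smooth_on Om (vcomp T i).
Hypothesis cT: forall x, Om x -> ccurl T x = 0.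
Implicit Types (x y z c: R3 R).

(** The integral of T along a segment. *)
Definition seg x y: R:= \int[leb1]_(s in `[0, 1]) \sum_i coord i (y-x) * vcomp T i (x+s *: (y-x)).

Definition exact_on (B: set (R3 R)):= exists Phi: R3 R -> R, forall x y, B x -> B y -> seg x y = Phi y-Phi x.

Lemma oball_convex c (r: R) x y (s: R): oball c r x -> oball c r y -> 0 <= s <= 1 -> oball c r (x+s *: (y-x)).
move=> xc yc /andP[s0 s1]; rewrite /oball/=.
have ->: x+s *: (y-x)-c = (1-s) *: (x-c)+s *: (y-c).
 rewrite !scalerBr !scalerBl !scale1r; move: (s *: x) (s *: y) (s *: c)=> u v w.
 rewrite opprD opprK !addrA (addrAC _ v (- w)) addrK.
 by rewrite (addrAC x v) (addrAC _ v).
apply: le_lt_trans (ler_normD _ _) _; rewrite !normrZ !ger0_norm ?subr_ge0//.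
have [->|sn]:= eqVneq s 1; first by rewrite subrr mul0r add0r mul1r.
have s1': 0 < 1-s by rewrite subr_gt0 lt_neqAle sn.
have h1: (1-s) * `|x-c| < (1-s) * r by rewrite ltr_pM2l.
have h2: s * `|y-c| <= s * r by rewrite ler_wpM2l// ltW.
by move: h1 h2; move: `|x-c| `|y-c| => u v; lra.
Qed.

Lemma exact_ball c (e: R): 0 < e -> oball c e `<=` Om -> exists Phi: R3 R -> R,
 [/\ smooth Phi, forall i y, oball c (e/2) y -> is_derive y (e_ i) Phi (vcomp T i y) &
 forall x y, oball c (e/2) x -> oball c (e/2) y -> seg x y = Phi y-Phi x].
move=> e0 cO; have [Phi smP hPhi]:= local_potential sT cT e0 cO; exists Phi; split=> // x y xB yB.
have oB: open (oball c (e/2)) by exact: oball_open.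
have BO: oball c (e/2) `<=` Om by move=> u /= uc; apply: cO; apply: lt_trans uc _; move: e0; lra.
have zB (s: R): 0 <= s <= 1 -> oball c (e/2) (x+s *: (y-x)) by exact: oball_convex.
pose f (s: R):= \sum_i coord i (y-x) * partial i Phi (x+s *: (y-x)).
have ->: seg x y = \int[leb1]_(s in `[0, 1]) f s.
 apply: eq_Rintegral=> s /set_mem; rewrite /= in_itv/= => s01.
 by apply: eq_bigr=> i _; have [_ E]:= hPhi i _ (zB s s01); rewrite -E.
by rewrite -(smooth_FTC x (y-x) smP) subrKC.
Qed.

Definition path_sum (n: nat) (g: R -> R3 R): R:= \sum_(k < n) seg (g (k%:R/n%:R)) (g (k.+1%:R/n%:R)).

Lemma exact_add B x y z: exact_on B -> B x -> B y -> B z -> seg x y+seg y z = seg x z.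
by move=> [Phi h] Bx By Bz; rewrite !h//; ring. Qed.

Lemma exact_refl B x: exact_on B -> B x -> seg x x = 0.
by move=> [Phi h] Bx; rewrite h// subrr. Qed.

Lemma exact_sym B x y: exact_on B -> B x -> B y -> seg y x = - seg x y.
by move=> [Phi h] Bx By; rewrite !h// opprB. Qed.

Lemma exact_path B (g: nat -> R3 R) (m: nat): exact_on B -> (forall k, (k <= m)%N -> B (g k)) ->
 \sum_(k < m) seg (g k) (g k.+1) = seg (g 0%N) (g m).
move=> [Phi h] Bg; rewrite h; [|exact: Bg|exact: Bg].
rewrite -(telescope_sumr (fun k=> Phi (g k)) (leq0n m)) big_mkord; apply: eq_bigr=> k _.
by rewrite h//; apply: Bg; [apply: ltnW|]; exact: ltn_ord.
Qed.

Lemma sum_blocks (n m: nat) (u: nat -> R): \sum_(k < n * m) u k = \sum_(i < n) \sum_(j < m) u (i * m+j)%N.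
elim: n=> [|n IH]; first by rewrite mul0n !big_ord0.
by rewrite mulSnr big_split_ord /= big_ord_recr /= -IH.
Qed.

Definition subdivided (n: nat) (g: R -> R3 R):= forall k, (k < n)%N -> exists2 B, exact_on B &
 forall t: R, k%:R/n%:R <= t <= k.+1%:R/n%:R -> B (g t).

(** Points of subdivision may be added to a path when the field has a potential
  near each of its pieces. *)
Lemma path_sum_refine (n m: nat) (g: R -> R3 R): (0 < n)%N -> (0 < m)%N -> subdivided n g -> path_sum (n * m) g = path_sum n g.
move=> n0 m0 fg; rewrite /path_sum (sum_blocks n m (fun k=> seg (g (k%:R/(n * m)%:R)) (g (k.+1%:R/(n * m)%:R)))).
have n0': (n%:R: R) != 0 by rewrite pnatr_eq0 -lt0n.
have m0': (m%:R: R) != 0 by rewrite pnatr_eq0 -lt0n.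
have nmp: 0 < (n * m)%:R :> R by rewrite ltr0n muln_gt0 n0.
apply: eq_bigr=> i _; have [B eB hB]:= fg i (ltn_ord i).
have E1: i%:R/n%:R = (i * m+0)%:R/(n * m)%:R :> R by rewrite addn0 !natrM; field; rewrite n0' m0'.
have E2: i.+1%:R/n%:R = (i * m+m)%:R/(n * m)%:R :> R by rewrite -mulSnr !natrM; field; rewrite n0' m0'.
have:= @exact_path B (fun j=> g ((i * m+j)%:R/(n * m)%:R)) m eB.
rewrite -E1 -E2=> <-.
 by apply: eq_bigr=> j _; rewrite addnS.
move=> k km; apply: hB; rewrite E1 E2 !ler_pM2r ?invr_gt0// !ler_nat !leq_add2l km.
by rewrite andbT.
Qed.

Lemma cover_fine (H: R * R -> R3 R): continuous H -> (forall p, Om (H p)) ->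
 exists N, forall n, (N <= n)%N -> forall p, (`[0%R, 1%R] `*` `[0%R, 1%R])%classic p ->
  exists2 B, exact_on B & forall q, `|q-p| <= n.+1%:R^-1 -> B (H q).
move=> cH HO; pose K: set (R * R):= (`[0%R, 1%R] `*` `[0%R, 1%R])%classic.
have cK: compact K by apply: compact_setX; exact: segment_compact.
have [|N _ hN]:= iffLR (compact_near_coveringP K) cK nat \oo
 (fun n p=> exists2 B, exact_on B & forall q, `|q-p| <= n.+1%:R^-1 -> B (H q)) _; last first.
 by exists N=> n Nn p Kp; exact: hN.
move=> p _; have [e e0 eO]:= iffLR (open3P _) oO (H p) (HO p).
have [Phi [_ _ hPhi]]:= exact_ball e0 eO.
have: nbhs p (H @^-1` (oball (H p) (e/2))).
 apply: cH; apply: open_nbhs_nbhs; split; first exact: oball_open.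
 by apply: oball_self; rewrite divr_gt0.
move=> /nbhs_ballP[d /= d0 hd]; have d20: 0 < d/2 by rewrite divr_gt0.
have [N hN]:= inv_small (divr_gt0 d20 (ltr0n R 2)).
exists (ball p (d/2), [set n | (N <= n)%N])=> /=.
 by split; [apply: nbhsx_ballx|exists N].
move=> [p' n] [/= pp' /hN hn]; exists (oball (H p) (e/2)); first by exists Phi.
move=> q qp'; apply: hd; rewrite -ball_normE/=; move: pp'; rewrite -ball_normE/= => pp'.
apply: le_lt_trans (ler_distD p' _ _) _; rewrite (distrC p' q).
by move: pp' (le_trans qp' hn); move: d20; move: (`|p-p'|) (`|q-p'|)=> u v; lra.
Qed.

Lemma norm2_le (a b t: R): `|a| <= t -> `|b| <= t -> `|((a, b): R * R)| <= t.
by move=> ha hb; rewrite /Num.norm/= ge_max ha hb. Qed.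

Lemma grid_bound (n k: nat): (k <= n.+1)%N -> 0 <= (k%:R/n.+1%:R: R) <= 1.
by move=> kn; rewrite divr_ge0//= ler_pdivrMr// mul1r ler_nat.
Qed.

Lemma grid_step (n k: nat): (k.+1%:R/n.+1%:R-k%:R/n.+1%:R: R) = n.+1%:R^-1.
by rewrite -mulrBl -natrB// subSnn mul1r. Qed.

Lemma path_fine (g: R -> R3 R): continuous g -> (forall t, Om (g t)) ->
 exists N, forall n, (N <= n)%N -> subdivided n.+1 g.
move=> cg gO; have cH: continuous (fun p: R * R=> g p.1).
 by move=> p; apply: (@continuous_comp _ _ _ fst g); [exact: cvg_fst|exact: cg].
have [N hN]:= cover_fine cH (fun p=> gO p.1).
exists N=> n Nn k kn; have [|B eB hB]:= hN n Nn (k%:R/n.+1%:R, 0).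
 by split; rewrite /= in_itv/= ?lexx ?ler01// grid_bound// ltnW.
exists B=> // t /andP[t0 t1]; apply: (hB (t, 0)); apply: norm2_le=> /=; last by rewrite subrr normr0.
by rewrite ger0_norm ?subr_ge0// -[leRHS](grid_step n k) lerD2r.
Qed.

(** Discrete Stokes formula on a null-homotopy: the sum over the boundary of
  each small cell vanishes. *)
Lemma null_homotopic_sum (H: R * R -> R3 R) c: continuous H -> (forall p, Om (H p)) ->
 (forall t, 0 <= t <= 1 -> H (1, t) = c) -> (forall s, 0 <= s <= 1 -> H (s, 0) = c /\ H (s, 1) = c) ->
 exists N, forall n, (N <= n)%N -> path_sum n.+1 (fun t=> H (0, t)) = 0.
move=> cH HO H1 H0; have [N hN]:= cover_fine cH HO; exists N=> n Nn.
pose a (i j: nat):= H (i%:R/n.+1%:R, j%:R/n.+1%:R).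
have n0: 0 < (n.+1%:R)^-1 :> R by rewrite invr_gt0.
have cell i j: (i <= n)%N -> (j <= n)%N -> exists2 B, exact_on B & [/\ B (a i j), B (a i.+1 j), B (a i j.+1) & B (a i.+1 j.+1)].
 move=> in_ jn; have [|B eB hB]:= hN n Nn (i%:R/n.+1%:R, j%:R/n.+1%:R).
  by split; rewrite /= in_itv/=; apply: grid_bound; exact: leqW.
 exists B=> //; split; apply: hB; apply: norm2_le=> /=; rewrite ?grid_step ?subrr ?normr0 ?(ger0_norm (ltW n0))//; exact: ltW.
have a0 i: (i <= n.+1)%N -> a i 0%N = c.
 by move=> h; rewrite /a mul0r; case: (H0 _ (grid_bound h)).
have an i: (i <= n.+1)%N -> a i n.+1 = c.
 by move=> h; rewrite /a divff ?pnatr_eq0//; case: (H0 _ (grid_bound h)).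
have cc: seg c c = 0.
 have [B eB [h _ _ _]]:= cell 0%N 0%N (leq0n _) (leq0n _).
 by apply: (exact_refl eB); rewrite -(a0 0%N).
pose row i:= \sum_(j < n.+1) seg (a i j) (a i j.+1).
have step i: (i <= n)%N -> row i = row i.+1.
 move=> in_; apply: subr0_eq; rewrite /row -sumrB.
 pose d j:= - seg (a i j) (a i.+1 j).
 rewrite (eq_bigr (fun j: 'I_n.+1=> d j.+1-d j)); last first.
  move=> j _; have [B eB [b00 b10 b01 b11]]:= cell i j in_ (ltn_ord j).
  have e1:= exact_add eB b00 b01 b11; have e2:= exact_add eB b00 b10 b11.
  by rewrite /d; move: e1 e2; move: (seg _ _) (seg _ _) (seg _ _) (seg _ _) (seg _ _)=> *; lra.
 rewrite -(big_mkord xpredT (fun j=> d j.+1-d j)) telescope_sumr//.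
 by rewrite /d !a0 ?an// ?(leqW in_)// cc oppr0 subrr.
have rows i: (i <= n.+1)%N -> row 0%N = row i.
 by elim: i=> [//|i IH] h; rewrite (IH (ltnW h)) (step i h).
have ->: path_sum n.+1 (fun t=> H (0, t)) = row 0%N by apply: eq_bigr=> j _; rewrite /a !mul0r.
rewrite (rows n.+1)// /row big1// => j _.
have ->: a n.+1 j = c by rewrite /a divff ?pnatr_eq0//; apply: H1; apply: grid_bound; exact: ltnW.
by rewrite /a divff ?pnatr_eq0// H1//; apply: grid_bound.
Qed.

Definition clamp (t: R): R:= Num.max 0 (Num.min 1 t).

Lemma clamp01 t: 0 <= clamp t <= 1.
by rewrite /clamp le_max lexx/= ge_max ler01 ge_min lexx. Qed.

Lemma clamp_id t: 0 <= t <= 1 -> clamp t = t.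
by move=> /andP[t0 t1]; rewrite /clamp min_r// max_r. Qed.

Lemma clamp_low t: t <= 0 -> clamp t = 0.
by move=> t0; rewrite /clamp min_r ?(le_trans t0)// max_l. Qed.

Lemma clamp_high t: 1 <= t -> clamp t = 1.
by move=> t1; rewrite /clamp min_l// max_r. Qed.

Lemma continuous_clamp: continuous clamp.
move=> t; apply: continuous_max; [exact: cvg_cst|apply: continuous_min; [exact: cvg_cst|exact: cvg_id]].
Qed.

Lemma within_comp (X Y Z: topologicalType) (A: set Y) (f: Y -> Z) (u: X -> Y) :
 {within A, continuous f} -> continuous u -> (forall p: X, A (u p)) -> continuous (f \o u).
move=> cf cu Au p U /(iffLR (subspace_continuousP A f) cf (u p) (Au p)) hU.
have h:= cu p _ hU; apply: (@filterS _ (nbhs p) _ _ _ _ h)=> q /= hq; exact: hq (Au q).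
Qed.

(** A loop made of a path to x, the segment from x to y and the reversed path
  to y. *)
Definition triangle (g1 g2: R -> R3 R) x y (t: R): R3 R:= g1 (3 * t)+clamp (3 * t-1) *: (y-x)+(g2 (3-3 * t)-y).

Section Triangle.
Variables (g1 g2: R -> R3 R) (x y: R3 R).
Hypotheses (h1: forall t, 1 <= t -> g1 t = x) (h2: forall t, 1 <= t -> g2 t = y).

Lemma triangle1 t: 0 <= 3 * t <= 1 -> triangle g1 g2 x y t = g1 (3 * t).
move=> /andP[a b]; rewrite /triangle h2; last by move: a b; lra.
by rewrite subrr addr0 clamp_low ?scale0r ?addr0// subr_le0.
Qed.

Lemma triangle2 t: 1 <= 3 * t <= 2 -> triangle g1 g2 x y t = x+(3 * t-1) *: (y-x).
move=> /andP[a b]; rewrite /triangle h2; last by move: a b; lra.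
by rewrite h1// subrr addr0 clamp_id//; move: a b; lra.
Qed.

Lemma triangle3 t: 2 <= 3 * t <= 3 -> triangle g1 g2 x y t = g2 (3-3 * t).
move=> /andP[a b]; rewrite /triangle h1; last by move: a b; lra.
by rewrite clamp_high; [rewrite scale1r subrKC subrKC|move: a b; lra].
Qed.

Lemma triangle_sum B (m: nat): exact_on B -> (forall s: R, 0 <= s <= 1 -> B (x+s *: (y-x))) -> subdivided m.+1 g2 ->
 path_sum (3 * m.+1) (triangle g1 g2 x y) = path_sum m.+1 g1+seg x y-path_sum m.+1 g2.
move=> eB hB fg; set M:= m.+1; set L:= triangle _ _ _ _.
have M0: (M%:R: R) != 0 by rewrite pnatr_eq0.
have tE (i j: nat): 3 * ((i * M+j)%:R/(3 * M)%:R) = i%:R+j%:R/M%:R :> R.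
 by rewrite natrD !natrM; move: M0; move: (M%:R: R)=> K K0; field.
have j01 (j: nat): (j <= M)%N -> 0 <= (j%:R/M%:R: R) <= 1 by exact: grid_bound.
have L1 j: (j <= M)%N -> L ((0 * M+j)%:R/(3 * M)%:R) = g1 (j%:R/M%:R).
 by move=> jM; rewrite /L triangle1 !tE add0r// j01.
have L2 j: (j <= M)%N -> L ((1 * M+j)%:R/(3 * M)%:R) = x+(j%:R/M%:R) *: (y-x).
 move=> /j01; move: (tE 1%N j); move: (j%:R/M%:R)=> r E r01; rewrite /L triangle2 E.
  by rewrite addrAC subrr add0r.
 by move: r01; lra.
have L3 j: (j <= M)%N -> L ((2 * M+j)%:R/(3 * M)%:R) = g2 ((M-j)%:R/M%:R).
 move=> jM; have e: (M-j)%:R/M%:R = 1-j%:R/M%:R :> R by rewrite natrB// mulrBl divff.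
 rewrite e; move: (j01 _ jM) (tE 2%N j); move: (j%:R/M%:R)=> r r01 E; rewrite /L triangle3 E.
  by congr g2; ring.
 by move: r01; lra.
rewrite /path_sum (sum_blocks 3 M (fun k=> seg (L (k%:R/(3 * M)%:R)) (L (k.+1%:R/(3 * M)%:R)))).
rewrite sum3E; congr (_ + _ + _).
- by apply: eq_bigr=> j _; rewrite -addnS !L1//; exact: ltnW.
- rewrite (eq_bigr (fun j: 'I_M=> seg (x+(j%:R/M%:R) *: (y-x)) (x+(j.+1%:R/M%:R) *: (y-x)))); last first.
  by move=> j _; rewrite -addnS !L2//; exact: ltnW.
 rewrite (@exact_path B (fun j: nat=> x+(j%:R/M%:R) *: (y-x)) M eB).
  by rewrite mul0r scale0r addr0 divff// scale1r subrKC.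
 by move=> k kM; apply: hB; exact: j01.
rewrite -sumrN (reindex_inj rev_ord_inj)/=; apply: eq_bigr=> j _; have jM:= ltn_ord j.
rewrite -addnS !L3 ?leq_subr//; last by rewrite -subSn// subSS leq_subr.
have ->: (M-(M-j.+1) = j.+1)%N by rewrite subKn.
have ->: (M-(M-j.+1).+1 = j)%N by rewrite -subSn// subSS subKn// ltnW.
have [B' eB' hB']:= fg j jM; have k0: (j%:R/M%:R: R) <= j.+1%:R/M%:R by rewrite ler_pM2r ?invr_gt0 ?ltr0n// ler_nat.
by apply: (exact_sym eB'); apply: hB'; rewrite lexx ?k0.
Qed.

End Triangle.

(** Simple connectedness makes the integral of T along a path depend on its
  endpoints only. *)
Lemma potential: Om !=set0 -> simply_connected Om ->
 exists P: R3 R -> R, smooth_on Om P /\ forall x, Om x -> forall i, is_derive x (e_ i) P (vcomp T i x).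
move=> [b Ob] [hp hh].
have /choice[g hg]: forall x, exists gN: (R -> R3 R) * nat, Om x ->
  [/\ continuous gN.1, forall t, Om (gN.1 t), forall t, t <= 0 -> gN.1 t = b,
    forall t, 1 <= t -> gN.1 t = x & forall n, (gN.2 <= n)%N -> subdivided n.+1 gN.1].
 move=> x; have [Ox|nO]:= pselect (Om x); last by exists (fun=> 0, 0%N).
 have [c [[cc cO] c0 c1]]:= hp b x Ob Ox.
 have ck: continuous (c \o clamp).
  by apply: within_comp cc continuous_clamp _=> t; rewrite /= in_itv/=; exact: clamp01.
 have kO t: Om ((c \o clamp) t) by apply: cO; exact: clamp01.
 have [N hN]:= path_fine ck kO; exists (c \o clamp, N)=> _; split=> //= t ht.
  by rewrite clamp_low.
 by rewrite clamp_high.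
pose P x:= path_sum (g x).2.+1 (g x).1.
have PE x (n: nat): Om x -> ((g x).2 <= n)%N -> path_sum n.+1 (g x).1 = P x.
 move=> Ox gn; have [_ _ _ _ fx]:= hg x Ox.
 rewrite -(path_sum_refine (ltn0Sn n) (ltn0Sn (g x).2) (fx n gn)) mulnC.
 exact: (path_sum_refine (ltn0Sn (g x).2) (ltn0Sn n) (fx _ (leqnn _))).
have dP x y B: exact_on B -> B `<=` Om -> (forall s: R, 0 <= s <= 1 -> B (x+s *: (y-x))) -> P y-P x = seg x y.
 move=> eB BO hB.
 have Bx: B x by have:= hB 0; rewrite scale0r addr0; apply; rewrite lexx ler01.
 have By: B y by have:= hB 1; rewrite scale1r subrKC; apply; rewrite lexx ler01.
 have Ox:= BO _ Bx; have Oy:= BO _ By.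
 have [cx gxO x0 x1 fx]:= hg x Ox; have [cy gyO y0 y1 fy]:= hg y Oy.
 pose L:= triangle (g x).1 (g y).1 x y.
 have cL: continuous L.
  have c3: continuous (fun t: R=> 3 * t) by move=> t; apply: cvgM; [exact: cvg_cst|exact: cvg_id].
  have d1: continuous ((g x).1 \o (fun t: R=> 3 * t)) by move=> t; apply: continuous_comp; [exact: c3|exact: cx].
  have d2: continuous (clamp \o (fun t: R=> 3 * t-1)).
   by move=> t; apply: continuous_comp; [apply: cvgB; [exact: c3|exact: cvg_cst]|exact: continuous_clamp].
  have d3: continuous ((g y).1 \o (fun t: R=> 3-3 * t)).
   by move=> t; apply: continuous_comp; [apply: cvgB; [exact: cvg_cst|exact: c3]|exact: cy].
  move=> t; apply: cvgD; first by apply: cvgD; [exact: d1|exact: (cvgZr_tmp (d2 t))].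
  by apply: cvgB; [exact: d3|exact: cvg_cst].
 have LO t: 0 <= t <= 1 -> Om (L t).
  move=> /andP[t0 t1]; have [a|a]:= lerP (3 * t) 1.
   by rewrite /L triangle1//; move: t0 a; lra.
  have [b2|b2]:= lerP (3 * t) 2.
   by rewrite /L triangle2//; [apply: BO; apply: hB|]; move: a b2; lra.
  by rewrite /L triangle3//; move: b2 t1; lra.
 have L0: L 0 = b by rewrite /L triangle1 ?mulr0 ?lexx ?ler01// x0.
 have L1: L 1 = b by rewrite /L triangle3 ?mulr1 ?subrr ?y0//; lra.
 have [||H [cH HO Hs0 Hs1 Ht]]:= hh L; [by split; first exact: continuous_subspaceT|by rewrite L0 L1|].
 pose K (p: R * R):= H (clamp p.1, clamp p.2).
 have cK: continuous K.
  apply: (within_comp cH (u:= fun p: R * R=> (clamp p.1, clamp p.2))).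
   have d1: continuous (clamp \o @fst R R) by move=> q; apply: continuous_comp; [exact: cvg_fst|exact: continuous_clamp].
   have d2: continuous (clamp \o @snd R R) by move=> q; apply: continuous_comp; [exact: cvg_snd|exact: continuous_clamp].
   by move=> q; exact: (cvg_pair (d1 q) (d2 q)).
  by move=> p; split; rewrite /= in_itv/=; exact: clamp01.
 have KO p: Om (K p) by apply: HO; exact: clamp01.
 have K1 (t: R): 0 <= t <= 1 -> K (1, t) = b.
  by move=> ht; rewrite /K /= clamp_high// Hs1 ?clamp01// L0.
 have K0 (s: R): 0 <= s <= 1 -> K (s, 0) = b /\ K (s, 1) = b.
  by move=> hs; rewrite /K /= (clamp_low (lexx 0)) (clamp_high (lexx 1)) -L0; apply: Ht; exact: clamp01.
 have [N hN]:= null_homotopic_sum cK KO K1 K0.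
 pose m:= (N+(g x).2+(g y).2)%N.
 have Nm: (N <= m)%N by rewrite /m -addnA leq_addr.
 have xm: ((g x).2 <= m)%N by rewrite /m addnAC leq_addl.
 have ym: ((g y).2 <= m)%N by rewrite /m leq_addl.
 have E: path_sum (3 * m.+1) L = 0.
  have ->: (3 * m.+1 = (3 * m+2).+1)%N by rewrite mulnS addnC addnS.
  rewrite -(hN (3 * m+2)%N); last exact: leq_trans Nm (leq_trans (leq_pmull m (isT: 0 < 3)%N) (leq_addr _ _)).
  apply: eq_bigr=> k _; rewrite /K /= clamp_low// !clamp_id ?Hs0 ?grid_bound//; try exact: ltnW; exact: ltn_ord.
 have fm: subdivided m.+1 (g y).1 by exact: fy.
 move: E; rewrite /L (triangle_sum x1 y1 eB hB fm) (PE x m Ox xm) (PE y m Oy ym).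
 by move: (P x) (P y) (seg x y)=> u v w; lra.
have loc x: Om x -> exists (e: R) (Phi: R3 R -> R), [/\ 0 < e, smooth Phi, (forall i y, oball x e y -> is_derive y (e_ i) Phi (vcomp T i y)) &
  forall y, oball x e y -> P y = Phi y+(P x-Phi x)].
 move=> Ox; have [r r0 rO]:= iffLR (open3P _) oO x Ox; have [Phi [smP dPhi sPhi]]:= exact_ball r0 rO.
 have r20: 0 < r/2 by rewrite divr_gt0.
 exists (r/2), Phi; split=> // y yx; have xx: oball x (r/2) x by exact: oball_self.
 have:= dP x y (oball x (r/2)); rewrite sPhi// => E.
 suff: P y-P x = Phi y-Phi x by move: (P y) (P x) (Phi y) (Phi x)=> u v w z h; lra.
 apply: E; first by exists Phi.
  by move=> u ux; apply: rO; apply: lt_trans ux _; move: r0; lra.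
 by move=> s s01; exact: oball_convex.
have dPx x: Om x -> forall i, is_derive x (e_ i) P (vcomp T i x).
 move=> Ox i; have [e [Phi [e0 _ dPhi PPhi]]]:= loc x Ox.
 have xx: oball x e x by exact: oball_self.
 have dc: is_derive x (e_ i) (fun y=> Phi y+(P x-Phi x)) (vcomp T i x).
  by apply: is_derive_eq (is_deriveD (dPhi i x xx) (is_derive_cst _ _ _)) _; rewrite addr0.
 have ob: nbhs x (oball x e):= open_nbhs_nbhs (conj (@oball_open R x e) xx).
 have nE: \forall y \near x, Phi y+(P x-Phi x) = P y by apply: filterS ob=> y hy; rewrite (PPhi y hy).
 exact: (near_eq_is_derive nE dc).
exists P; split=> //; apply: (smooth_on_intro (g:= vcomp T))=> // [x i Ox|x Ox]; first exact: dPx.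
have [e [Phi [e0 smP _ PPhi]]]:= loc x Ox.
have ob: nbhs x (oball x e):= open_nbhs_nbhs (conj (@oball_open R x e) (oball_self x e0)).
have nE: \forall y \near x, Phi y+(P x-Phi x) = P y by apply: filterS ob=> y hy; rewrite (PPhi y hy).
apply: (near_continuous nE); apply: cvgD; [exact: (smooth_cont smP)|exact: cvg_cst].
Qed.

End Monodromy.

(** * Square integrability of the pressure *)

Section Profile.
Context {R: realType}.
Implicit Types (x v: R3 R).

(** A smooth version of the positive part: the square of the profile at scale c
  is the square of the one at scale 2c times a lower bound of the slope at
  scale c. *)
Definition profile (c t: R): R:= t * expinv 0 (c * t).
Definition slope (c t: R): R:= expinv 0 (c * t)+c * t * expinv 2 (c * t).

Lemma profile_derive c (q: R3 R -> R) x v (g: R): is_derive x v q g ->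
 is_derive x v (fun y=> profile c (q y)) (slope c (q x) * g).
move=> dq; have d1: is_derive x v (fun y=> c * q y) (c * g) by exact: is_deriveZ.
have d2:= is_derive_comp3 (expinv_derive 0 (c * q x)) d1.
apply: is_derive_eq (is_deriveM dq d2) _; rewrite /slope /GRing.scale/=; ring.
Qed.

Lemma expinv0_pos (t: R): 0 < t -> expinv 0 t = expR (- t^-1).
by move=> t0; rewrite /expinv t0 expr0 mul1r. Qed.

Lemma expinv0_le1 (t: R): expinv 0 t <= 1.
have [t0|t0]:= ltrP 0 t; last by rewrite expinv_nonpos.
by rewrite expinv0_pos// -expR0 ler_expR oppr_le0 invr_ge0 ltW.
Qed.

Lemma profile_nonpos c t: 0 < c -> t <= 0 -> profile c t = 0.
by move=> c0 t0; rewrite /profile expinv_nonpos ?mulr0// mulr_ge0_le0// ltW. Qed.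

Lemma profile_ge0 c t: 0 < c -> 0 <= profile c t.
move=> c0; have [t0|t0]:= lerP 0 t; first by apply: mulr_ge0=> //; exact: expinv_ge0.
by rewrite profile_nonpos// ltW.
Qed.

Lemma profile_le c t: 0 < c -> profile c t <= `|t|.
move=> c0; have [t0|t0]:= lerP 0 t.
 by rewrite /profile (ger0_norm t0) ler_piMr//; exact: expinv0_le1.
by rewrite profile_nonpos// ltW.
Qed.

Lemma slope_ge c t: 0 < c -> expinv 0 (c * t) <= slope c t.
move=> c0; rewrite /slope lerDl; have [t0|t0]:= lerP 0 (c * t); first by apply: mulr_ge0=> //; exact: expinv_ge0.
by rewrite (expinv_nonpos _ (ltW t0)) mulr0.
Qed.

Lemma slope_le1 c t: slope c t <= 1.
rewrite /slope; move: (c * t)=> u; have [u0|u0]:= ltrP 0 u; last by rewrite !expinv_nonpos// mulr0 addr0.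
have un: u != 0 by rewrite gt_eqF.
have ->: expinv 0 u+u * expinv 2 u = (1+u^-1) * expR (- u^-1).
 by rewrite /expinv u0 expr0; move: (expR _)=> E; field.
by rewrite expRN ler_pdivrMr ?expR_gt0// mul1r expR_ge1Dx.
Qed.

Lemma profile_sqr c t: 0 < c -> profile c t^+2 = profile (2 * c) t^+2 * expinv 0 (c * t).
move=> c0; have [t0|t0]:= ltrP 0 t; last by rewrite !profile_nonpos ?mulr_gt0// expr0n mul0r.
rewrite /profile !expinv0_pos ?mulr_gt0//.
have ->: expR (- (c * t)^-1) = expR (- (2 * c * t)^-1)^+2.
 rewrite expr2 -expRD; congr expR; field; by rewrite gt_eqF// gt_eqF.
by move: (expR _)=> E; ring.
Qed.

Lemma smooth_profile U c (q: R3 R -> R): open U -> smooth_on U q -> smooth_on U (fun y=> profile c (q y)).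
by move=> oU sq; apply: smooth_onM=> //; apply: smooth_expinv=> //; exact: smooth_onZ. Qed.

Lemma derive_bound (p: R3 R -> R) x v (D a K r: R): 0 < r -> is_derive x v p D ->
 (forall t: R, `|t| < r -> `|p (x+t *: v)-p x-t * a| <= K * `|t|) -> `|D-a| <= K.
move=> r0 [dp <-] h.
have cv: `|t^-1 *: (p (t *: v+x)-p x)-a| @[t --> (0:R)^'] --> `|'D_v p x-a|.
 by apply: cvg_norm; apply: cvgB; [exact: dp|exact: cvg_cst].
have cK: K @[t --> (0:R)^'] --> K by exact: cvg_cst.
apply: (ler_cvg_to cv cK); near=> t.
have t0: t != 0 by near: t; exact: nbhs_dnbhs_neq.
have tr: `|t| < r by near: t; exact: dnbhs0_lt.
have ->: t^-1 *: (p (t *: v+x)-p x)-a = t^-1 * (p (x+t *: v)-p x-t * a).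
 by rewrite (addrC (t *: v)) mulrBr mulKf.
by rewrite normrM normrV ?unitfE// mulrC ler_pdivrMr ?normr_gt0// h.
Unshelve. all: by end_near.
Qed.

(** The absorption of the derivative term in the Hardy inequality. *)
Lemma hardy_scalar (th D f g W E P tau b2 la cf: R): 0 <= th -> 0 <= f -> f <= cf -> 0 <= b2 -> 0 < la ->
 - D <= b2/la -> E <= W -> f^+2 = g^+2 * E -> 0 <= E ->
 th^+2 * E * P^+2 <= 2 * (2 * th * D * f * P^+2+th^+2 * W * P^+2+2 * th^+2 * f * P * tau) +
  4 * cf/la * (th * b2 * P^+2)+4 * ((th * g)^+2 * tau^+2).
move=> t0 f0 fc b0 l0 hD EW fE E0.
have P0: 0 <= P^+2:= sqr_ge0 P.
have h1: - (th * D * f * P^+2) <= cf/la * (th * b2 * P^+2).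
 have ->: - (th * D * f * P^+2) = th * P^+2 * (f * - D) by ring.
 have ->: cf/la * (th * b2 * P^+2) = th * P^+2 * (cf * (b2/la)) by ring.
 apply: ler_wpM2l; first exact: mulr_ge0.
 apply: le_trans (_: f * (b2/la) <= _); first exact: ler_wpM2l.
 by apply: ler_wpM2r=> //; rewrite divr_ge0// ltW.
have h2: - (2 * (f * P * tau)) <= 2^-1 * (E * P^+2)+2 * (g^+2 * tau^+2).
 set A:= E * P^+2; set B:= g^+2 * tau^+2; have A0: 0 <= A by exact: mulr_ge0.
 have B0: 0 <= B by apply: mulr_ge0; exact: sqr_ge0.
 have e: (f * P * tau)^+2 = A * B by rewrite /A /B !exprMn fE; ring.
 move: e A0 B0; move: (f * P * tau) A B=> u A B e A0 B0.
 have [u0|u0]:= lerP 0 u; first by move: u0 A0 B0; lra.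
 have s0: 0 <= 2^-1 * A+2 * B by move: A0 B0; lra.
 rewrite -(@ler_pXn2r _ 2)// ?nnegrE//; last by move: u0; lra.
 have:= sqr_ge0 (2^-1 * A-2 * B).
 have ->: (- (2 * u))^+2 = 4 * (A * B) by rewrite -e; ring.
 have ->: (2^-1 * A+2 * B)^+2 = (2^-1 * A-2 * B)^+2+4 * (A * B) by field.
 by rewrite lerDr.
have h3: th^+2 * E * P^+2 <= th^+2 * W * P^+2.
 by apply: ler_wpM2r=> //; apply: ler_wpM2l=> //; exact: sqr_ge0.
have h4:= ler_wpM2l (sqr_ge0 th) h2.
have e1: th^+2 * (- (2 * (f * P * tau))) = - (2 * th^+2 * f * P * tau) by ring.
have e2: th^+2 * (2^-1 * (E * P^+2)+2 * (g^+2 * tau^+2)) =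
 2^-1 * (th^+2 * E * P^+2)+2 * ((th * g)^+2 * tau^+2) by ring.
have e3: 4 * cf/la * (th * b2 * P^+2) = 4 * (cf/la * (th * b2 * P^+2)) by ring.
have e4: 2 * th * D * f * P^+2 = 2 * (th * D * f * P^+2) by ring.
rewrite e1 e2 in h4; rewrite e3 e4; move: h1 h3 h4.
move: (th * D * f * P^+2) (cf/la * _) (th^+2 * E * _) (th^+2 * W * _) (2 * th^+2 * f * P * tau) ((th * g)^+2 * tau^+2).
by move=> *; lra.
Qed.

Lemma cross_bound (a b: 'rV[R]_3) (m: R): (forall i, `|a 0 i| <= m) -> frob (cross a b) (cross a b) <= 4 * m^+2 * frob b b.
move=> am; have m0: 0 <= m:= le_trans (normr_ge0 _) (am 0).
have F (c: 'rV[R]_3): frob c c = c 0 0^+2+c 0 1^+2+c 0 2^+2.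
 by rewrite /frob big_ord1 sum3E !expr2.
have A i: a 0 i^+2 <= m^+2 by exact: sqr_le_of_norm (am i).
rewrite !F !mxE /=; move: (A 0) (A 1) (A 2)=> A0 A1 A2.
have S (u v p q: R): u^+2 <= m^+2 -> v^+2 <= m^+2 -> (u * p-v * q)^+2 <= 2 * m^+2 * (p^+2+q^+2).
 move=> hu hv; have h1:= sqr_ge0 (u * p+v * q).
 have h2:= ler_wpM2r (sqr_ge0 p) hu; have h3:= ler_wpM2r (sqr_ge0 q) hv.
 have ->: (u * p-v * q)^+2 = 2 * (u^+2 * p^+2)+2 * (v^+2 * q^+2)-(u * p+v * q)^+2 by ring.
 have ->: 2 * m^+2 * (p^+2+q^+2) = 2 * (m^+2 * p^+2)+2 * (m^+2 * q^+2) by ring.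
 by move: h1 h2 h3; move: (_ ^+ 2) (u^+2 * _) (v^+2 * _) (m^+2 * _) (m^+2 * _)=> *; lra.
have:= S _ _ (b 0 2) (b 0 1) A1 A2; have:= S _ _ (b 0 0) (b 0 2) A2 A0; have:= S _ _ (b 0 1) (b 0 0) A0 A1.
move=> h1 h2 h3; apply: le_trans (lerD (lerD h3 h2) h1) _.
rewrite le_eqVlt; apply/orP; left; apply/eqP; move: (b 0 0) (b 0 1) (b 0 2)=> u v w; ring.
Qed.

End Profile.

Section SmoothedCharts.
Context {R: realType}.
Notation T3:= (space3 R).
Notation mu:= (@lebesgue3 R).
Implicit Types (x y z d: R3 R).

Lemma average_affine (Q k: R3 R -> R) (c x y: R3 R) (e B s t b: R): averaging c e k -> continuous Q -> (forall z, `|Q z| <= B) ->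
 (forall z, k z != 0 -> `|Q (x+z)-s * Q (y+z)-t| <= b) -> `|average Q k x-s * average Q k y-t| <= b.
move=> ak cQ QB h; have [tk k0 k1 ks]:= ak; have ck: continuous k:= smooth_cont tk.1.
have mQ:= continuous_measurable3 cQ.
have mQx u: measurable3 (fun z=> Q (u+z)).
 under eq_fun do rewrite addrC; exact: measurableT_comp mQ (measurable_shift3 u).
have ik:= test_integrable tk.
have iQ u: mu.-integrable setT (EFin \o (fun z=> Q (u+z) * k z)).
 by apply: (@rintegrable_bmul _ _ _ _ _ _ _ _ B).
have iy:= rintegrableZ measurableT s (iQ y); have it:= rintegrableZ measurableT t ik.
have E: average Q k x-s * average Q k y-t = \int[mu]_z ((Q (x+z)-s * Q (y+z)-t) * k z).
 rewrite !averageE// -{1}[t]mulr1 -k1 -!RintegralZl//.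
 rewrite -(RintegralB measurableT (iQ x) iy) -(RintegralB measurableT (rintegrableB measurableT (iQ x) iy) it).
 by apply: eq_Rintegral=> z _; rewrite !mulrBl mulrA.
rewrite E; apply: (average_le ak)=> //.
- by apply: measurable_funB=> //; apply: measurable_funB=> //; exact: measurable_funM.
- exists (B + `|s| * B + `|t|)=> z; apply: le_trans (ler_normB _ _) _; rewrite lerD2r.
 by apply: le_trans (ler_normB _ _) _; rewrite normrM lerD// ler_wpM2l.
Qed.

Variable Om: set (R3 R).

(** Averaging the defining function of a chart keeps its Lipschitz constant and
  its unit slope in the direction d. *)
Lemma chart_smoothing x0 G d (L r delta: R): chart Om x0 G d L r -> 0 < delta -> exists gam: R3 R -> R,
 smooth gam /\ forall x, `|x-x0| < r/2 -> [/\ `|gam x-G x| <= delta, forall i, `|partial i gam x| <= L &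
  \sum_i coord i d * partial i gam x = 1].
move=> [r0 L1 GL Gd _] d0; have L0: 0 < L by apply: lt_le_trans L1.
have r20: 0 < 2 * r by rewrite mulr_gt0.
have [psi [tpsi psi01 psi1]]:= plateau_ball x0 r20.
pose Q x:= psi x * G x.
have cG:= lipschitz_continuous3 (ltW L0) GL.
have cQ: continuous Q by move=> x; apply: cvgM; [exact: smooth_cont tpsi.1 x|exact: cG].
pose B:= `|G x0| + L * (2 * r).
have B0: 0 <= B by rewrite addr_ge0// mulr_ge0// ltW.
have QB x: `|Q x| <= B * psi x.
 have [px _]:= andP (psi01 x); rewrite /Q normrM (ger0_norm px) mulrC.
 have [xr|xr]:= ltrP `|x-x0| (2 * r); last first.
  rewrite (test_outside tpsi) ?mulr0//; move=> h; have: `|x-x0| < 2 * r by exact: h.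
  by rewrite ltNge xr.
 apply: ler_wpM2r=> //; rewrite -[G x](subrK (G x0)) addrC.
 apply: le_trans (ler_normD _ _) _; rewrite lerD2l; apply: le_trans (GL _ _) _.
 by rewrite ler_pM2l// ltW.
have QB' x: `|Q x| <= B.
 by apply: le_trans (QB x) _; rewrite ler_piMr//; case/andP: (psi01 x).
have iQ: mu.-integrable setT (EFin \o Q).
 apply: (@le_rintegrable _ _ _ mu _ measurableT _ (fun x=> B * psi x))=> //.
  exact: continuous_measurable3.
 by apply: rintegrableZ=> //; exact: test_integrable tpsi.
have QG x: `|x-x0| < r -> Q x = G x.
 by move=> h; rewrite /Q psi1 ?mul1r//; apply: lt_le_trans h _; move: r0; lra.
pose e:= Num.min (r/4) (delta/L).
have e0: 0 < e by rewrite lt_min !divr_gt0.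
have er: e <= r/4 by rewrite ge_min lexx.
have eL: L * e <= delta by rewrite mulrC -ler_pdivlMr// ge_min lexx orbT.
have ak:= averaging_mollifier 0 e0; have [tk _ _ ks]:= ak.
pose gam:= average Q (mollifier 0 e).
have sg: smooth gam by apply: average_smooth iQ (test_bounded_smooth tk).
have kz z: mollifier 0 e z != 0 -> `|z| < e by move=> /ks; rewrite subr0.
exists gam; split=> // x xr.
have QGz z w: mollifier 0 e z != 0 -> `|w| < r/4 -> Q (x+w+z) = G (x+w+z).
 move=> /kz ze wr; apply: QG; have ->: x+w+z-x0 = (x-x0)+w+z by rewrite addrAC (addrAC x).
 apply: le_lt_trans (ler_normD _ _) _; apply: le_lt_trans (lerD (ler_normD _ _) (lexx _)) _.
 by move: xr wr (lt_le_trans ze er); move: `|_| `|_| `|_| => u1 u2 u3; lra.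
have n0: `|(0: R3 R)| < r/4 by rewrite normr0 divr_gt0.
have QGz0 z: mollifier 0 e z != 0 -> Q (x+z) = G (x+z).
 by move=> h; have:= QGz z 0 h n0; rewrite addr0.
have near v (a K: R): 0 <= K -> (forall (z: R3 R) (t: R), `|G (z+t *: v)-G z-t * a| <= K * `|t|) ->
  `|\sum_i coord i v * partial i gam x-a| <= K.
 move=> K0 hv; have v0: 0 < `|v| + 1 by rewrite ltr_wpDl.
 have h0: 0 < r/4/(`|v| + 1) by rewrite !divr_gt0.
 apply: (derive_bound h0 (smooth_on_dir v openT (iffLR (smoothP _) sg) (I: setT x)))=> t ht.
 have tv: `|t *: v| < r/4.
  rewrite normrZ; apply: le_lt_trans (_: `|t| * (`|v| + 1) < _); first by rewrite ler_wpM2l// lerDl.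
  by rewrite -ltr_pdivlMr.
 have:= @average_affine Q (mollifier 0 e) 0 (x+t *: v) x e B 1 (t * a) (K * `|t|) ak cQ QB'.
 rewrite mul1r; apply=> z hz; rewrite mul1r QGz// QGz0// (addrAC x (t *: v) z); exact: hv.
split.
- have:= @average_affine Q (mollifier 0 e) 0 x x e B 0 (G x) delta ak cQ QB'.
 rewrite mul0r subr0; apply=> z hz; rewrite mul0r subr0 QGz0//.
 apply: le_trans (GL _ _) _; rewrite addrAC subrr add0r; apply: le_trans eL.
 by rewrite ler_pM2l// ltW// kz.
- move=> i; have:= near (e_ i) 0 L (ltW L0) _.
 rewrite subr0 (bigD1 i)//= coord_e eqxx mul1r big1 ?addr0; last by move=> j ji; rewrite coord_e (negPf ji) mul0r.
 apply=> z t; rewrite mulr0 subr0; apply: le_trans (GL _ _) _.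
 by rewrite addrAC subrr add0r normrZ norm_e_ mulr1.
have:= near d 1 0 (lexx 0); rewrite normr_le0 subr_eq0=> h; apply/eqP/h=> z t.
by rewrite Gd mulr1 [G z+t]addrC addrK subrr normr0 mul0r.
Qed.

End SmoothedCharts.
Section PotentialL2.
Context {R: realType}.
Notation T3:= (space3 R).
Notation mu:= (@lebesgue3 R).
Notation leb1:= (@lebesgue_measure R).
Implicit Types (x y z d: R3 R).

Lemma open_measurable_fun3 (U: set (R3 R)) (f: R3 R -> R): open U -> (forall x, U x -> {for x, continuous f}) ->
 measurable_fun (U: set T3) (f: T3 -> R).
move=> oU cf; apply: (measurability _ (RGenOpens.measurableE R)).
move=> _ [_ [a [b ->] <-]]; apply: open_measurable3; rewrite openE=> y [Uy fy].
apply: filterI; first by apply: open_nbhs_nbhs.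
by apply: (cf y Uy); apply: open_nbhs_nbhs; split=> //; exact: interval_open.
Qed.

Lemma crossZr (t: R) (a b: 'rV[R]_3): cross a (t *: b) = t *: cross a b.
by apply/rowP=> i; rewrite !mxE; case: i=> -[|[|[|//]]] Hi /=; ring. Qed.

Lemma frob_sqr (c: 'rV[R]_3): frob c c = c 0 0^+2+c 0 1^+2+c 0 2^+2.
by rewrite /frob big_ord1 sum3E !expr2. Qed.

Lemma absorb (E A K: R): 0 <= E -> 0 <= A -> 0 <= K -> E^+2 <= A * (K * E) -> E <= K * A.
move=> E0 A0 K0 h; have [->|e]:= eqVneq E 0; first exact: mulr_ge0.
have Ep: 0 < E by rewrite lt_neqAle eq_sym e.
rewrite -(ler_pM2r Ep) -expr2; apply: le_trans h _; rewrite le_eqVlt; apply/orP; left; apply/eqP; ring.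
Qed.

Variables (Om: set (R3 R)) (M: R).
Hypothesis oO: open Om.
Hypothesis OM: Om `<=` cube M.
Variables (T a: vfield R) (p: R3 R -> R).
Hypothesis la: L2 Om a.
Hypothesis sT: forall i, smooth_on Om (vcomp T i).
Hypothesis cT: forall x, Om x -> ccurl T x = 0.
Hypothesis dual: forall eta, vtest Om eta -> ip Om T eta = ip Om a (ccurl eta).
Hypothesis sp: smooth_on Om p.
Hypothesis dp: forall x, Om x -> forall i, is_derive x (e_ i) p (vcomp T i x).
Let mO: measurable (Om: set T3):= open_measurable3 oO.

Lemma vtest_cut chi: test Om chi -> vtest Om (fun x=> chi x *: T x).
by move=> tc i; rewrite vcomp_scale; apply: (testM_on oO tc (sT i)). Qed.

Lemma ccurl_cut chi x: test Om chi -> Om x -> ccurl (fun y=> chi y *: T y) x = cross (cgrad chi x) (T x).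
move=> tc Ox.
have P i j: partial i (vcomp (fun y=> chi y *: T y) j) x = partial i chi x * T x 0 j+chi x * partial i (vcomp T j) x.
 by rewrite vcomp_scale partialM//; [exact: smooth_der tc.1|exact: smooth_on_der (sT j) _ Ox].
have G i: cgrad chi x 0 i = partial i chi x by rewrite -vcomp_cgrad.
have E: ccurl (fun y=> chi y *: T y) x = chi x *: ccurl T x+cross (cgrad chi x) (T x).
 rewrite /ccurl /cross !P !G.
 by apply/rowP=> i; rewrite !mxE; case: i=> -[|[|[|//]]] Hi /=; rewrite mulrBr opprD addrACA addrC; congr (_ + _).
by rewrite E cT// scaler0 add0r.
Qed.

(** Testing the identity defining T with chi^2 T, on whose support T has no
  curl. *)
Lemma caccioppoli chi (m: R): test Om chi -> (forall x, Om x -> chi x != 0 -> forall i, `|partial i chi x| <= m) ->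
 ip Om (fun x=> chi x *: T x) (fun x=> chi x *: T x) <= 16 * m^+2 * ip Om a a.
move=> tc hm; set V:= fun x=> chi x *: T x.
have tV: vtest Om V by exact: vtest_cut.
pose W x:= chi x *: V x; have tW: vtest Om W by exact: (vtest_scale tc (fun i=> (tV i).1)).
have lV:= vtest_L2 tV; have lC:= vtest_L2 (vtest_ccurl tW).
have E: ip Om V V = ip Om a (ccurl W).
 rewrite -dual//; apply: eq_Rintegral=> x _.
 by rewrite /V frobZ (frobC (T x) (W x)) /W frobZ frobC.
have CE x: Om x -> ccurl W x = 2 *: cross (cgrad chi x) (V x).
 move=> Ox; rewrite (ccurl_scale x tc.1 (fun i=> (tV i).1)) (ccurl_cut tc Ox) -crossZr.
 by rewrite -/(V x) scaler_nat mulr2n.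
have CV: ip Om (ccurl W) (ccurl W) <= 16 * m^+2 * ip Om V V.
 have iV:= frob_integrable mO lV lV; have iC:= frob_integrable mO lC lC.
 rewrite /ip -RintegralZl//; apply: le_Rintegral=> //; first exact: rintegrableZ.
 move=> x Ox; rewrite CE// frobZ frobC frobZ.
 have [c0|c0]:= eqVneq (chi x) 0.
  have ->: V x = 0 *: T x by rewrite /V c0.
  by rewrite crossZr !frobZ !mul0r !mulr0.
 have:= cross_bound (V x) (a:= cgrad chi x) (m:= m).
 move=> h; have {}h:= h (fun i=> _); move: h.
 have ->: 16 * m^+2 * frob (V x) (V x) = 4 * (4 * m^+2 * frob (V x) (V x)) by move: (frob _ _)=> F; ring.
 move=> h; rewrite mulrA -natrM; apply: ler_wpM2l=> //; apply: h=> i.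
 have ->: cgrad chi x 0 i = partial i chi x by rewrite -vcomp_cgrad.
 exact: hm.
apply: absorb; [exact: ip_ge0|exact: ip_ge0|by rewrite mulr_ge0 ?sqr_ge0|].
rewrite [in leLHS]E; apply: le_trans (ip_CS mO la lC) _.
by apply: ler_wpM2l CV; exact: ip_ge0.
Qed.

Lemma cut_test x0 (r1 r2 c: R) theta gam: 0 < c -> smooth theta -> smooth gam -> r1 < r2 ->
 (forall x, theta x != 0 -> `|x-x0| <= r1) -> (forall x, `|x-x0| < r2 -> 0 <= gam x -> Om x) ->
 test Om (fun x=> theta x * profile c (gam x)).
move=> c0 st sg r12 ht hg; split.
 apply/smoothP; apply: smooth_onM; [exact: openT|exact/smoothP|].
 by apply: smooth_profile; [exact: openT|exact/smoothP].
exists ([set x | `|x-x0| <= r1] `&` (gam @^-1` [set t | 0 <= t])); split.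
- apply: compact_closedI; first exact: closed_ball_compact.
 by apply: closed_comp; [move=> y _; exact: smooth_cont|exact: closed_ge].
- by move=> x [/= h1 h2]; apply: hg=> //; exact: le_lt_trans h1 r12.
move=> x nK; have [->|t0]:= eqVneq (theta x) 0; first by rewrite mul0r.
rewrite profile_nonpos ?mulr0//; apply: ltW; rewrite ltNge; apply/negP=> g0.
by apply: nK; split; [exact: ht|].
Qed.

Lemma directional_sqr d (t: R) (b: 'rV[R]_3) :
 t^+2 * (\sum_i coord i d * b 0 i)^+2 <= 3 * `|d| ^+ 2 * frob (t *: b) (t *: b).
rewrite frob_sqr !mxE sum3E.
have S i: (t * (coord i d * b 0 i))^+2 <= `|d| ^+ 2 * (t * b 0 i)^+2.
 have ->: (t * (coord i d * b 0 i))^+2 = coord i d^+2 * (t * b 0 i)^+2 by ring.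
 by apply: ler_wpM2r; [exact: sqr_ge0|apply: sqr_le_of_norm; exact: coord_le].
rewrite -exprMn !mulrDr; apply: le_trans (sqr3_le _ _ _) _.
apply: le_trans (ler_wpM2l (ler0n R 3) (lerD (lerD (S 0) (S 1)) (S 2))) _.
by rewrite !mulrDr !mulrA.
Qed.

Lemma radius_sum (q r: R): 0 < r -> q <= r/8 -> q+r/4 < r/2.
lra. Qed.

Lemma radius_sum3 (u w q r: R): 0 < r -> q <= r/8 -> u <= q -> w <= r/4 -> u+w < r.
lra. Qed.

Lemma radius_pos (g l B: R): - (g + - l) <= B -> B <= l/2 -> 0 < l -> 0 < g.
lra. Qed.

Lemma chart_pos (g G e: R): g-G <= e/2 -> 0 <= g-e -> 0 < e -> 0 < G.
lra. Qed.

Lemma gam_large (g G e: R): - (g-G) <= e/2 -> 3 * e <= G -> 0 < e -> e <= g-e.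
lra. Qed.

Lemma gam_bound (g G e B: R): `|g-G| <= e/2 -> `|G| <= B -> 0 < e -> e <= 1 -> `|g-e| <= B+2.
by move=> /ler_normlP[h1 h2] /ler_normlP[h3 h4] e0 e1; apply/ler_normlP; split; lra. Qed.

Lemma small_time (rho V: R): 0 < rho -> 0 <= V -> exists s: R, [/\ 0 < s, s <= 1 & s * V <= rho/4].
move=> r0 V0; have D0: 0 < V+1+rho by lra.
exists (rho/4/(V+1+rho)); split; first by rewrite !divr_gt0.
 by rewrite ler_pdivrMr// mul1r; lra.
rewrite -[leRHS](divfK (lt0r_neq0 D0)); apply: ler_wpM2l; last lra.
by rewrite divr_ge0// ltW// divr_gt0.
Qed.

(** Hardy's inequality: integrate the derivative of theta^2 profile(gam) p^2 in
  the transversal direction d. The cutoff theta averages a bump along -d, so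
  its derivative along d is nonnegative near the boundary and negative only on
  a fixed compact part of Om; the term in T is absorbed and then controlled by
  the Caccioppoli estimate. The bounds are uniform in the scale delta, which
  tends to 0. *)
Lemma hardy_boundary x0 G d (L r: R): boundary Om x0 -> chart Om x0 G d L r ->
 exists theta (rho s: R), [/\ smooth theta, 0 < rho, 0 < s, forall x, `|x-x0| < rho -> s <= theta x & L2s Om (fun x=> theta x * p x)].
move=> bx ch; have Gx0:= chart_boundary oO bx ch; have [r0 L1 GL Gd GO]:= ch.
have L0: 0 < L by apply: lt_le_trans L1.
have d10: 0 < `|d| + 1 by rewrite ltr_wpDl.
pose la':= r/4/(`|d| + 1); have l0: 0 < la' by rewrite !divr_gt0.
pose v:= (- la') *: d.
have vr: `|v| <= r/4.
 rewrite /v normrZ normrN (gtr0_norm l0) -[leRHS](divfK (lt0r_neq0 d10)) ler_pM2l//.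
 by rewrite lerDl.
pose rho:= Num.min (r/8) (la'/(2 * L)).
have rho0: 0 < rho by rewrite lt_min !divr_gt0// mulr_gt0.
have rho8: rho <= r/8 by rewrite ge_min lexx.
have rhoL: L * rho <= la'/2.
 have: rho <= la'/(2 * L) by rewrite ge_min lexx orbT.
 rewrite ler_pdivlMr ?mulr_gt0// => h; rewrite ler_pdivlMr//.
 by have ->: L * rho * 2 = rho * (2 * L) by ring.
have [b [tb b01 b1]]:= plateau_ball x0 rho0.
have tbT: test setT b by exact: test_sub tb.
have bb:= test_bounded_smooth tbT; have cb:= smooth_cont tb.1.
pose theta:= ray_average v b; have st: smooth theta by exact: ray_average_smooth.
have b0 x: 0 <= b x by case/andP: (b01 x).
have t0 x: 0 <= theta x by apply: Rintegral_ge0=> s _; exact: b0.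
have tsupp x: theta x != 0 -> `|x-x0| <= rho+r/4.
 move=> tx; rewrite leNgt; apply/negP=> xr; move/negP: tx; apply; apply/eqP.
 apply: ray_average0=> s /andP[s0 s1]; apply: (test_outside tb)=> h.
 have hs: `|s *: v| <= r/4 by rewrite normrZ (ger0_norm s0); apply: le_trans vr; rewrite ler_piMl.
 have h': `|x+s *: v-x0| < rho by exact: h.
 have: `|x-x0| <= `|x+s *: v-x0| + `|s *: v|.
  have ->: x-x0 = (x+s *: v-x0)-s *: v by rewrite addrAC addrK.
  exact: ler_normB.
 by apply/negP; rewrite -ltNge; apply: lt_trans xr; exact: ltr_leD.
have r12: rho+r/4 < r/2 by exact: radius_sum.
have tt: test setT theta.
 split=> //; exists [set x | `|x-x0| <= rho+r/4]; split=> //; first exact: closed_ball_compact.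
 by move=> x h; apply/eqP; apply: contraT=> /tsupp.
have [K0 K00 hK0]:= test_bounded tt.
have [K1 K10 hK1]: exists2 K1: R, 0 <= K1 & forall i x, `|partial i theta x| <= K1.
 have h i:= test_bounded (test_partial i tt).
 have [k0 k00 h0]:= h 0; have [k1 k10 h1]:= h 1; have [k2 k20 h2]:= h 2.
 exists (k0+k1+k2)=> [|i x]; first by rewrite !addr_ge0.
 elim/ord3_ind: i.
 - by apply: le_trans (h0 x) _; rewrite -addrA lerDl addr_ge0.
 - by apply: le_trans (h1 x) _; rewrite addrAC lerDr addr_ge0.
 - by apply: le_trans (h2 x) _; rewrite lerDr addr_ge0.
have Dt x: \sum_i coord i d * partial i theta x = (b x-b (x+v))/la'.
 have E: b (x+v)-b x = \sum_i coord i v * partial i theta x.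
  rewrite (smooth_FTC x v tb.1) sum3E /theta !(ray_average_partial v _ x bb).
  have cp i: continuous (fun y=> coord i v * partial i b y).
   by move=> y; apply: cvgM; [exact: cvg_cst|exact: (smooth_cont (smooth_partial i tb.1))].
  have ip i:= ray_integrable v x (cp i).
  rewrite -!ray_averageZ; [|exact: (smooth_cont (smooth_partial _ tb.1))..].
  transitivity (\int[leb1]_(s in `[0, 1]) (coord 0 v * partial 0 b (x+s *: v)+coord 1 v * partial 1 b (x+s *: v)+coord 2 v * partial 2 b (x+s *: v))).
   by apply: eq_Rintegral=> s _; rewrite sum3E.
  by rewrite (RintegralD _ (rintegrableD _ (ip 0) (ip 1)) (ip 2)) ?(RintegralD _ (ip 0) (ip 1)).
 move: E; rewrite !sum3E /v !coordZ; move: (coord 0 d) (coord 1 d) (coord 2 d) (partial 0 _ _) (partial 1 _ _) (partial 2 _ _).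
 move: (b _) (b _)=> u w c0 c1 c2 p0 p1 p2 E; apply: (mulIf (lt0r_neq0 l0)); rewrite divfK ?gt_eqF//.
 by rewrite -opprB E; ring.
pose b2 x:= b (x+v).
have tb2: test Om b2.
 split; first by have:= @affine_smooth R b 1 v tb.1; under eq_fun do rewrite scale1r.
 exists [set x | `|x-(x0-v)| <= rho]; split; first exact: closed_ball_compact.
  move=> y /= hy; have yv: `|y+v-x0| <= rho by move: hy; rewrite opprB addrA.
  have yr: `|y-x0| < r.
   have ->: y-x0 = (y+v-x0)-v by rewrite addrAC addrK.
   by apply: le_lt_trans (ler_normB _ _) _; exact: radius_sum3 rho8 yv vr.
  apply/(GO _ yr); have:= GL (y+v) x0; rewrite Gx0 subr0 /v Gd=> /ler_normlP[h _].
  have: L * `|y+(- la') *: d-x0| <= la'/2 by apply: le_trans rhoL; rewrite ler_pM2l.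
  by move=> h1; exact: radius_pos h h1 l0.
 move=> x /= h; apply: (test_outside tb)=> h'; apply: h.
 by apply: ltW; have ->: x-(x0-v) = x+v-x0 by rewrite opprB addrA.
have spp: smooth_on Om (fun x=> p x * p x) by exact: smooth_onM.
pose kap x:= b2 x * theta x * (p x * p x).
have tk: test Om kap by apply: (testM_on oO _ spp)=> //; exact: testM.
pose cf:= L * r+2; have cf0: 0 <= cf by rewrite addr_ge0// mulr_ge0// ltW.
pose m:= K1 * cf+K0 * L.
pose C1:= 4 * cf/la' * \int[mu]_(x in Om) kap x+12 * `|d| ^+ 2 * (16 * m^+2 * ip Om a a).
suff main (delta: R): 0 < delta -> delta <= 1 -> exists H: R3 R -> R, [/\ mu.-integrable Om (EFin \o H),
  \int[mu]_(x in Om) H x <= C1, forall x, Om x -> 0 <= H x &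
  forall x, Om x -> theta x != 0 -> 3 * delta <= G x -> (theta x * p x)^+2 <= expR 1 * H x].
 have [s [s0 s1 sv]]:= small_time rho0 (normr_ge0 v).
 exists theta, (rho/4), s; split=> //; first exact: divr_gt0.
  move=> x xr; pose J: set R:= `[0%R, s]%classic.
  have mI: measurable (`[0%R, 1%R]%classic: set (measurableTypeR R)) by exact: measurable_itv.
  have mJ: measurable (J: set (measurableTypeR R)) by exact: measurable_itv.
  have iJ: leb1.-integrable `[0%R, 1%R] (EFin \o (\1_J: R -> R)).
   by apply: (integrableS measurableT)=> //; exact: integrable_indic_itv.
  have <- : \int[leb1]_(u in `[0%R, 1%R]) (\1_J u: R) = s.
   rewrite /Rintegral integral_indic//.
   have ->: J `&` `[0%R, 1%R] = J.
    apply/setIidPl=> u; rewrite /J /= !in_itv/= => /andP[-> us]; exact: le_trans us s1.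
   have e:= @lebesgue_measure_itv R `[0%R, s]; rewrite /= lte_fin s0 oppr0 adde0 in e.
   have e': leb1 J = s%:E by rewrite -e.
   by apply: (etrans (congr1 constructive_ereal.fine e')).
  apply: le_Rintegral=> //; first exact: ray_integrable.
  move=> u _; rewrite indicE; case: (boolP (u \in J))=> [/set_mem|_]; last exact: b0.
  rewrite /J /= in_itv/= => /andP[u0 us]; rewrite b1//.
  have ->: x+u *: v-x0 = (x-x0)+u *: v by rewrite addrAC.
  apply: le_lt_trans (ler_normD _ _) _; rewrite normrZ (ger0_norm u0).
  have ->: rho/2 = rho/4+rho/4 by field.
  by apply: ltr_leD=> //; apply: le_trans sv; rewrite ler_wpM2r.
 pose F x: \bar R:= ((theta x * p x)^+2)%:E.
 have mtp: measurable_fun (Om: set T3) ((fun x=> theta x * p x): T3 -> R).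
  apply: measurable_funM; first by apply: measurable_funTS; exact: continuous_measurable3 (smooth_cont st).
  by apply: open_measurable_fun3=> // x Ox; exact: smooth_on_cont sp _ Ox.
 have mF: measurable_fun (Om: set T3) (F: T3 -> \bar R) by apply/measurable_EFinP; exact: measurable_funX.
 have mG:= continuous_measurable3 (lipschitz_continuous3 (ltW L0) GL).
 pose A (n: nat): set (R3 R):= Om `&` ([set x | 3 * n.+1%:R^-1 <= G x] `|` [set x | theta x = 0]).
 have mA n: measurable (A n: set T3).
  apply: measurableI=> //; apply: measurableU.
   have:= mG measurableT _ (measurable_itv `[3 * n.+1%:R^-1, +oo[); rewrite setTI.
   by under eq_set do rewrite /= in_itv/= andbT.
  have:= continuous_measurable3 (smooth_cont st) measurableT (measurable_set1 0); rewrite setTI; exact.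
 have AU: \bigcup_n A n = Om.
  apply/seteqP; split=> [x [n _ []]//|x Ox]; have [tx|tx]:= eqVneq (theta x) 0.
   by exists 0%N=> //; split=> //; right.
  have xr: `|x-x0| < r by apply: le_lt_trans (tsupp x tx) _; apply: lt_trans r12 _; rewrite ltr_pdivrMr// ltr_pMr// ltr1n.
  have G0: 0 < G x/3 by rewrite divr_gt0//; exact/(GO _ xr).
  have [N hN]:= inv_small G0; exists N=> //; split=> //; left.
  by rewrite /= mulrC -ler_pdivlMr//; exact: hN.
 have An n: (\int[mu]_(x in A n) F x <= (expR 1 * C1)%:E)%E.
  have n0: 0 < n.+1%:R^-1 :> R by rewrite invr_gt0.
  have n1: n.+1%:R^-1 <= 1 :> R by rewrite invf_le1// ler1n.
  have [H [iH HC H0 HF]]:= main _ n0 n1.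
  have e0: 0 < expR 1 :> R by exact: expR_gt0.
  have mH: measurable_fun (Om: set T3) ((fun x=> (expR 1 * H x)%:E): T3 -> \bar R).
   by apply/measurable_EFinP; apply: measurable_funM=> //; case/integrableP: iH=> /measurable_EFinP.
  have AO: A n `<=` Om by move=> x [].
  apply: le_trans (_: (\int[mu]_(x in A n) (expR 1 * H x)%:E <= _)%E).
   apply: ge0_le_integral=> //.
   - by move=> x _; rewrite lee_fin sqr_ge0.
   - exact: measurable_funS mF.
   - exact: measurable_funS mH.
   move=> x [Ox [h|h]]; rewrite lee_fin; last first.
    by rewrite h mul0r expr0n/=; apply: mulr_ge0; [exact: ltW|exact: H0].
   have [tx|tx]:= eqVneq (theta x) 0; last exact: HF.
   by rewrite tx mul0r expr0n/=; apply: mulr_ge0; [exact: ltW|exact: H0].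
  apply: le_trans (_: (\int[mu]_(x in Om) (expR 1 * H x)%:E <= _)%E).
   by apply: ge0_subset_integral=> // x Ox; rewrite lee_fin; apply: mulr_ge0; [exact: ltW|exact: H0].
  have ieH:= rintegrableZ mO (expR 1) iH.
  rewrite -[leLHS]fineK; last exact: integrable_fin_num ieH.
  rewrite -/(Rintegral mu Om (fun x=> expR 1 * H x)).
  have ->: \int[mu]_(x in Om) (expR 1 * H x) = expR 1 * \int[mu]_(x in Om) H x by rewrite RintegralZl.
  by rewrite lee_fin ler_pM2l.
 have bound: (\int[mu]_(x in Om) F x <= (expR 1 * C1)%:E)%E.
  have hA: {homo A: n k/(n <= k)%N >-> (n <= k)%O}.
   move=> n k nk; apply/subsetPset=> x [Ox [h|h]]; split=> //; [left|by right].
   by apply: le_trans h; rewrite ler_pM2l// lef_pV2 ?posrE// ler_nat.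
  have mFA n: measurable_fun (A n: set T3) (F: T3 -> \bar R) by apply: measurable_funS mF=> // x [].
  have FA n x: A n x -> (0 <= F x)%E by move=> _; rewrite lee_fin sqr_ge0.
  have:= ge0_nondecreasing_set_cvg_integral (mu:= mu) hA mA mFA FA; rewrite AU=> cv.
  rewrite -(cvg_lim (@ereal_hausdorff R) cv); apply: lime_le; first exact: cvgP cv.
  exact: nearW.
 apply/L2sP=> //; split; first exact/(measurable_restrictT _ mO).
 apply/integrableP; split; first by apply/measurable_EFinP; apply: measurable_funX; exact/(measurable_restrictT _ mO).
 apply: le_lt_trans (ltry (expR 1 * C1)); apply: le_trans bound; rewrite [leRHS]integral_mkcond.
 apply: ge0_le_integral=> //.
 - apply: measurableT_comp=> //; apply/measurable_EFinP; apply: measurable_funX; exact/(measurable_restrictT _ mO).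
 - exact/(measurable_restrictT _ mO).
 move=> x _; rewrite /= !patchE; case: ifP=> _; first by rewrite lee_fin ger0_norm// sqr_ge0.
 by rewrite expr0n/= normr0.
move=> de0 de1; have [gs [sgs hgs]]:= chart_smoothing ch (divr_gt0 de0 (ltr0n R 2)).
pose gam x:= gs x-delta; have c0: 0 < delta^-1 by rewrite invr_gt0.
have c20: 0 < 2 * delta^-1 by rewrite mulr_gt0.
have sgam: smooth gam by apply/smoothP; apply: smooth_onB; [exact: openT|exact/smoothP|exact: smooth_on_cst].
have pgam i x: partial i gam x = partial i gs x.
 have ds: is_derive x (e_ i) gs (partial i gs x):= DeriveDef (smooth_der sgs) erefl.
 by have [_ E]:= is_deriveB ds (is_derive_cst delta x (e_ i)); rewrite /partial E subr0.
have rr x: `|x-x0| < r/2 -> `|x-x0| < r by move=> h; apply: lt_trans h _; rewrite ltr_pdivrMr// ltr_pMr// ltr1n.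
have hg x: `|x-x0| < r/2 -> 0 <= gam x -> Om x.
 move=> xr g0; have [h _ _]:= hgs x xr; apply/(GO _ (rr _ xr)); move: h g0 de0; rewrite /gam=> /ler_normlP[_]; exact: chart_pos.
have tball x: theta x != 0 -> `|x-x0| < r/2 by move=> /tsupp h; exact: le_lt_trans h r12.
have gcf x: `|x-x0| < r/2 -> `|gam x| <= cf.
 move=> xr; have [h _ _]:= hgs x xr; have:= GL x x0; rewrite Gx0 subr0=> hG.
 have hL: L * `|x-x0| <= L * r by rewrite ler_pM2l// ltW// rr.
 exact: gam_bound h (le_trans hG hL) de0 de1.
have tF:= cut_test c0 st sgam r12 tsupp hg; have tchi:= cut_test c20 st sgam r12 tsupp hg.
pose chi x:= theta x * profile (2 * delta^-1) (gam x); pose V x:= chi x *: T x.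
have hV: ip Om V V <= 16 * m^+2 * ip Om a a.
 apply: (caccioppoli tchi)=> x Ox cx i; have tx: theta x != 0 by apply: contraNneq cx=> ->; rewrite mul0r.
 have xr:= tball x tx; have [_ hL _]:= hgs x xr.
 have dt: is_derive x (e_ i) theta (partial i theta x):= DeriveDef (smooth_der st) erefl.
 have dg: is_derive x (e_ i) gam (partial i gam x):= DeriveDef (smooth_der sgam) erefl.
 have [_ E]:= is_deriveM dt (profile_derive (2 * delta^-1) dg).
 rewrite /partial E; apply: le_trans (ler_normD _ _) _; rewrite addrC /m; apply: lerD.
  rewrite normrM mulrC; apply: ler_pM=> //.
  by rewrite ger0_norm ?profile_ge0//; apply: le_trans (profile_le _ c20) (gcf x xr).
 rewrite normrM; apply: ler_pM=> //; rewrite normrM -[leRHS]mul1r; apply: ler_pM=> //.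
  rewrite ger0_norm ?slope_le1//; apply: le_trans (slope_ge _ c20); exact: expinv_ge0.
 by rewrite pgam.
pose q x:= (theta x * profile delta^-1 (gam x)) * theta x * (p x * p x).
have tq: test Om q by apply: (testM_on oO _ spp)=> //; exact: testM.
pose I x:= \sum_i coord i d * partial i q x.
pose E x:= expinv 0 (delta^-1 * gam x).
pose H x:= 2 * I x+4 * cf/la' * kap x+12 * `|d| ^+ 2 * frob (V x) (V x).
have tV: vtest Om V by exact: vtest_cut.
have HE x: Om x -> theta x^+2 * E x * p x^+2 <= H x.
 move=> Ox; pose tau:= \sum_i coord i d * T x 0 i; pose S:= \sum_i coord i d * partial i gam x.
 have dq:= smooth_on_dir d openT (iffLR (smoothP _) tq.1) (Logic.I: setT x).
 have dt:= smooth_on_dir d openT (iffLR (smoothP _) st) (Logic.I: setT x).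
 have dg:= smooth_on_dir d openT (iffLR (smoothP _) sgam) (Logic.I: setT x).
 have dpx: is_derive x d p tau.
  apply: is_derive_eq (smooth_on_dir d oO sp Ox) _; apply: eq_bigr=> i _.
  by have [_ e]:= dp Ox i; rewrite -[T x 0 i]e.
 have [_ e1]:= dq; have [_ e2]:= is_deriveM (is_deriveM (is_deriveM dt (profile_derive delta^-1 dg)) dt) (is_deriveM dpx dpx).
 have IE: I x = 2 * theta x * ((b x-b2 x)/la') * profile delta^-1 (gam x) * p x^+2 +
   theta x^+2 * (slope delta^-1 (gam x) * S) * p x^+2+2 * theta x^+2 * profile delta^-1 (gam x) * p x * tau.
  rewrite /I -e1 [LHS]e2 -Dt /GRing.scale/= -/S.
  have PR: forall D th f W S P tau: R, th * f * th * (P * tau+P * tau)+P * P * (th * f * D+th * (th * (W * S)+f * D)) =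
   2 * th * D * f * P^+2+th^+2 * (W * S) * P^+2+2 * th^+2 * f * P * tau by move=> *; ring.
  exact: PR.
 have F0: 0 <= frob (V x) (V x) by rewrite frob_sqr !addr_ge0 ?sqr_ge0.
 have dF: 0 <= 12 * `|d| ^+ 2 * frob (V x) (V x) by apply: mulr_ge0=> //; apply: mulr_ge0=> //; exact: sqr_ge0.
 rewrite /H IE /kap; have [tx|tx]:= eqVneq (theta x) 0; first by rewrite tx expr0n/= !(mul0r,mulr0,addr0,add0r).
 have [_ _ S1]:= hgs x (tball x tx); have ->: S = 1 by rewrite -S1; apply: eq_bigr=> i _; rewrite pgam.
 rewrite mulr1; have D0: - ((b x-b2 x)/la') <= b2 x/la'.
  by rewrite -mulNr opprB ler_pM2r ?invr_gt0// gerBl.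
 apply: le_trans (hardy_scalar (p x) tau (t0 x) (profile_ge0 _ c0) (le_trans (profile_le _ c0) (gcf x (tball x tx))) (b0 (x+v)) l0 D0 (slope_ge _ c0) (profile_sqr _ c0) (expinv_ge0 _ _)) _.
 have:= directional_sqr d (chi x) (T x); rewrite -/tau -/(V x) -/(chi x)=> h.
 have e12: forall u w: R, 12 * u * w = 4 * (3 * u * w) by move=> *; ring.
 apply: lerD; last by rewrite e12 ler_pM2l.
 by rewrite lerD2l /b2 (mulrC (b (x+v))) -expr2.
have iq i: mu.-integrable setT (EFin \o partial i q):= test_integrable (test_partial i tq).
have iO (f: R3 R -> R): mu.-integrable setT (EFin \o f) -> mu.-integrable Om (EFin \o f).
 by move=> h; apply: (integrableS measurableT) h.
have iI: mu.-integrable Om (EFin \o I).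
 by apply: iO; apply: rintegrable_sum=> // i _; exact: rintegrableZ.
have ik:= rintegrableZ mO (4 * cf/la') (iO _ (test_integrable tk)).
have iF:= rintegrableZ mO (12 * `|d| ^+ 2) (frob_integrable mO (vtest_L2 tV) (vtest_L2 tV)).
have iI2:= rintegrableZ mO 2 iI.
have I0: \int[mu]_(x in Om) I x = 0.
 rewrite Rintegral_sum//; last by move=> i _; apply: rintegrableZ=> //; exact: iO.
 apply: big1=> i _; rewrite RintegralZl//; last exact: iO.
 have ->: \int[mu]_(x in Om) partial i q x = \int[mu]_x partial i q x.
  rewrite Rintegral_mkcond; apply: eq_Rintegral=> x _; rewrite patchE; case: ifPn=> // /negP nx.
  by rewrite (test_outside (test_partial i tq))// => Ox; apply: nx; exact: mem_set.
 by rewrite integral_partial_test ?mulr0//; exact: test_sub tq.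
have E0 x: 0 <= E x by exact: expinv_ge0.
exists H; split.
- exact: (rintegrableD mO (rintegrableD mO iI2 ik) iF).
- have i1: \int[mu]_(x in Om) (2 * I x) = 2 * \int[mu]_(x in Om) I x by rewrite RintegralZl.
 have i2: \int[mu]_(x in Om) (4 * cf/la' * kap x) = 4 * cf/la' * \int[mu]_(x in Om) kap x.
  by rewrite RintegralZl//; exact: iO (test_integrable tk).
 have i3: \int[mu]_(x in Om) (12 * `|d| ^+ 2 * frob (V x) (V x)) = 12 * `|d| ^+ 2 * ip Om V V.
  by rewrite RintegralZl//; apply: frob_integrable=> //; exact: vtest_L2.
 rewrite (RintegralD mO (rintegrableD mO iI2 ik) iF) (RintegralD mO iI2 ik) i1 i2 i3.
 by rewrite I0 mulr0 add0r /C1 lerD2l; apply: ler_wpM2l hV; apply: mulr_ge0=> //; exact: sqr_ge0.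
- by move=> x Ox; apply: le_trans (HE x Ox); apply: mulr_ge0; [apply: mulr_ge0=> //|]; exact: sqr_ge0.
move=> x Ox tx Gx; apply: le_trans (_: expR 1 * (theta x^+2 * E x * p x^+2) <= _); last by rewrite ler_pM2l ?expR_gt0// HE.
have u1: 1 <= delta^-1 * gam x.
 have [h _ _]:= hgs x (tball x tx); rewrite mulrC ler_pdivlMr// mul1r /gam; move: h=> /ler_normlP[h _]; exact: gam_large h Gx de0.
have e1: 1 <= expR 1 * E x.
 rewrite /E expinv0_pos; last by apply: lt_le_trans u1.
 by rewrite -expRD -[leLHS]expR0 ler_expR subr_ge0 invf_le1// (lt_le_trans ltr01).
have ->: expR 1 * (theta x^+2 * E x * p x^+2) = expR 1 * E x * (theta x * p x)^+2 by move: (expR 1) (E x)=> *; ring.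
by rewrite ler_peMl ?sqr_ge0.
Qed.

Lemma potential_local x0: lipschitz_boundary Om ->
 exists2 r: R, 0 < r & forall t, test (oball x0 r) t -> L2s Om (fun x=> t x * p x).
move=> LO; have [Ox|nO]:= pselect (Om x0).
 have [e e0 eO]:= iffLR (open3P _) oO x0 Ox; exists e=> // t tt.
 apply: test_L2s=> //; apply: (testM_on (@oball_open R x0 e) tt (smooth_on_sub eO sp)); exact: eO.
have [bx|nb]:= pselect (boundary Om x0); last first.
 have nc: ~ closure Om x0 by move=> h; apply: nb; split=> //; rewrite interior_open.
 have [e e0 he]: exists2 e: R, 0 < e & forall y, Om y -> ~ oball x0 e y.
  apply: contrapT=> h; apply: nc; apply/closure3P=> e e0; apply: contrapT=> h'.
  by apply: h; exists e=> // y Oy hy; apply: h'; exists y.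
 exists e=> // t tt; apply: (eq_L2s (p:= fun=> 0)); last exact: L2s0.
 by move=> x Ox; rewrite (test_outside tt) ?mul0r//; exact: he.
have [G [d [L [r ch]]]]:= lipschitz_chart LO bx.
have [theta [rho [s [st rho0 s0 hs lp]]]]:= hardy_boundary bx ch; exists rho=> // t tt.
have [K K0 hK]:= test_bounded tt.
have /L2sP lq: L2s Om (fun x=> K/s * (theta x * p x)) by apply: L2sZ.
apply/L2sP; apply: (le_sqint _ _ lq)=> [|x].
 apply/(measurable_restrictT _ mO); apply: measurable_funM; first by apply: measurable_funTS; exact: continuous_measurable3 (smooth_cont tt.1).
 by apply: open_measurable_fun3=> // x Ox; exact: smooth_on_cont sp _ Ox.
rewrite !patchE; case: ifP=> // _; rewrite mulrA !normrM; apply: ler_wpM2r=> //.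
have [xr|xr]:= pselect (oball x0 rho x); last by rewrite (test_outside tt xr) normr0 mulr_ge0.
rewrite -!normrM; apply: le_trans (hK x) _; rewrite ger0_norm; last first.
 by apply: mulr_ge0; [exact: divr_ge0 K0 (ltW s0)|exact: le_trans (ltW s0) (hs x xr)].
by rewrite -[leLHS](divfK (lt0r_neq0 s0)); apply: ler_wpM2l; [exact: divr_ge0 K0 (ltW s0)|exact: hs].
Qed.

Lemma potential_L2: lipschitz_boundary Om -> L2s Om p.
move=> LO; have P0: L2s Om (fun x=> (fun=> 0) x * p x).
 by apply: (eq_L2s (p:= fun=> 0)); [move=> x _; rewrite mul0r|exact: L2s0].
have PD (t s: R3 R -> R): L2s Om (fun x=> t x * p x) -> L2s Om (fun x=> s x * p x) -> L2s Om (fun x=> (t x+s x) * p x).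
 by move=> h1 h2; apply: eq_L2s (L2sD h1 h2)=> x _; rewrite mulrDl.
have [th [lt _ t1]]:= @local_to_global R (fun t=> L2s Om (fun x=> t x * p x)) M P0 PD (fun x=> potential_local x LO).
by apply: eq_L2s lt=> x Ox; rewrite t1 ?mul1r//; exact: OM.
Qed.

End PotentialL2.

(** * Duality and the decoupling *)

Section Duality.
Context {R: realType}.
Notation T3:= (space3 R).
Notation mu:= (@lebesgue3 R).
Variables (Om: set (R3 R)) (M: R).
Hypothesis oO: open Om.
Hypothesis M0: 0 < M.
Hypothesis OM: Om `<=` cube M.
Hypothesis LO: lipschitz_boundary Om.
Let mO: measurable (Om: set T3):= open_measurable3 oO.
Implicit Types (u v w f phi psi: vfield R) (F: vfield R -> R).

Lemma H0curl_curl_L2 u: H0curl Om u -> L2 Om (curl Om u).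
by move=> [h _]; case: (curl_xget h). Qed.

Lemma le_norm_Hcurl u: Num.sqrt (ip Om u u) <= Hcurl_norm Om u /\ Num.sqrt (ip Om (curl Om u) (curl Om u)) <= Hcurl_norm Om u.
by rewrite /Hcurl_norm; split; apply: ler_wsqrtr; rewrite ?lerDl ?lerDr; exact: ip_ge0. Qed.

Lemma ip_norm_le u v: L2 Om u -> L2 Om v -> `|ip Om u v| <= Num.sqrt (ip Om u u) * Num.sqrt (ip Om v v).
move=> lu lv; rewrite -sqrtrM ?ip_ge0// -sqrtr_sqr; apply: ler_wsqrtr; exact: ip_CS.
Qed.

(** Bounded functionals on H0(curl) are determined by their values on test
  fields. *)
Lemma dual_zero F (C: R): (forall a u v, H0curl Om u -> H0curl Om v -> F (fun x=> a *: u x+v x) = a * F u+F v) ->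
 (forall u, H0curl Om u -> `|F u| <= C * Hcurl_norm Om u) -> (forall eta, vtest Om eta -> F eta = 0) ->
 forall u, H0curl Om u -> F u = 0.
move=> FL FB F0 u hu.
have key (e: R): 0 < e -> `|F u| <= `|C| * e.
 move=> e0; have [eta te he]:= H0curl_dense oO OM LO hu (exprn_gt0 2 e0).
 have hw:= H0curl_lin oO OM (-1) (H0curl_vtest oO OM te) hu.
 have:= FL (-1) _ _ (H0curl_vtest oO OM te) hu; rewrite (F0 _ te) mulr0 add0r=> <-.
 apply: le_trans (FB _ hw) _; apply: le_trans (_: `|C| * Hcurl_norm Om (fun x=> -1 *: eta x+u x) <= _).
  by apply: ler_wpM2r; [exact: sqrtr_ge0|exact: ler_norm].
 apply: ler_wpM2l=> //; rewrite /Hcurl_norm -[leRHS](ger0_norm (ltW e0)) -sqrtr_sqr; apply: ler_wsqrtr.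
 apply: le_trans he; have lc:= H0curl_curl_L2 hu; have lce:= vtest_L2 (vtest_ccurl te).
 have cE: ae_eq_on Om (curl Om (fun x=> -1 *: eta x+u x)) (fun x=> curl Om u x-ccurl eta x).
  have:= curl_lin oO OM (-1) (Hcurl_vtest oO te) hu.1; move=> h; apply: ae_trans h _.
  by apply: (ae_imp (curl_vtest oO OM te))=> x h Ox; rewrite (h Ox) scaleN1r addrC.
 have l1:= L2B mO lc lce; have l2:= H0curl_curl_L2 hw.
 rewrite (ip_ae mO l2 l2 l1 l1 cE cE) lerD2r le_eqVlt; apply/orP; left; apply/eqP.
 by apply: ip_eq=> x; rewrite scaleN1r addrC.
apply/eqP; rewrite -normr_le0 leNgt; apply/negP=> Fp.
have d0: 0 < `|C| + 1 by rewrite ltr_wpDl.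
have:= key _ (divr_gt0 Fp d0); rewrite leNgt=> /negP; apply.
by rewrite mulrCA -[ltRHS]mulr1 ltr_pM2l// ltr_pdivrMr// mul1r ltrDl.
Qed.

Lemma curlcurl_spec phi F: is_curlcurl Om phi F -> is_curlcurl Om phi (curlcurl Om phi).
by move=> h; have:= @xgetPex _ (fun=> 0) [set F | is_curlcurl Om phi F] (ex_intro _ F h).
Qed.

Lemma curlcurl_unique phi F F' v: is_curlcurl Om phi F -> is_curlcurl Om phi F' -> H0curl Om v -> F v = F' v.
move=> [[L1 [C1 B1] _] t1] [[L2' [C2 B2] _] t2] hv; apply/eqP; rewrite -subr_eq0; apply/eqP.
apply: (@dual_zero (fun v=> F v-F' v) (C1+C2))=> // [a u w hu hw|u hu|eta te].
- by rewrite L1// L2'//; ring.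
- by apply: le_trans (ler_normB _ _) _; rewrite mulrDl; apply: lerD; [exact: B1|exact: B2].
- by rewrite t1// t2// subrr.
Qed.

Lemma curlcurlE phi F v: is_curlcurl Om phi F -> H0curl Om v -> curlcurl Om phi v = F v.
by move=> h hv; exact: (curlcurl_unique (curlcurl_spec h) h hv). Qed.

Lemma H10_H0curl p: H10 Om p -> H0curl Om (grad Om p) /\ ae_eq_on Om (curl Om (grad Om p)) (fun=> 0).
move=> [h1 hp]; have [lg _]:= weak_grad_xget h1.
have /choice[phi hphi] (n: nat): exists phi: R3 R -> R, test Om phi /\
  ips Om (p \- phi) (p \- phi)+ip Om (fun x=> grad Om p x-cgrad phi x) (fun x=> grad Om p x-cgrad phi x) < n.+1%:R^-1.
 have n0: 0 < n.+1%:R^-1 :> R by rewrite invr_gt0.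
 by have [q tq hq]:= hp _ n0; exists q.
have tg n: vtest Om (cgrad (phi n)):= vtest_cgrad (hphi n).1.
have c0 n: ae_eq_on Om (curl Om (cgrad (phi n))) (fun=> 0).
 apply: (ae_imp (curl_vtest oO OM (tg n)))=> x h Ox; rewrite (h Ox).
 exact: (ccurl_cgrad (hphi n).1.1).
have l0: L2 Om (fun=> 0: 'rV[R]_3) by exact: L2_0.
apply: (H0curl_closed oO OM (fun=> fun=> 0) (U:= fun n=> cgrad (phi n)))=> //.
- by move=> n; exact: H0curl_vtest oO OM _ (tg n).
- move=> eps /inv_small[N hN]; exists N=> n /hN; apply: le_trans; apply: ltW.
 rewrite ip_symB; apply: le_lt_trans (hphi n).2; rewrite lerDr; exact: ips_ge0.
move=> eps e0; exists 0%N=> n _.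
have lc:= H0curl_curl_L2 (H0curl_vtest oO OM (tg n)).
have E: ae_eq_on Om (fun x=> curl Om (cgrad (phi n)) x-0) (fun=> 0).
 by apply: (ae_imp (c0 n))=> x h Ox; rewrite (h Ox) subr0.
have l1:= L2B mO lc l0.
apply: le_trans (ltW e0); have -> // : ip Om (fun x=> curl Om (cgrad (phi n)) x-0) (fun x=> curl Om (cgrad (phi n)) x-0) = 0.
by rewrite (ip_ae mO l1 l1 l0 l0 E E) ip0l.
Qed.

Lemma curl_form_curlcurl w: H0curl Om w -> is_curlcurl Om w (fun v=> ip Om (curl Om w) (curl Om v)).
move=> hw; have lw:= H0curl_curl_L2 hw; split; first split.
- move=> a u v hu hv; have lu:= H0curl_curl_L2 hu; have lv:= H0curl_curl_L2 hv.
 have ll:= H0curl_curl_L2 (H0curl_lin oO OM a hu hv).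
 rewrite (ip_aer oO lw ll (L2_lin mO a lu lv) (curl_lin oO OM a hu.1 hv.1)).
 exact: (ip_linr mO a lu lv lw).
- exists (Num.sqrt (ip Om (curl Om w) (curl Om w)))=> u hu.
 apply: le_trans (ip_norm_le lw (H0curl_curl_L2 hu)) _; apply: ler_wpM2l; first exact: sqrtr_ge0.
 by case: (le_norm_Hcurl u).
- move=> p hp; have [hg g0]:= H10_H0curl hp.
 have l0: L2 Om (fun=> 0: 'rV[R]_3) by exact: L2_0.
 by rewrite (ip_aer oO lw (H0curl_curl_L2 hg) l0 g0) ipC ip0l.
move=> eta te; have lce:= vtest_L2 (vtest_ccurl te).
rewrite (ip_aer oO lw (H0curl_curl_L2 (H0curl_vtest oO OM te)) lce (curl_vtest oO OM te)).
by have [_ wc]:= curl_xget hw.1; rewrite wc//; exact: vtest_ccurl.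
Qed.

Lemma H0curl_split v: H0curl Om v -> exists2 q, H10 Om q & K0c Om (fun x=> -1 *: grad Om q x+v x).
move=> hv; have [q [b [hq lb db ab]]]:= helmholtz oO OM hv.1.1.
have [hg _]:= H10_H0curl hq; exists q=> //; have hl:= H0curl_lin oO OM (-1) hg hv; split=> // phi tp.
have E: ae_eq_on Om (fun x=> -1 *: grad Om q x+v x) b.
 by apply: (ae_imp ab)=> x h Ox; rewrite (h Ox) scaleN1r addKr.
by rewrite (ip_ael oO (vtest_L2 (vtest_cgrad tp)) hl.1.1 lb E); exact: db.
Qed.

(** By the Helmholtz decomposition, functionals vanishing on gradients are
  determined by their values on K0c. *)
Lemma K0c_dual_eq F F' v: K0c_dual Om F -> K0c_dual Om F' -> (forall u, K0c Om u -> F u = F' u) -> H0curl Om v -> F v = F' v.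
move=> [L1 _ g1] [L2' _ g2] h hv; have [q hq kb]:= H0curl_split hv; have [hg _]:= H10_H0curl hq.
have:= h _ kb; rewrite L1// L2'// g1// g2//; lra.
Qed.

End Duality.

Section Pressure.
Context {R: realType}.
Notation T3:= (space3 R).
Notation mu:= (@lebesgue3 R).

Lemma ord3_eq (Q: 'I_3 -> 'I_3 -> Prop): Q 0 0 -> Q 0 1 -> Q 0 2 -> Q 1 0 -> Q 1 1 -> Q 1 2 -> Q 2 0 -> Q 2 1 -> Q 2 2 -> forall i j, Q i j.
by move=> ? ? ? ? ? ? ? ? ? i j; elim/ord3_ind: i; elim/ord3_ind: j. Qed.

Lemma skw_unspn (A: 'M[R]_3): spn (unspn (skw A)) = skw A.
by apply: unspnK; apply/matrixP=> i j; rewrite !mxE; ring. Qed.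

Lemma frob_spn (a b: 'rV[R]_3): frob (spn a) (spn b) = 2 * frob a b.
by rewrite /frob big_ord1 !sum3E !mxE /=; ring. Qed.

Lemma frob_skw (A B: 'M[R]_3): frob (skw A) (skw B) = 2 * frob (unspn (skw A)) (unspn (skw B)).
by rewrite -frob_spn !skw_unspn. Qed.

Lemma frob_spn_skw (a: 'rV[R]_3) (B: 'M[R]_3): frob (spn a) (skw B) = 2 * frob a (unspn (skw B)).
by rewrite -frob_spn skw_unspn. Qed.

(** The matrix with the prescribed trace part and skew part. *)
Definition stress (p: R) (a: 'rV[R]_3): 'M[R]_3:= p%:M+spn a.

Lemma unspn_stress p (a: 'rV[R]_3): unspn (skw (stress p a)) = a.
by apply/rowP; apply: ord3_ind; rewrite !mxE /= ?mulr0n ?mulr1n; field.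
Qed.

Lemma tr_stress p (a: 'rV[R]_3): \tr (stress p a) = 3 * p.
by rewrite /mxtrace sum3E !mxE /=; ring. Qed.

Lemma dev_sym_stress p (a: 'rV[R]_3): dev (sym (stress p a)) = 0.
have ->: sym (stress p a) = p%:M.
 by apply/matrixP; apply: ord3_eq; rewrite !mxE /= ?mulr0n ?mulr1n; field.
by rewrite /dev mxtrace_scalar; apply/matrixP; apply: ord3_eq; rewrite !mxE /= ?mulr0n ?mulr1n; field.
Qed.

Lemma stressE (A: 'M[R]_3): dev (sym A) = 0 -> A = stress (\tr (sym A)/3) (unspn (skw A)).
move=> h; have h': sym A = (\tr (sym A)/3)%:M by apply/eqP; rewrite -subr_eq0; apply/eqP; exact: h.
by rewrite /stress skw_unspn -h' /sym /skw -scalerDr addrACA subrr addr0 -mulr2n -(scaler_nat 2 A) scalerA mulVf ?scale1r ?pnatr_eq0.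
Qed.

Lemma row_stress p (a: 'rV[R]_3) (g: 'I_3 -> 'I_3 -> R) :
 \sum_i \sum_j stress p a i j * g j i = p * (g 0 0+g 1 1+g 2 2) +
 (a 0 0 * (g 1 2-g 2 1)+a 0 1 * (g 2 0-g 0 2)+a 0 2 * (g 0 1-g 1 0)).
by rewrite !sum3E !mxE /=; ring. Qed.

End Pressure.

Section Decoupling.
Context {R: realType}.
Notation T3:= (space3 R).
Notation mu:= (@lebesgue3 R).
Variables (Om: set (R3 R)) (M: R).
Hypothesis oO: open Om.
Hypothesis M0: 0 < M.
Hypothesis OM: Om `<=` cube M.
Hypothesis LO: lipschitz_boundary Om.
Let mO: measurable (Om: set T3):= open_measurable3 oO.
Implicit Types (u v w f phi psi a: vfield R) (tau: mfield R) (p q: R3 R -> R).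

Lemma unspn_L2 tau: L2 Om tau -> L2 Om (fun x=> unspn (skw (tau x))).
move=> lt; have S i j: L2s Om (fun x=> skw (tau x) i j).
 apply: (eq_L2s (p:= fun x=> 2^-1 * (tau x i j-tau x j i))); first by move=> x _; rewrite !mxE.
 by apply: (L2sZ mO); apply: (L2sB mO); exact: lt.
exact: (vL2_row3 (S 2 1) (S 0 2) (S 1 0)).
Qed.

Lemma stress_L2 p a: L2s Om p -> L2 Om a -> L2 Om (fun x=> stress (p x) (a x)).
move=> lp /vL2P la; apply: ord3_eq.
- by apply: eq_L2s lp=> x _; rewrite !mxE /= mulr1n addr0.
- by apply: eq_L2s (L2sN mO (la 2))=> x _; rewrite !mxE /= mulr0n add0r.
- by apply: eq_L2s (la 1)=> x _; rewrite !mxE /= mulr0n add0r.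
- by apply: eq_L2s (la 2)=> x _; rewrite !mxE /= mulr0n add0r.
- by apply: eq_L2s lp=> x _; rewrite !mxE /= mulr1n addr0.
- by apply: eq_L2s (L2sN mO (la 0))=> x _; rewrite !mxE /= mulr0n add0r.
- by apply: eq_L2s (L2sN mO (la 1))=> x _; rewrite !mxE /= mulr0n add0r.
- by apply: eq_L2s (la 0)=> x _; rewrite !mxE /= mulr0n add0r.
- by apply: eq_L2s lp=> x _; rewrite !mxE /= mulr1n addr0.
Qed.

Lemma row_L2 tau i: L2 Om tau -> L2 Om (fun x=> row i (tau x)).
by move=> lt k j; apply: eq_L2s (lt i j)=> x _; rewrite mxE. Qed.

Lemma cdiv_L2s eta: vtest Om eta -> L2s Om (cdiv eta).
by move=> te; apply: test_L2s; apply: test_sum=> i; exact: test_partial (te i). Qed.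

Lemma rows_pairing tau eta: L2 Om tau -> vtest Om eta ->
 \sum_i ip Om (fun x=> row i (tau x)) (cgrad (vcomp eta i)) =
 \int[mu]_(x in Om) (\sum_i \sum_j tau x i j * partial j (vcomp eta i) x).
move=> lt te; have I i:= frob_integrable mO (row_L2 i lt) (vtest_L2 (vtest_cgrad (te i))).
have ->: \int[mu]_(x in Om) (\sum_i \sum_j tau x i j * partial j (vcomp eta i) x) =
  \int[mu]_(x in Om) (\sum_i frob (row i (tau x)) (cgrad (vcomp eta i) x)).
 apply: eq_Rintegral=> x _; apply: eq_bigr=> i _; rewrite /frob big_ord1; apply: eq_bigr=> j _.
 by rewrite mxE -[partial j _ x](congr1 (@^~ x) (vcomp_cgrad (vcomp eta i) j)).
by rewrite Rintegral_sum.
Qed.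

Lemma stress_pairing p a eta: L2s Om p -> L2 Om a -> vtest Om eta ->
 \int[mu]_(x in Om) (\sum_i \sum_j stress (p x) (a x) i j * partial j (vcomp eta i) x) =
 ips Om p (cdiv eta)+ip Om a (ccurl eta).
move=> lp la te; have i1:= ips_integrable mO lp (cdiv_L2s te).
have i2:= frob_integrable mO la (vtest_L2 (vtest_ccurl te)).
rewrite -(RintegralD mO i1 i2); apply: eq_Rintegral=> x _.
rewrite (row_stress (p x) (a x) (fun j i=> partial j (vcomp eta i) x)) /cdiv sum3E; congr (_ + _).
by rewrite /frob big_ord1 sum3E /ccurl !mxE.
Qed.

Lemma devsym_pressure tau: H0div_devsym Om tau -> exists2 p, L2s Om p & forall eta, vtest Om eta ->
 ips Om p (cdiv eta)+ip Om (fun x=> unspn (skw (tau x))) (ccurl eta) = 0.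
move=> [lt _ dt st]; pose p x:= \tr (sym (tau x))/3; pose a x:= unspn (skw (tau x)).
have la: L2 Om a by exact: unspn_L2.
have lp : L2s Om p.
 apply: (eq_L2s (p:= fun x=> 3^-1 * (tau x 0 0+tau x 1 1+tau x 2 2))).
  by move=> x _; rewrite /p /mxtrace sum3E !mxE; field.
 by apply: (L2sZ mO); apply: L2sD; [apply: L2sD|]; exact: lt.
exists p=> // eta te; rewrite -(stress_pairing lp la te).
have ls:= stress_L2 lp la.
have E: ae_eq_on Om tau (fun x=> stress (p x) (a x)).
 by apply: (ae_imp st)=> x h Ox; exact: stressE (h Ox).
pose Z x: 'M[R]_3:= \matrix_(i, j) partial j (vcomp eta i) x.
have lZ: L2 Om Z.
 by move=> i j; apply: (eq_L2s (p:= partial j (vcomp eta i))); [move=> x _; rewrite mxE|exact: test_L2s (test_partial j (te i))].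
have F (t: mfield R): \int[mu]_(x in Om) (\sum_i \sum_j t x i j * partial j (vcomp eta i) x) = ip Om t Z.
 by apply: eq_Rintegral=> x _; apply: eq_bigr=> i _; apply: eq_bigr=> j _; rewrite mxE.
rewrite F -(ip_ae mO lt lZ ls lZ E (@ae_refl R Om _ Z)) -F -rows_pairing//.
by apply: big1=> i _; exact: weak_div0 (dt i) (te i).
Qed.

Lemma ips_cdiv1 eta: vtest Om eta -> ips Om (fun=> 1) (cdiv eta) = 0.
move=> te; have s1: smooth (fun=> 1: R) by apply/smoothP; exact: smooth_on_cst.
have P i: ips Om (fun=> 1) (partial i (vcomp eta i)) = 0.
 have:= ips_partial i s1 (te i); rewrite (eq_ips (p':= fun=> 0) (q':= vcomp eta i))//; last first.
  by move=> x _; rewrite /partial derive_cst.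
 rewrite /ips; under eq_Rintegral=> x _ do rewrite mul0r.
 by rewrite /Rintegral integral0=> /eqP; rewrite eq_sym oppr_eq0=> /eqP.
have I i: mu.-integrable Om (EFin \o (fun x=> 1 * partial i (vcomp eta i) x)).
 apply: (integrableS measurableT)=> //; under [X in _ \o X]funext=> x do rewrite mul1r.
 exact: test_integrable (test_partial i (te i)).
rewrite /ips /cdiv; under eq_Rintegral=> x _ do rewrite mulr_sumr.
by rewrite Rintegral_sum//; apply: big1=> i _; exact: P.
Qed.

Lemma one_L2s: L2s Om (fun=> 1).
by apply: (L2s_bounded mO (M:= M) (c:= 1))=> // x _; rewrite normr1. Qed.

(** The identity is the weak form of div (pI+spn a) = 0, by pairing the rows
  with the gradients of the components of eta; subtracting a constant from p
  keeps it and makes the trace have mean zero. *)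
Lemma pressure_devsym p a: L2s Om p -> L2 Om a -> (forall eta, vtest Om eta -> ips Om p (cdiv eta)+ip Om a (ccurl eta) = 0) ->
 exists2 tau, H0div_devsym Om tau & forall x, unspn (skw (tau x)) = a x.
move=> lp la h; pose m:= ips Om (fun=> 1) (fun=> 1); pose c:= ips Om p (fun=> 1)/m.
have l1:= one_L2s.
pose q x:= - c * 1+p x; have lq: L2s Om q by apply: L2sD=> //; exact: (@L2sZ R Om mO (fun=> 1) (- c) l1).
have cm: ips Om q (fun=> 1) = 0.
 rewrite (ips_linl mO (- c) l1 lp l1) -/m /c; have [m0|mn]:= eqVneq m 0; last by rewrite mulNr divfK// addNr.
 have:= ips_CS lp l1; rewrite -/m m0 mulr0=> hs.
 have /eqP: ips Om p (fun=> 1)^+2 = 0 by apply/eqP; rewrite eq_le hs sqr_ge0.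
 by rewrite sqrf_eq0=> /eqP ->; rewrite mulr0 addr0.
exists (fun x=> stress (q x) (a x))=> [|x]; last exact: unspn_stress.
split.
- exact: stress_L2.
- transitivity (3 * ips Om q (fun=> 1)); last by rewrite cm mulr0.
 rewrite /ips -RintegralZl//; last exact: ips_integrable.
 by apply: eq_Rintegral=> x _; rewrite tr_stress mulr1.
- move=> i phi tp; pose eta:= single i phi; have te: vtest Om eta by exact: vtest_single.
 have ls:= stress_L2 lq la.
 have:= rows_pairing ls te; rewrite stress_pairing// (ips_linl mO (- c) l1 lp (cdiv_L2s te)).
 rewrite (ips_cdiv1 te) mulr0 add0r h// (bigD1 i)//= big1=> [|k ki].
  rewrite addr0 vcomp_single eqxx; under [cgrad _]eq_fun do rewrite /=.
  have ->: (fun x=> true%:R * phi x) = phi by apply/funext=> x; rewrite mul1r.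
  move=> ->; rewrite oppr0 /ips; under eq_Rintegral=> x _ do rewrite mul0r.
  by rewrite /Rintegral integral0.
 rewrite vcomp_single eq_sym (negPf ki) ipC; apply: etrans (_: ip Om (fun=> 0) (fun x=> row k (stress (q x) (a x))) = 0); last exact: ip0l.
 apply: ip_eq=> // x; apply/rowP=> j; rewrite [RHS]mxE.
 have ->: cgrad (fun x=> false%:R * phi x) x 0 j = partial j (fun x=> false%:R * phi x) x by rewrite -vcomp_cgrad.
 by rewrite (partialZ 0 (smooth_der tp.1)) mul0r.
by apply: ae_all=> x Ox; exact: dev_sym_stress.
Qed.

(** Fields in L2 with vanishing double curl have a pressure: their curl is a
  curl-free harmonic field, hence a gradient. *)
Lemma pressure a: Om !=set0 -> simply_connected Om -> L2 Om a -> (forall eta, vtest Om eta -> ip Om a (ccurl (ccurl eta)) = 0) ->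
 exists2 p, L2s Om p & forall eta, vtest Om eta -> ips Om p (cdiv eta)+ip Om a (ccurl eta) = 0.
move=> ne sc la h; have [T [sT _ cT dT]]:= curl_regular oO OM la h.
have [p [sp dp]]:= potential oO sT cT ne sc.
have lp := potential_L2 oO OM la sT cT dT sp dp LO; exists p=> // eta te.
pose q i x:= vcomp eta i x * p x.
have tq i: test Om (q i) by apply: (testM_on oO (te i) sp).
have dq i x: Om x -> partial i (q i) x = partial i (vcomp eta i) x * p x+vcomp eta i x * vcomp T i x.
 move=> Ox; rewrite /q partialM; [|exact: smooth_der (te i).1|exact: smooth_on_der sp _ Ox].
 by have [_ e]:= dp x Ox i; rewrite -[partial i p x]/('D_(e_ i) p x) e.
have I0 i: \int[mu]_(x in Om) partial i (q i) x = 0.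
 have ->: \int[mu]_(x in Om) partial i (q i) x = \int[mu]_x partial i (q i) x.
  rewrite Rintegral_mkcond; apply: eq_Rintegral=> x _; rewrite patchE; case: ifPn=> // /negP nx.
  by rewrite (test_outside (test_partial i (tq i)))// => Ox; apply: nx; exact: mem_set.
 by rewrite integral_partial_test//; exact: test_sub (tq i).
have iq i: mu.-integrable Om (EFin \o partial i (q i)).
 by apply: (integrableS measurableT)=> //; exact: test_integrable (test_partial i (tq i)).
have ip1:= ips_integrable mO lp (cdiv_L2s te).
have iS: mu.-integrable Om (EFin \o (fun x=> \sum_i partial i (q i) x)) by apply: rintegrable_sum.
have E: ip Om T eta = \int[mu]_(x in Om) (\sum_i partial i (q i) x-p x * cdiv eta x).
 apply: eq_Rintegral=> x /set_mem Ox; rewrite /frob big_ord1 /cdiv !sum3E !dq//.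
 rewrite /vcomp; move: (T x 0 0) (T x 0 1) (T x 0 2) (eta x 0 0) (eta x 0 1) (eta x 0 2) (p x) (partial _ _ _) (partial _ _ _) (partial _ _ _)=> *; ring.
rewrite -dT// E (RintegralB mO iS ip1) Rintegral_sum// big1// sub0r -/(ips Om p (cdiv eta)); exact: subrr.
Qed.

(** What remains of psi after subtracting the solution w of the curl problem with
  datum curl curl psi has vanishing double curl. *)
Lemma residual_stress psi F w: Om !=set0 -> simply_connected Om -> L2 Om psi -> is_curlcurl Om psi F -> K0c Om w ->
 (forall v, K0c Om v -> ip Om (curl Om w) (curl Om v) = F v) ->
 exists2 tau, H0div_devsym Om tau & forall x, unspn (skw (tau x)) = psi x-w x.
move=> ne sc lpsi hF kw hw; have lw: L2 Om w:= kw.1.1.1.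
have fw:= curl_form_curlcurl oO OM kw.1.
have lb:= L2B mO lpsi lw.
have h eta: vtest Om eta -> ip Om (fun x=> psi x-w x) (ccurl (ccurl eta)) = 0.
 move=> te; have lc:= vtest_L2 (vtest_ccurl (vtest_ccurl te)).
 rewrite (ipBl mO lpsi lw lc) -(hF.2 _ te) -(fw.2 _ te).
 by rewrite (K0c_dual_eq oO OM hF.1 fw.1 _ (H0curl_vtest oO OM te)) ?subrr// => v kv; rewrite hw.
have [p lp hp]:= pressure ne sc lb h.
exact: (pressure_devsym lp lb hp).
Qed.

End Decoupling.

Theorem mainTheorem10 (R: realType) (Omega: set (R3 R)) (f: vfield R)
  (hLip: bounded_lipschitz_domain Omega)
  (hsc: simply_connected Omega)
  (hbd: connected (boundary Omega))
  (hf: Hdiv Omega f)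
  (hdivf: weak_div Omega f (fun=> 0)) :
 forall phi u: vfield R, L2 Omega phi ->
  (mixed_solution Omega f phi u <->
  exists (w: vfield R) (sigma: mfield R),
   decoupled_solution Omega f w sigma u /\
   ae_eq_on Omega phi (phi_of sigma w)).
have [ne oO _ bO LO]:= hLip; have [M M0 OM]:= bounded_cube bO.
have mO:= open_measurable3 oO; have lf:= hf.1.
(* The solution of (curl w, curl v) = F v. *)
have riesz (F: vfield R -> R): (forall a u v, K0c Omega u -> K0c Omega v -> F (fun x=> a *: u x+v x) = a * F u+F v) ->
  (exists K, forall u, K0c Omega u -> `|F u| <= K * Hcurl_norm Omega u) ->
  exists2 w, K0c Omega w & forall v, K0c Omega v -> ip Omega (curl Omega w) (curl Omega v) = F v.
 by move=> hl [K hK]; exact: (curl_riesz oO M0 OM ne LO hbd hl hK).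
have skwE sigma tau: L2 Omega sigma -> L2 Omega tau -> ip Omega (skw \o sigma) (skw \o tau) =
  2 * ip Omega (fun x=> unspn (skw (sigma x))) (fun x=> unspn (skw (tau x))).
 move=> ls lt; rewrite /ip -RintegralZl//; last by apply: frob_integrable=> //; exact: unspn_L2.
 by apply: eq_Rintegral=> x _; rewrite /= frob_skw.
have spnE w tau: L2 Omega w -> L2 Omega tau -> ip Omega (spn \o w) (skw \o tau) =
  2 * ip Omega w (fun x=> unspn (skw (tau x))).
 move=> ls lt; rewrite /ip -RintegralZl//; last by apply: frob_integrable=> //; exact: unspn_L2.
 by apply: eq_Rintegral=> x _; rewrite /= frob_spn_skw.
have devsym0 tau: H0div_devsym Omega tau -> forall eta, vtest Omega eta ->
  ip Omega (fun x=> unspn (skw (tau x))) (ccurl (ccurl eta)) = 0.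
 move=> ht eta te; have [p _ hp]:= devsym_pressure oO ht.
 have:= hp _ (vtest_ccurl te); rewrite (eq_ips (p':= p) (q':= fun=> 0))//; last by move=> x _; exact: (cdiv_ccurl (fun i=> (te i).1)).
 by rewrite ipsC /ips; under eq_Rintegral=> x _ do rewrite mul0r; rewrite /Rintegral integral0 add0r.
have dual0: K0c_dual Omega (fun=> 0).
 split=> //; first by move=> a u v _ _; rewrite mulr0 addr0.
 by exists 0=> u _; rewrite normr0 mul0r.
move=> phi u lphi; split.
 move=> [[_ [F hF]] ku first second].
 have second' v: K0c Omega v -> F v = ip Omega f v.
  by move=> kv; rewrite -(second v kv); apply/esym; exact: (curlcurlE oO OM LO hF kv.1).
 have [w kw hw]: exists2 w, K0c Omega w & forall v, K0c Omega v -> ip Omega (curl Omega w) (curl Omega v) = F v.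
  apply: riesz; first by move=> a v1 v2 k1 k2; have [h _ _]:= hF.1; exact: h k1.1 k2.1.
  by have [_ [C hC] _]:= hF.1; exists C=> v kv; exact: hC kv.1.
 have [sigma hs sE]:= residual_stress oO OM LO ne hsc lphi hF kw hw.
 have phiE x: phi_of sigma w x = phi x by rewrite /phi_of sE subrK.
 have ls: L2 Omega sigma by case: hs.
 exists w, sigma; split; last by apply: ae_all=> x _; rewrite phiE.
 split; first by split.
 split=> [v kv|tau ht|chi kc].
 - by rewrite hw// second'.
 - have lt: L2 Omega tau by case: ht.
  have la:= unspn_L2 oO lt; have lw: L2 Omega w:= kw.1.1.1.
  have hz: is_curlcurl Omega (fun x=> unspn (skw (tau x))) (fun=> 0).
   by split=> // eta te; rewrite devsym0.
  have:= first _ (conj la (ex_intro _ _ hz)); rewrite (curlcurlE oO OM LO hz ku.1) addr0.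
  rewrite skwE// spnE// (ip_eq (u':= fun x=> unspn (skw (sigma x))+w x) (v':= fun x=> unspn (skw (tau x))) Omega)//.
   by rewrite (ipDl mO (unspn_L2 oO ls) lw la); move: (ip _ _ _) (ip _ _ _)=> *; lra.
  by move=> x; rewrite -phiE.
 - have hc:= curl_form_curlcurl oO OM kc.1.
  have:= first _ (conj kc.1.1.1 (ex_intro _ _ hc)); rewrite (curlcurlE oO OM LO hc ku.1) ipC.
  rewrite (ip_eq (u':= chi) (v':= phi_of sigma w) Omega)// (ipC _ (phi_of sigma w)) (ipC _ (curl Omega u)).
  by move: (ip _ _ _) (ip _ _ _)=> *; lra.
move=> [w [sigma [[[kw hs ku] [e1 e2 e3]] pe]]].
have ls: L2 Omega sigma by case: hs.
have lw: L2 Omega w:= kw.1.1.1; have la:= unspn_L2 oO ls.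
have lpo: L2 Omega (phi_of sigma w):= L2D mO la lw.
have fw:= curl_form_curlcurl oO OM kw.1.
have hphi: is_curlcurl Omega phi (fun v=> ip Omega (curl Omega w) (curl Omega v)).
 split; first exact: fw.1.
 move=> eta te; rewrite (fw.2 _ te); have lc:= vtest_L2 (vtest_ccurl (vtest_ccurl te)).
 by rewrite (ip_ael oO lc lphi lpo pe) (ipDl mO la lw lc) devsym0// add0r.
split=> //; first by split=> //; eexists; exact: hphi.
- move=> psi [lpsi [F hF]].
 have [wp kwp hwp]: exists2 w, K0c Omega w & forall v, K0c Omega v -> ip Omega (curl Omega w) (curl Omega v) = F v.
  apply: riesz; first by move=> a v1 v2 k1 k2; have [h _ _]:= hF.1; exact: h k1.1 k2.1.
  by have [_ [C hC] _]:= hF.1; exists C=> v kv; exact: hC kv.1.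
 have [tau ht tE]:= residual_stress oO OM LO ne hsc lpsi hF kwp hwp.
 have lt: L2 Omega tau by case: ht.
 have lb:= unspn_L2 oO lt; have lwp: L2 Omega wp:= kwp.1.1.1.
 rewrite (curlcurlE oO OM LO hF ku.1) -hwp// (ip_ael oO lpsi lphi lpo pe).
 rewrite (ip_eq (u':= phi_of sigma w) (v':= fun x=> unspn (skw (tau x))+wp x) Omega)//; last by move=> x; rewrite tE subrK.
 rewrite (ipDr mO lb lwp lpo) (ipC _ (curl Omega wp)) e3//.
 have:= e2 _ ht; rewrite skwE// spnE// (ipDl mO la lw lb).
 by move: (ip _ _ _) (ip _ _ _) (ip _ _ _)=> *; lra.
- by move=> v kv; rewrite (curlcurlE oO OM LO hphi kv.1) e1.
Qed.
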